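(* Let $\mathcal F$ be a Riemannian foliation on a closed manifold $M$, let $\mathfrak g$ be its structural Lie algebra, and let $\bar\Delta_*(y_1)$ be the element defined by the first secondary invariant $\Delta_*(y_1)\in H^1(M/\mathcal F)$ of Molino's central sheaf in the quotient $H^1(M/\mathcal F)/F^1H^1(M/\mathcal F)$. Then $\bar\Delta_*(y_1)=0$ if and only if $\mathfrak g$ is unimodular.
   Context: Everything is $C^\infty$. $\Omega^\cdot(M/\mathcal F)$ is the complex of basic forms of $\mathcal F$ (forms $\alpha$ with $i_X\alpha=0$ and $i_Xd\alpha=0$ for all $X$ tangent to the leaves), and $H^\cdot(M/\mathcal F)$ is its cohomology. Filtration: $F^k\Omega^r(M/\mathcal F)$ is the set of basic $r$-forms $\alpha$ with $i_X\alpha=0$ for every $X=X_1\wedge\dots\wedge X_{r-k+1}$ with the $X_j$ vector fields tangent to the leaf closures. These are differential ideals; $F^kH^\cdot(M/\mathcal F)$ is the induced filtration of cohomology, i.e. $F^kH^r(M/\mathcal F)$ consists of the classes having a closed representative in $F^k\Omega^r(M/\mathcal F)$. Holonomy pseudogroup: take a regular covering $\{(U_i,f_i)\}$ of $M$, i.e. open sets $U_i$ and submersions $f_i:U_i\to T_i$ whose fibers define $\mathcal F|_{U_i}$, together with well-defined diffeomorphisms $h_{ij}:f_i(U_i\cap U_j)\to f_j(U_i\cap U_j)$ with $h_{ij}f_i=f_j$ on $U_i\cap U_j$. Let $T=\bigsqcup_iT_i$ and let $\mathcal H$ be the pseudogroup on $T$ generated by the $h_{ij}$. A transverse Riemannian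 structure of $\mathcal F$ makes $\mathcal H$ a complete pseudogroup of local isometries of $T$. There is a canonical isomorphism between the complex of $\mathcal H$-invariant forms on $T$ and $\Omega^\cdot(M/\mathcal F)$, $\alpha\mapsto\alpha'$ with $\alpha'|_{U_i}=f_i^*(\alpha|_{T_i})$. Central sheaf and structural Lie algebra: let $\bar{\mathcal H}$ be the closure of $\mathcal H$, i.e. the pseudogroup of local diffeomorphisms of $T$ all of whose 1-jets lie in the closure of the set of 1-jets of elements of $\mathcal H$. Let $\mathcal C(\mathcal H)$ be the sheaf on $T$ of local vector fields whose local flows belong to $\bar{\mathcal H}$; it is a locally trivial (locally constant) sheaf of finite-dimensional Lie algebras. Pulling back by the $f_i$ gives Molino's central sheaf $\mathcal C(\mathcal F)$ on $M$. Its typical fiber is the opposite Lie algebra $\mathfrak g^-$ of the structural Lie algebra $\mathfrak g$ of $\mathcal F$. A Lie algebra is unimodular if $\operatorname{trace}(\operatorname{ad}_Y)=0$ for all its elements $Y$. Let $C=C(\mathcal F)$ be the vector bundle over $M$ associated with $\mathcal C(\mathcal F)$, of rank $m=\dim\mathfrak g$, with the flat connection $\nabla$ whose local parallel sections are the sections of the sheaf. First secondary invariant: choose on $C$ a Riemannian structure that is basic (on each $U_i$ it is the pull-back by $f_i$ of an $\mathcal H$-invariant Riemannian structure on the bundle $C(\mathcal H)$ associated with $\mathcal C(\mathcal H)$). Let $\Delta(y_1)$ be the 1-form on $M$ determined by $\nabla_ZX=2\pi\,\Delta(y_1)(Z)\,X$ for every vector field $Z$ and every local unitary section $X$ of $\bigwedge^mC$;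 equivalently $\Delta(y_1)=\frac1{2\pi}s^*(\operatorname{trace}\omega)$, where $\omega$ is the connection form of $\nabla$ on the frame bundle $P$ of $C$ and $s:M\to P/\mathrm O(m)$ is the section given by the Riemannian structure. This form is basic and closed, and $\Delta_*(y_1)\in H^1(M/\mathcal F)$ is its class, which does not depend on the choices. *)

(* Defs.v *)
From HB Require Import structures.
From mathcomp Require Import all_boot all_order all_algebra.
From mathcomp Require Import all_classical all_reals all_analysis.

Set Implicit Arguments.
Unset Strict Implicit.
Unset Printing Implicit Defensive.

Import Order.TTheory GRing.Theory Num.Theory numFieldNormedType.Exports.
Local Open Scope classical_set_scope.
Local Open Scope ring_scope.

(* Everything is C^oo. Manifolds are given by atlases; vector fields on a
   manifold are derivations of its algebra of smooth functions, and 1-forms are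
   linear maps from vector fields to functions, linear over smooth functions.
   On open subsets of R^q, vector fields are maps 'rV_q -> 'rV_q. *)

Section SmoothMaps.
Variable R : realType.

(* For U open: all partial derivatives of order <= k exist and are continuous
   on U. *)
Fixpoint Ck (p k : nat) (U : set 'rV[R]_p) (f : 'rV[R]_p -> R) : Prop :=
  (forall x, U x -> {for x, continuous f}) /\
  match k with
  | 0%N => True
  | k'.+1 => forall l : 'I_p,
      (forall x, U x -> derivable f x (delta_mx 0 l)) /\
      Ck k' U (fun x => 'D_(delta_mx 0 l) f x)
  end.

Definition smooth_on p (U : set 'rV[R]_p) (f : 'rV[R]_p -> R) : Prop :=
  forall k, Ck k U f.

Definition smooth_map_on p r (U : set 'rV[R]_p) (f : 'rV[R]_p -> 'rV[R]_r) :=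
  forall j, smooth_on U (fun x => f x 0 j).

End SmoothMaps.

Section Manifolds.
Variables (R : realType) (n : nat).

Record manifold := Manifold {
  mspace :> topologicalType;
  chart_idx : Type;
  dom : chart_idx -> set mspace;
  chart : chart_idx -> mspace -> 'rV[R]_n;
  chart_inv : chart_idx -> 'rV[R]_n -> mspace;
  dom_open : forall a, open (dom a);
  dom_cover : forall x, exists a, dom a x;
  chart_open : forall a, open (chart a @` dom a);
  chartK : forall a x, dom a x -> chart_inv a (chart a x) = x;
  chart_continuous : forall a x, dom a x -> {for x, continuous (chart a)};
  chart_inv_continuous : forall a y, (chart a @` dom a) y ->
    {for y, continuous (chart_inv a)};
  chart_transition : forall a b,
    smooth_map_on (chart a @` (dom a `&` dom b)) (chart b \o chart_inv a)
}.

Definition closed_manifold (M : manifold) : Prop :=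
  [/\ hausdorff_space M, compact [set: M] & connected [set: M]].

Section FormsOnManifold.
Variable M : manifold.

Definition smooth (u : M -> R) : Prop :=
  forall a, smooth_on (chart a @` dom a) (u \o chart_inv a).

(* The values of an operator at non-smooth functions are irrelevant. *)
Definition operator := (M -> R) -> (M -> R).

Definition vector_field (X : operator) : Prop :=
  [/\ forall u, smooth u -> smooth (X u),
      forall (a : R) u v, smooth u -> smooth v ->
        forall x, X (fun y => a * u y + v y) x = a * X u x + X v x &
      forall u v, smooth u -> smooth v ->
        forall x, X (fun y => u y * v y) x = X u x * v x + u x * X v x].

Definition lie_bracket (X Y : operator) : operator :=
  fun u x => X (Y u) x - Y (X u) x.

Definition form1 := operator -> (M -> R).

Definition one_form (w : form1) : Prop :=
  [/\ forall X, vector_field X -> smooth (w X),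
      forall X Y, vector_field X -> vector_field Y ->
        (forall u, smooth u -> X u = Y u) -> w X = w Y &
      forall f X Y, smooth f -> vector_field X -> vector_field Y ->
        forall x, w (fun u y => f y * X u y + Y u y) x = f x * w X x + w Y x].

Definition dform (w : form1) (X Y : operator) : M -> R :=
  fun x => X (w Y) x - Y (w X) x - w (lie_bracket X Y) x.

Definition closed_form (w : form1) : Prop :=
  forall X Y, vector_field X -> vector_field Y -> forall x, dform w X Y x = 0.

(* When N is an embedded submanifold through x, this says that the vector X_x
   belongs to T_x N. *)
Definition tangent_at (X : operator) (x : M) (N : set M) : Prop :=
  forall u, smooth u -> (\forall y \near x, N y -> u y = u x) -> X u x = 0.

End FormsOnManifold.
End Manifolds.

(* A foliation of codimension q, given by a regular covering {(U_i, f_i)} by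
   connected-fibre submersions onto open subsets T_i = f_i(U_i) of R^q, with
   transition diffeomorphisms h_ij. The inverse of h_ij is h_ji, so that the
   smoothness of all the h_ij makes them diffeomorphisms. *)
Record foliation (R : realType) (n : nat) (M : manifold R n) (q : nat) :=
  Foliation {
  fidx : Type;
  fU : fidx -> set M;
  ff : fidx -> M -> 'rV[R]_q;
  fh : fidx -> fidx -> 'rV[R]_q -> 'rV[R]_q;
  fU_open : forall i, open (fU i);
  fU_cover : forall x, exists i, fU i x;
  ff_smooth : forall i a,
    smooth_map_on (chart a @` (dom a `&` fU i)) (ff i \o chart_inv a);
  ff_submersion : forall i (a : chart_idx M) x, dom a x -> fU i x ->
    \rank ('J (ff i \o chart_inv a) (chart a x)) = q;
  ff_connected : forall i t, connected (fU i `&` ff i @^-1` [set t]);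
  fh_smooth : forall i j, smooth_map_on (ff i @` (fU i `&` fU j)) (fh i j);
  fhE : forall i j x, fU i x -> fU j x -> fh i j (ff i x) = ff j x
}.

Section Foliations.
Variables (R : realType) (n : nat) (M : manifold R n) (q : nat).
Variable F : foliation M q.
Notation I := (fidx F).

Definition plaque (i : I) (x : M) : set M := fU i `&` [set y | ff i y = ff i x].

Inductive leaf (x : M) : set M :=
| leaf_refl : leaf x x
| leaf_step (i : I) y z : leaf x y -> fU i y -> plaque i y z -> leaf x z.

Definition tangent_to_leaves (X : operator M) : Prop :=
  vector_field X /\ forall (i : I) x, fU i x -> tangent_at X x (plaque i x).

Definition tangent_to_leaf_closures (X : operator M) : Prop :=
  vector_field X /\ forall x, tangent_at X x (closure (leaf x)).

Definition basic_function (u : M -> R) : Prop :=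
  smooth u /\ forall X, tangent_to_leaves X -> forall x, X u x = 0.

Definition basic_form (w : form1 M) : Prop :=
  one_form w /\
  forall X, tangent_to_leaves X -> forall x,
    w X x = 0 /\ forall Y, vector_field Y -> dform w X Y x = 0.

Definition closed_basic_form (w : form1 M) := basic_form w /\ closed_form w.

(* F^1 Omega^1(M/F): the degree is r = 1 and k = 1, so r - k + 1 = 1. *)
Definition F1_form (w : form1 M) : Prop :=
  basic_form w /\
  forall X, tangent_to_leaf_closures X -> forall x, w X x = 0.

(* The class in H^1(M/F) of a closed basic 1-form w, as the set of the closed
   basic 1-forms w + du with u a basic function. *)
Definition H1_class (w : form1 M) : set (form1 M) :=
  [set eta | closed_basic_form eta /\
    exists2 u, basic_function u &
      forall X, vector_field X -> forall x, eta X x = w X x + X u x].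

Definition F1H1 : set (set (form1 M)) :=
  [set c | exists w, [/\ closed_basic_form w, F1_form w & c = H1_class w]].

(* The element of H^1(M/F) / F^1 H^1(M/F) defined by a closed basic 1-form w,
   as the set of all its representatives; the class of the form 0 is the zero
   element. *)
Definition H1_mod_F1_class (w : form1 M) : set (form1 M) :=
  [set eta | closed_basic_form eta /\
             F1H1 (H1_class (fun X x => eta X x - w X x))].

Definition trans (i : I) : set 'rV[R]_q := ff i @` fU i.
Definition trans2 (i j : I) : set 'rV[R]_q := ff i @` (fU i `&` fU j).

Definition inner (G : 'M[R]_q) (v w : 'rV[R]_q) : R := (v *m G *m w^T) 0 0.

Definition transverse_metric (G : I -> 'rV[R]_q -> 'M[R]_q) : Prop :=
  [/\ forall i k l, smooth_on (trans i) (fun t => G i t k l),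
      forall i t, trans i t -> (G i t)^T = G i t,
      forall i t, trans i t -> forall v, v != 0 -> 0 < inner (G i t) v v &
      forall i j t, trans2 i j t -> forall v w,
        inner (G j (fh i j t)) (v *m 'J (fh i j) t) (w *m 'J (fh i j) t)
        = inner (G i t) v w].

Definition riemannian_foliation : Prop := exists G, transverse_metric G.

(* The composites of the h_ij, with their domains of definition. *)
Inductive composite (i : I) : I -> set 'rV[R]_q -> ('rV[R]_q -> 'rV[R]_q) -> Prop :=
| composite_id : composite i i (trans i) id
| composite_step j k O phi : composite i j O phi ->
    composite i k (O `&` phi @^-1` trans2 j k) (fh j k \o phi).

(* The elements of the holonomy pseudogroup H on T (the disjoint union of the
   T_i) with domain contained in T_i and image contained in T_j. *)
Definition in_holonomy (i j : I) (O : set 'rV[R]_q) (phi : 'rV[R]_q -> 'rV[R]_q) :=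
  [/\ open O, O `<=` trans i, {in O &, injective phi} &
      forall t, O t -> exists O' phi',
        [/\ composite i j O' phi', O' t & \forall s \near t, phi s = phi' s]].

(* 1-jets from T_i to T_j: source, target and Jacobian matrix. *)
Definition jet_space := ('rV[R]_q * 'rV[R]_q * 'M[R]_q)%type.

Definition jet1 (phi : 'rV[R]_q -> 'rV[R]_q) (t : 'rV[R]_q) : jet_space :=
  (t, phi t, 'J phi t).

Definition holonomy_jets (i j : I) : set jet_space :=
  [set p | exists O phi t, [/\ in_holonomy i j O phi, O t & p = jet1 phi t]].

Definition local_diffeo (i j : I) (O : set 'rV[R]_q) (phi : 'rV[R]_q -> 'rV[R]_q) :=
  [/\ open O, O `<=` trans i & phi @` O `<=` trans j] /\
  [/\ smooth_map_on O phi, {in O &, injective phi} &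
      forall t, O t -> 'J phi t \in unitmx].

Definition in_holonomy_closure (i j : I) O phi : Prop :=
  local_diffeo i j O phi /\
  forall t, O t -> closure (holonomy_jets i j) (jet1 phi t).

Definition local_flow (O : set 'rV[R]_q) (X : 'rV[R]_q -> 'rV[R]_q)
    (V : set 'rV[R]_q) (e : R) (Phi : R -> 'rV[R]_q -> 'rV[R]_q) : Prop :=
  [/\ open V, V `<=` O, forall t, V t -> Phi 0 t = t &
      forall t s, V t -> `|s| < e ->
        O (Phi s t) /\ is_derive s 1 (fun r : R => Phi r t) (X (Phi s t))].

(* X is a section over O, contained in T_i, of the sheaf C(H). *)
Definition central_section (i : I) (O : set 'rV[R]_q)
    (X : 'rV[R]_q -> 'rV[R]_q) : Prop :=
  [/\ open O, O `<=` trans i, smooth_map_on O X &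
      forall V e Phi, local_flow O X V e Phi ->
        forall s, `|s| < e -> in_holonomy_closure i i V (Phi s)].

Definition germ_eq (t : 'rV[R]_q) (X Y : 'rV[R]_q -> 'rV[R]_q) : Prop :=
  \forall s \near t, X s = Y s.

(* X represents an element of the stalk of C(H) at t in T_i; this stalk is the
   fibre at t of the bundle C(H), and the fibre of C at any x in U_i such that
   f_i x = t. *)
Definition central_germ (i : I) (t : 'rV[R]_q) (X : 'rV[R]_q -> 'rV[R]_q) :=
  exists2 O : set 'rV[R]_q, O t & central_section i O X.

Definition vf_bracket (X Y : 'rV[R]_q -> 'rV[R]_q) (t : 'rV[R]_q) : 'rV[R]_q :=
  X t *m 'J Y t - Y t *m 'J X t.

End Foliations.

Record lie_algebra (R : realType) := LieAlgebra {
  lie_space :> vectType R;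
  lie_br : lie_space -> lie_space -> lie_space;
  lie_br_linearl : forall (a : R) x y z,
    lie_br (a *: x + y) z = a *: lie_br x z + lie_br y z;
  lie_br_alt : forall x, lie_br x x = 0;
  lie_br_linearr : forall (a : R) x y z,
    lie_br z (a *: x + y) = a *: lie_br z x + lie_br z y;
  lie_jacobi : forall x y z,
    lie_br x (lie_br y z) + lie_br y (lie_br z x) + lie_br z (lie_br x y) = 0
}.

Definition ad_matrix (R : realType) (g : lie_algebra R) (y : g) :
    'M[R]_(\dim {: g}) :=
  \matrix_(i, j) coord (vbasis {: g}) j (lie_br y (vbasis {: g})`_i).

Definition unimodular (R : realType) (g : lie_algebra R) : Prop :=
  forall y : g, \tr (ad_matrix y) = 0.

Section CentralSheaf.
Variables (R : realType) (n : nat) (M : manifold R n) (q : nat).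
Variable F : foliation M q.
Notation I := (fidx F).

(* iota is an isomorphism of the opposite g^- of g onto a stalk of C(H). *)
Definition opposite_iso_stalk (g : lie_algebra R) (i : I) (t : 'rV[R]_q)
    (iota : g -> 'rV[R]_q -> 'rV[R]_q) : Prop :=
  [/\ forall y, central_germ i t (iota y),
      forall (a : R) y z,
        germ_eq t (iota (a *: y + z)) (fun s => a *: iota y s + iota z s),
      forall y, germ_eq t (iota y) (fun=> 0) -> y = 0,
      forall X, central_germ i t X -> exists y, germ_eq t X (iota y) &
      forall y z,
        germ_eq t (vf_bracket (iota y) (iota z)) (iota (- lie_br y z))].

Definition structural_lie_algebra (g : lie_algebra R) : Prop :=
  exists (i : I) t iota, trans i t /\ @opposite_iso_stalk g i t iota.

Definition fibre_metric :=
  I -> 'rV[R]_q -> ('rV[R]_q -> 'rV[R]_q) -> ('rV[R]_q -> 'rV[R]_q) -> R.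

(* B i t is an inner product on the stalk of C(H) at t in T_i, depending
   smoothly on t and invariant by H. The metric on C is its pull-back by the
   f_i: at x in U_i it is B i (f_i x). *)
Definition basic_metric (B : fibre_metric) : Prop :=
  [/\ forall i t, trans i t ->
        [/\ forall X X' Y, central_germ i t X -> central_germ i t X' ->
              central_germ i t Y -> germ_eq t X X' -> B i t X Y = B i t X' Y,
            forall X Y, central_germ i t X -> central_germ i t Y ->
              B i t X Y = B i t Y X,
            forall (a : R) X Y Z, central_germ i t X -> central_germ i t Y ->
              central_germ i t Z ->
              B i t (fun s => a *: X s + Y s) Z = a * B i t X Z + B i t Y Z &
            forall X, central_germ i t X -> ~ germ_eq t X (fun=> 0) ->
              0 < B i t X X],
      forall i O X Y, central_section i O X -> central_section i O Y ->
        smooth_on O (fun t => B i t X Y) &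
      forall i j t X Y X' Y', trans2 i j t ->
        central_germ i t X -> central_germ i t Y ->
        central_germ j (fh i j t) X' -> central_germ j (fh i j t) Y' ->
        (\forall s \near t, X' (fh i j s) = X s *m 'J (fh i j) s) ->
        (\forall s \near t, Y' (fh i j s) = Y s *m 'J (fh i j) s) ->
        B j (fh i j t) X' Y' = B i t X Y].

Definition parallel_frame (i : I) (O : set 'rV[R]_q) (m : nat)
    (e : 'I_m -> 'rV[R]_q -> 'rV[R]_q) : Prop :=
  [/\ open O, O `<=` trans i, forall a, central_section i O (e a) &
      forall t X, O t -> central_germ i t X ->
        exists! c : 'rV[R]_m,
          germ_eq t X (fun s => \sum_(a < m) c 0 a *: e a s)].

(* Over an open W of U_i mapped by f_i into O, every section of the m-th
   exterior power of C is u . (e_1 /\ ... /\ e_m) for a function u. Since the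
   e_a are parallel, its covariant derivative along Z is
   (Z u) . (e_1 /\ ... /\ e_m); its squared norm is u^2 times the Gram
   determinant of the e_a. Near each point of W, u extends to a smooth function
   on M, which is why u may be taken to be globally defined. *)
Definition unitary_coefficient (B : fibre_metric) (i : I) (m : nat)
    (e : 'I_m -> 'rV[R]_q -> 'rV[R]_q) (W : set M) (u : M -> R) : Prop :=
  forall x, W x ->
    u x ^+ 2 * \det (\matrix_(a, b) B i (ff i x) (e a) (e b)) = 1.

Definition first_secondary_form (B : fibre_metric) (delta : form1 M) : Prop :=
  one_form delta /\
  forall (i : I) O m (e : 'I_m -> 'rV[R]_q -> 'rV[R]_q) (W : set M) u,
    parallel_frame i O e -> open W -> W `<=` fU i `&` ff i @^-1` O ->
    smooth u -> unitary_coefficient B i e W u ->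
    forall Z, vector_field Z -> forall x, W x ->
      Z u x = 2 * pi * delta Z x * u x.

End CentralSheaf.

(* Main.v *)
Require Import Defs.
From HB Require Import structures.
From mathcomp Require Import all_boot all_order all_algebra.
From mathcomp Require Import all_classical all_reals all_analysis.
From mathcomp Require Import fingroup perm lra ring.

Set Implicit Arguments.
Unset Strict Implicit.
Unset Printing Implicit Defensive.

Import Order.TTheory GRing.Theory Num.Theory numFieldNormedType.Exports.
Local Open Scope classical_set_scope.
Local Open Scope ring_scope.

(* Let D be the Gram determinant of a local parallel frame e of the central sheaf, as a function on T. The unit
   section of the top exterior power of C is D^(-1/2) e_1 /\ ... /\ e_m, so 4 pi delta = - d log D. Basic functions are
   constant on leaf closures, hence the class vanishes modulo F^1 exactly when delta kills the fields tangent to the leaf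
   closures. Local lifts of central fields X are such fields, and X D = 2 tr(b) D where b is the matrix of [X, -] in
   the frame: its flow is a limit of holonomy maps, which preserve the metric and multiply the parallel frame by constant
   matrices. At the structural stalk this says that X D = 0 for all X iff g is unimodular, and since the tr(b) are
   constants, X D = 0 near one point propagates over the connected M. Finally, if all central X kill D, then D is constant
   along the orbits of the holonomy near a point, so that delta kills all fields tangent to the leaf closures: otherwise
   compare the jets of holonomy maps changing D with the closest limit jet that keeps it; the rescaled differences
   converge to a central field, whose flow leads to a closer jet that keeps D.
   Central fields are obtained as limits of (h_n - id)/d_n for holonomy maps h_n, with derivatives bounded because
   isometries are determined by their 1-jets. *)

(** The obstacle is that a central section is specified through all of its local flows, and the
    closure of the holonomy through 1-jets with moving sources. From this, neither the closure of
    central sections under sums nor the existence of flows made of limits of holonomy maps is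
    immediate. Both follow once central germs are identified with limits of rescaled sequences:
    composing two sequences adds the fields, and iterating h_n about s/d_n times gives Euler
    polygons that converge to the flow at time s, which is thereby a limit of holonomy maps. The
    Koszul formula writes the second derivatives of an isometry as a Lipschitz function of its
    1-jet. It yields the control of isometries by one jet, the bounds of all orders on rescaled
    differences, and the bound q + q^2 on the dimension of the stalks. Limits are taken along an
    ultrafilter on the naturals, so that bounded sequences converge at all points at once.
    Compactness of M gives a radius, independent of the length of the chain of plaques, on which
    every germ of holonomy extends. *)

Notation selfmap R q := ('rV[R]_q -> 'rV[R]_q).

(** * Smooth maps on open subsets of R^n *)

Lemma contP (R : realType) (T : topologicalType) (V : normedModType R) (f : T -> V) (x : T) :
  {for x, continuous f} <-> forall e : R, 0 < e -> \forall y \near x, `|f y - f x| < e.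
Proof.
split=> [/cvgrPdist_lt H e /H|H].
  by apply: filterS => y; rewrite distrC.
apply/cvgrPdist_lt => e /H.
by apply: filterS => y; rewrite distrC.
Qed.

Lemma near_all (T : topologicalType) (x : T) (I : finType) (P : I -> T -> Prop) :
  (forall i, \forall y \near x, P i y) -> \forall y \near x, forall i, P i y.
Proof. by move=> H; apply: filter_forall. Qed.

Lemma near_normP (R : realType) (V : normedModType R) (x : V) (P : V -> Prop) :
  (\forall y \near x, P y) <-> exists2 d : R, 0 < d & forall y, `|y - x| < d -> P y.
Proof.
split=> [/nbhs_ballP[d /= d0 dP]|[d d0 dP]].
  by exists d => // y yd; apply: dP; rewrite -ball_normE /= distrC.
apply/nbhs_ballP; exists d => //= y.
by rewrite -ball_normE /= distrC; exact: dP.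
Qed.

Section Differential.
Variables (R : realType) (V W : normedModType R).

Lemma near0_ballP (P : V -> Prop) : (\forall h \near (0 : V), P h) <->
  exists2 d : R, 0 < d & forall h, `|h| < d -> P h.
Proof.
split=> [/nbhs_ballP[d /= d0 dP]|[d d0 dP]].
  by exists d => // h hd; apply: dP; rewrite -ball_normE /= sub0r normrN.
apply/nbhs_ballP; exists d => //= h.
by rewrite -ball_normE /= sub0r normrN; exact: dP.
Qed.

Lemma diff_intro (f : V -> W) (x : V) (L : {linear V -> W}) : continuous L ->
  (forall e : R, 0 < e -> \forall h \near (0 : V), `|f (x + h) - f x - L h| <= e * `|h|) ->
  differentiable f x /\ 'd f x = L :> (V -> W).
Proof.
move=> cL fL.
have fE : f \o shift x = cst (f x) + L +o_ (0 : V) id.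
  apply/eqaddoP => e e0; have := fL e e0; apply: filterS => h /=.
  rewrite -[X in _ -> `|X| <= _]/(f (h + x) - (f x + L h)).
  by rewrite [h + x]addrC opprD addrA.
have dE := diff_unique cL fE.
split => //; apply/diff_locallyP; rewrite dE; split => //.
Qed.

Lemma diff_eps (f : V -> W) (x : V) : differentiable f x ->
  forall e : R, 0 < e ->
  \forall h \near (0 : V), `|f (x + h) - f x - 'd f x h| <= e * `|h|.
Proof.
move=> /diff_locally /eqaddoP fE e e0; have := fE e e0; apply: filterS => h /=.
rewrite -[X in `|X| <= _ -> _]/(f (h + x) - (f x + 'd f x h)).
by rewrite [h + x]addrC opprD addrA.
Qed.

End Differential.

Section Partials.
Variable R : realType.
Implicit Types p q r : nat.

Definition pd p (l : 'I_p) (f : 'rV[R]_p -> R) (x : 'rV[R]_p) : R :=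
  'D_(delta_mx 0 l) f x.

Lemma Ck_cont p k (U : set 'rV[R]_p) f x : Ck k U f -> U x -> {for x, continuous f}.
Proof. by case: k => [|k] [H _] /H. Qed.

Lemma Ck_le p k (U : set 'rV[R]_p) f : Ck k.+1 U f -> Ck k U f.
Proof.
elim: k f => [|k IH] f; first by case.
move=> [H1 H2]; split=> // l; have [H3 H4] := H2 l; split=> //; exact: IH.
Qed.

Lemma Ck_leq p k k' (U : set 'rV[R]_p) f : (k <= k')%N -> Ck k' U f -> Ck k U f.
Proof.
elim: k' => [|k' IH]; first by rewrite leqn0 => /eqP ->.
by rewrite leq_eqVlt => /predU1P[->//|]; rewrite ltnS => /IH H /Ck_le.
Qed.

Lemma Ck_sub p k (U U' : set 'rV[R]_p) f : U' `<=` U -> Ck k U f -> Ck k U' f.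
Proof.
move=> UU; elim: k f => [|k IH] f [H1 H2]; split=> //; first by move=> x /UU/H1.
  by move=> x /UU/H1.
move=> l; by have [H3 H4] := H2 l; split=> [x /UU/H3//|]; exact: IH.
Qed.

Lemma smooth_sub p (U U' : set 'rV[R]_p) f : U' `<=` U -> smooth_on U f -> smooth_on U' f.
Proof. by move=> UU H k; exact: Ck_sub (H k). Qed.

Lemma open_near (T : topologicalType) (U : set T) x : open U -> U x -> \forall y \near x, U y.
Proof. by move=> oU Ux; apply: open_nbhs_nbhs; split. Qed.

Lemma eq_on_near p (U : set 'rV[R]_p) (f g : 'rV[R]_p -> R) x : open U -> U x ->
  {in U, f =1 g} -> \forall y \near x, f y = g y.
Proof.
move=> oU Ux fg; apply: filterS (open_near oU Ux) => y Uy; apply: fg.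
exact/mem_set.
Qed.

Lemma cont_near_eq (T T' : topologicalType) (f g : T -> T') x :
  (\forall y \near x, f y = g y) -> {for x, continuous f} -> {for x, continuous g}.
Proof.
move=> fg; have E : f x = g x := nbhs_singleton fg.
rewrite /prop_for /continuous_at E => H.
exact: (cvg_trans (@near_eq_cvg _ _ (nbhs x) _ _ _ fg) H).
Qed.

Lemma Ck_ext p k (U : set 'rV[R]_p) f g : open U -> {in U, f =1 g} ->
  Ck k U f -> Ck k U g.
Proof.
move=> oU; elim: k f g => [|k IH] f g fg [H1 H2].
  by split=> // x Ux; apply: cont_near_eq (H1 x Ux); exact: (eq_on_near oU Ux fg).
split.
  by move=> x Ux; apply: cont_near_eq (H1 x Ux); exact: (eq_on_near oU Ux fg).
move=> l; have [H3 H4] := H2 l; split.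
  by move=> x Ux; apply: near_eq_derivable (H3 x Ux); exact: (eq_on_near oU Ux fg).
apply: IH H4 => x /set_mem Ux; apply: near_eq_derive; exact: (eq_on_near oU Ux fg).
Qed.

Lemma smooth_ext p (U : set 'rV[R]_p) f g : open U -> {in U, f =1 g} ->
  smooth_on U f -> smooth_on U g.
Proof. by move=> oU fg H k; exact: Ck_ext (H k). Qed.

Lemma smooth_pd p (U : set 'rV[R]_p) f l : smooth_on U f -> smooth_on U (pd l f).
Proof. by move=> H k; have [_ /(_ l)[]] := H k.+1. Qed.

Lemma smooth_derivable p (U : set 'rV[R]_p) f l x : smooth_on U f -> U x ->
  derivable f x (delta_mx 0 l).
Proof. by move=> H; have [_ /(_ l)[+ _]] := H 1%N; apply. Qed.

Lemma row_delta p (v : 'rV[R]_p) : v = \sum_l v 0 l *: delta_mx 0 l.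
Proof. exact: row_sum_delta. Qed.

Lemma diff_pd p (f : 'rV[R]_p -> R) x v : differentiable f x ->
  'd f x v = \sum_l v 0 l * pd l f x.
Proof.
move=> df; rewrite {1}(row_delta v) linear_sum; apply: eq_bigr => l _.
by rewrite linearZ /= /pd deriveE.
Qed.

Lemma derivable_line (V : normedModType R) (f : V -> R) (x v : V) (s : R) :
  derivable f (x + s *: v) v ->
  is_derive s 1 (fun s => f (x + s *: v)) ('D_v f (x + s *: v)).
Proof.
move=> df.
have E : (fun h => h^-1 *: (((fun s => f (x + s *: v)) \o shift s) (h *: 1) - f (x + s *: v)))
  = (fun h => h^-1 *: ((f \o shift (x + s *: v)) (h *: v) - f (x + s *: v))).
  apply/funext => h /=; congr (_ *: (f _ - _)).
  by rewrite [_ *: 1]mulr1 scalerDl addrCA addrA.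
by apply: DeriveDef; rewrite /derivable /derive E.
Qed.

Lemma derivable_scale (V : normedModType R) (f : V -> R) (x v : V) (h : R) :
  derivable f x v -> derivable f x (h *: v) /\ 'D_(h *: v) f x = h * 'D_v f x.
Proof.
move=> df; have [->|h0] := eqVneq h 0.
  by rewrite scale0r mul0r; split; [exact: derivable0|exact: derive0].
have dl : derivable f (x + 0 *: v) v by rewrite scale0r addr0.
have H := derivable_line dl.
have H1 : is_derive (0 : R) 1 (fun s : R => h * s) h.
  have E : (fun s : R => h * s) = h *: (id : R -> R) by [].
  by rewrite E; apply: is_derive_eq; rewrite /GRing.scale /= mulr1.
have := @is_derive1_comp R (fun s => f (x + s *: v)) (fun s : R => h * s) 0
  ('D_v f (x + 0 *: v)) h.
rewrite mulr0 => /(_ H H1).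
have -> : (fun s => f (x + s *: v)) \o (fun s : R => h * s)
  = fun s : R => f (s *: (h *: v) + x).
  by apply/funext => s /=; rewrite scalerA addrC mulrC.
move=> [D1 D2]; split; first by apply/derivable1P.
move: D2; rewrite scale0r addr0 mulrC => <-.
rewrite /derive.
have -> // : (fun t : R => t^-1 *: ((f \o shift x) (t *: (h *: v)) - f x)) =
  (fun t : R => t^-1 *: (((fun s => f (s *: (h *: v) + x)) \o shift 0) (t *: 1) -
     f (0 *: (h *: v) + x))).
by apply/funext => t /=; rewrite addr0 scale0r add0r [_ *: 1]mulr1.
Qed.

Lemma mvt_line (V : normedModType R) (f : V -> R) (x v : V) :
  (forall s : R, 0 <= s <= 1 -> derivable f (x + s *: v) v) ->
  exists2 c : R, 0 <= c <= 1 & f (x + v) - f x = 'D_v f (x + c *: v).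
Proof.
move=> H.
have [| |c] := @MVT_segment R (fun s => f (x + s *: v)) (fun s => 'D_v f (x + s *: v)) 0 1 ler01.
- by move=> s /[!in_itv]/= /andP[s0 s1]; apply/derivable_line/H; rewrite !ltW.
- apply: derivable_within_continuous => s /[!in_itv]/= /H/derivable_line[] //.
- by rewrite in_itv /= subr0 mulr1 scale1r scale0r addr0 => c01 E; exists c.
Qed.

Lemma mvt_coord p (f : 'rV[R]_p -> R) x l (h : R) :
  (forall s : R, 0 <= s <= 1 -> derivable f (x + (s * h) *: delta_mx 0 l) (delta_mx 0 l)) ->
  exists2 c : R, 0 <= c <= 1 &
    f (x + h *: delta_mx 0 l) - f x = h * pd l f (x + (c * h) *: delta_mx 0 l).
Proof.
move=> H; have [s s01|c c01 ->] := @mvt_line _ f x (h *: delta_mx 0 l).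
  by rewrite scalerA; exact: (derivable_scale _ (H s s01)).1.
by exists c => //; rewrite scalerA (derivable_scale _ (H c c01)).2.
Qed.

Lemma mx_norm_le m n (A : 'M[R]_(m, n)) (e : R) : 0 <= e ->
  `|A| <= e <-> forall i j, `|A i j| <= e.
Proof.
move=> e0; rewrite /Num.Def.normr/= mx_normrE; split=> [H i j|H].
  apply: le_trans H.
  exact: (@le_bigmax _ _ _ 0 (fun i : 'I_m * 'I_n => `|A i.1 i.2|) (i, j)).
by apply: bigmax_le => // -[i j] _; exact: H.
Qed.

Lemma mx_entry_le m n (A : 'M[R]_(m, n)) i j : `|A i j| <= `|A|.
Proof. by apply: (mx_norm_le A (normr_ge0 A)).1. Qed.

Lemma mx_entry_leB m n (A B : 'M[R]_(m, n)) i j : `|A i j - B i j| <= `|A - B|.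
Proof. by have := mx_entry_le (A - B) i j; rewrite !mxE. Qed.

Lemma mx_norm_leB m n (A B : 'M[R]_(m, n)) (e : R) : 0 <= e ->
  (forall i j, `|A i j - B i j| <= e) -> `|A - B| <= e.
Proof. by move=> e0 H; apply/mx_norm_le => // i j; rewrite !mxE. Qed.

Lemma mx_norm_lt m n (A : 'M[R]_(m, n)) (e : R) : 0 < e ->
  (forall i j, `|A i j| < e) -> `|A| < e.
Proof.
move=> e0 H; rewrite /Num.Def.normr/= mx_normrE.
by apply: bigmax_lt => // -[i j] _; exact: H.
Qed.

Lemma ballE (V : normedModType R) (x : V) (e : R) y : ball x e y = (`|y - x| < e).
Proof. by rewrite -ball_normE /= distrC. Qed.

(* The k-th vertex of the path from x to x + h along the coordinate axes. *)
Definition cpath p (x h : 'rV[R]_p) (k : nat) : 'rV[R]_p :=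
  \row_l (if (l < k)%N then x 0 l + h 0 l else x 0 l).

Lemma cpath0 p (x h : 'rV[R]_p) : cpath x h 0 = x.
Proof. by apply/rowP => l; rewrite mxE. Qed.

Lemma cpathn p (x h : 'rV[R]_p) : cpath x h p = x + h.
Proof. by apply/rowP => l; rewrite !mxE ltn_ord. Qed.

Lemma cpathS p (x h : 'rV[R]_p) (k : 'I_p) :
  cpath x h k.+1 = cpath x h k + h 0 k *: delta_mx 0 k.
Proof.
apply/rowP => l; rewrite !mxE eqxx /= ltnS leq_eqVlt.
rewrite val_eqE; case: (eqVneq l k) => [->|ne] /=.
  by rewrite ltnn mulr1.
by rewrite mulr0 addr0.
Qed.

Lemma cpath_near p (x h : 'rV[R]_p) (k : 'I_p) (c : R) : 0 <= c <= 1 ->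
  `|cpath x h k + (c * h 0 k) *: delta_mx 0 k - x| <= `|h|.
Proof.
move=> /andP[c0 c1]; apply/mx_norm_le => // i l; rewrite (ord1 i) !mxE eqxx /=.
have hl := mx_entry_le h 0 l.
case: (ltngtP l k) => [lk|lk|lk].
- by rewrite -val_eqE (ltn_eqF lk) mulr0 addr0 addrAC subrr add0r.
- by rewrite -val_eqE (gtn_eqF lk) mulr0 addr0 subrr normr0.
- have -> : l = k by apply: val_inj.
  rewrite eqxx mulr1 addrAC subrr add0r normrM (ger0_norm c0).
  by rewrite (le_trans _ (mx_entry_le h 0 k)) // ler_piMl.
Qed.

(** The increment is split along the axis-parallel path from x to x + h. The mean value theorem
    turns each edge into a partial derivative at a point within |h| of x, where it is close to its
    value at x. *)
Lemma C1_diff p (U : set 'rV[R]_p) f x : open U -> Ck 1 U f -> U x -> differentiable f x.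
Proof.
move=> oU [fc f1] Ux.
pose c : 'cV[R]_p := \col_l pd l f x.
pose L0 (v : 'rV[R]_p) : R := (v *m c) 0 0.
have L0l : linear L0 by move=> a u v; rewrite /L0 mulmxDl -scalemxAl !mxE.
pose LL := GRing.isLinear.Build R 'rV[R]_p R _ L0 L0l.
pose L : {linear 'rV[R]_p -> R} := HB.pack L0 LL.
have LE v : L v = \sum_l v 0 l * pd l f x.
  by rewrite /= /L0 mxE; apply: eq_bigr => l _; rewrite mxE.
have Lb v : `|L v| <= (\sum_l `|pd l f x|) * `|v|.
  rewrite LE mulr_suml; apply: le_trans (ler_norm_sum _ _ _) _.
  by apply: ler_sum => l _; rewrite normrM mulrC ler_wpM2l // mx_entry_le.
have cL : continuous L.
  apply: bounded_linear_continuous; apply/linear_boundedP.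
  apply: filterS (nbhs_pinfty_ge (num_real (\sum_l `|pd l f x|))) => r Hr v.
  by apply: le_trans (Lb v) _; rewrite ler_wpM2r.
apply: (diff_intro cL _).1 => e e0.
(* Dividing by p + 1 keeps the quotient meaningful for p = 0; the extra share of the error is given
   away below. *)
pose e' := e / (p.+1)%:R.
have e'0 : 0 < e' by rewrite divr_gt0.
have H2 : \forall y \near x, forall l, `|pd l f y - pd l f x| <= e'.
  apply: near_all => l.
  have /contP/(_ _ e'0) := (f1 l).2.1 x Ux.
  by apply: filterS => y /ltW.
have /near_normP[d d0 dH] : \forall y \near x, U y /\ forall l, `|pd l f y - pd l f x| <= e'.
  exact: filterI (open_near oU Ux) H2.
apply/near0_ballP; exists d => // h hd.
have Hd (k : 'I_p) (s : R) : 0 <= s <= 1 -> `|cpath x h k + (s * h 0 k) *: delta_mx 0 k - x| < d.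
  by move=> s01; rewrite (le_lt_trans _ hd) // cpath_near.
have T : f (x + h) - f x = \sum_(k < p) (f (cpath x h k.+1) - f (cpath x h k)).
  rewrite -(big_mkord xpredT (fun k => f (cpath x h k.+1) - f (cpath x h k))).
  by rewrite telescope_sumr // cpath0 cpathn.
rewrite T LE -sumrB.
apply: le_trans (ler_norm_sum _ _ _) _.
have -> : e * `|h| = \sum_(k < p.+1) e' * `|h|.
  rewrite sumr_const card_ord -mulr_natl mulrA; congr (_ * _).
  by rewrite /e' mulrC -mulrA mulVf ?mulr1.
rewrite big_ord_recl; apply: ler_wpDl; first by rewrite mulr_ge0 // ltW.
apply: ler_sum => k _.
have [s s01|s s01] := @mvt_coord p f (cpath x h k) k (h 0 k).
  by apply: (f1 k).1; apply: (dH _ (Hd k s s01)).1.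
rewrite -cpathS => ->; rewrite -mulrBr normrM mulrC.
apply: ler_pM => //; first exact: (dH _ (Hd k s s01)).2.
exact: mx_entry_le.
Qed.

Lemma smooth_diff p (U : set 'rV[R]_p) f x : open U -> smooth_on U f -> U x -> differentiable f x.
Proof. by move=> oU H; exact: C1_diff (H 1%N). Qed.

Lemma Ck_cst p k (U : set 'rV[R]_p) (c : R) : Ck k U (fun=> c).
Proof.
elim: k c => [|k IH] c; split=> //; try by move=> x _; exact: cst_continuous.
move=> l; split; first by move=> x _; exact: derivable_cst.
suff -> : 'D_(delta_mx 0 l) (fun=> c) = (fun=> 0 : R) :> ('rV[R]_p -> R) by exact: IH.
by apply/funext => x; exact: derive_cst.
Qed.

Lemma diff_coord p (l : 'I_p) (x : 'rV[R]_p) :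
  differentiable (fun x : 'rV[R]_p => x 0 l) x.
Proof. exact: differentiable_coord. Qed.

Lemma pd_coord p (l k : 'I_p) (x : 'rV[R]_p) : pd k (fun x : 'rV[R]_p => x 0 l) x = (k == l)%:R.
Proof.
rewrite /pd; apply: derive_val.
apply: DeriveDef; first exact/diff_derivable/diff_coord.
rewrite /derive; apply: cvg_lim => //.
apply: (@cvg_trans _ ((fun=> ((k == l)%:R : R)) @ (0 : R)^')); last exact: cvg_cst.
apply: near_eq_cvg; near=> h; rewrite /= !mxE eqxx /= addrK.
rewrite /GRing.scale /= mulrA mulVf ?mul1r //; first by rewrite eq_sym.
by near: h; exact: nbhs_dnbhs_neq.
Unshelve. all: by end_near.
Qed.

Lemma Ck_coord p k (U : set 'rV[R]_p) (l : 'I_p) : Ck k U (fun x : 'rV[R]_p => x 0 l).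
Proof.
case: k => [|k]; split=> //; try by move=> x _; exact: coord_continuous.
move=> j; split; first by move=> x _; exact/diff_derivable/diff_coord.
suff -> : 'D_(delta_mx 0 j) (fun x : 'rV[R]_p => x 0 l) = (fun=> (j == l)%:R) by exact: Ck_cst.
by apply/funext => x; exact: pd_coord.
Qed.

Lemma Ck_add p k (U : set 'rV[R]_p) f g : open U -> Ck k U f -> Ck k U g ->
  Ck k U (fun x => f x + g x).
Proof.
move=> oU; elim: k f g => [|k IH] f g [f1 f2] [g1 g2]; split=> //;
  try by move=> x Ux; apply: continuousD; [exact: f1|exact: g1].
move=> l; have [f3 f4] := f2 l; have [g3 g4] := g2 l; split.
  by move=> x Ux; apply: derivableD; [exact: f3|exact: g3].
apply: (Ck_ext oU _ (IH _ _ f4 g4)) => x /set_mem Ux.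
by rewrite /pd (deriveD (f3 x Ux) (g3 x Ux)).
Qed.

Lemma Ck_mul p k (U : set 'rV[R]_p) f g : open U -> Ck k U f -> Ck k U g ->
  Ck k U (fun x => f x * g x).
Proof.
move=> oU; elim: k f g => [|k IH] f g Hf Hg; split=> //;
  try by move=> x Ux; apply: continuousM; [exact: (Ck_cont Hf)|exact: (Ck_cont Hg)].
have [_ f2] := Hf; have [_ g2] := Hg.
move=> l; have [f3 f4] := f2 l; have [g3 g4] := g2 l; split.
  by move=> x Ux; apply: derivableM; [exact: f3|exact: g3].
have H := Ck_add oU (IH _ _ (Ck_le Hf) g4) (IH _ _ f4 (Ck_le Hg)).
apply: (Ck_ext oU _ H) => x /set_mem Ux.
by rewrite (deriveM (f3 x Ux) (g3 x Ux)) /GRing.scale /= [X in _ + X]mulrC.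
Qed.

Lemma pdD p (f g : 'rV[R]_p -> R) l x : derivable f x (delta_mx 0 l) ->
  derivable g x (delta_mx 0 l) -> pd l (fun x => f x + g x) x = pd l f x + pd l g x.
Proof. by move=> df dg; rewrite /pd (deriveD df dg). Qed.

Lemma pdM p (f g : 'rV[R]_p -> R) l x : derivable f x (delta_mx 0 l) ->
  derivable g x (delta_mx 0 l) ->
  pd l (fun x => f x * g x) x = f x * pd l g x + pd l f x * g x.
Proof. by move=> df dg; rewrite /pd (deriveM df dg) /GRing.scale /= [X in _ + X]mulrC. Qed.

Lemma smooth_cst p (U : set 'rV[R]_p) (c : R) : smooth_on U (fun=> c).
Proof. by move=> k; exact: Ck_cst. Qed.

Lemma smooth_coord p (U : set 'rV[R]_p) l : smooth_on U (fun x : 'rV[R]_p => x 0 l).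
Proof. by move=> k; exact: Ck_coord. Qed.

Lemma smooth_add p (U : set 'rV[R]_p) f g : open U -> smooth_on U f -> smooth_on U g ->
  smooth_on U (fun x => f x + g x).
Proof. by move=> oU Hf Hg k; apply: Ck_add. Qed.

Lemma smooth_mul p (U : set 'rV[R]_p) f g : open U -> smooth_on U f -> smooth_on U g ->
  smooth_on U (fun x => f x * g x).
Proof. by move=> oU Hf Hg k; apply: Ck_mul. Qed.

Lemma Ck_sum p k (U : set 'rV[R]_p) (I : Type) (r : seq I) (P : pred I) (f : I -> 'rV[R]_p -> R) :
  open U -> (forall i, P i -> Ck k U (f i)) -> Ck k U (fun x => \sum_(i <- r | P i) f i x).
Proof.
move=> oU Hf; elim: r => [|i r IH].
  by apply: (Ck_ext oU _ (Ck_cst k U 0)) => x _; rewrite big_nil.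
have [Pi|nPi] := boolP (P i).
  by apply: (Ck_ext oU _ (Ck_add oU (Hf i Pi) IH)) => x _; rewrite big_cons Pi.
by apply: (Ck_ext oU _ IH) => x _; rewrite big_cons (negbTE nPi).
Qed.

Lemma Ck_prod p k (U : set 'rV[R]_p) (I : Type) (r : seq I) (P : pred I) (f : I -> 'rV[R]_p -> R) :
  open U -> (forall i, P i -> Ck k U (f i)) -> Ck k U (fun x => \prod_(i <- r | P i) f i x).
Proof.
move=> oU Hf; elim: r => [|i r IH].
  by apply: (Ck_ext oU _ (Ck_cst k U 1)) => x _; rewrite big_nil.
have [Pi|nPi] := boolP (P i).
  by apply: (Ck_ext oU _ (Ck_mul oU (Hf i Pi) IH)) => x _; rewrite big_cons Pi.
by apply: (Ck_ext oU _ IH) => x _; rewrite big_cons (negbTE nPi).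
Qed.

Lemma smooth_sum p (U : set 'rV[R]_p) (I : Type) (r : seq I) (P : pred I) (f : I -> 'rV[R]_p -> R) :
  open U -> (forall i, P i -> smooth_on U (f i)) -> smooth_on U (fun x => \sum_(i <- r | P i) f i x).
Proof. by move=> oU Hf k; apply: Ck_sum => // i Pi; exact: Hf. Qed.

Lemma smooth_opp p (U : set 'rV[R]_p) f : open U -> smooth_on U f -> smooth_on U (fun x => - f x).
Proof.
move=> oU Hf; apply: (smooth_ext oU _ (smooth_mul oU (smooth_cst U (-1)) Hf)).
by move=> x _; rewrite mulN1r.
Qed.

Lemma smooth_sub2 p (U : set 'rV[R]_p) f g : open U -> smooth_on U f -> smooth_on U g ->
  smooth_on U (fun x => f x - g x).
Proof. by move=> oU Hf Hg; apply: smooth_add => //; exact: smooth_opp. Qed.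

Lemma smooth_det p m (U : set 'rV[R]_p) (A : 'rV[R]_p -> 'M[R]_m) : open U ->
  (forall i j, smooth_on U (fun x => A x i j)) -> smooth_on U (fun x => \det (A x)).
Proof.
move=> oU HA k; apply: Ck_sum => // s _; apply: Ck_mul => //; first exact: Ck_cst.
by apply: Ck_prod => // i _; exact: HA.
Qed.

Lemma smooth_inv p (U : set 'rV[R]_p) (f : 'rV[R]_p -> R) : open U -> (forall x, U x -> f x != 0) ->
  smooth_on U f -> smooth_on U (fun x => (f x)^-1).
Proof.
move=> oU f0 Hf; elim => [|k IH].
  by split=> // x Ux; apply: continuousV; [exact: f0|exact: (Ck_cont (Hf 0%N))].
split; first by move=> x Ux; apply: continuousV; [exact: f0|exact: (Ck_cont (Hf 0%N))].
move=> l; split.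
  by move=> x Ux; apply: derivableV; [exact: f0|exact: (smooth_derivable Hf)].
have H := Ck_mul oU (Ck_mul oU (Ck_cst k U (-1)) (Ck_mul oU IH IH)) (smooth_pd l Hf k).
apply: (Ck_ext oU _ H) => x /set_mem Ux.
rewrite (deriveV (f0 x Ux) (smooth_derivable Hf Ux)) mulN1r /GRing.scale /=.
by rewrite -exprVn expr2.
Qed.

Lemma smooth_adj p m (U : set 'rV[R]_p) (A : 'rV[R]_p -> 'M[R]_m) : open U ->
  (forall i j, smooth_on U (fun x => A x i j)) ->
  forall i j, smooth_on U (fun x => (\adj (A x)) i j).
Proof.
move=> oU HA i j.
suff: smooth_on U (fun x => cofactor (A x) j i).
  by apply: smooth_ext => // x _; rewrite mxE.
apply: smooth_mul => //; first exact: smooth_cst.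
by apply: smooth_det => // i' j'; apply: (smooth_ext oU _ (HA (lift j i') (lift i j'))) => x _; rewrite !mxE.
Qed.

Lemma smooth_invmx p m (U : set 'rV[R]_p) (A : 'rV[R]_p -> 'M[R]_m) : open U ->
  (forall x, U x -> A x \in unitmx) -> (forall i j, smooth_on U (fun x => A x i j)) ->
  forall i j, smooth_on U (fun x => (invmx (A x)) i j).
Proof.
move=> oU A1 HA i j.
have H : smooth_on U (fun x => (\det (A x))^-1 * (\adj (A x)) i j).
  apply: smooth_mul => //; last exact: smooth_adj.
  apply: smooth_inv => //; last exact: smooth_det.
  by move=> x /A1; rewrite unitmxE unitfE.
by apply: (smooth_ext oU _ H) => x /set_mem/A1 Ax; rewrite /invmx Ax [RHS]mxE.
Qed.

Lemma smooth_mulmx p m n r (U : set 'rV[R]_p) (A : 'rV[R]_p -> 'M[R]_(m, n))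
   (A' : 'rV[R]_p -> 'M[R]_(n, r)) : open U ->
  (forall i j, smooth_on U (fun x => A x i j)) -> (forall i j, smooth_on U (fun x => A' x i j)) ->
  forall i j, smooth_on U (fun x => (A x *m A' x) i j).
Proof.
move=> oU HA HA' i j.
have H : smooth_on U (fun x => \sum_k A x i k * A' x k j).
  by apply: smooth_sum => // k _; exact: smooth_mul.
by apply: (smooth_ext oU _ H) => x _; rewrite mxE.
Qed.

Lemma cont_comp_row p r (phi : 'rV[R]_p -> 'rV[R]_r) (x : 'rV[R]_p) :
  (forall j, {for x, continuous (fun y => phi y 0 j)}) -> {for x, continuous phi}.
Proof.
move=> H; apply/contP => e e0.
have /nbhs_ballP[d /= d0 dH] : \forall y \near x, forall j, `|phi y 0 j - phi x 0 j| < e.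
  by apply: near_all => j; exact: ((contP _ _).1 (H j) e e0).
apply/nbhs_ballP; exists d => //= y /dH Hy.
by apply: mx_norm_lt => // i j; rewrite (ord1 i) !mxE.
Qed.

Lemma diff_row p r (phi : 'rV[R]_p -> 'rV[R]_r) (x : 'rV[R]_p) :
  (forall j, differentiable (fun y => phi y 0 j) x) ->
  differentiable phi x /\ forall v j, ('d phi x v) 0 j = 'd (fun y => phi y 0 j) x v.
Proof.
move=> H.
pose L0 (v : 'rV[R]_p) : 'rV[R]_r := \row_j 'd (fun y => phi y 0 j) x v.
have L0l : linear L0.
  by move=> a u v; apply/rowP => j; rewrite !mxE linearP.
pose LL := GRing.isLinear.Build R 'rV[R]_p 'rV[R]_r _ L0 L0l.
pose L : {linear 'rV[R]_p -> 'rV[R]_r} := HB.pack L0 LL.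
have cL : continuous L.
  move=> y; apply: cont_comp_row => j.
  have -> : (fun v => L v 0 j) = 'd (fun y => phi y 0 j) x.
    by apply/funext => v; rewrite mxE.
  exact: (diff_continuous (H j)).
have [|d1 d2] := diff_intro (f := phi) (x := x) cL.
  move=> e e0.
  have /near0_ballP[d d0 dH] : \forall h \near (0 : 'rV[R]_p), forall j,
      `|phi (x + h) 0 j - phi x 0 j - 'd (fun y => phi y 0 j) x h| <= e * `|h|.
    by apply: near_all => j; exact: (diff_eps (H j) e0).
  apply/near0_ballP; exists d => // h /dH Hh; apply/mx_norm_le => [|i j].
    by rewrite mulr_ge0 // ltW.
  by rewrite (ord1 i) !mxE.
by split=> // v j; rewrite d2 mxE.
Qed.

Lemma smooth_map_diff p r (U : set 'rV[R]_p) (phi : 'rV[R]_p -> 'rV[R]_r) x : open U ->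
  smooth_map_on U phi -> U x -> differentiable phi x.
Proof.
by move=> oU H Ux; apply: (diff_row _).1 => j; exact: (smooth_diff oU (H j)).
Qed.

(* Sealed by Qed, to keep unification from unfolding the differential. *)
Lemma jac_seal : {J : forall p r, ('rV[R]_p -> 'rV[R]_r) -> 'rV[R]_p -> 'M[R]_(p, r) |
  forall p r (phi : 'rV[R]_p -> 'rV[R]_r) x, J p r phi x = 'J phi x}.
Proof. by exists (fun p r phi x => 'J phi x). Qed.

Definition Jac p r (phi : 'rV[R]_p -> 'rV[R]_r) x : 'M[R]_(p, r) := sval jac_seal p r phi x.

Lemma JacE p r (phi : 'rV[R]_p -> 'rV[R]_r) x : Jac phi x = 'J phi x.
Proof. exact: (svalP jac_seal). Qed.

Lemma jacE p r (phi : 'rV[R]_p -> 'rV[R]_r) x i j :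
  (forall j, differentiable (fun y => phi y 0 j) x) ->
  (Jac phi x) i j = pd i (fun y => phi y 0 j) x.
Proof.
move=> H; have [d1 d2] := diff_row H.
by rewrite JacE /jacobian mxE d2 /pd deriveE.
Qed.

Lemma jacE_smooth p r (U : set 'rV[R]_p) (phi : 'rV[R]_p -> 'rV[R]_r) x i j :
  open U -> smooth_map_on U phi -> U x ->
  (Jac phi x) i j = pd i (fun y => phi y 0 j) x.
Proof. by move=> oU H Ux; apply: jacE => k; exact: (smooth_diff oU (H k)). Qed.

Lemma diff_jac p r (phi : 'rV[R]_p -> 'rV[R]_r) x v :
  'd phi x v = v *m Jac phi x.
Proof. by rewrite JacE /jacobian mul_rV_lin1. Qed.

Lemma jac_comp p r t (phi : 'rV[R]_p -> 'rV[R]_r) (psi : 'rV[R]_r -> 'rV[R]_t) x :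
  differentiable phi x -> differentiable psi (phi x) ->
  Jac (psi \o phi) x = Jac phi x *m Jac psi (phi x).
Proof.
move=> d1 d2; apply/row_matrixP => i; rewrite !rowE mulmxA -!diff_jac.
by rewrite diff_comp.
Qed.

Lemma jac_id p (x : 'rV[R]_p) : Jac id x = 1%:M.
Proof.
apply/row_matrixP => i; rewrite !rowE -diff_jac mulmx1.
by rewrite (@diff_val _ _ _ _ _ id id _).
Qed.

Lemma diff_near (V W : normedModType R) (phi psi : V -> W) x : differentiable phi x ->
  (\forall y \near x, phi y = psi y) ->
  differentiable psi x /\ 'd psi x = 'd phi x :> (V -> W).
Proof.
move=> dphi H; apply: diff_intro; first exact: diff_continuous.
have E0 := nbhs_singleton H => e e0.
have /near0_ballP[d d0 dH] := diff_eps dphi e0.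
have /nbhs_ballP[d' /= d'0 dH'] := H.
apply/near0_ballP; exists (Num.min d d') => [|h]; first by rewrite lt_min d0.
rewrite lt_min => /andP[h1 h2]; rewrite -E0 -dH' ?dH //.
by rewrite ballE addrAC subrr add0r.
Qed.

Lemma jac_near p r (phi psi : 'rV[R]_p -> 'rV[R]_r) x : differentiable phi x ->
  (\forall y \near x, phi y = psi y) -> Jac psi x = Jac phi x.
Proof.
move=> dphi H; have [_ E] := diff_near dphi H.
have E1 (v : 'rV[R]_p) : v *m Jac psi x = v *m Jac phi x.
  transitivity ('d psi x v); first exact/esym/diff_jac.
  transitivity ('d phi x v); last exact: diff_jac.
  exact: (congr1 (fun g => g v) E).
apply/row_matrixP => i.
apply: etrans (rowE _ _) _.
apply: etrans (E1 _) _.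
exact/esym/rowE.
Qed.

(** [phi] is of class C^k only, while f is smooth: the induction applies to the partial derivatives
    of f composed with the same [phi], whose class has dropped by one. *)
Lemma Ck_comp p r k (U : set 'rV[R]_p) (W : set 'rV[R]_r) (phi : 'rV[R]_p -> 'rV[R]_r) f :
  open U -> open W -> (forall x, U x -> W (phi x)) ->
  (forall j, Ck k U (fun x => phi x 0 j)) -> smooth_on W f -> Ck k U (f \o phi).
Proof.
move=> oU oW UW; elim: k f => [|k IH] f Hphi Hf.
  split=> // x Ux; apply: continuous_comp; last exact: (Ck_cont (Hf 0%N) (UW x Ux)).
  by apply: cont_comp_row => j; exact: (Ck_cont (Hphi j)).
have cphi x : U x -> {for x, continuous (f \o phi)}.
  move=> Ux; apply: continuous_comp; last exact: (Ck_cont (Hf 0%N) (UW x Ux)).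
  by apply: cont_comp_row => j; exact: (Ck_cont (Hphi j)).
have dphi x : U x -> forall j, differentiable (fun y => phi y 0 j) x.
  by move=> Ux j; apply: (C1_diff oU _ Ux); exact: Ck_leq (Hphi j).
have df x : U x -> differentiable f (phi x).
  by move=> Ux; exact: (smooth_diff oW Hf (UW x Ux)).
split=> // l; split.
  move=> x Ux; apply: diff_derivable; apply: differentiable_comp; last exact: df.
  exact: (diff_row (dphi x Ux)).1.
have H : Ck k U (fun x => \sum_j pd l (fun y => phi y 0 j) x * (pd j f \o phi) x).
  apply: Ck_sum => // j _; apply: Ck_mul => //; first exact: ((Hphi j).2 l).2.
  by apply: IH; [move=> i; exact: Ck_le|exact: smooth_pd].
apply: (Ck_ext oU _ H) => x /set_mem Ux.
have [d1 d2] := diff_row (dphi x Ux).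
rewrite deriveE; last by apply: differentiable_comp => //; exact: df.
rewrite diff_comp //; last exact: df.
rewrite /= (diff_pd _ (df x Ux)); apply: eq_bigr => j _.
by rewrite d2 /pd -deriveE //; exact: dphi.
Qed.

Lemma smooth_comp p r (U : set 'rV[R]_p) (W : set 'rV[R]_r) (phi : 'rV[R]_p -> 'rV[R]_r) f :
  open U -> open W -> (forall x, U x -> W (phi x)) ->
  smooth_map_on U phi -> smooth_on W f -> smooth_on U (f \o phi).
Proof. by move=> oU oW UW Hphi Hf k; apply: (Ck_comp oU oW) => // j; exact: Hphi. Qed.

Lemma smooth_map_comp p r t (U : set 'rV[R]_p) (W : set 'rV[R]_r) (phi : 'rV[R]_p -> 'rV[R]_r)
  (psi : 'rV[R]_r -> 'rV[R]_t) :
  open U -> open W -> (forall x, U x -> W (phi x)) ->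
  smooth_map_on U phi -> smooth_map_on W psi -> smooth_map_on U (psi \o phi).
Proof. by move=> oU oW UW Hphi Hf j; apply: (smooth_comp oU oW UW Hphi (Hf j)). Qed.

Lemma pd_comp p r (phi : 'rV[R]_p -> 'rV[R]_r) (f : 'rV[R]_r -> R) x l :
  (forall j, differentiable (fun y => phi y 0 j) x) -> differentiable f (phi x) ->
  pd l (f \o phi) x = \sum_j pd l (fun y => phi y 0 j) x * pd j f (phi x).
Proof.
move=> dphi df; have [d1 d2] := diff_row dphi.
rewrite /pd deriveE; last exact: differentiable_comp.
rewrite diff_comp //= (diff_pd _ df); apply: eq_bigr => j _.
by rewrite d2 /pd -deriveE //; exact: dphi.
Qed.

Lemma smooth_jac p r (U : set 'rV[R]_p) (phi : 'rV[R]_p -> 'rV[R]_r) : open U ->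
  smooth_map_on U phi -> forall i j, smooth_on U (fun x => Jac phi x i j).
Proof.
move=> oU H i j; apply: (smooth_ext oU _ (smooth_pd i (H j))) => x /set_mem Ux.
by rewrite (jacE_smooth _ _ oU H Ux).
Qed.

Lemma smooth_cont p r (U : set 'rV[R]_p) (phi : 'rV[R]_p -> 'rV[R]_r) x :
  smooth_map_on U phi -> U x -> {for x, continuous phi}.
Proof. by move=> H Ux; apply: cont_comp_row => j; exact: (Ck_cont (H j 0%N)). Qed.

End Partials.

Lemma near_and (T : topologicalType) (x : T) (P Q : T -> Prop) :
  (\forall y \near x, P y) -> (\forall y \near x, Q y) -> \forall y \near x, P y /\ Q y.
Proof. by move=> H1 H2; exact: filterI. Qed.

Lemma filter_and (T : Type) (U : set_system T) (P Q : T -> Prop) : Filter U ->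
  (\forall y \near U, P y) -> (\forall y \near U, Q y) -> \forall y \near U, P y /\ Q y.
Proof. by move=> FU H1 H2; exact: filterI. Qed.

Lemma proper_ex (T : Type) (U : set_system T) (P : T -> Prop) : ProperFilter U ->
  (\forall y \near U, P y) -> exists y, P y.
Proof. by move=> FU; exact: filter_ex. Qed.

(** * Mean value inequalities, symmetry of second derivatives, connectedness *)

Section Mvt.
Variable R : realType.

(** A quadratic remainder with a fixed constant passes to pointwise limits, which an o(h) does not.
    Derivatives of limit functions and of Euler curves are obtained in this way. *)
Lemma derive_quad (V W : normedModType R) (f : V -> W) (x v : V) (d : W) (C r : R) : 0 < r ->
  (forall h : R, `|h| < r -> `|f (x + h *: v) - f x - h *: d| <= C * h ^+ 2) ->
  is_derive x v f d.
Proof.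
move=> r0 H.
suff c : (h^-1 *: ((f \o shift x) (h *: v) - f x)) @[h --> (0:R)^'] --> d.
  by apply: DeriveDef; [apply/cvg_ex; exists d|exact: cvg_lim c].
apply/cvgrPdist_le => e e0.
have C1 : 0 < `|C| + 1 by rewrite ltr_wpDl.
near=> h.
have h0 : h != 0 by near: h; exact: nbhs_dnbhs_neq.
have hr : `|h| < r by near: h; exact: dnbhs0_lt.
have he : `|h| <= e / (`|C| + 1) by near: h; apply: dnbhs0_le; rewrite divr_gt0.
have -> : d - h^-1 *: ((f \o shift x) (h *: v) - f x) =
   - (h^-1 *: (f (x + h *: v) - f x - h *: d)).
  by rewrite /= addrC [in RHS]scalerBr scalerA mulVf // scale1r opprB [h *: v + x]addrC addrC.
rewrite normrN normrZ normfV ler_pdivrMl ?normr_gt0 //.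
apply: le_trans (H h hr) _.
rewrite -[h ^+ 2]real_normK ?num_real // expr2 mulrCA ler_wpM2l //.
apply: (@le_trans _ _ ((`|C| + 1) * `|h|)).
  by rewrite ler_wpM2r // (le_trans (ler_norm _)) // lerDl.
by rewrite mulrC -ler_pdivlMr.
Unshelve. all: by end_near.
Qed.

Lemma ball_seg p (c x y : 'rV[R]_p) (r s : R) : 0 <= s <= 1 ->
  `|x - c| < r -> `|y - c| < r -> `|x + s *: (y - x) - c| < r.
Proof.
move=> /andP[s0 s1] xr yr.
have -> : x + s *: (y - x) - c = (1 - s) *: (x - c) + s *: (y - c).
  by apply/rowP => i; rewrite !mxE; ring.
apply: le_lt_trans (ler_normD _ _) _; rewrite !normrZ (ger0_norm s0) ger0_norm ?subr_ge0 //.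
have -> : r = (1 - s) * r + s * r by rewrite -mulrDl subrK mul1r.
have [->|s1'] := eqVneq s 1; first by rewrite subrr !mul0r !add0r !mul1r.
apply: ltr_leD; first by rewrite ltr_pM2l // subr_gt0 lt_neqAle s1'.
by rewrite ler_wpM2l // ltW.
Qed.

Lemma mvt_ball p (c : 'rV[R]_p) (r : R) (f : 'rV[R]_p -> R) (C : R) :
  (forall x, ball c r x -> differentiable f x) ->
  (forall l x, ball c r x -> `|pd l f x| <= C) ->
  forall x y, ball c r x -> ball c r y -> `|f y - f x| <= p%:R * C * `|y - x|.
Proof.
move=> df fC x y; rewrite !ballE => xr yr.
have seg s : 0 <= s <= 1 -> ball c r (x + s *: (y - x)).
  by move=> s01; rewrite ballE; exact: ball_seg.
have [s s01|s s01] := @mvt_line R _ f x (y - x).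
  exact/diff_derivable/df/seg.
have -> : x + (y - x) = y by rewrite addrC subrK.
move=> ->.
have dfs := df _ (seg s s01).
rewrite deriveE // (diff_pd _ dfs).
apply: le_trans (ler_norm_sum _ _ _) _.
have -> : p%:R * C * `|y - x| = \sum_(l < p) C * `|y - x|.
  by rewrite sumr_const card_ord -[RHS]mulr_natl mulrA.
apply: ler_sum => l _; rewrite normrM mulrC ler_pM //; last exact: mx_entry_le.
exact: fC (seg s s01).
Qed.

Lemma ball_open (V : normedModType R) (c : V) (r : R) : open (ball c r).
Proof. exact: ball_open. Qed.

Lemma smooth_ball_lip p (c : 'rV[R]_p) (r : R) (f : 'rV[R]_p -> R) (C : R) :
  smooth_on (ball c r) f -> (forall l x, ball c r x -> `|pd l f x| <= C) ->
  forall x y, ball c r x -> ball c r y -> `|f y - f x| <= p%:R * C * `|y - x|.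
Proof.
by move=> sf; apply: mvt_ball => x Bx; apply: smooth_diff sf Bx; exact: ball_open.
Qed.

Lemma norm_delta p (l : 'I_p) (h : R) : `|h *: (delta_mx 0 l : 'rV[R]_p)| = `|h|.
Proof.
rewrite normrZ -[RHS]mulr1; congr (_ * _); apply/eqP; rewrite eq_le; apply/andP; split.
  apply/mx_norm_le => // i j; rewrite !mxE; case: (_ && _); rewrite ?normr1 ?normr0 //.
by have := mx_entry_le (delta_mx 0 l : 'rV[R]_p) 0 l; rewrite mxE !eqxx normr1.
Qed.

Lemma pdB_shift p (f : 'rV[R]_p -> R) (w : 'rV[R]_p) l x : derivable f (x + w) (delta_mx 0 l) ->
  derivable f x (delta_mx 0 l) ->
  derivable (fun y => f (y + w) - f y) x (delta_mx 0 l) /\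
  pd l (fun y => f (y + w) - f y) x = pd l f (x + w) - pd l f x.
Proof.
move=> d1 d2.
have E : (fun h : R => h^-1 *: (((fun y => f (y + w)) \o shift x) (h *: delta_mx 0 l) - f (x + w)))
  = (fun h : R => h^-1 *: ((f \o shift (x + w)) (h *: delta_mx 0 l) - f (x + w))).
  by apply/funext => h /=; rewrite addrA.
have d3 : derivable (fun y => f (y + w)) x (delta_mx 0 l) by rewrite /derivable E.
have E3 : pd l (fun y => f (y + w)) x = pd l f (x + w) by rewrite /pd /derive E.
split; first exact: derivableB.
by rewrite -E3 /pd (deriveB d3 d2).
Qed.

(** The left side is symmetric in a and b, whereas two applications of the mean value theorem
    present it as a mixed partial in a prescribed order. Comparing both orders at points within 2|h|
    of x gives [clairaut]. *)
Lemma second_diff p (U : set 'rV[R]_p) f a b x (h : R) : open U -> Ck 2 U f ->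
  (forall y, `|y - x| <= 2 * `|h| -> U y) ->
  exists2 z, `|z - x| <= 2 * `|h| &
  f (x + h *: delta_mx 0 a + h *: delta_mx 0 b) - f (x + h *: delta_mx 0 a)
  - (f (x + h *: delta_mx 0 b) - f x) = h * (h * pd b (pd a f) z).
Proof.
move=> oU f2 Ux; set ea := delta_mx 0 a; set eb := delta_mx 0 b.
have f1 := Ck_le f2.
have nU (c c' : R) : 0 <= c <= 1 -> 0 <= c' <= 1 -> `|x + (c * h) *: ea + (c' * h) *: eb - x| <= 2 * `|h|.
  move=> /andP[c0 c1] /andP[c'0 c'1].
  have -> : x + (c * h) *: ea + (c' * h) *: eb - x = (c * h) *: ea + (c' * h) *: eb.
    by apply/rowP => i; rewrite !mxE; ring.
  apply: le_trans (ler_normD _ _) _.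
  rewrite !norm_delta mulr_natl mulr2n !normrM; apply: lerD; rewrite ger0_norm // ler_piMl //.
have z01 : is_true (((0 : R) <= 0) && ((0 : R) <= 1)) by rewrite lexx ler01.
have o01 : is_true (((0 : R) <= 1) && ((1 : R) <= 1)) by rewrite lexx ler01.
have [s s01|s s01] := @mvt_coord R p (fun y => f (y + h *: eb) - f y) x a h.
  apply: (pdB_shift _ _).1; apply: (f1.2 a).1; apply: Ux.
    by have := nU s 1 s01 o01; rewrite mul1r.
  by have := nU s 0 s01 z01; rewrite mul0r scale0r addr0.
rewrite -/ea addrAC => ->.
rewrite (pdB_shift _ _).2; first last.
- by apply: (f1.2 a).1; apply: Ux; have := nU s 0 s01 z01; rewrite mul0r scale0r addr0.
- by apply: (f1.2 a).1; apply: Ux; have := nU s 1 s01 o01; rewrite mul1r.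
have [t t01|t t01] := @mvt_coord R p (pd a f) (x + (s * h) *: ea) b h.
  by apply: ((f2.2 a).2.2 b).1; apply: Ux; exact: nU.
rewrite -/eb => ->; exists (x + (s * h) *: ea + (t * h) *: eb) => //.
exact: nU.
Qed.

Lemma clairaut p (U : set 'rV[R]_p) f a b x : open U -> Ck 2 U f -> U x ->
  pd a (pd b f) x = pd b (pd a f) x.
Proof.
move=> oU f2 Ux; apply/eqP; rewrite -subr_eq0 -normr_le0; apply/ler_addgt0Pl => e e0.
rewrite addr0.
have c1 : {for x, continuous (pd a (pd b f))} := ((f2.2 b).2.2 a).2.1 x Ux.
have c2 : {for x, continuous (pd b (pd a f))} := ((f2.2 a).2.2 b).2.1 x Ux.
have e2 : 0 < e / 2 by rewrite divr_gt0.
have /near_normP[d d0 dH] :=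
  near_and (open_near oU Ux) (near_and ((contP _ _).1 c1 _ e2) ((contP _ _).1 c2 _ e2)).
pose h : R := d / 4.
have h0 : 0 < h by rewrite divr_gt0.
have hd y : `|y - x| <= 2 * `|h| -> `|y - x| < d.
  move=> H; apply: le_lt_trans H _; rewrite gtr0_norm // /h.
  by move: d0; lra.
have HU y : `|y - x| <= 2 * `|h| -> U y by move=> /hd/dH[].
have [z1 zn1 E1] := second_diff a b oU f2 HU.
have [z2 zn2 E2] := second_diff b a oU f2 HU.
have E : pd b (pd a f) z1 = pd a (pd b f) z2.
  move: (pd b (pd a f) z1) (pd a (pd b f) z2) E1 E2 => P1 P2 E1 E2.
  apply: (mulfI (lt0r_neq0 h0)); apply: (mulfI (lt0r_neq0 h0)).
  rewrite -E1 -E2 (addrAC x); ring.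
have [_ [_ H1]] := dH _ (hd _ zn1); have [_ [H2 _]] := dH _ (hd _ zn2).
move: E H1 H2; move: (pd b (pd a f) z1) (pd a (pd b f) z2) (pd b (pd a f) x) (pd a (pd b f) x).
move=> p1 p2 p3 p4 -> H1 H2.
have -> : p4 - p3 = (p2 - p3) - (p2 - p4) by ring.
by rewrite (le_trans (ler_normB _ _)) // (splitr e) lerD // ltW.
Qed.

(** Connectedness as an induction principle: the hypothesis makes both P and its negation relatively
    open in A. *)
Lemma conn_ind (T : topologicalType) (A : set T) (P : T -> Prop) : connected A ->
  (forall x, A x -> \forall y \near x, A y -> (P y <-> P x)) ->
  forall x y, A x -> A y -> P x -> P y.
Proof.
move=> cA H x y Ax Ay Px.
have oE (Q : T -> Prop) : (forall x, A x -> \forall y \near x, A y -> (Q y <-> Q x)) ->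
    exists2 C, open C & A `&` [set z | Q z] = A `&` C.
  move=> HQ; exists (\bigcup_(z in A `&` [set z | Q z]) ((fun y => A y -> (Q y <-> Q z)) : set T)^°).
    by apply: bigcup_open => z _; exact: open_interior.
  apply/seteqP; split=> z [Az Qz]; split=> //.
    by exists z => //; exact: HQ.
  by case: Qz => w [Aw Qw] /interior_subset/(_ Az)[_ /(_ Qw)].
have [C oC EC] := oE P H.
have [D oD ED] : exists2 C, open C & A `&` [set z | ~ P z] = A `&` C.
  apply: oE => z Az; have := H z Az; apply: filterS => w Hw Aw.
  by have := Hw Aw; tauto.
suff E : A `&` [set z | P z] = A by have : A y by []; rewrite -E => -[].
apply: cA; first by exists x.
- by exists C.
- exists (~` D); first exact: open_closedC.
  apply/seteqP; split=> z [Az Pz]; split=> //.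
    by move=> Dz; have : (A `&` D) z by []; rewrite -ED => -[].
  by apply: contrapT => nP; have : (A `&` [set z | ~ P z]) z by []; rewrite ED => -[].
Qed.

Lemma interval_ind (e : R) (P : R -> Prop) :
  (forall x, `|x| < e -> exists2 d : R, 0 < d & forall y, `|y| < e -> `|y - x| < d -> (P y <-> P x)) ->
  forall x y, `|x| < e -> `|y| < e -> P x -> P y.
Proof.
move=> H x y xe ye.
have cA : connected ([set x | `|x| < e] : set R).
  have -> : [set x : R | `|x| < e] = [set` `](- e), e[ ].
    by apply/seteqP; split=> z /=; rewrite in_itv /= ltr_norml.
  exact/connected_intervalP/interval_is_interval.
apply: (conn_ind cA) => // z ze; have [d d0 dH] := H z ze.
by apply/near_normP; exists d => // w wd we; exact: dH.
Qed.

End Mvt.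

(** * Limits of functions along an ultrafilter *)

Section Limits.
Variables (R : realType) (U : set_system nat).
Context {UF : UltraFilter U}.

Lemma unear (P Q : nat -> Prop) : (\forall n \near U, P n) -> (forall n, P n -> Q n) ->
  \forall n \near U, Q n.
Proof. by move=> H PQ; apply: filterS H. Qed.

Lemma unear_all (I : finType) (P : I -> nat -> Prop) : (forall i, \forall n \near U, P i n) ->
  \forall n \near U, forall i, P i n.
Proof. by move=> H; apply: filter_forall. Qed.

Lemma ultra_fmap (T : Type) (u : nat -> T) : UltraFilter (u @ U).
Proof.
split; first exact: fmap_proper_filter.
move=> G PG UG; apply/seteqP; split=> A //; last exact: UG.
move=> GA; have [//|H] := in_ultra_setVsetC (u @^-1` A) UF.
have GnA : G (~` A) by apply: UG.
by have [z [Az nAz]] := filter_ex (filterI GA GnA).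
Qed.

(** An ultrafilter on a compact interval converges. This stands in for every extraction of a
    convergent subsequence, and it serves all points of a domain with one and the same [U]. *)
Lemma ultra_bounded_cvg (u : nat -> R) (C : R) : (\forall n \near U, `|u n| <= C) ->
  cvg (u n @[n --> U]).
Proof.
move=> H.
have : compact (`[- C, C]%classic : set R) by exact: segment_compact.
rewrite compact_ultra => /(_ (u @ U) (ultra_fmap u))[].
  by apply: (unear H) => n; rewrite /= in_itv /= ler_norml.
by move=> l [_ ul]; apply/cvg_ex; exists l.
Qed.

Lemma lim_le_norm (V : normedModType R) (u : nat -> V) (l : V) (C : R) :
  u n @[n --> U] --> l -> (\forall n \near U, `|u n| <= C) -> `|l| <= C.
Proof.
move=> ul H.
apply/ler_addgt0Pl => e e0.
have [n [H1 H2]] := proper_ex _ (filter_and _ ((cvgrPdist_lt _ _).1 ul e e0) H).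
rewrite -[l](subrK (u n)); apply: le_trans (ler_normD _ _) _.
by rewrite lerD // ltW.
Qed.

Lemma cvg_row p (u : nat -> 'rV[R]_p) (l : 'rV[R]_p) :
  (forall j, (u n 0 j) @[n --> U] --> l 0 j) -> u n @[n --> U] --> l.
Proof.
move=> H; apply/cvgrPdist_lt => e e0.
have : \forall n \near U, forall j, `|l 0 j - u n 0 j| < e.
  by apply: filter_forall => j; exact: ((cvgrPdist_lt _ _).1 (H j) e e0).
apply: filterS => n Hn; apply: mx_norm_lt => // i j.
by rewrite (ord1 i) !mxE; exact: Hn.
Qed.

Lemma cvg_mx p q (u : nat -> 'M[R]_(p, q)) (l : 'M[R]_(p, q)) :
  (forall i j, (u n i j) @[n --> U] --> l i j) -> u n @[n --> U] --> l.
Proof.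
move=> H; apply/cvgrPdist_lt => e e0.
have : \forall n \near U, forall ij : 'I_p * 'I_q, `|l ij.1 ij.2 - u n ij.1 ij.2| < e.
  by apply: filter_forall => ij; exact: ((cvgrPdist_lt _ _).1 (H _ _) e e0).
apply: filterS => n Hn; apply: mx_norm_lt => // i j.
by rewrite !mxE; exact: (Hn (i, j)).
Qed.

Lemma cvg_entry p q (u : nat -> 'M[R]_(p, q)) (l : 'M[R]_(p, q)) i j :
  u n @[n --> U] --> l -> (u n i j) @[n --> U] --> l i j.
Proof.
move=> H; apply/cvgrPdist_lt => e e0.
apply: (unear ((cvgrPdist_lt _ _).1 H e e0)) => n; apply: le_lt_trans.
by have := mx_entry_le (l - u n) i j; rewrite !mxE.
Qed.

Lemma ultra_bounded_mx p q (u : nat -> 'M[R]_(p, q)) (C : R) : (\forall n \near U, `|u n| <= C) ->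
  cvg (u n @[n --> U]).
Proof.
move=> H.
have c i j : cvg (u n i j @[n --> U]).
  apply: (@ultra_bounded_cvg _ C); apply: filterS H => n; apply: le_trans; exact: mx_entry_le.
apply/cvg_ex; exists (\matrix_(i, j) lim (u n i j @[n --> U])).
by apply: cvg_mx => i j; rewrite mxE; exact: c.
Qed.

(** The bound [C] is uniform in the point and in n, up to a set of indices outside [U]: the
    hypothesis of an Ascoli-type theorem at every order up to k. *)
Fixpoint bfam p k (B : set 'rV[R]_p) (f : nat -> 'rV[R]_p -> R) : Prop :=
  (exists C : R, \forall n \near U, forall x, B x -> `|f n x| <= C) /\
  match k with
  | 0%N => True
  | k'.+1 => forall l, bfam k' B (fun n => pd l (f n))
  end.

(** Bounded second derivatives make the first-order Taylor remainder of [f n] at most C h^2 with C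
    independent of n. This inequality survives the limit, so [derive_quad] identifies the derivative
    of the limit with the limit of the derivatives. *)
Lemma lim_step p (c : 'rV[R]_p) (r : R) (f : nat -> 'rV[R]_p -> R) :
  (\forall n \near U, smooth_on (ball c r) (f n)) -> bfam 2 (ball c r) f ->
  (forall x, ball c r x -> {for x, continuous (fun x => lim (f n x @[n --> U]))}) /\
  (forall x l, ball c r x -> is_derive x (delta_mx 0 l) (fun x => lim (f n x @[n --> U]))
      (lim (pd l (f n) x @[n --> U]))).
Proof.
move=> sf [[C0 f0] f1]; set B := ball c r; set F := fun x => lim _.
have cf x : B x -> f n x @[n --> U] --> F x.
  move=> Bx; apply: (@ultra_bounded_cvg _ C0).
  by apply: filterS f0 => n; apply.
have cd l x : B x -> pd l (f n) x @[n --> U] --> lim (pd l (f n) x @[n --> U]).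
  have [[C1 fl] _] := f1 l.
  move=> Bx; apply: (@ultra_bounded_cvg _ C1).
  by apply: filterS fl => n; apply.
have [C1 H1] : exists C : R, \forall n \near U, forall l x, B x -> `|pd l (f n) x| <= C.
  have /choice[g Hg] : forall l, exists C : R, \forall n \near U, forall x, B x -> `|pd l (f n) x| <= C.
    by move=> l; exact: (f1 l).1.
  exists (\sum_l `|g l|); apply: (unear (unear_all Hg)) => n H l x Bx.
  apply: le_trans (H l x Bx) _; rewrite (bigD1 l) //= (le_trans (ler_norm _)) // lerDl.
  exact: sumr_ge0.
split.
  move=> x Bx; apply/contP => e e0.
  pose K := p%:R * `|C1| + 1.
  have K0 : 0 < K by rewrite ltr_wpDl // mulr_ge0.
  have /near_normP[d d0 dB] : \forall y \near x, B y by apply: open_near => //; exact: ball_open.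
  apply/near_normP; exists (Num.min d (e / K)) => [|y]; first by rewrite lt_min d0 divr_gt0.
  rewrite lt_min => /andP[/dB By yK].
  have H : `|F y - F x| <= K * `|y - x|.
    apply: (@lim_le_norm _ (fun n => f n y - f n x)).
      by apply: cvgB; exact: cf.
    apply: filterS2 sf H1 => n sn Hn.
    apply: le_trans (smooth_ball_lip sn Hn Bx By) _.
    rewrite ler_wpM2r // ler_wpDr // ler_wpM2l //; exact: ler_norm.
  apply: le_lt_trans H _; by rewrite mulrC -ltr_pdivlMr.
move=> x l Bx.
have [_ /(_ l)[[C2 H2] _]] := f1 l.
have /near_normP[d d0 dB] : \forall y \near x, B y by apply: open_near => //; exact: ball_open.
apply: (@derive_quad _ _ _ F x (delta_mx 0 l) _ C2 d d0) => h hd.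
have Bh s : 0 <= s <= 1 -> B (x + (s * h) *: delta_mx 0 l).
  move=> /andP[s0 s1]; apply: dB; rewrite addrAC subrr add0r norm_delta normrM ger0_norm //.
  by apply: le_lt_trans hd; rewrite ler_piMl.
have o01 : is_true (((0 : R) <= 1) && ((1 : R) <= 1)) by rewrite lexx ler01.
apply: (@lim_le_norm _ (fun n => f n (x + h *: delta_mx 0 l) - f n x - h *: pd l (f n) x)).
  apply: cvgB; last by apply: cvgZr; exact: cd.
  apply: cvgB; last exact: cf.
  by have := Bh 1 o01; rewrite mul1r; exact: cf.
apply: filterS2 sf H2 => n sn Hn.
have [s s01|s s01 ->] := @mvt_coord R p (f n) x l h.
  exact: smooth_derivable sn (Bh s s01).
rewrite /GRing.scale /= -mulrBr normrM.
have [t t01|t t01 ->] := @mvt_coord R p (pd l (f n)) x l (s * h).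
  rewrite mulrA; apply: (smooth_derivable (smooth_pd _ sn)); apply: Bh.
  move: s01 t01 => /andP[s0 s1] /andP[t0 t1]; rewrite mulr_ge0 //=.
  by rewrite mulr_ile1.
have C20 : `|pd l (pd l (f n)) (x + (t * (s * h)) *: delta_mx 0 l)| <= C2.
  apply: Hn; rewrite mulrA; apply: Bh.
  move: s01 t01 => /andP[s0 s1] /andP[t0 t1]; rewrite mulr_ge0 //=.
  by rewrite mulr_ile1.
move: C20; move: (pd l (pd l (f n)) _) => X C20.
have hh : h ^+ 2 = `|h| * `|h| by rewrite -expr2 real_normK ?num_real.
move: s01 => /andP[s0 s1]; rewrite hh !normrM (ger0_norm s0).
have -> : `|h| * (s * `|h| * `|X|) = (s * `|X|) * (`|h| * `|h|) by ring.
by rewrite ler_wpM2r ?mulr_ge0 // (le_trans _ C20) // ler_piMl.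
Qed.

Lemma bfam_le p k (B : set 'rV[R]_p) f : bfam k.+1 B f -> bfam k B f.
Proof.
elim: k f => [|k IH] f [H1 H2]; split=> // l; have := H2 l; exact: IH.
Qed.

Lemma limit_smooth p (c : 'rV[R]_p) (r : R) (f : nat -> 'rV[R]_p -> R) :
  (\forall n \near U, smooth_on (ball c r) (f n)) -> (forall k, bfam k (ball c r) f) ->
  smooth_on (ball c r) (fun x => lim (f n x @[n --> U])) /\
  forall x l, ball c r x -> pd l (fun x => lim (f n x @[n --> U])) x = lim (pd l (f n) x @[n --> U]).
Proof.
move=> sf bf; split; last first.
  move=> x l Bx; have [_ /(_ x l Bx) H] := lim_step sf (bf 2%N).
  by rewrite /pd; apply: derive_val.
move=> k; elim: k f sf bf => [|k IH] f sf bf.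
  by split=> // x Bx; have [/(_ x Bx)] := lim_step sf (bf 2%N).
have [H1 H2] := lim_step sf (bf 2%N).
split; first exact: H1.
move=> l; split; first by move=> x Bx; have [] := H2 x l Bx.
have sl : \forall n \near U, smooth_on (ball c r) (pd l (f n)).
  by apply: filterS sf => n; exact: smooth_pd.
apply: (Ck_ext (@ball_open _ _ c r) _ (IH (fun n => pd l (f n)) sl _)).
  move=> x /set_mem Bx; have H := H2 x l Bx.
  by apply/esym; apply: derive_val.
by move=> k'; exact: (bf k'.+1).2.
Qed.

End Limits.

(** * Curves, differential equations and Euler polygons *)

(** P is asked for every scale below d, so that near-covering compactness along the filter of e
    tending to 0 from the right turns the scales depending on the point into a common one. *)
Lemma compact_unif (R : realType) (T : topologicalType) (K : set T) (P : R -> T -> Prop) :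
  compact K ->
  (forall x, K x -> exists2 d : R, 0 < d &
     \forall y \near x, forall e, 0 < e -> e <= d -> P e y) ->
  exists2 d : R, 0 < d & forall e, 0 < e -> e <= d -> forall y, K y -> P e y.
Proof.
move=> cK H.
pose Q (e : R) y := forall e', 0 < e' -> e' <= e -> P e' y.
have := (compact_near_coveringP K).1 cK R (0 : R)^'+ Q _ => /(_ _)[].
  move=> x Kx; have [d d0 dH] := H x Kx.
  exists ([set y | forall e, 0 < e -> e <= d -> P e y], [set e | e <= d]).
    split => //=; exact: nbhs_right_le.
  move=> [y e] [/= Hy ed] e' e'0 e'e; apply: Hy => //; exact: le_trans e'e ed.
move=> d /= d0 dH.
exists (d / 2); first by rewrite divr_gt0.
move=> e e0 ed y Ky.
have d20 : 0 < d / 2 by rewrite divr_gt0.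
apply: (dH (d / 2) _ d20 _ Ky) => //=.
by rewrite sub0r normrN gtr0_norm // ltr_pdivrMr // ltr_pMr // ltr1n.
Qed.

Section Curves.
Variable R : realType.

Definition cball p (c : 'rV[R]_p) (r : R) : set 'rV[R]_p := [set x | `|x - c| <= r].

Lemma open_cball p (U : set 'rV[R]_p) x : open U -> U x -> exists2 r : R, 0 < r & cball x r `<=` U.
Proof.
move=> oU Ux; have /near_normP[d d0 Hd] := open_near oU Ux; exists (d / 2); first by rewrite divr_gt0.
by move=> z; rewrite /cball /= => zr; apply: Hd; apply: le_lt_trans zr _; rewrite ltr_pdivrMr // ltr_pMr // ltr1n.
Qed.

Lemma cball_compact p (c : 'rV[R]_p) r : compact (cball c r).
Proof.
apply: bounded_closed_compact.
  exists (r + `|c|); split; first exact: num_real.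
  move=> M Mr x xc /=; rewrite ltW // (le_lt_trans _ Mr) // -[x](subrK c).
  by apply: le_trans (ler_normD _ _) _; rewrite lerD2r.
have -> : cball c r = (fun x => `|x - c|) @^-1` [set y | y <= r] by [].
apply: closed_comp => [x _|]; last exact: closed_le.
apply/contP => e e0; apply/near_normP; exists e => // y yx.
apply: le_lt_trans (ler_dist_dist _ _) _.
by rewrite opprB addrA subrK.
Qed.

Lemma cball_bounded p (c : 'rV[R]_p) r (f : 'rV[R]_p -> R) :
  (forall x, cball c r x -> {for x, continuous f}) ->
  exists2 C : R, 0 < C & forall x, cball c r x -> `|f x| <= C.
Proof.
move=> cf.
have [x Kx|d d0 H] := @compact_unif R _ (cball c r) (fun e y => `|f y| <= e^-1) (@cball_compact p c r).
  have fx0 : 0 < (`|f x| + 1)^-1 by rewrite invr_gt0 ltr_wpDl.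
  exists (`|f x| + 1)^-1 => //.
  have /contP/(_ _ ltr01) := cf x Kx; apply: filterS => y Hy e e0 ed.
  rewrite (@le_trans _ _ (`|f x| + 1)) //.
    rewrite -[f y](subrK (f x)) (le_trans (ler_normD _ _)) // addrC lerD2l.
    exact: ltW.
  by rewrite -[leLHS]invrK lef_pV2.
by exists d^-1; [rewrite invr_gt0|exact: H].
Qed.

Lemma smooth_cball p (U : set 'rV[R]_p) (c : 'rV[R]_p) r (f : 'rV[R]_p -> R) :
  smooth_on U f -> cball c r `<=` U ->
  exists2 C : R, 0 < C & forall x, cball c r x -> `|f x| <= C.
Proof.
move=> sf sub; apply: cball_bounded => x /sub Ux; exact: (Ck_cont (sf 0%N) Ux).
Qed.

Lemma exists_bound (I : finType) (P : I -> R -> Prop) :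
  (forall i C C', C <= C' -> P i C -> P i C') -> (forall i, exists C, P i C) ->
  exists2 C, 0 < C & forall i, P i C.
Proof.
move=> mono /choice[g Hg]; exists (1 + \sum_i `|g i|).
  by rewrite ltr_wpDr // sumr_ge0.
move=> i; apply: mono (Hg i); rewrite (bigD1 i) //=.
by rewrite (le_trans (ler_norm _)) // addrCA lerDl addr_ge0 // sumr_ge0.
Qed.

Lemma smooth_map_cball p r (U : set 'rV[R]_p) (c : 'rV[R]_p) rho (f : 'rV[R]_p -> 'rV[R]_r) :
  open U -> smooth_map_on U f -> cball c rho `<=` U ->
  exists2 C : R, 0 < C & (forall x, cball c rho x -> `|f x| <= C) /\
    (forall x y, ball c rho x -> ball c rho y -> `|f y - f x| <= C * `|y - x|).
Proof.
move=> oU sf sub.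
have [C1 C10 H1] : exists2 C, 0 < C & forall j, forall x, cball c rho x -> `|f x 0 j| <= C.
  apply: exists_bound => [j C C' CC H x /H/le_trans|j]; first exact.
  by have [C _ HC] := smooth_cball (sf j) sub; exists C.
have [C2 C20 H2] : exists2 C, 0 < C & forall jl : 'I_r * 'I_p, forall x, cball c rho x ->
     `|pd jl.2 (fun y => f y 0 jl.1) x| <= C.
  apply: exists_bound => [j C C' CC H x /H/le_trans|[j l]]; first exact.
  by have [C _ HC] := smooth_cball (smooth_pd l (sf j)) sub; exists C.
exists (C1 + p%:R * C2); first by rewrite ltr_wpDr // mulr_ge0 // ltW.
have sB : ball c rho `<=` U by move=> x; rewrite ballE => /ltW; exact: sub.
split.
  move=> x Bx; apply/mx_norm_le => [|i j]; first by rewrite addr_ge0 // ?mulr_ge0 // ltW.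
  by rewrite (ord1 i); apply: le_trans (H1 j x Bx) _; rewrite lerDl mulr_ge0 // ltW.
move=> x y Bx By; apply/mx_norm_le => [|i j].
  by rewrite mulr_ge0 // addr_ge0 // ?mulr_ge0 // ltW.
rewrite (ord1 i) !mxE.
have H : forall l x, ball c rho x -> `|pd l (fun y => f y 0 j) x| <= C2.
  by move=> l z Bz; apply: (H2 (j, l)); rewrite ballE in Bz; exact: ltW.
apply: le_trans (smooth_ball_lip (smooth_sub sB (sf j)) H Bx By) _.
by rewrite ler_wpM2r // lerDr ltW.
Qed.

Lemma smooth_local_lip p r (U : set 'rV[R]_p) (c : 'rV[R]_p) (f : 'rV[R]_p -> 'rV[R]_r) :
  open U -> smooth_map_on U f -> U c ->
  exists rho C : R, [/\ 0 < rho, 0 < C, ball c rho `<=` U,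
    (forall x, ball c rho x -> `|f x| <= C) &
    (forall x y, ball c rho x -> ball c rho y -> `|f y - f x| <= C * `|y - x|)].
Proof.
move=> oU sf Uc; have /near_normP[d d0 dH] := open_near oU Uc.
have d2 : 0 < d / 2 by rewrite divr_gt0.
have sub : cball c (d / 2) `<=` U.
  move=> x xd; apply: dH; apply: le_lt_trans xd _; by rewrite ltr_pdivrMr // ltr_pMr // ltr1n.
have [C C0 [H1 H2]] := smooth_map_cball oU sf sub.
exists (d / 2), C; split=> // x; rewrite ballE => /ltW; [exact: sub|exact: H1].
Qed.

Lemma curve_coord q (c : R -> 'rV[R]_q) (s : R) v j : is_derive s 1 c v ->
  is_derive s 1 (fun r => c r 0 j) (v 0 j).
Proof.
move=> [d1 d2]; have dj := (derivable_mxP _ _ _).1 d1 0 j.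
by apply: DeriveDef => //; rewrite -d2 derive_mx // mxE.
Qed.

Lemma curve_lip q (c d : R -> 'rV[R]_q) (K a b : R) : a <= b -> 0 <= K ->
  (forall r, a <= r <= b -> is_derive r 1 c (d r) /\ `|d r| <= K) ->
  `|c b - c a| <= K * (b - a).
Proof.
move=> ab K0 H; apply/mx_norm_le => [|i j]; first by rewrite mulr_ge0 // subr_ge0.
rewrite (ord1 i) !mxE.
have [r /[!in_itv]/= /andP[r1 r2]| |r rab ->] := @MVT_segment R (fun r => c r 0 j) (fun r => d r 0 j) a b ab.
- by apply: curve_coord; apply: (H r _).1; rewrite !ltW.
- apply: derivable_within_continuous => r /[!in_itv]/= rab.
  by have [] := curve_coord j (H r rab).1.
- rewrite normrM [`|b - a|]ger0_norm ?subr_ge0 // ler_wpM2r ?subr_ge0 //.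
  apply: le_trans (mx_entry_le _ _ _) _; apply: (H r _).2.
  by move: rab; rewrite in_itv.
Qed.

Lemma is_derive_cont (V : normedModType R) (c : R -> V) (s : R) v : is_derive s 1 c v ->
  {for s, continuous c}.
Proof. by move=> [/derivable1_diffP d _]; exact: differentiable_continuous. Qed.

Lemma half_le0 (x C : R) : (forall k, x <= C / 2 ^+ k) -> x <= 0.
Proof.
move=> H; rewrite leNgt; apply/negP => x0.
have C0 : 0 <= C / x by rewrite divr_ge0 ?(ltW x0) //; have := H 0%N; rewrite expr0 divr1; apply: le_trans; exact: ltW.
have /andP[_ Hk] := truncn_itv C0.
set k := (Num.trunc (C / x)).+1 in Hk.
have := H k; rewrite leNgt; apply/negP; rewrite negbK.
rewrite ltr_pdivrMr ?exprn_gt0 // mulrC -ltr_pdivrMr //.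
apply: lt_le_trans Hk _.
by rewrite -natrX ler_nat ltnW // ltn_expl.
Qed.

(** The set of times of agreement is open and closed. Near such a time, integrating the Lipschitz
    bound on X halves any bound on c - d; iterating brings the difference below 2 rho / 2^k for
    every k. *)
Lemma ode_uniq q (O : set 'rV[R]_q) (X : selfmap R q) (c d : R -> 'rV[R]_q) (e s0 : R) :
  open O -> smooth_map_on O X ->
  (forall s, `|s| < e -> O (c s) /\ is_derive s 1 c (X (c s))) ->
  (forall s, `|s| < e -> O (d s) /\ is_derive s 1 d (X (d s))) ->
  `|s0| < e -> c s0 = d s0 -> forall s, `|s| < e -> c s = d s.
Proof.
move=> oO sX Hc Hd s0e E s se.
apply: (@interval_ind R e (fun r => c r = d r)) (s0e) (se) E => r0 r0e.
have cc := is_derive_cont (Hc r0 r0e).2; have cd := is_derive_cont (Hd r0 r0e).2.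
have [E0|ne] := eqVneq (c r0) (d r0); last first.
  have n0 : 0 < `|c r0 - d r0| / 2 by rewrite divr_gt0 // normr_gt0 subr_eq0.
  have /near_normP[t t0 Ht] := near_and ((contP _ _).1 cc _ n0) ((contP _ _).1 cd _ n0).
  exists t => // r re /Ht[H1 H2]; split=> Er; last by rewrite Er eqxx in ne.
  have : `|c r0 - d r0| < `|c r0 - d r0|; last by rewrite ltxx.
  rewrite {1}(_ : c r0 - d r0 = (d r - d r0) - (c r - c r0)).
    apply: le_lt_trans (ler_normB _ _) _; rewrite [ltRHS](splitr `|c r0 - d r0|).
    exact: ltrD.
  by rewrite Er; apply/rowP => i; rewrite !mxE; ring.
have [rho [C [rho0 C0 Bsub _ HL]]] := smooth_local_lip oO sX (Hc r0 r0e).1.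
have cdt : {for r0, continuous d} by [].
have /near_normP[t t0 Ht] := near_and ((contP _ _).1 cc _ rho0) ((contP _ _).1 cd _ rho0).
(* The three terms keep both curves in the ball where X is C-Lipschitz, keep r in the interval of
   definition, and make C t' at most 1/2. *)
pose t' := Num.min (t / 2) (Num.min ((e - `|r0|) / 2) (C^-1 / 2)).
have t'0 : 0 < t' by rewrite /t' !lt_min !divr_gt0 // ?subr_gt0 // invr_gt0.
have HI r : `|r - r0| <= t' -> [/\ `|r| < e, `|r - r0| < t & C * `|r - r0| <= 2^-1].
  rewrite /t' !le_min => /andP[H1 /andP[H2 H3]]; split.
  - rewrite -[r](subrK r0) (le_lt_trans (ler_normD _ _)) // -ltrBrDr.
    by apply: le_lt_trans H2 _; rewrite ltr_pdivrMr // ltr_pMr ?subr_gt0 // ltr1n.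
  - by apply: le_lt_trans H1 _; rewrite ltr_pdivrMr // ltr_pMr // ltr1n.
  - by rewrite -ler_pdivlMl.
suff H : forall r, `|r - r0| <= t' -> c r = d r.
  exists t' => // r _ /ltW/H E1; split=> _ //.
have Hk k r : `|r - r0| <= t' -> `|c r - d r| <= (2 * rho) / 2 ^+ k.
  elim: k r => [|k IH] r rt.
    have [H1 H2 H3] := HI r rt; have [H4 H5] := Ht r H2.
    rewrite expr0 divr1 -(subrK (c r0) (c r)) -addrA {2}E0.
    rewrite -[X in _ + X]opprB; apply: le_trans (ler_normB _ _) _.
    by rewrite mulr_natl mulr2n lerD // ltW.
  pose f := c - d.
  have fd s1 : `|s1 - r0| <= t' -> is_derive s1 1 f (X (c s1) - X (d s1)) /\
      `|X (c s1) - X (d s1)| <= C * ((2 * rho) / 2 ^+ k).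
    move=> Hs1; have [H1 H2 H3] := HI s1 Hs1; have [H4 H5] := Ht s1 H2; split.
      by apply: is_deriveB; [exact: (Hc _ H1).2|exact: (Hd _ H1).2].
    have Bc : ball (c r0) rho (c s1) by rewrite ballE.
    have Bd : ball (c r0) rho (d s1) by rewrite ballE E0.
    apply: le_trans (HL _ _ Bd Bc) _; rewrite ler_wpM2l ?(ltW C0) //; exact: IH.
  have f0 : f r0 = 0 by rewrite /f /GRing.add /= E0 subrr.
  have K0 : 0 <= C * ((2 * rho) / 2 ^+ k) by rewrite !mulr_ge0 // ?invr_ge0 ?exprn_ge0 // ltW.
  have H : `|f r| <= C * ((2 * rho) / 2 ^+ k) * `|r - r0|.
    have [le|le] := leP r0 r.
      rewrite -[f r]subr0 -f0 [X in _ * X]ger0_norm ?subr_ge0 //.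
      apply: curve_lip (le) K0 _ => s1 /andP[a1 a2]; apply: fd.
      rewrite ger0_norm ?subr_ge0 // (le_trans _ rt) // ger0_norm ?subr_ge0 // lerD2r //.
    rewrite [X in _ * X]ler0_norm ?subr_le0 ?(ltW le) // opprB.
    have -> : `|f r| = `|f r0 - f r| by rewrite f0 sub0r normrN.
    apply: curve_lip (ltW le) K0 _ => s1 /andP[a1 a2]; apply: fd.
    rewrite ler0_norm ?subr_le0 // (le_trans _ rt) // ler0_norm ?subr_le0 ?(ltW le) //.
    by rewrite lerN2 lerD2r.
  apply: le_trans H _; have [_ _ H3] := HI r rt.
  have W0 : 0 <= 2 * rho / 2 ^+ k by rewrite mulr_ge0 ?invr_ge0 ?exprn_ge0 // mulr_ge0 // ltW.
  have -> : 2 * rho / 2 ^+ k.+1 = 2^-1 * (2 * rho / 2 ^+ k) by rewrite exprS invfM; ring.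
  by rewrite mulrAC ler_wpM2r.
move=> r rt; apply/eqP; rewrite -subr_eq0 -normr_le0.
by apply: half_le0 => k; exact: (Hk k r rt).
Qed.

End Curves.

(** * Euler polygons of maps close to the identity *)

Section Euler.
Variables (R : realType) (U : set_system nat) (q : nat).
Context {UF : UltraFilter U}.
Implicit Types (p x : 'rV[R]_q).

Lemma lim_le_lim (V : normedModType R) (u : nat -> V) (l : V) (b : nat -> R) (B : R) :
  u n @[n --> U] --> l -> b n @[n --> U] --> B -> (\forall n \near U, `|u n| <= b n) -> `|l| <= B.
Proof.
move=> ul bB H; apply/ler_addgt0Pl => e e0.
have e2 : 0 < e / 2 by rewrite divr_gt0.
have [n [[H1 H2] H3]] := proper_ex _ (filter_and _ (filter_and _ ((cvgrPdist_lt _ _).1 ul _ e2)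
   ((cvgrPdist_lt _ _).1 bB _ e2)) H).
rewrite -[l](subrK (u n)); apply: le_trans (ler_normD _ _) _.
have : b n <= B + e / 2.
  move: H2; rewrite distrC => /ltW; rewrite ler_norml => /andP[_]; lra.
move: H1 H3; move: (`|l - u n|) (`|u n|) => a1 a2; lra.
Qed.

Variables (h : nat -> selfmap R q) (delta : nat -> R) (Z : selfmap R q).
Variables (p0 : 'rV[R]_q) (rho K L : R).
Let B := ball p0 rho.
Hypotheses (K0 : 0 <= K) (L0 : 0 <= L).
Hypothesis delta_gt0 : \forall n \near U, 0 < delta n.
Hypothesis delta_cvg : delta n @[n --> U] --> (0 : R).
Hypothesis hK : \forall n \near U, forall x, B x -> `|h n x - x| <= K * delta n.
Hypothesis hL : \forall n \near U, forall x y, B x -> B y ->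
  `|(h n x - x) - (h n y - y)| <= L * delta n * `|x - y|.
Hypothesis hZ : forall x, B x -> (delta n)^-1 *: (h n x - x) @[n --> U] --> Z x.

(** Steps of length [delta n] needed to cover the time s, up to an error less than [delta n]. The
    corresponding iterates of [h n] converge to the flow of Z at time s, so the flow inherits what
    is stable under composition and limits. *)
Definition euler_steps (n : nat) (s : R) : nat := Num.trunc (s / delta n).
Definition euler_pt p (n : nat) (s : R) := iter (euler_steps n s) (h n) p.
Definition euler_curve p (s : R) : 'rV[R]_q := lim (euler_pt p n s @[n --> U]).

Lemma euler_lip x y : B x -> B y -> `|Z x - Z y| <= L * `|x - y|.
Proof.
move=> Bx By.
apply: (@lim_le_norm _ _ _ _ (fun n => (delta n)^-1 *: (h n x - x) - (delta n)^-1 *: (h n y - y))).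
  by apply: cvgB; exact: hZ.
apply: (unear (filter_and _ delta_gt0 hL)) => n [d0 H].
rewrite -scalerBr normrZ normfV gtr0_norm // ler_pdivrMl // mulrA [delta n * L]mulrC.
exact: H.
Qed.

Lemma euler_bound x : B x -> `|Z x| <= K.
Proof.
move=> Bx.
apply: (@lim_le_norm _ _ _ _ (fun n => (delta n)^-1 *: (h n x - x))); first exact: hZ.
apply: (unear (filter_and _ delta_gt0 hK)) => n [d0 H].
by rewrite normrZ normfV gtr0_norm // ler_pdivrMl // mulrC; exact: H.
Qed.

Variables (p : 'rV[R]_q) (tau : R).
Hypothesis tau0 : 0 < tau.
Hypothesis p_in : `|p - p0| + K * tau < rho.

Lemma euler_iter : \forall n \near U, forall k, k%:R * delta n <= tau ->
  `|iter k (h n) p - p| <= K * (k%:R * delta n) /\ B (iter k (h n) p).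
Proof.
apply: (unear (filter_and _ delta_gt0 hK)) => n [d0 H].
have aux k : k%:R * delta n <= tau -> `|iter k (h n) p - p| <= K * (k%:R * delta n) ->
   B (iter k (h n) p).
  move=> kt Hk; rewrite /B ballE -[iter k (h n) p](subrK p) -addrA.
  apply: le_lt_trans (ler_normD _ _) _; apply: le_lt_trans p_in.
  by rewrite [leLHS]addrC lerD2l (le_trans Hk) // ler_wpM2l.
suff Hk k : k%:R * delta n <= tau -> `|iter k (h n) p - p| <= K * (k%:R * delta n).
  by move=> k kt; split; [exact: Hk|exact: aux (Hk k kt)].
elim: k => [|k IH] kt; first by rewrite /= subrr normr0 mul0r mulr0.
have kt' : k%:R * delta n <= tau.
  by apply: le_trans kt; rewrite ler_wpM2r ?(ltW d0) // ler_nat.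
rewrite iterS -(subrK (iter k (h n) p) (h n (iter k (h n) p))) -addrA.
apply: le_trans (ler_normD _ _) _.
have -> : K * (k.+1%:R * delta n) = K * delta n + K * (k%:R * delta n) by rewrite -natr1; ring.
by apply: lerD; [apply: H; exact: aux (IH kt')|exact: IH].
Qed.

(** After m steps the point has moved by at most K m delta, so by the Lipschitz bound the next
    displacement differs from the very first by at most L delta times that; the sum of these errors
    is at most L K (m delta)^2. *)
Lemma euler_multi : \forall n \near U, forall k m, (k + m)%:R * delta n <= tau ->
  `|iter (k + m) (h n) p - iter k (h n) p| <= K * (m%:R * delta n) /\
  `|iter (k + m) (h n) p - iter k (h n) p - m%:R *: (h n (iter k (h n) p) - iter k (h n) p)|
   <= L * K * (m%:R * delta n) ^+ 2.
Proof.
apply: (unear (filter_and _ euler_iter (filter_and _ delta_gt0 (filter_and _ hK hL)))) => n [H1 [d0 [H2 H3]]] k.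
have le m : (k + m.+1)%:R * delta n <= tau -> (k + m)%:R * delta n <= tau.
  by apply: le_trans; rewrite ler_wpM2r ?(ltW d0) // ler_nat addnS.
elim=> [|m IH] kt.
  by rewrite addn0 subrr !scale0r subr0 !normr0 !mul0r expr2 !mulr0.
have [IH1 IH2] := IH (le _ kt).
have Bm := (H1 _ (le _ kt)).2.
have Bk : B (iter k (h n) p).
  by apply: (H1 _ _).2; apply: le_trans kt; rewrite ler_wpM2r ?(ltW d0) // ler_nat leq_addr.
rewrite addnS iterS; set y := iter (k + m) _ _ in IH1 IH2 Bm *; set x := iter k _ _ in IH1 IH2 Bk *.
split.
  have -> : h n y - x = (h n y - y) + (y - x) by rewrite addrA subrK.
  apply: le_trans (ler_normD _ _) _.
  have -> : K * (m.+1%:R * delta n) = K * delta n + K * (m%:R * delta n) by rewrite -natr1; ring.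
  by apply: lerD => //; exact: H2.
have -> : h n y - x - m.+1%:R *: (h n x - x) =
  ((h n y - y) - (h n x - x)) + (y - x - m%:R *: (h n x - x)).
  by rewrite -natr1; apply/rowP => i; rewrite !mxE; ring.
apply: le_trans (ler_normD _ _) _.
have H4 : `|(h n y - y) - (h n x - x)| <= L * delta n * (K * (m%:R * delta n)).
  by apply: le_trans (H3 _ _ Bm Bk) _; rewrite ler_wpM2l // mulr_ge0 // ltW.
apply: le_trans (lerD H4 IH2) _.
rewrite -natr1 -subr_ge0.
have -> : L * K * ((m%:R + 1) * delta n) ^+ 2 - (L * delta n * (K * (m%:R * delta n)) + L * K * (m%:R * delta n) ^+ 2)
  = L * K * delta n ^+ 2 * (m%:R + 1) by ring.
apply: mulr_ge0; last exact: addr_ge0.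
by apply: mulr_ge0; [exact: mulr_ge0|exact: sqr_ge0].
Qed.

Lemma euler_stepsP s : 0 <= s -> \forall n \near U,
  (euler_steps n s)%:R * delta n <= s /\ s < (euler_steps n s)%:R * delta n + delta n.
Proof.
move=> s0; apply: (unear delta_gt0) => n d0.
have /truncn_itv/andP[H1 H2] : 0 <= s / delta n by rewrite divr_ge0 // ltW.
split; first by rewrite -ler_pdivlMr.
by move: H2; rewrite -natr1 ltr_pdivrMr // mulrDl mul1r.
Qed.

Lemma euler_cvg s : 0 <= s <= tau ->
  [/\ euler_pt p n s @[n --> U] --> euler_curve p s, `|euler_curve p s - p| <= K * s &
      B (euler_curve p s)].
Proof.
move=> /andP[s0 st].
have H : \forall n \near U, `|euler_pt p n s - p| <= K * s.
  apply: (unear (filter_and _ (euler_stepsP s0) euler_iter)) => n [[H1 H2] H3].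
  apply: le_trans (H3 _ (le_trans H1 st)).1 _.
  by rewrite ler_wpM2l.
have c : euler_pt p n s @[n --> U] --> euler_curve p s.
  apply: (@ultra_bounded_mx _ _ _ _ _ _ (K * s + `|p|)).
  apply: (unear H) => n Hn; rewrite -[euler_pt p n s](subrK p).
  by apply: le_trans (ler_normD _ _) _; rewrite lerD2r.
have H1 : `|euler_curve p s - p| <= K * s.
  apply: (@lim_le_norm _ _ _ _ (fun n => euler_pt p n s - p)) H.
  by apply: cvgB => //; exact: cvg_cst.
split=> //; rewrite /B ballE -[euler_curve p s](subrK p) -addrA.
apply: le_lt_trans (ler_normD _ _) _; apply: le_lt_trans p_in.
by rewrite [leLHS]addrC lerD2l (le_trans H1) // ler_wpM2l.
Qed.

Lemma euler_curve0 : euler_curve p 0 = p.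
Proof.
have [|_ + _] := @euler_cvg 0; first by rewrite lexx ltW.
by rewrite mulr0 normr_le0 subr_eq0 => /eqP.
Qed.

(** The limit of [euler_multi] applied to the steps between the times s and t. The quadratic
    remainder makes the limit curve differentiable with derivative Z, by [derive_quad]. *)
Lemma euler_quad s t : 0 <= s -> s <= t -> t <= tau ->
  `|euler_curve p t - euler_curve p s - (t - s) *: Z (euler_curve p s)| <= L * K * (t - s) ^+ 2.
Proof.
move=> s0 st tt.
have t0 := le_trans s0 st.
have sr : 0 <= s <= tau by rewrite s0 (le_trans st).
have [cs _ Bs] := euler_cvg sr.
have tr : 0 <= t <= tau by rewrite t0.
have [ct _ Bt] := euler_cvg tr.
pose m n := (euler_steps n t - euler_steps n s)%N.
have Hm : \forall n \near U, (euler_steps n s <= euler_steps n t)%N /\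
   `|(m n)%:R * delta n - (t - s)| <= delta n.
  apply: (unear (filter_and _ delta_gt0 (filter_and _ (euler_stepsP s0) (euler_stepsP t0)))).
  move=> n [d0 [[H1 H2] [H3 H4]]].
  have le : (euler_steps n s <= euler_steps n t)%N.
    by rewrite le_truncn // ler_wpM2r // invr_ge0 ltW.
  split => //; rewrite /m natrB // mulrBl ler_norml; move: H1 H2 H3 H4.
  by move: (_ * _) (_ * _) => a b; lra.
have cm : (m n)%:R * delta n @[n --> U] --> t - s.
  apply/cvgrPdist_le => e e0; have He : \forall n \near U, `|0 - delta n| <= e by exact: ((cvgrPdist_le _ _).1 delta_cvg e e0).
  apply: (unear (filter_and _ Hm (filter_and _ He delta_gt0))) => n [[_ H1] [H2 d0]].
  rewrite distrC; apply: le_trans H1 _; move: H2.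
  by rewrite sub0r normrN gtr0_norm.
(* The rescaled displacements are L-Lipschitz uniformly in n, so their convergence at the limit
   point carries over to the moving points [euler_pt p n s]. *)
have cv : (delta n)^-1 *: (h n (euler_pt p n s) - euler_pt p n s) @[n --> U] --> Z (euler_curve p s).
  have -> : Z (euler_curve p s) = 0 + Z (euler_curve p s) by rewrite add0r.
  rewrite (_ : (fun n => _) = (fun n => ((delta n)^-1 *: (h n (euler_pt p n s) - euler_pt p n s) -
     (delta n)^-1 *: (h n (euler_curve p s) - euler_curve p s)) +
     (delta n)^-1 *: (h n (euler_curve p s) - euler_curve p s))); last first.
    by apply/funext => n; rewrite subrK.
  apply: cvgD; last exact: hZ.
  apply/cvgrPdist_le => e e0.
  have L1 : 0 < L + 1 by rewrite ltr_wpDl.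
  have He : \forall n \near U, `|euler_curve p s - euler_pt p n s| <= e / (L + 1).
    exact: ((cvgrPdist_le _ _).1 cs (e / (L + 1)) (divr_gt0 e0 L1)).
  apply: (unear (filter_and _ He (filter_and _ hL (filter_and _ euler_iter (filter_and _ delta_gt0 (euler_stepsP s0)))))).
  move=> n [H1 [H2 [H3 [d0 [H4 H5]]]]].
  rewrite sub0r normrN -scalerBr normrZ normfV gtr0_norm // ler_pdivrMl //.
  have Bn : B (euler_pt p n s) by apply: (H3 _ _).2; apply: le_trans H4 _; exact: le_trans st tt.
  apply: le_trans (H2 _ _ Bn Bs) _; rewrite distrC [L * _]mulrC -mulrA ler_wpM2l ?(ltW d0) //.
  rewrite ler_pdivlMr // in H1; apply: le_trans H1; rewrite mulrC ler_wpM2l //.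
  by rewrite lerDl.
apply: (@lim_le_lim _ (fun n => euler_pt p n t - euler_pt p n s -
     ((m n)%:R * delta n) *: ((delta n)^-1 *: (h n (euler_pt p n s) - euler_pt p n s))) _
     (fun n => L * K * ((m n)%:R * delta n) ^+ 2)).
- by apply: cvgB; [exact: cvgB|exact: cvgZ].
- by apply: cvgMr; rewrite expr2; exact: cvgM.
- apply: (unear (filter_and _ Hm (filter_and _ euler_multi (filter_and _ delta_gt0 (euler_stepsP t0))))).
  move=> n [[le _] [H [d0 [H4 H5]]]].
  have [|_] := H (euler_steps n s) (m n).
    by rewrite /m subnKC //; exact: le_trans tt.
  have E v : ((m n)%:R * delta n) *: ((delta n)^-1 *: v) = (m n)%:R *: v :> 'rV[R]_q.
    by rewrite scalerA -mulrA mulfV ?mulr1 // lt0r_neq0.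
  by rewrite E {1 2}/m subnKC.
Qed.

End Euler.

(** [cm] solves the equation for -Z and is run backwards for negative times. The remainder estimates
    are given only for s <= t; [back] extends them to t < s at the price of the term L K, by
    exchanging the base points and using that Z is Lipschitz. *)
Lemma glue_curve (R : realType) q (B : set 'rV[R]_q) (Z : selfmap R q) (L K C tau : R)
   (cp cm : R -> 'rV[R]_q) : 0 <= L -> 0 <= C ->
  (forall x y, B x -> B y -> `|Z x - Z y| <= L * `|x - y|) ->
  (forall s, 0 <= s <= tau -> B (cp s)) -> (forall s, 0 <= s <= tau -> B (cm s)) ->
  (forall s t, 0 <= s -> s <= t -> t <= tau -> `|cp t - cp s - (t - s) *: Z (cp s)| <= C * (t - s) ^+ 2) ->
  (forall s t, 0 <= s -> s <= t -> t <= tau -> `|cm t - cm s + (t - s) *: Z (cm s)| <= C * (t - s) ^+ 2) ->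
  (forall s t, 0 <= s -> s <= t -> t <= tau -> `|cp t - cp s| <= K * (t - s)) ->
  (forall s t, 0 <= s -> s <= t -> t <= tau -> `|cm t - cm s| <= K * (t - s)) ->
  cp 0 = cm 0 ->
  forall s : R, `|s| < tau -> is_derive s 1 (fun r => if 0 <= r then cp r else cm (- r))
     (Z (if 0 <= s then cp s else cm (- s))).
Proof.
move=> L0 C0 HL Bp Bm qp qm kp km E0 s st.
have K0 : 0 < tau by apply: le_lt_trans st.
have K1 : 0 <= K.
  have := kp 0 tau (lexx _) (ltW K0) (lexx _); rewrite subr0 => H.
  by have := le_trans (normr_ge0 _) H; rewrite pmulr_lge0.
have back (c : R -> 'rV[R]_q) (sg : R) : (sg = 1 \/ sg = -1) ->
  (forall s, 0 <= s <= tau -> B (c s)) ->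
  (forall s t, 0 <= s -> s <= t -> t <= tau -> `|c t - c s - sg *: ((t - s) *: Z (c s))| <= C * (t - s) ^+ 2) ->
  (forall s t, 0 <= s -> s <= t -> t <= tau -> `|c t - c s| <= K * (t - s)) ->
  forall s t, 0 <= s -> 0 <= t -> s <= tau -> t <= tau ->
   `|c t - c s - sg *: ((t - s) *: Z (c s))| <= (C + L * K) * (t - s) ^+ 2.
  move=> sg1 Bc qc kc s1 t1 s10 t10 s1t t1t; have [le|/ltW le] := leP s1 t1.
    apply: le_trans (qc _ _ s10 le t1t) _; by rewrite mulrDl lerDl mulr_ge0 ?sqr_ge0 // mulr_ge0.
  have -> : c t1 - c s1 - sg *: ((t1 - s1) *: Z (c s1)) =
     - (c s1 - c t1 - sg *: ((s1 - t1) *: Z (c t1))) + (t1 - s1) *: (sg *: (Z (c t1) - Z (c s1))).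
    by apply/rowP => i; rewrite !mxE; ring.
  apply: le_trans (ler_normD _ _) _; rewrite normrN mulrDl lerD //.
    by apply: le_trans (qc _ _ t10 le s1t) _; rewrite -[(t1 - s1) ^+ 2]sqrrN opprB.
  rewrite normrZ distrC ger0_norm ?subr_ge0 // normrZ.
  have -> : `|sg| = 1 by case: sg1 => ->; rewrite ?normrN normr1.
  rewrite mul1r -sqrrN opprB expr2 mulrCA ler_wpM2l ?subr_ge0 //.
  have b1 : B (c t1) by apply: Bc; rewrite t10.
  have b2 : B (c s1) by apply: Bc; rewrite s10.
  apply: le_trans (HL _ _ b1 b2) _; rewrite -mulrA ler_wpM2l // distrC.
  exact: kc.
have H1 := back cp 1 (or_introl erefl) Bp _ kp.
have H2 := back cm (-1) (or_intror erefl) Bm _ km.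
have {}H1 s1 t1 : 0 <= s1 -> 0 <= t1 -> s1 <= tau -> t1 <= tau ->
   `|cp t1 - cp s1 - ((t1 - s1) *: Z (cp s1))| <= (C + L * K) * (t1 - s1) ^+ 2.
  move=> a b c d; have := H1 _ s1 t1 a b c d; rewrite scale1r; apply => s2 t2 a2 b2 c2.
  by rewrite scale1r; exact: qp.
have {}H2 s1 t1 : 0 <= s1 -> 0 <= t1 -> s1 <= tau -> t1 <= tau ->
   `|cm t1 - cm s1 + ((t1 - s1) *: Z (cm s1))| <= (C + L * K) * (t1 - s1) ^+ 2.
  move=> a b c d; have := H2 _ s1 t1 a b c d; rewrite scaleN1r opprK; apply => s2 t2 a2 b2 c2.
  by rewrite scaleN1r opprK; exact: qm.
have tn (a : R) : `|a| < tau -> (0 <= a -> a <= tau) /\ (a < 0 -> 0 <= - a <= tau).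
  move=> at'; split=> [a0|a0]; first by rewrite ltW // -[a]ger0_norm.
  by rewrite oppr_ge0 (ltW a0) /= ltW // -[- a]ltr0_norm.
have [s0|s0|s0] := ltgtP s 0.
- pose r := Num.min (- s) (tau - `|s|).
  have r0 : 0 < r by rewrite lt_min oppr_gt0 s0 subr_gt0.
  apply: (derive_quad (C := C + L * K) r0) => h0; rewrite lt_min => /andP[h1 h2].
  have sh0 : s + h0 *: 1 < 0.
    rewrite [_ *: 1]mulr1; move: h1; rewrite ltr_norml => /andP[_]; lra.
  have sht : `|s + h0 *: 1| < tau.
    by rewrite [_ *: 1]mulr1; apply: le_lt_trans (ler_normD _ _) _; rewrite addrC -ltrBrDr.
  have -> : (0 <= s + h0 *: 1) = false by apply/negbTE; rewrite -ltNge.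
  have /andP[x1 x2] := (tn _ st).2 s0; have /andP[x3 x4] := (tn _ sht).2 sh0.
  have := H2 _ _ x1 x3 x2 x4.
  have -> : - (s + h0 *: 1) - - s = - h0 by rewrite [_ *: 1]mulr1; ring.
  have -> : (0 <= s) = false by apply/negbTE; rewrite -ltNge.
  by rewrite scaleNr sqrrN.
- pose r := Num.min s (tau - `|s|).
  have r0 : 0 < r by rewrite lt_min s0 subr_gt0.
  apply: (derive_quad (C := C + L * K) r0) => h0; rewrite lt_min => /andP[h1 h2].
  have sh0 : 0 <= s + h0 *: 1.
    rewrite [_ *: 1]mulr1; move: h1; rewrite ltr_norml => /andP[+ _]; lra.
  have sht : `|s + h0 *: 1| < tau.
    by rewrite [_ *: 1]mulr1; apply: le_lt_trans (ler_normD _ _) _; rewrite addrC -ltrBrDr.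
  rewrite sh0.
  have := H1 _ _ (ltW s0) sh0 ((tn _ st).1 (ltW s0)) ((tn _ sht).1 sh0).
  have -> : s + h0 *: 1 - s = h0 by rewrite [_ *: 1]mulr1; ring.
  by rewrite (ltW s0).
- rewrite s0; apply: (derive_quad (C := C + L * K) K0) => h0 ht; rewrite add0r [_ *: 1]mulr1.
  rewrite lexx; have [h1|h1] := leP 0 h0.
    by have := H1 0 h0 (lexx _) h1 (ltW K0) ((tn _ ht).1 h1); rewrite subr0.
  have /andP[x3 x4] := (tn _ ht).2 h1.
  have := H2 0 _ (lexx _) x3 (ltW K0) x4.
  by rewrite subr0 sqrrN scaleNr -E0.
Qed.

(** * Isometries and their jets *)

Section MetricAlgebra.
Variables (R : realType) (q : nat).
Implicit Types (G : 'M[R]_q) (v w : 'rV[R]_q).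

Definition posdef G := G^T = G /\ forall v, v != 0 -> 0 < inner G v v.

Lemma innerDl G u v w : inner G (u + v) w = inner G u w + inner G v w.
Proof. by rewrite /inner !mulmxDl mxE. Qed.

Lemma innerDr G u v w : inner G u (v + w) = inner G u v + inner G u w.
Proof. by rewrite /inner linearD /= !mulmxDr mxE. Qed.

Lemma innerZl G a v w : inner G (a *: v) w = a * inner G v w.
Proof. by rewrite /inner -!scalemxAl mxE. Qed.

Lemma innerZr G a v w : inner G v (a *: w) = a * inner G v w.
Proof. by rewrite /inner linearZ /= -!scalemxAr mxE. Qed.

Lemma inner_sym G v w : G^T = G -> inner G v w = inner G w v.
Proof.
move=> sG; rewrite /inner -[LHS]trace_mx11 -[RHS]trace_mx11 -mxtrace_tr.
by rewrite !trmx_mul trmxK sG mulmxA.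
Qed.

Lemma inner_delta G a b : inner G (delta_mx 0 a) (delta_mx 0 b) = G a b.
Proof. by rewrite /inner -rowE trmx_delta -colE !mxE. Qed.

Lemma inner_mul G (A : 'M[R]_q) v w :
  inner G (v *m A) (w *m A) = inner (A *m G *m A^T) v w.
Proof. by rewrite /inner trmx_mul !mulmxA. Qed.

Lemma inner_inj G G' : (forall v w, inner G v w = inner G' v w) -> G = G'.
Proof. by move=> H; apply/matrixP => a b; rewrite -!inner_delta. Qed.

Lemma posdef_ge0 G v : posdef G -> 0 <= inner G v v.
Proof.
move=> [_ H]; have [->|v0] := eqVneq v 0; last exact/ltW/H.
by rewrite /inner !mul0mx mxE.
Qed.

Lemma posdef_unit G : posdef G -> G \in unitmx.
Proof.
move=> [_ H]; rewrite unitmxE unitfE; apply/det0P => -[v v0 vG].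
by have := H v v0; rewrite /inner vG mul0mx mxE ltxx.
Qed.

Lemma cauchy_schwarz G v w : posdef G -> inner G v w ^+ 2 <= inner G v v * inner G w w.
Proof.
move=> pG; have [->|w0] := eqVneq w 0.
  have -> : inner G v 0 = 0 by rewrite -(scale0r (0 : 'rV_q)) innerZr mul0r.
  by rewrite expr0n /= mulr_ge0 // posdef_ge0.
have W := pG.2 w w0.
have := posdef_ge0 (v - (inner G v w / inner G w w) *: w) pG.
rewrite -scaleNr innerDl !innerDr !innerZl !innerZr (inner_sym w v pG.1).
move: W; move: (inner G v v) (inner G v w) (inner G w w) => a b c c0.
have -> : a + - (b / c) * b + (- (b / c) * b + - (b / c) * (- (b / c) * c)) = a - b ^+ 2 / c.
  by field; rewrite lt0r_neq0.
by rewrite subr_ge0 ler_pdivrMr.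
Qed.

(** The vector w represents the k-th coordinate with respect to the inner product, and its squared
    norm is the k-th diagonal entry of the inverse; the rest is Cauchy-Schwarz. *)
Lemma entry_le_inner G v k : posdef G -> (v 0 k) ^+ 2 <= inner G v v * (invmx G) k k.
Proof.
move=> pG; have uG := posdef_unit pG.
pose w : 'rV[R]_q := delta_mx 0 k *m invmx G.
have E1 : inner G v w = v 0 k.
  by rewrite (inner_sym _ _ pG.1) /inner /w mulmxKV // -rowE !mxE.
have E2 : inner G w w = (invmx G) k k.
  rewrite /inner {1}/w mulmxKV // /w trmx_mul trmx_delta.
  by rewrite -colE -rowE !mxE.
by rewrite -E1 -E2; exact: cauchy_schwarz.
Qed.

(** Bounds the Jacobian of an isometry by the metrics at source and target alone, whatever chain of
    transition maps produced it. *)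
Lemma isometry_entry_le G G' (A : 'M[R]_q) a k : posdef G' -> A *m G' *m A^T = G ->
  (A a k) ^+ 2 <= G a a * (invmx G') k k.
Proof.
move=> pG' E; have := entry_le_inner (row a A) k pG'; rewrite mxE.
suff -> : inner G' (row a A) (row a A) = G a a by [].
by rewrite -E -inner_delta -inner_mul -rowE.
Qed.

End MetricAlgebra.

Section Isometries.
Variables (R : realType) (q : nat) (T : set 'rV[R]_q) (G : 'rV[R]_q -> 'M[R]_q).
Hypothesis oT : open T.
Hypothesis sG : forall k l, smooth_on T (fun t => G t k l).
Hypothesis pG : forall t, T t -> posdef (G t).
Implicit Types (B : set 'rV[R]_q) (phi h : selfmap R q) (x y t : 'rV[R]_q) (A : 'M[R]_q).

Definition isom B phi := [/\ smooth_map_on B phi, forall x, B x -> T (phi x) &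
  forall x, B x -> Jac phi x *m G (phi x) *m (Jac phi x)^T = G x].

Lemma isom_sub B B' phi : B' `<=` B -> isom B phi -> isom B' phi.
Proof.
move=> BB [H1 H2 H3]; split=> [j|x /BB/H2//|x /BB/H3//].
exact: smooth_sub (H1 j).
Qed.

Lemma isom_id B : B `<=` T -> isom B id.
Proof.
move=> BT; split=> [j||x Bx] //; first exact: smooth_coord.
by rewrite jac_id mul1mx trmx1 mulmx1.
Qed.

Lemma isom_comp B B' phi psi : open B -> open B' -> (forall x, B x -> B' (phi x)) ->
  isom B phi -> isom B' psi -> isom B (psi \o phi).
Proof.
move=> oB oB' BB [H1 H2 H3] [H4 H5 H6]; split.
- exact: (smooth_map_comp oB oB' BB).
- by move=> x /BB/H5.
- move=> x Bx; rewrite jac_comp; first last.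
  + by apply: (smooth_map_diff oB' H4); exact: BB.
  + exact: (smooth_map_diff oB H1).
  by rewrite trmx_mul !mulmxA -(mulmxA _ (Jac psi _)) -(mulmxA _ _ (Jac psi _)^T)
    H6 ?H3 //; exact: BB.
Qed.

(** Differentiate J G(phi) J^T = G in direction c: this is what the two terms with second
    derivatives of phi add up to, for y = phi(x) and A = J. *)
Definition Mf x y A c a b : R := pd c (fun x => G x a b) x
  - \sum_m A c m * \sum_k \sum_l A a k * pd m (fun x => G x k l) y * A b l.

(** The counterpart of the Christoffel symbols: the Koszul combination of three values of [Mf]
    isolates a single term, whose index b is then turned back into k by [invmx (G x)] and A. *)
Definition Ff x y A c a k : R :=
  \sum_b (2^-1 * (Mf x y A c a b + Mf x y A a b c - Mf x y A b c a)) *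
     \sum_m (invmx (G x)) b m * A m k.

Lemma pd_sum (I : finType) (f : I -> 'rV[R]_q -> R) c x :
  (forall i, derivable (f i) x (delta_mx 0 c)) ->
  derivable (fun x => \sum_i f i x) x (delta_mx 0 c) /\
  pd c (fun x => \sum_i f i x) x = \sum_i pd c (f i) x.
Proof.
move=> H.
have E : (fun x => \sum_i f i x) = \sum_i f i.
  by apply/funext => y; rewrite fct_sumE.
suff K : is_derive x (delta_mx 0 c) (\sum_i f i) (\sum_i pd c (f i) x).
  by rewrite E; split; [|apply: derive_val].
elim/big_rec2: _ => [|i d g _ IH]; first exact: is_derive_cst.
by apply: is_deriveD => //; exact: derivableP.
Qed.

(* Koszul formula: differentiating J G(phi) J^T = G gives the second derivatives of an
   isometry phi as a function of its 1-jet. *)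
Lemma iso_pde B phi x c a k : open B -> isom B phi -> B `<=` T -> B x ->
  pd c (fun x => Jac phi x a k) x = Ff x (phi x) (Jac phi x) c a k.
Proof.
move=> oB [sphi phiT Hiso] BT Bx.
have sJ := smooth_jac oB sphi.
pose Gp k l := (fun t => G t k l) \o phi.
have sGp k' l : smooth_on B (Gp k' l).
  exact: (smooth_comp oB oT phiT sphi (sG k' l)).
have dJ a' b' c' : derivable (fun x => Jac phi x a' b') x (delta_mx 0 c').
  exact: smooth_derivable (sJ a' b') Bx.
have dG a' b' c' : derivable (Gp a' b') x (delta_mx 0 c').
  exact: smooth_derivable (sGp a' b') Bx.
pose S c a b := \sum_k \sum_l pd c (fun x => Jac phi x a k) x * Gp k l x * Jac phi x b l.
have pdGp c' k' l : pd c' (Gp k' l) x = \sum_m Jac phi x c' m * pd m (fun t => G t k' l) (phi x).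
  rewrite pd_comp; first last.
  - exact: smooth_diff oT (sG k' l) (phiT x Bx).
  - by move=> j; exact: smooth_diff oB (sphi j) Bx.
  by apply: eq_bigr => m _; rewrite (jacE_smooth _ _ oB sphi Bx).
have HM c' a' b' : Mf x (phi x) (Jac phi x) c' a' b' = S c' a' b' + S c' b' a'.
  have E : {in B, (fun x => \sum_k \sum_l Jac phi x a' k * Gp k l x * Jac phi x b' l) =1 (fun x => G x a' b')}.
    move=> y /set_mem By; rewrite -(Hiso y By) mxE exchange_big /=; apply: eq_bigr => l _.
    rewrite !mxE mulr_suml; apply: eq_bigr => k' _ //.
  have dt y k' l : is_derive x (delta_mx 0 c') (fun x => Jac phi x a' k' * Gp k' l x * Jac phi x b' l)
    (pd c' (fun x => Jac phi x a' k' * Gp k' l x * Jac phi x b' l) x).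
    apply: derivableP; apply: derivableM => //; exact: derivableM.
  have dt' k' l : derivable (fun x => Jac phi x a' k' * Gp k' l x * Jac phi x b' l) x (delta_mx 0 c').
    by apply: derivableM => //; exact: derivableM.
  have dt2 k' : derivable (fun x => \sum_l Jac phi x a' k' * Gp k' l x * Jac phi x b' l) x (delta_mx 0 c').
    exact: (pd_sum _).1.
  have := near_eq_derive (delta_mx 0 c') (eq_on_near oB Bx E).
  rewrite -/(pd c' _ x) -[in RHS]/(pd c' _ x) (pd_sum dt2).2 /Mf => <-.
  have -> : \sum_m Jac phi x c' m * (\sum_k0 \sum_l Jac phi x a' k0 * pd m (fun t => G t k0 l) (phi x) * Jac phi x b' l)
    = \sum_k0 \sum_l Jac phi x a' k0 * pd c' (Gp k0 l) x * Jac phi x b' l.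
    under eq_bigr do rewrite mulr_sumr.
    rewrite exchange_big; apply: eq_bigr => k' _.
    under eq_bigr do rewrite mulr_sumr.
    rewrite exchange_big; apply: eq_bigr => l _.
    rewrite pdGp mulr_sumr mulr_suml; apply: eq_bigr => m _; ring.
  rewrite -sumrB /S [X in _ = _ + X]exchange_big -big_split; apply: eq_bigr => k' _ /=.
  rewrite (pd_sum (dt' k')).2 -sumrB -big_split; apply: eq_bigr => l _ /=.
  rewrite pdM //; last exact: derivableM.
  rewrite pdM //.
  have -> : Gp l k' x = Gp k' l x.
    by have /matrixP/(_ l k') := (pG (phiT x Bx)).1; rewrite mxE.
  ring.
(* The second derivatives of phi are symmetric in the two directions of differentiation; with this
   the three equations [HM] can be solved for [S]. *)
have Ssym c' a' b' : S c' a' b' = S a' c' b'.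
  apply: eq_bigr => k' _; apply: eq_bigr => l _; congr (_ * _ * _).
  have E d e : pd d (fun x => Jac phi x e k') x = pd d (pd e (fun x => phi x 0 k')) x.
    apply: near_eq_derive; apply: (eq_on_near oB Bx) => y /set_mem By.
    by rewrite (jacE_smooth _ _ oB sphi By).
  by rewrite !E; apply: (clairaut _ _ oB (sphi k' 2%N) Bx).
have HS c' a' b' : 2^-1 * (Mf x (phi x) (Jac phi x) c' a' b' + Mf x (phi x) (Jac phi x) a' b' c'
    - Mf x (phi x) (Jac phi x) b' c' a') = S c' a' b'.
  rewrite !HM (Ssym a' b' c') (Ssym c' b' a') (Ssym a' c' b'); by field.
rewrite /Ff; under eq_bigr do rewrite HS.
pose D : 'rV[R]_q := \row_k pd c (fun x => Jac phi x a k) x.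
pose J := Jac phi x.
have uG := posdef_unit (pG (BT x Bx)).
(* For square matrices this right inverse of J is also a left inverse, which recovers the row D of
   second derivatives from D G(phi) J^T. *)
have E1 : J *m (G (phi x) *m J^T *m invmx (G x)) = 1%:M.
  by rewrite !mulmxA Hiso // mulmxV.
have E2 : D *m (G (phi x) *m J^T *m invmx (G x) *m J) = D.
  by rewrite (mulmx1C E1) mulmx1.
have -> : pd c (fun x => Jac phi x a k) x = D 0 k by rewrite mxE.
have E3 : (D *m G (phi x) *m J^T) *m (invmx (G x) *m J) = D by rewrite -[RHS]E2 !mulmxA.
rewrite -[in LHS]E3 mxE; apply: eq_bigr => b _; congr (_ * _); last by rewrite mxE.
rewrite -mulmxA mxE /S; apply: eq_bigr => k' _.
rewrite mxE [in LHS]mxE mulr_sumr; apply: eq_bigr => l _.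
have -> : J^T l b = J b l by rewrite mxE.
by rewrite mulrA.
Qed.

Lemma Ff_id x c a k : T x -> Ff x x 1%:M c a k = 0.
Proof.
move=> Tx; have := iso_pde c a k oT (isom_id (fun x H => H)) (fun x H => H) Tx.
rewrite jac_id => <-.
have -> : (fun x => Jac (id : selfmap R q) x a k) = fun=> (1%:M : 'M[R]_q) a k.
  by apply/funext => y; rewrite jac_id.
exact: derive_cst.
Qed.

End Isometries.

(** * Estimates for isometries in terms of their 1-jets *)

Section Estimates.
Variables (R : realType) (q : nat) (T : set 'rV[R]_q) (G : 'rV[R]_q -> 'M[R]_q).
Hypothesis oT : open T.
Hypothesis sG : forall k l, smooth_on T (fun t => G t k l).
Hypothesis pG : forall t, T t -> posdef (G t).
Variables (t0 : 'rV[R]_q) (rT : R).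
Hypothesis rT0 : 0 < rT.
Hypothesis ballT : cball t0 rT `<=` T.
Implicit Types (phi h : selfmap R q) (x y t : 'rV[R]_q) (A : 'M[R]_q).
Let D := ball t0 rT.

Lemma D_T : D `<=` T.
Proof. by move=> x; rewrite /D ballE => /ltW H; exact: ballT. Qed.

Lemma isom_jac_bound : exists2 C : R, 0 < C &
  forall x y A, D x -> D y -> A *m G y *m A^T = G x -> `|A| <= C.
Proof.
have [C1 C10 H1] : exists2 C, 0 < C & forall a, forall x, cball t0 rT x -> `|G x a a| <= C.
  apply: exists_bound => [j C C' CC H x /H/le_trans|j]; first exact.
  by have [C _ HC] := smooth_cball (sG j j) ballT; exists C.
have sI := smooth_invmx oT (fun x Tx => posdef_unit (pG Tx)) sG.
have [C2 C20 H2] : exists2 C, 0 < C & forall a, forall x, cball t0 rT x -> `|invmx (G x) a a| <= C.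
  apply: exists_bound => [j C C' CC H x /H/le_trans|j]; first exact.
  by have [C _ HC] := smooth_cball (sI j j) ballT; exists C.
(* The square of each entry is at most C1 C2, and z^2 <= C1 C2 forces z <= 1 + C1 C2. *)
exists (1 + C1 * C2); first by rewrite ltr_wpDr // mulr_ge0 // ltW.
move=> x y A; rewrite /D !ballE => /ltW Dx /ltW Dy E; apply/mx_norm_le => [|a k].
  by rewrite addr_ge0 // mulr_ge0 // ltW.
have := isometry_entry_le a k (pG (ballT Dy)) E.
have := H1 a x Dx; have := H2 k y Dy.
rewrite -[A a k ^+ 2]real_normK ?num_real //.
move: (normr_ge0 (A a k)); move: (`|A a k|) (G x a a) (invmx (G y) k k) => z u v z0.
rewrite !ler_norml => /andP[v1 v2] /andP[u1 u2] H.
rewrite leNgt; apply/negP => Hz.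
have uv : u * v <= C1 * C2.
  have [v0|/ltW v0] := leP 0 v.
    by apply: (@le_trans _ _ (C1 * v)); [rewrite ler_wpM2r|rewrite ler_wpM2l // ltW].
  rewrite -mulrNN; apply: (@le_trans _ _ (C1 * - v)).
    by rewrite ler_wpM2r ?oppr_ge0 // lerNl.
  by rewrite ler_wpM2l ?(ltW C10) // lerNl.
have : 1 + C1 * C2 < z ^+ 2; last by lra.
have P : 0 < C1 * C2 by rewrite mulr_gt0.
nra.
Qed.

(** Boundedness is part of the notion so that it is closed under products. The Lipschitz dependence
    concerns (y, A) only, because two isometries are always compared at the same source x. *)
Definition lipb (C : R) (f : 'rV[R]_q -> 'rV[R]_q -> 'M[R]_q -> R) := exists2 K : R, 0 < K &
  forall x y y' A A', D x -> D y -> D y' -> `|A| <= C -> `|A'| <= C ->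
    `|f x y A| <= K /\ `|f x y A - f x y' A'| <= K * (`|y - y'| + `|A - A'|).

Lemma lipb_x C (g : 'rV[R]_q -> R) : smooth_on T g -> lipb C (fun x _ _ => g x).
Proof.
move=> sg; have [K K0 H] := smooth_cball sg ballT; exists K => // x y y' A A' Dx _ _ _ _.
split; first by apply: H; move: Dx; rewrite /D ballE => /ltW.
by rewrite subrr normr0 mulr_ge0 ?addr_ge0 // ltW.
Qed.

Lemma lipb_y C (g : 'rV[R]_q -> R) : smooth_on T g -> lipb C (fun _ y _ => g y).
Proof.
move=> sg; have [K K0 H] := smooth_cball sg ballT.
have [K' K'0 H'] : exists2 C, 0 < C & forall l, forall x, cball t0 rT x -> `|pd l g x| <= C.
  apply: exists_bound => [j C0 C' CC H0 x /H0/le_trans|j]; first exact.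
  by have [C0 _ HC] := smooth_cball (smooth_pd j sg) ballT; exists C0.
have H2 l x : D x -> `|pd l g x| <= K' by rewrite /D ballE => /ltW; exact: H'.
exists (K + q%:R * K'); first by rewrite ltr_wpDr // mulr_ge0 // ltW.
move=> x y y' A A' _ Dy Dy' _ _; split.
  apply: (@le_trans _ _ K); last by rewrite lerDl mulr_ge0 // ltW.
  by apply: H; move: Dy; rewrite /D ballE => /ltW.
apply: le_trans (smooth_ball_lip (smooth_sub D_T sg) H2 Dy' Dy) _.
apply: ler_pM => //; first by rewrite mulr_ge0 // ltW.
  by rewrite lerDr ltW.
by rewrite lerDl.
Qed.

Lemma lipb_A C a k : 0 < C -> lipb C (fun _ _ A => A a k).
Proof.
move=> C0; exists (C + 1); first by rewrite ltr_wpDr.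
move=> x y y' A A' _ _ _ HA HA'; split.
  by rewrite (le_trans (mx_entry_le _ _ _)) // (le_trans HA) // lerDl.
apply: (@le_trans _ _ (1 * (`|y - y'| + `|A - A'|))).
  rewrite mul1r; have := mx_entry_le (A - A') a k; rewrite !mxE => /le_trans; apply.
  by rewrite lerDr.
by rewrite ler_wpM2r ?addr_ge0 // lerDr ltW.
Qed.

Lemma lipb_add C f g : lipb C f -> lipb C g -> lipb C (fun x y A => f x y A + g x y A).
Proof.
move=> [K K0 H] [K' K'0 H']; exists (K + K'); first exact: addr_gt0.
move=> x y y' A A' Dx Dy Dy' HA HA'.
have [H1 H2] := H x y y' A A' Dx Dy Dy' HA HA'; have [H3 H4] := H' x y y' A A' Dx Dy Dy' HA HA'.
split; first by apply: le_trans (ler_normD _ _) (lerD H1 H3).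
rewrite mulrDl opprD addrACA; apply: le_trans (ler_normD _ _) (lerD H2 H4).
Qed.

Lemma lipb_mul C f g : lipb C f -> lipb C g -> lipb C (fun x y A => f x y A * g x y A).
Proof.
move=> [K K0 H] [K' K'0 H']; exists (K * K' + K * K'); first by rewrite addr_gt0 // mulr_gt0.
move=> x y y' A A' Dx Dy Dy' HA HA'.
have [H1 H2] := H x y y' A A' Dx Dy Dy' HA HA'; have [H3 H4] := H' x y y' A A' Dx Dy Dy' HA HA'.
have [H5 _] := H' x y' y A' A Dx Dy' Dy HA' HA.
split.
  rewrite normrM (@le_trans _ _ (K * K')) //; first exact: ler_pM.
  by rewrite lerDl mulr_ge0 // ltW.
have -> : f x y A * g x y A - f x y' A' * g x y' A' =
   f x y A * (g x y A - g x y' A') + (f x y A - f x y' A') * g x y' A' by ring.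
apply: le_trans (ler_normD _ _) _; rewrite !normrM mulrDl; apply: lerD.
  by rewrite -mulrA; apply: ler_pM.
rewrite mulrAC; apply: ler_pM => //.
Qed.

Lemma lipb_ext C f g : (forall x y A, f x y A = g x y A) -> lipb C f -> lipb C g.
Proof.
move=> E [K K0 H]; exists K => // x y y' A A' Dx Dy Dy' HA HA'.
by rewrite -!E; exact: H.
Qed.

Lemma lipb_cst C c : lipb C (fun _ _ _ => c).
Proof. by apply: lipb_x; exact: smooth_cst. Qed.

Lemma lipb_opp C f : lipb C f -> lipb C (fun x y A => - f x y A).
Proof.
move=> H; apply: lipb_ext (lipb_mul (lipb_cst C (-1)) H) => x y A.
by rewrite mulN1r.
Qed.

Lemma lipb_sum C (I : Type) (r : seq I) f : (forall i, lipb C (f i)) ->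
  lipb C (fun x y A => \sum_(i <- r) f i x y A).
Proof.
move=> H; elim: r => [|i r IH].
  by apply: lipb_ext (lipb_cst C 0) => x y A; rewrite big_nil.
by apply: lipb_ext (lipb_add (H i) IH) => x y A; rewrite big_cons.
Qed.

Lemma lipb_Mf C c a b : 0 < C -> lipb C (fun x y A => Mf G x y A c a b).
Proof.
move=> C0; apply: lipb_add; first by apply: lipb_x; exact: smooth_pd.
apply: lipb_opp; apply: lipb_sum => m; apply: lipb_mul; first exact: lipb_A.
apply: lipb_sum => k; apply: lipb_sum => l; apply: lipb_mul; last exact: lipb_A.
by apply: lipb_mul; [exact: lipb_A|apply: lipb_y; exact: smooth_pd].
Qed.

Lemma lipb_Ff C c a k : 0 < C -> lipb C (fun x y A => Ff G x y A c a k).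
Proof.
move=> C0; apply: lipb_sum => b; apply: lipb_mul.
  apply: lipb_mul; first exact: lipb_cst.
  apply: lipb_add; last by apply: lipb_opp; exact: lipb_Mf.
  by apply: lipb_add; exact: lipb_Mf.
apply: lipb_sum => m; apply: lipb_mul; last exact: lipb_A.
by apply: lipb_x; exact: (smooth_invmx oT (fun x Tx => posdef_unit (pG Tx)) sG).
Qed.

Lemma norm_step (V : normedModType R) (a b : V) (e : R) : `|a - b| <= e -> `|a| <= `|b| + e.
Proof.
move=> H; rewrite -[a](subrK b); apply: le_trans (ler_normD _ _) _.
by rewrite addrC lerD2l.
Qed.

Definition jd (h k : selfmap R q) x : R := `|h x - k x| + `|Jac h x - Jac k x|.

Lemma Ff_lip : exists C K : R, [/\ 0 < C, 0 < K,
  (forall B h x, isom T G B h -> D x -> B x -> D (h x) -> `|Jac h x| <= C) &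
  (forall c a k x y y' A A', D x -> D y -> D y' -> `|A| <= C -> `|A'| <= C ->
    `|Ff G x y A c a k - Ff G x y' A' c a k| <= K * (`|y - y'| + `|A - A'|))].
Proof.
have [C C0 HC] := isom_jac_bound.
have [K K0 HK] : exists2 K, 0 < K & forall cak : 'I_q * 'I_q * 'I_q, forall x y y' A A', D x -> D y -> D y' -> `|A| <= C -> `|A'| <= C ->
    `|Ff G x y A cak.1.1 cak.1.2 cak.2 - Ff G x y' A' cak.1.1 cak.1.2 cak.2| <= K * (`|y - y'| + `|A - A'|).
  apply: exists_bound => [j K K' KK H x y y' A A' a1 a2 a3 a4 a5|[[c a] k]].
    by apply: le_trans (H x y y' A A' a1 a2 a3 a4 a5) _; rewrite ler_wpM2r // addr_ge0.
  have [K _ H] := lipb_Ff c a k C0; exists K => x y y' A A' a1 a2 a3 a4 a5.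
  by have [] := H x y y' A A' a1 a2 a3 a4 a5.
exists C, K; split=> // [B h x [_ _ H] Dx Bx Dh|c a k].
  exact: HC Dx Dh (H x Bx).
exact: (HK (c, a, k)).
Qed.

(* The second derivatives are a Lipschitz function of the 1-jet (iso_pde), so on a
   small ball jd varies by at most half of its supremum. *)
Lemma jet_control : exists2 r1 : R, 0 < r1 < rT & forall c r h k,
  ball c r `<=` D -> r <= r1 -> isom T G (ball c r) h -> isom T G (ball c r) k ->
  (forall x, ball c r x -> D (h x)) -> (forall x, ball c r x -> D (k x)) ->
  forall x x', ball c r x -> ball c r x' -> jd h k x <= 2 * jd h k x'.
Proof.
have [C [K [C0 K0 HC HK]]] := Ff_lip.
pose K1 := 1 + K.
have K10 : 0 < K1 by rewrite addr_gt0.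
(* With this bound on r, a function whose partial derivatives are at most K1 N varies by at most q
   K1 N (2 r) <= N / 4 over the ball. *)
pose r1 := Num.min (rT / 2) ((8 * (q%:R + 1) * K1)^-1).
have r10 : 0 < r1.
  by rewrite lt_min divr_gt0 //= invr_gt0 !mulr_gt0 // ltr_wpDl.
have r1T : r1 < rT.
  by rewrite gt_min ltr_pdivrMr // ltr_pMr // ltr1n.
exists r1; first by rewrite r10.
move=> c r h k sub rr ih ik Dh Dk x x' Bx Bx'.
have oB : open (ball c r) by exact: ball_open.
have BT : ball c r `<=` T by move=> z /sub; exact: D_T.
have rb : q%:R * K1 * (2 * r) <= 4^-1.
  have : r <= (8 * (q%:R + 1) * K1)^-1 by apply: le_trans rr _; rewrite ge_min lexx orbT.
  rewrite -[leRHS]div1r ler_pdivlMr; last by rewrite !mulr_gt0 // ltr_wpDl.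
  have := ballE c r c; rewrite subrr normr0.
  have r0 : 0 <= r by have := normr_ge0 (x - c); move: Bx; rewrite ballE => /ltW; lra.
  move=> _; have : 0 <= r * K1 by rewrite mulr_ge0 // ltW.
  have : 0 <= q%:R * K1 * r by rewrite !mulr_ge0 // ltW.
  move: (q%:R : R) => n; nra.
have bd z : ball c r z -> [/\ D z, `|Jac h z| <= C & `|Jac k z| <= C].
  move=> Bz; have Dz := sub _ Bz; split=> //.
    exact: HC ih Dz Bz (Dh _ Bz).
  exact: HC ik Dz Bz (Dk _ Bz).
have [sh _ _] := ih; have [sk _ _] := ik.
(* If N bounds [jd] on the ball, then the difference of values and the difference of Jacobians each
   vary by at most N / 4. *)
have step N : (forall z, ball c r z -> jd h k z <= N) ->
   forall z, ball c r z -> jd h k z <= jd h k x' + N / 2.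
  move=> HN z Bz.
  have N0 : 0 <= N by apply: le_trans (HN z Bz); rewrite addr_ge0.
  have zx : `|z - x'| <= 2 * r.
    rewrite -(subrK c z) -addrA mulr_natl mulr2n; apply: le_trans (ler_normD _ _) _.
    by move: Bz Bx'; rewrite !ballE (distrC c) => /ltW a /ltW b; exact: lerD.
  have mv (f : 'rV[R]_q -> R) : smooth_on (ball c r) f ->
      (forall l y, ball c r y -> `|pd l f y| <= K1 * N) -> `|f z - f x'| <= N / 4.
    move=> sf Hf; apply: le_trans (smooth_ball_lip sf Hf Bx' Bz) _.
    apply: (@le_trans _ _ ((q%:R * K1 * (2 * r)) * N)).
      have -> : q%:R * (K1 * N) * `|z - x'| = q%:R * K1 * `|z - x'| * N by ring.
      by rewrite ler_wpM2r // ler_wpM2l // mulr_ge0 // ltW.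
    by rewrite mulrC ler_wpM2l.
  have H1 : `|(h z - k z) - (h x' - k x')| <= N / 4.
    apply/mx_norm_le => [|i j]; first by rewrite divr_ge0.
    have := mv (fun y => h y 0 j - k y 0 j); rewrite (ord1 i) !mxE; apply.
      exact: smooth_sub2.
    move=> l y By.
    have -> : pd l (fun y => h y 0 j - k y 0 j) y = Jac h y l j - Jac k y l j.
      have E1 := jacE_smooth l j oB sh By; have E2 := jacE_smooth l j oB sk By.
      transitivity (pd l (fun y => h y 0 j) y - pd l (fun y => k y 0 j) y); last exact: (congr2 (fun a b => a - b) (esym E1) (esym E2)).
      exact: (deriveB (smooth_derivable (sh j) By) (smooth_derivable (sk j) By)).
    apply: le_trans (mx_entry_leB (Jac h y) (Jac k y) l j) _.
    apply: le_trans (_ : jd h k y <= _); first by rewrite lerDr.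
    by apply: le_trans (HN y By) _; rewrite ler_peMl // lerDl ltW.
  have H2 : `|(Jac h z - Jac k z) - (Jac h x' - Jac k x')| <= N / 4.
    apply: mx_norm_leB => [|a j]; first by rewrite divr_ge0.
    have sJh := smooth_jac oB sh a j; have sJk := smooth_jac oB sk a j.
    suff : `|(Jac h z a j - Jac k z a j) - (Jac h x' a j - Jac k x' a j)| <= N / 4.
      by move: (Jac h z) (Jac k z) (Jac h x') (Jac k x') => X1 X2 X3 X4; rewrite !mxE.
    apply: (mv (fun y => Jac h y a j - Jac k y a j)); first exact: smooth_sub2.
    move=> l y By.
    have -> : pd l (fun y => Jac h y a j - Jac k y a j) y =
       Ff G y (h y) (Jac h y) l a j - Ff G y (k y) (Jac k y) l a j.
      have E1 := iso_pde oT sG pG l a j oB ih BT By; have E2 := iso_pde oT sG pG l a j oB ik BT By.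
      transitivity (pd l (fun x => Jac h x a j) y - pd l (fun x => Jac k x a j) y); last exact: (congr2 (fun a b => a - b) E1 E2).
      exact: (deriveB (smooth_derivable sJh By) (smooth_derivable sJk By)).
    have [Dy b1 b2] := bd y By.
    apply: le_trans (HK l a j _ _ _ _ _ Dy (Dh _ By) (Dk _ By) b1 b2) _.
    apply: (@ler_pM _ K K1 (jd h k y) N); [exact: ltW|exact: addr_ge0|by rewrite lerDr|exact: HN].
  have := norm_step H1; have := norm_step H2; rewrite /jd.
  move: (`|h z - k z|) (`|Jac h z - Jac k z|) (`|h x' - k x'|) (`|Jac h x' - Jac k x'|) => a1 a2 a3 a4; lra.
have [N HN] : exists N, forall z, ball c r z -> jd h k z <= N.
  exists (2 * rT + 2 * C) => z Bz; have [_ b1 b2] := bd z Bz.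
  rewrite /jd !mulr_natl !mulr2n; apply: lerD; last by apply: le_trans (ler_normB _ _) (lerD b1 b2).
  have := Dh _ Bz; have := Dk _ Bz; rewrite /D !ballE => d1 d2.
  have -> : h z - k z = (h z - t0) - (k z - t0) by rewrite opprB addrA subrK.
  by apply: le_trans (ler_normB _ _) (lerD (ltW d2) (ltW d1)).
(* Repeating [step] from any crude bound N halves the excess over [2 * jd h k x'] each time. *)
have iter n : forall z, ball c r z -> jd h k z <= 2 * jd h k x' + N / 2 ^+ n.
  have N0 : 0 <= jd h k x' by rewrite addr_ge0.
  elim: n => [|n IH] z Bz.
    rewrite expr0 divr1; apply: le_trans (HN z Bz) _; rewrite lerDr mulr_ge0 //.
  apply: le_trans (step _ IH z Bz) _; rewrite exprS invfM mulrDl.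
  rewrite [2 * _ / 2]mulrAC divff // mul1r addrA mulrDl mul1r.
  by rewrite [N * (2^-1 * _)]mulrCA [N / 2 ^+ n / 2]mulrC mulrA.
rewrite -subr_le0; apply: half_le0 => n.
by rewrite lerBlDl; exact: iter.
Qed.

End Estimates.

(** * Uniform bounds on all derivatives of rescaled differences *)

Section BoundedFamilies.
Variables (R : realType) (U : set_system nat) (p : nat).
Context {UF : UltraFilter U}.
Variable (B : set 'rV[R]_p).
Hypothesis oB : open B.
Local Notation fam := (nat -> 'rV[R]_p -> R).
Local Notation fn := ('rV[R]_p -> R).

Lemma bfam_ext k (f : fam) (g : fam) : (\forall n \near U, {in B, f n =1 g n}) -> bfam U k B f -> bfam U k B g.
Proof.
elim: k f g => [|k IH] f g E [[C HC] H].
  split=> //; exists C; apply: (unear (filter_and _ E HC)) => n [e H1] x Bx.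
  by rewrite -e ?H1 //; exact/mem_set.
split.
  exists C; apply: (unear (filter_and _ E HC)) => n [e H1] x Bx.
  by rewrite -e ?H1 //; exact/mem_set.
move=> l; apply: IH (H l); apply: (unear E) => n e x /set_mem Bx.
by apply: near_eq_derive; exact: (eq_on_near oB Bx e).
Qed.

Lemma bfam_const k (c : nat -> R) C : (\forall n \near U, `|c n| <= C) -> bfam U k B (fun n _ => c n).
Proof.
elim: k c C => [|k IH] c C Hc.
  by split=> //; exists C; apply: (unear Hc).
split; first by exists C; apply: (unear Hc).
move=> l; apply: (@bfam_ext _ (fun n _ => 0)).
  by near=> n => x _; rewrite /pd derive_cst.
by apply: (IH _ 0); near=> n; rewrite normr0.
Unshelve. all: by end_near.
Qed.

Lemma bfam_add k (f : fam) (g : fam) : (\forall n \near U, smooth_on B (f n)) -> (\forall n \near U, smooth_on B (g n)) ->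
  bfam U k B f -> bfam U k B g -> bfam U k B (fun n x => f n x + g n x).
Proof.
elim: k f g => [|k IH] f g sf sg [[C HC] H] [[C' HC'] H'].
  split=> //; exists (C + C'); apply: (unear (filter_and _ HC HC')) => n [H1 H2] x Bx.
  by apply: le_trans (ler_normD _ _) (lerD (H1 x Bx) (H2 x Bx)).
split.
  exists (C + C'); apply: (unear (filter_and _ HC HC')) => n [H1 H2] x Bx.
  by apply: le_trans (ler_normD _ _) (lerD (H1 x Bx) (H2 x Bx)).
move=> l; apply: (@bfam_ext _ (fun n x => pd l (f n) x + pd l (g n) x)).
  apply: (unear (filter_and _ sf sg)) => n [s1 s2] x /set_mem Bx.
  by rewrite pdD //; [exact: smooth_derivable s1 Bx|exact: smooth_derivable s2 Bx].
apply: IH => //.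
- by apply: (unear sf) => n; exact: smooth_pd.
- by apply: (unear sg) => n; exact: smooth_pd.
- exact: H.
- exact: H'.
Qed.

Lemma bfam_mul k (f : fam) (g : fam) : (\forall n \near U, smooth_on B (f n)) -> (\forall n \near U, smooth_on B (g n)) ->
  bfam U k B f -> bfam U k B g -> bfam U k B (fun n x => f n x * g n x).
Proof.
have aux f' g' : (exists C, \forall n \near U, forall x, B x -> `|f' n x| <= C) ->
   (exists C, \forall n \near U, forall x, B x -> `|g' n x| <= C) ->
   exists C : R, \forall n \near U, forall x, B x -> `|f' n x * g' n x| <= C.
  move=> [C HC] [C' HC']; exists (C * C'); apply: (unear (filter_and _ HC HC')) => n [H1 H2] x Bx.
  by rewrite normrM; apply: ler_pM => //; [exact: H1|exact: H2].
elim: k f g => [|k IH] f g sf sg Hf Hg; first by split=> //; apply: aux; [exact: Hf.1|exact: Hg.1].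
split; first by apply: aux; [exact: Hf.1|exact: Hg.1].
move=> l; apply: (@bfam_ext _ (fun n x => f n x * pd l (g n) x + pd l (f n) x * g n x)).
  apply: (unear (filter_and _ sf sg)) => n [s1 s2] x /set_mem Bx.
  by rewrite pdM //; [exact: smooth_derivable s1 Bx|exact: smooth_derivable s2 Bx].
have sf' : \forall n \near U, smooth_on B (pd l (f n)) by apply: (unear sf) => n; exact: smooth_pd.
have sg' : \forall n \near U, smooth_on B (pd l (g n)) by apply: (unear sg) => n; exact: smooth_pd.
apply: bfam_add.
- by apply: (unear (filter_and _ sf sg')) => n [s1 s2]; exact: smooth_mul.
- by apply: (unear (filter_and _ sf' sg)) => n [s1 s2]; exact: smooth_mul.
- by apply: IH => //; [exact: bfam_le|exact: Hg.2].
- by apply: IH => //; [exact: Hf.2|exact: bfam_le].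
Qed.

Variable (delta : nat -> R).
Hypothesis delta01 : \forall n \near U, 0 < delta n <= 1.

(* Families f0 + delta n * w n with w n bounded in all derivatives: this class is
   stable under sums, products and composition, unlike bounds on f n - id alone. *)
Definition pert k (f : fam) (f0 : 'rV[R]_p -> R) :=
  [/\ \forall n \near U, smooth_on B (f n), smooth_on B f0,
     (forall k, bfam U k B (fun=> f0)) & bfam U k B (fun n x => (f n x - f0 x) / delta n)].

Lemma smooth_quot (f : fam) (f0 : fn) : (\forall n \near U, smooth_on B (f n)) -> smooth_on B f0 ->
  \forall n \near U, smooth_on B (fun x => (f n x - f0 x) / delta n).
Proof.
move=> sf s0; apply: (unear sf) => n s1; apply: smooth_mul => //; last exact: smooth_cst.
exact: smooth_sub2.
Qed.

Lemma pert_ext k (f : fam) (g : fam) (f0 : fn) (g0 : fn) : (\forall n \near U, {in B, f n =1 g n}) -> {in B, f0 =1 g0} ->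
  pert k f f0 -> pert k g g0.
Proof.
move=> E E0 [H1 H2 H3 H4]; split.
- by apply: (unear (filter_and _ E H1)) => n [e s]; exact: smooth_ext s.
- exact: smooth_ext H2.
- by move=> k'; apply: bfam_ext (H3 k'); near=> n.
- by apply: bfam_ext H4; apply: (unear E) => n e x Bx; rewrite e // E0.
Unshelve. all: by end_near.
Qed.

Lemma pert_add k (f : fam) (f0 : fn) (g : fam) (g0 : fn) : pert k f f0 -> pert k g g0 ->
  pert k (fun n x => f n x + g n x) (fun x => f0 x + g0 x).
Proof.
move=> [f1 f2 f3 f4] [g1 g2 g3 g4]; split.
- by apply: (unear (filter_and _ f1 g1)) => n [s1 s2]; exact: smooth_add.
- exact: smooth_add.
- by move=> k'; apply: bfam_add => //; near=> n.
- have := bfam_add (smooth_quot f1 f2) (smooth_quot g1 g2) f4 g4.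
  by apply: bfam_ext; near=> n => x _; rewrite -mulrDl; congr (_ / _); ring.
Unshelve. all: by end_near.
Qed.

Lemma pert_mul k (f : fam) (f0 : fn) (g : fam) (g0 : fn) : pert k f f0 -> pert k g g0 ->
  pert k (fun n x => f n x * g n x) (fun x => f0 x * g0 x).
Proof.
move=> [f1 f2 f3 f4] [g1 g2 g3 g4].
have F0 : \forall n \near U, smooth_on B f0 by near=> n.
have G0 : \forall n \near U, smooth_on B g0 by near=> n.
split.
- by apply: (unear (filter_and _ f1 g1)) => n [s1 s2]; exact: smooth_mul.
- exact: smooth_mul.
- by move=> k'; apply: bfam_mul.
- have qf := smooth_quot f1 f2; have qg := smooth_quot g1 g2.
  have bd : bfam U k B (fun n _ => delta n).
    by apply: (@bfam_const _ _ 1); apply: (unear delta01) => n /andP[d0 d1]; rewrite gtr0_norm.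
  have sd : \forall n \near U, smooth_on B (fun=> delta n) by near=> n; exact: smooth_cst.
  have s1 : \forall n \near U, smooth_on B (fun x => (f n x - f0 x) / delta n * g0 x).
    by apply: (unear qf) => n s; exact: smooth_mul.
  have s2 : \forall n \near U, smooth_on B (fun x => f0 x * ((g n x - g0 x) / delta n)).
    by apply: (unear qg) => n s; exact: smooth_mul.
  have s3 : \forall n \near U, smooth_on B (fun x => ((f n x - f0 x) / delta n) * ((g n x - g0 x) / delta n)).
    by apply: (unear (filter_and _ qf qg)) => n [s s']; exact: smooth_mul.
  have b1 := bfam_mul qf G0 f4 (g3 k).
  have b2 := bfam_mul F0 qg (f3 k) g4.
  have b3 := bfam_mul sd s3 bd (bfam_mul qf qg f4 g4).
  have s4 : \forall n \near U, smooth_on B (fun x => delta n * (((f n x - f0 x) / delta n) * ((g n x - g0 x) / delta n))).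
    by apply: (unear (filter_and _ sd s3)) => n [s s']; exact: smooth_mul.
  have s5 : \forall n \near U, smooth_on B (fun x => (f n x - f0 x) / delta n * g0 x + f0 x * ((g n x - g0 x) / delta n)).
    by apply: (unear (filter_and _ s1 s2)) => n [s s']; exact: smooth_add.
  have := bfam_add s5 s4 (bfam_add s1 s2 b1 b2) b3.
  apply: bfam_ext; apply: (unear delta01) => n /andP[d0 _] x _.
  by field; rewrite lt0r_neq0.
Unshelve. all: by end_near.
Qed.

Lemma pert_fix k (g : fn) : smooth_on B g -> (forall k, bfam U k B (fun=> g)) -> pert k (fun=> g) g.
Proof.
move=> sg bg; split=> //; first by near=> n.
apply: (@bfam_ext _ (fun _ _ => 0)).
  by near=> n => x _; rewrite subrr mul0r.
by apply: (@bfam_const _ _ 0); near=> n; rewrite normr0.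
Unshelve. all: by end_near.
Qed.

Lemma pert_cst k (c : R) : pert k (fun _ _ => c) (fun=> c).
Proof.
apply: pert_fix; first exact: smooth_cst.
by move=> k'; apply: (@bfam_const _ _ `|c|); near=> n.
Unshelve. all: by end_near.
Qed.

Lemma pert_opp k (f : fam) (f0 : fn) : pert k f f0 -> pert k (fun n x => - f n x) (fun x => - f0 x).
Proof.
move=> H; apply: pert_ext (pert_mul (pert_cst k (-1)) H); last by move=> x _; rewrite mulN1r.
by near=> n => x _; rewrite mulN1r.
Unshelve. all: by end_near.
Qed.

Lemma pert_sum k (I : Type) (r : seq I) (f : I -> nat -> 'rV[R]_p -> R) (f0 : I -> 'rV[R]_p -> R) :
  (forall i, pert k (f i) (f0 i)) -> pert k (fun n x => \sum_(i <- r) f i n x) (fun x => \sum_(i <- r) f0 i x).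
Proof.
move=> H; elim: r => [|i r IH].
  apply: pert_ext (pert_cst k 0); last by move=> x _; rewrite big_nil.
  by near=> n => x _; rewrite big_nil.
apply: pert_ext (pert_add (H i) IH); last by move=> x _; rewrite big_cons.
by near=> n => x _; rewrite big_cons.
Unshelve. all: by end_near.
Qed.

Lemma pd_quot (f g : fn) (d : R) l x : derivable f x (delta_mx 0 l) -> derivable g x (delta_mx 0 l) ->
  pd l (fun x => (f x - g x) / d) x = (pd l f x - pd l g x) / d.
Proof.
move=> df dg.
have -> : (fun x => (f x - g x) / d) = d^-1 *: (f - g).
  by apply/funext => y; rewrite mulrC.
have H : is_derive x (delta_mx 0 l) (d^-1 *: (f - g)) (d^-1 *: (pd l f x - pd l g x)).
  by apply: is_deriveZ; apply: is_deriveB; exact: derivableP.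
by rewrite mulrC; apply: derive_val.
Qed.

Lemma pert_step k (f : fam) (f0 : fn) : (\forall n \near U, smooth_on B (f n)) -> smooth_on B f0 ->
  (forall k, bfam U k B (fun=> f0)) ->
  (exists C, \forall n \near U, forall x, B x -> `|f n x - f0 x| <= C * delta n) ->
  (forall l, pert k (fun n => pd l (f n)) (pd l f0)) -> pert k.+1 f f0.
Proof.
move=> sf s0 b0 [C HC] H; split=> //; split.
  exists C; apply: (unear (filter_and _ HC delta01)) => n [H1 /andP[d0 _]] x Bx.
  by rewrite normrM normfV (gtr0_norm d0) ler_pdivrMr //; exact: H1.
move=> l; have [_ _ _] := H l; apply: bfam_ext; apply: (unear sf) => n sn x /set_mem Bx.
have d1 := smooth_derivable (l := l) sn Bx; have d2 := smooth_derivable (l := l) s0 Bx.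
exact/esym/pd_quot.
Qed.

Lemma pert_base (f : fam) (f0 : fn) : (\forall n \near U, smooth_on B (f n)) -> smooth_on B f0 ->
  (forall k, bfam U k B (fun=> f0)) ->
  (exists C, \forall n \near U, forall x, B x -> `|f n x - f0 x| <= C * delta n) -> pert 0 f f0.
Proof.
move=> sf s0 b0 [C HC]; split=> //; split=> //.
exists C; apply: (unear (filter_and _ HC delta01)) => n [H1 /andP[d0 _]] x Bx.
by rewrite normrM normfV (gtr0_norm d0) ler_pdivrMr //; exact: H1.
Qed.

End BoundedFamilies.

Section Families.
Variables (R : realType) (U : set_system nat) (q : nat) (T : set 'rV[R]_q) (G : 'rV[R]_q -> 'M[R]_q).
Context {UF : UltraFilter U}.
Hypothesis oT : open T.
Hypothesis sG : forall k l, smooth_on T (fun t => G t k l).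
Hypothesis pG : forall t, T t -> posdef (G t).
Variables (t0 : 'rV[R]_q) (rT : R).
Hypothesis rT0 : 0 < rT.
Hypothesis ballT : cball t0 rT `<=` T.
Let D := ball t0 rT.
Variables (c : 'rV[R]_q) (r : R) (h : nat -> selfmap R q) (delta : nat -> R) (C : R).
Let B := ball c r.
Hypothesis BD : B `<=` D.
Hypothesis delta01 : \forall n \near U, 0 < delta n <= 1.
Hypothesis h_isom : \forall n \near U, isom T G B (h n).
Hypothesis hD : \forall n \near U, forall x, B x -> D (h n x).
Hypothesis h_near : \forall n \near U, forall x, B x -> jd (h n) id x <= C * delta n.

Let oB : open B. Proof. exact: ball_open. Qed.
Let BT : B `<=` T.
Proof. by move=> x /BD; rewrite /D ballE => /ltW H; exact: ballT. Qed.
Let DT : D `<=` T.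
Proof. by move=> x; rewrite /D ballE => /ltW H; exact: ballT. Qed.

Lemma bfam_fix k (g : 'rV[R]_q -> R) : smooth_on T g -> bfam U k B (fun=> g).
Proof.
have aux f : smooth_on T f -> exists K : R, \forall n \near U, forall x, B x -> `|f x| <= K.
  move=> sf; have [K _ HK] := smooth_cball sf ballT; exists K; near=> n => x /BD.
  by rewrite /D ballE => /ltW; exact: HK.
elim: k g => [|k IH] g sg; first by split=> //; exact: aux.
by split; [exact: aux|move=> l; apply: IH; exact: smooth_pd].
Unshelve. all: by end_near.
Qed.

Lemma pert_smooth k (g : 'rV[R]_q -> R) : smooth_on T g -> pert U B delta k (fun=> g) g.
Proof.
move=> sg; apply: pert_fix => //; first exact: smooth_sub sg.
by move=> k'; exact: bfam_fix.
Qed.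

Let J n x := Jac (h n) x.

Lemma h_smooth : \forall n \near U, smooth_map_on B (h n).
Proof. by apply: (unear h_isom) => n []. Qed.

Lemma J_smooth a b : \forall n \near U, smooth_on B (fun x => J n x a b).
Proof. by apply: (unear h_smooth) => n s; exact: smooth_jac. Qed.

Lemma comp_bound (g : 'rV[R]_q -> R) : smooth_on T g ->
  exists K, \forall n \near U, forall x, B x -> `|g (h n x) - g x| <= K * delta n.
Proof.
move=> sg; have [K K0 HK] := lipb_y ballT 1 sg; exists (K * C).
apply: (unear (filter_and _ h_near hD)) => n [H1 H2] x Bx.
have [||_ H] := HK x (h n x) x 0 0 (BD Bx) (H2 _ Bx) (BD Bx); rewrite ?normr0 //.
apply: le_trans H _; rewrite -mulrA ler_wpM2l ?(ltW K0) // subrr normr0 addr0.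
by apply: le_trans (H1 x Bx); rewrite lerDl.
Qed.

(** A derivative of g o h n is a sum of Jacobian entries times derivatives of g along h n, of order
    one less. Hence only orders below k of the Jacobian are assumed, which fits the strong induction
    of [pert_J]. *)
Lemma pert_comp k : (forall k', (k' < k)%N -> forall a b, pert U B delta k' (fun n x => J n x a b) (fun=> (1%:M : 'M[R]_q) a b)) ->
  forall g, smooth_on T g -> pert U B delta k (fun n x => g (h n x)) g.
Proof.
elim: k => [|k IH] HJ g sg.
all: have s1 : \forall n \near U, smooth_on B (fun x => g (h n x)) by
  apply: (unear h_isom) => n [s hT _]; exact: (smooth_comp oB oT hT s sg).
all: have s0 : smooth_on B g by exact: smooth_sub sg.
all: have b0 k' : bfam U k' B (fun=> g) by exact: bfam_fix.
all: have bd := comp_bound sg.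
- exact: pert_base.
apply: pert_step => // l.
have IH' := IH (fun k' kk => HJ k' (ltn_trans kk (ltnSn k))).
have P : pert U B delta k (fun n x => \sum_j J n x l j * pd j g (h n x)) (fun x => \sum_j (1%:M : 'M[R]_q) l j * pd j g x).
  apply: pert_sum => // j; apply: pert_mul => //; first exact: HJ.
  by apply: IH'; exact: smooth_pd.
apply: (pert_ext oB _ _ P).
  apply: (unear (filter_and _ h_smooth h_isom)) => n [s [_ hT _]] x /set_mem Bx.
  rewrite (pd_comp (phi := h n) (f := g)).
  - by apply: eq_bigr => j _; rewrite /J (jacE_smooth _ _ oB s Bx).
  - by move=> j; exact: smooth_diff oB (s j) Bx.
  - exact: smooth_diff oT sg (hT _ Bx).
move=> x _; rewrite (bigD1 l) //= big1 ?addr0 ?mxE ?eqxx ?mul1r // => j /negbTE jl.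
by rewrite mxE eq_sym jl mul0r.
Qed.

(** Bootstrap through [iso_pde]: the derivatives of the Jacobian are expressed by the 1-jet itself,
    so the bounds of order k give those of order k + 1. Only order 0 uses [h_near]. The limit value
    is right because [Ff] vanishes at the jet of the identity. *)
Lemma pert_J k a b : pert U B delta k (fun n x => J n x a b) (fun=> (1%:M : 'M[R]_q) a b).
Proof.
have b0 k' a' b' : bfam U k' B (fun _ _ => (1%:M : 'M[R]_q) a' b').
  by apply: (@bfam_const _ _ _ _ _ oB _ _ `|(1%:M : 'M[R]_q) a' b'|); near=> n.
have bd a' b' : exists K, \forall n \near U, forall x, B x -> `|J n x a' b' - (1%:M : 'M[R]_q) a' b'| <= K * delta n.
  exists C; apply: (unear h_near) => n H x Bx; apply: le_trans (H x Bx).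
  rewrite /jd jac_id; apply: le_trans (mx_entry_leB _ _ a' b') _.
  by rewrite lerDr.
have sc a' b' : smooth_on B (fun=> (1%:M : 'M[R]_q) a' b') by exact: smooth_cst.
elim/ltn_ind: k a b => -[|k] IH a b.
  by apply: pert_base => //; exact: J_smooth.
apply: pert_step => //; first exact: J_smooth.
move=> l.
have PJ a' b' : pert U B delta k (fun n x => J n x a' b') (fun=> (1%:M : 'M[R]_q) a' b') by exact: IH.
have PC g : smooth_on T g -> pert U B delta k (fun n x => g (h n x)) g.
  by apply: pert_comp => k' kk a' b'; apply: IH; exact: ltnW.
have PM c' a' b' : pert U B delta k (fun n x => Mf G x (h n x) (J n x) c' a' b') (fun x => Mf G x x 1%:M c' a' b').
  apply: pert_add => //; first by apply: pert_smooth; exact: smooth_pd.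
  apply: pert_opp => //; apply: pert_sum => // m; apply: pert_mul => //.
  apply: pert_sum => // k'; apply: pert_sum => // l'; apply: pert_mul => //.
  by apply: pert_mul => //; apply: PC; exact: smooth_pd.
have P : pert U B delta k (fun n x => Ff G x (h n x) (J n x) l a b) (fun x => Ff G x x 1%:M l a b).
  apply: pert_sum => // b'; apply: pert_mul => //.
    apply: pert_mul => //; first exact: pert_cst.
    by apply: pert_add => //; [apply: pert_add|apply: pert_opp].
  apply: pert_sum => // m; apply: pert_mul => //; apply: pert_smooth.
  exact: (smooth_invmx oT (fun x Tx => posdef_unit (pG Tx)) sG).
apply: (pert_ext oB _ _ P).
  apply: (unear h_isom) => n iso x /set_mem Bx.
  by rewrite /J -(iso_pde oT sG pG _ _ _ oB iso BT Bx).
move=> x /set_mem Bx; rewrite (Ff_id oT sG pG) //; last exact: BT.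
by rewrite /pd derive_cst.
Unshelve. all: by end_near.
Qed.

Lemma pert_h k j : pert U B delta k (fun n x => h n x 0 j) (fun x => x 0 j).
Proof.
have sh : \forall n \near U, smooth_on B (fun x => h n x 0 j).
  by apply: (unear h_smooth) => n; apply.
have bd : exists K, \forall n \near U, forall x, B x -> `|h n x 0 j - x 0 j| <= K * delta n.
  exists C; apply: (unear h_near) => n H x Bx; apply: le_trans (H x Bx).
  rewrite /jd; apply: le_trans (mx_entry_leB _ _ 0 j) _.
  by rewrite lerDl.
have sx : smooth_on T (fun x => x 0 j) by exact: smooth_coord.
have b0 k' : bfam U k' B (fun=> fun x => x 0 j) by exact: bfam_fix.
case: k => [|k]; first by apply: pert_base => //; exact: smooth_coord.
apply: pert_step => //; first exact: smooth_coord.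
move=> l; apply: (pert_ext oB _ _ (pert_J k l j)).
  by apply: (unear h_smooth) => n s x /set_mem Bx; rewrite /J (jacE_smooth _ _ oB s Bx).
by move=> x _; rewrite pd_coord mxE.
Qed.

Definition rescaled_limit (x : 'rV[R]_q) : 'rV[R]_q :=
  \row_j lim ((h n x 0 j - x 0 j) / delta n @[n --> U]).

(** By [pert_h] the quotients (h n - id) / delta n have bounded derivatives of every order, so they
    have a smooth limit and their Jacobians converge to its Jacobian. *)
Lemma family_limit : [/\ smooth_map_on B rescaled_limit,
  forall x, B x -> (delta n)^-1 *: (h n x - x) @[n --> U] --> rescaled_limit x &
  forall x, B x -> (delta n)^-1 *: (Jac (h n) x - 1%:M) @[n --> U] --> Jac rescaled_limit x].
Proof.
pose w j n x := (h n x 0 j - x 0 j) / delta n.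
have sw j : \forall n \near U, smooth_on B (w j n).
  have [H1 H2 _ _] := pert_h 0 j; exact: (smooth_quot oB delta H1 H2).
have bw j k : bfam U k B (w j) by have [] := pert_h k j.
have HL j := limit_smooth (UF := UF) (sw j) (bw j).
have cw (f : nat -> 'rV[R]_q -> R) x : bfam U 0 B f -> B x -> f n x @[n --> U] --> lim (f n x @[n --> U]).
  move=> [[K HK] _] Bx; apply: (@ultra_bounded_cvg _ _ _ _ K).
  by apply: (unear HK) => n; apply.
have sL : smooth_map_on B rescaled_limit.
  move=> j; have [H _] := HL j.
  have E : {in (B : set 'rV[R]_q), (fun x => lim (w j n x @[n --> U])) =1 (fun x => rescaled_limit x 0 j)}.
    by move=> x _; rewrite /rescaled_limit mxE.
  exact: (smooth_ext oB E H).
split=> // x Bx.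
  apply: cvg_row => j; rewrite mxE.
  apply: cvg_trans (cw (w j) x (bw j 0%N) Bx).
  by apply: near_eq_cvg; near=> n; rewrite /w !mxE mulrC.
apply: cvg_mx => i j; rewrite (jacE_smooth _ _ oB sL Bx).
have -> : pd i (fun y => rescaled_limit y 0 j) x = lim (pd i (w j n) x @[n --> U]).
  rewrite -(HL j).2 //; apply: near_eq_derive; apply: (eq_on_near oB Bx) => y _.
  by rewrite mxE.
apply: cvg_trans (cw (fun n => pd i (w j n)) x ((bw j 1%N).2 i) Bx).
apply: near_eq_cvg; apply: (unear h_smooth) => n s.
have d1 := smooth_derivable (l := i) (s j) Bx.
have d2 := smooth_derivable (l := i) (smooth_coord B j) Bx.
rewrite /w (pd_quot _ d1 d2) pd_coord.
have E (X Y : 'M[R]_q) a : (a *: (X - Y)) i j = a * (X i j - Y i j) by rewrite !mxE.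
have E1 : (1%:M : 'M[R]_q) i j = (i == j)%:R by rewrite mxE.
by rewrite E E1 (jacE_smooth i j oB s Bx) mulrC.
Unshelve. all: by end_near.
Qed.

End Families.

(** * Foliations and their holonomy *)

Lemma open_from_near (T : topologicalType) (A : set T) :
  (forall x, A x -> \forall y \near x, A y) -> open A.
Proof. by move=> H; rewrite openE => x /H. Qed.

Lemma nat_ultra : exists U : set_system nat, UltraFilter U /\ forall P : nat -> Prop,
  (\forall n \near \oo, P n) -> \forall n \near U, P n.
Proof.
have [U [UU sub]] := ultraFilterLemma (eventually_filter : ProperFilter \oo).
by exists U; split=> // P; exact: sub.
Qed.

(** * A quantitative open mapping theorem *)

Section RightInverse.
Variables (R : realType) (n q : nat).

Lemma mulmx_norm_le m r s (A : 'M[R]_(m, r)) (B : 'M[R]_(r, s)) : `|A *m B| <= r%:R * `|A| * `|B|.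
Proof.
apply/mx_norm_le => [|i j]; first by rewrite !mulr_ge0.
rewrite mxE; apply: le_trans (ler_norm_sum _ _ _) _.
have -> : r%:R * `|A| * `|B| = \sum_(k < r) `|A| * `|B|.
  by rewrite sumr_const card_ord -[RHS]mulr_natl mulrA.
by apply: ler_sum => k _; rewrite normrM; apply: ler_pM => //; exact: mx_entry_le.
Qed.

Lemma mulmx_bound r s (A : 'M[R]_(r, s)) : exists2 C : R, 0 < C & forall v : 'rV[R]_r, `|v *m A| <= C * `|v|.
Proof.
exists (r%:R * `|A| + 1); first by rewrite ltr_wpDl // mulr_ge0.
by move=> v; apply: le_trans (mulmx_norm_le v A) _; rewrite mulrAC ler_wpM2r // lerDl.
Qed.

Lemma linear_approx (U : set 'rV[R]_n) (f : 'rV[R]_n -> 'rV[R]_q) x0 (e : R) : open U ->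
  smooth_map_on U f -> U x0 -> 0 < e ->
  exists2 rho : R, 0 < rho & ball x0 rho `<=` U /\ forall x y, ball x0 rho x -> ball x0 rho y ->
    `|f y - f x - (y - x) *m Jac f x0| <= e * `|y - x|.
Proof.
move=> oU sf Ux0 e0.
pose e' := e / (n%:R + 1).
have n1 : 0 < n%:R + 1 :> R by rewrite ltr_wpDl.
have e'0 : 0 < e' by rewrite divr_gt0.
have H : \forall z \near x0, forall lj : 'I_n * 'I_q, `|Jac f z lj.1 lj.2 - Jac f x0 lj.1 lj.2| < e'.
  apply: near_all => -[l j] /=.
  by apply: ((contP _ _).1 _ e' e'0); exact: (Ck_cont (smooth_jac oU sf l j 0%N) Ux0).
have /near_normP[rho rho0 Hr] := near_and (open_near oU Ux0) H.
have BU : ball x0 rho `<=` U by move=> z; rewrite ballE => /Hr[].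
exists rho => //; split=> // x y Bx By.
apply: mx_norm_leB => [|i j]; first by rewrite mulr_ge0 // ltW.
rewrite (ord1 i).
pose F z := f z 0 j - (z *m Jac f x0) 0 j.
have sL : smooth_on (ball x0 rho) (fun z => (z *m Jac f x0) 0 j).
  have oB := @ball_open _ _ x0 rho.
  by apply: smooth_mulmx => // a b; [rewrite (ord1 a); exact: smooth_coord|exact: smooth_cst].
have sF : smooth_on (ball x0 rho) F.
  apply: smooth_sub2 => //; first exact: ball_open.
  exact: smooth_sub (sf j).
have dF l z : ball x0 rho z -> `|pd l F z| <= e'.
  move=> Bz.
  have d1 := smooth_derivable (l := l) (smooth_sub BU (sf j)) Bz.
  have d2 := smooth_derivable (l := l) sL Bz.
  have -> : pd l F z = pd l (fun z => f z 0 j) z - pd l (fun z => (z *m Jac f x0) 0 j) z.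
    exact: deriveB.
  have -> : pd l (fun z => (z *m Jac f x0) 0 j) z = Jac f x0 l j.
    have -> : (fun z : 'rV[R]_n => (z *m Jac f x0) 0 j) = (fun z => \sum_k z 0 k * Jac f x0 k j).
      by apply/funext => w; rewrite mxE.
    have d3 k : derivable (fun z : 'rV[R]_n => z 0 k * Jac f x0 k j) z (delta_mx 0 l).
      by apply: derivableM; [exact/diff_derivable/diff_coord|exact: derivable_cst].
    rewrite (pd_sum d3).2 (bigD1 l) //= big1 ?addr0.
      rewrite pdM; first by rewrite pd_coord eqxx mul1r /pd derive_cst mulr0 add0r.
        exact/diff_derivable/diff_coord.
      exact: derivable_cst.
    move=> k kl; rewrite pdM; first by rewrite pd_coord eq_sym (negbTE kl) mul0r /pd derive_cst mulr0 addr0.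
      exact/diff_derivable/diff_coord.
    exact: derivable_cst.
  rewrite -(jacE_smooth l j oU sf (BU _ Bz)).
  by move: Bz; rewrite ballE => /Hr[_ /(_ (l, j)) /ltW].
have := smooth_ball_lip sF dF Bx By.
have -> : F y - F x = (f y - f x) 0 j - ((y - x) *m Jac f x0) 0 j.
  by rewrite /F mulmxBl; move: (y *m _) (x *m _) => Y X; rewrite !mxE; ring.
move/le_trans; apply; rewrite ler_wpM2r // /e' mulrCA ler_piMr ?(ltW e0) //.
by rewrite ler_pdivrMr // mul1r lerDl.
Qed.

(** Simplified Newton iteration w' = w + (y - f(x + w P)), with the fixed right inverse P of the
    Jacobian at x0. The linear approximation halves the residual at each step, so the corrections
    sum to at most 2 |y - f(x)|. The radius is uniform in x near x0. *)
Lemma right_inverse (U : set 'rV[R]_n) (f : 'rV[R]_n -> 'rV[R]_q) x0 (P : 'M[R]_(q, n)) : open U ->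
  smooth_map_on U f -> U x0 -> P *m Jac f x0 = 1%:M ->
  exists rho rho1 : R, [/\ 0 < rho, 0 < rho1, ball x0 rho1 `<=` U,
   (forall z v, ball x0 rho1 z -> ball x0 rho1 (z + v *m P) ->
      `|f (z + v *m P) - f z - v| <= 2^-1 * `|v|) &
   (forall x y, ball x0 rho x -> `|y - f x| < rho -> exists w : 'rV[R]_q,
      [/\ `|w| <= 2 * `|y - f x|, ball x0 rho1 (x + w *m P) & f (x + w *m P) = y])].
Proof.
move=> oU sf Ux0 PJ.
have [CP CP0 HP] := mulmx_bound P.
have e0 : 0 < (2 * CP)^-1 by rewrite invr_gt0 mulr_gt0.
have [rho1 rho10 [BU HA]] := linear_approx oU sf Ux0 e0.
have H1 z v : ball x0 rho1 z -> ball x0 rho1 (z + v *m P) -> `|f (z + v *m P) - f z - v| <= 2^-1 * `|v|.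
  move=> Bz Bv; have := HA _ _ Bz Bv.
  have -> : z + v *m P - z = v *m P by rewrite addrAC subrr add0r.
  rewrite -mulmxA PJ mulmx1 => /le_trans; apply.
  by rewrite invfM -mulrA ler_wpM2l ?invr_ge0 // ler_pdivrMl.
(* Chosen so that rho + CP (2 rho) = rho1 / 2: all iterates x + w P with |w| <= 2 |y - f(x)| then
   stay in the ball of radius [rho1]. *)
exists (rho1 / (2 * (2 * CP + 1))), rho1.
set rho := rho1 / _.
have D0 : 0 < 2 * (2 * CP + 1) by rewrite mulr_gt0 // ltr_wpDl // mulr_ge0 // ltW.
have rho0 : 0 < rho by rewrite divr_gt0.
have rhoE : (2 * CP + 1) * rho = rho1 / 2 by rewrite /rho; field; rewrite lt0r_neq0 // ltr_wpDl // mulr_ge0 // ltW.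
split=> // x y; rewrite ballE => xr yr.
pose w := fix w k := if k is k'.+1 then w k' + (y - f (x + w k' *m P)) else 0.
have Bw v : `|v| <= 2 * `|y - f x| -> ball x0 rho1 (x + v *m P).
  move=> Hv; rewrite ballE addrAC; apply: le_lt_trans (ler_normD _ _) _.
  apply: (@lt_trans _ _ (rho1 / 2)); last by rewrite ltr_pdivrMr // ltr_pMr // ltr1n.
  have -> : rho1 / 2 = rho + CP * (2 * rho) by rewrite -rhoE; ring.
  apply: (ltrD xr); apply: (@le_lt_trans _ _ (CP * `|v|)); first exact: HP.
  rewrite ltr_pM2l //.
  by apply: le_lt_trans Hv _; rewrite ltr_pM2l.
have Hw k : `|y - f (x + w k *m P)| <= `|y - f x| / 2 ^+ k /\
   `|w k| <= 2 * `|y - f x| * (1 - (2 ^+ k)^-1).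
  elim: k => [|k [IH1 IH2]].
    by rewrite /= mul0mx addr0 expr0 divr1 normr0 invr1 subrr mulr0.
  have wk1 : w k.+1 = w k + (y - f (x + w k *m P)) by [].
  have p2 : 0 < (2 ^+ k : R)^-1 by rewrite invr_gt0 exprn_gt0.
  have IH3 : `|w k.+1| <= 2 * `|y - f x| * (1 - (2 ^+ k.+1)^-1).
    rewrite wk1; apply: le_trans (ler_normD _ _) _; apply: le_trans (lerD IH2 IH1) _.
    by rewrite exprS invfM; move: (`|y - f x|) ((2 ^+ k)^-1) => a b; lra.
  split=> //.
  have le2 a : 0 <= a -> 2 * `|y - f x| * (1 - a) <= 2 * `|y - f x|.
    by move=> a0; rewrite ler_piMr // ?mulr_ge0 // lerBlDr lerDl.
  have B1 := Bw _ (le_trans IH2 (le2 _ (ltW p2))).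
  have B2 : ball x0 rho1 (x + w k.+1 *m P).
    by apply: Bw; apply: le_trans IH3 _; apply: le2; rewrite invr_ge0 exprn_ge0.
  have E : x + w k.+1 *m P = (x + w k *m P) + (y - f (x + w k *m P)) *m P.
    by rewrite wk1 mulmxDl addrA.
  rewrite E in B2 *; have := H1 _ _ B1 B2.
  set a := f (_ + _ *m P); set b := f (x + _) => H2.
  have -> : y - a = - (a - b - (y - b)) by rewrite !opprB addrA subrK addrC.
  rewrite normrN; apply: le_trans H2 _; rewrite exprS invfM mulrCA ler_wpM2l ?invr_ge0 //.
have [U' [UF sub]] := nat_ultra.
have wb k : `|w k| <= 2 * `|y - f x|.
  apply: le_trans (Hw k).2 _; rewrite ler_piMr // ?mulr_ge0 // lerBlDr lerDl invr_ge0 exprn_ge0 //.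
have cw : cvg (w k @[k --> U']).
  by apply: (@ultra_bounded_mx _ _ _ _ _ _ (2 * `|y - f x|)); apply: sub; near=> k.
set v := lim (w k @[k --> U']) in cw.
have vb : `|v| <= 2 * `|y - f x|.
  by apply: (@lim_le_norm _ _ _ _ w) => //; apply: sub; near=> k.
have Bv := Bw _ vb.
exists v; split=> //.
apply/eqP; rewrite eq_sym -subr_eq0 -normr_le0; apply/ler_addgt0Pl => e e1.
rewrite addr0.
have cf : {for (x + v *m P), continuous f}.
  exact: (smooth_cont sf (BU _ Bv)).
have [d d0 Hd] := (near_normP _ _).1 ((contP _ _).1 cf _ (divr_gt0 e1 (ltr0n R 2))).
have dC : 0 < d / CP by rewrite divr_gt0.
have H3 : \forall k \near U', `|v - w k| < d / CP.
  exact: ((cvgrPdist_lt _ _).1 cw _ dC).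
have H4 : \forall k \near U', `|y - f x| / 2 ^+ k <= e / 2.
  apply: sub; have [k0 Hk0] : exists k, `|y - f x| / 2 ^+ k <= e / 2.
    apply: contrapT => /forallNP Hn.
    have : e / 2 <= 0; last by rewrite leNgt divr_gt0.
    by apply: (@half_le0 _ _ (`|y - f x|)) => k; rewrite ltW // ltNge; apply/negP.
  exists k0 => // k /= kk; apply: le_trans Hk0; rewrite ler_wpM2l // lef_pV2 ?posrE ?exprn_gt0 //.
  by rewrite ler_eXn2l ?ltr1n.
have [k [H5 H6]] := proper_ex _ (filter_and _ H3 H4).
rewrite -(subrK (f (x + w k *m P)) y) -addrA (splitr e).
apply: le_trans (ler_normD _ _) _; apply: lerD; first exact: le_trans (Hw k).1 H6.
rewrite ltW //; apply: Hd.
have -> : x + w k *m P - (x + v *m P) = - ((v - w k) *m P).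
  by rewrite mulmxBl opprB opprD addrACA subrr add0r.
rewrite normrN; apply: (@le_lt_trans _ _ (CP * `|v - w k|)); first exact: HP.
by rewrite mulrC -ltr_pdivlMr.
Unshelve. all: by end_near.
Qed.

Lemma rank_right_inverse (A : 'M[R]_(n, q)) : \rank A = q -> exists P : 'M[R]_(q, n), P *m A = 1%:M.
Proof.
move=> rA; exists (pinvmx A); apply: mulVpmx; by rewrite /row_full rA.
Qed.

Lemma submersion_open (U : set 'rV[R]_n) (f : 'rV[R]_n -> 'rV[R]_q) : open U ->
  smooth_map_on U f -> (forall x, U x -> \rank (Jac f x) = q) -> open (f @` U).
Proof.
move=> oU sf rf; apply: open_from_near => _ [x Ux <-].
have [P PJ] := rank_right_inverse (rf x Ux).
have [rho [rho1 [r0 r10 sub _ H]]] := right_inverse oU sf Ux PJ.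
apply/near_normP; exists rho => // y yr.
have [|w [_ Bw E]] := H x y _ yr; first exact: ballxx.
by exists (x + w *m P) => //; exact: sub.
Qed.

End RightInverse.

(** * Composites of transition maps *)

Section FoliationBasics.
Variables (R : realType) (n q : nat) (M : manifold R n) (F : foliation M q).
Implicit Types (i j k : fidx F) (a b : chart_idx M) (x y z : M) (t : 'rV[R]_q).

Lemma chart_image_open a (V : set M) : open V -> open (chart a @` (dom a `&` V)).
Proof.
move=> oV; apply: open_from_near => _ [x [dx Vx] <-].
have iy : (chart a @` dom a) (chart a x) by exists x.
have H := chart_inv_continuous iy.
have nV : \forall z \near chart a x, (dom a `&` V) (chart_inv a z).
  by apply: H; rewrite chartK //; apply: open_near => //; exact: openI (dom_open a) oV.
have nD : \forall z \near chart a x, (chart a @` dom a) z by apply: open_near (iy); exact: chart_open.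
have /near_normP[d d0 Hd] := near_and nV nD.
apply/near_normP; exists d => // z /Hd[[dz Vz] [w dw wz]].
by exists w => //; split=> //; rewrite -(chartK dw) wz.
Qed.

Lemma chart_inv_image a (V : set M) (z : 'rV[R]_n) : (chart a @` (dom a `&` V)) z ->
  (dom a `&` V) (chart_inv a z) /\ chart a (chart_inv a z) = z.
Proof. by move=> [x [dx Vx] <-]; rewrite chartK. Qed.

Definition frep i a := ff i \o chart_inv a.

Lemma frep_smooth i a : smooth_map_on (chart a @` (dom a `&` fU i)) (frep i a).
Proof. exact: ff_smooth. Qed.

Lemma frep_rank i a (z : 'rV[R]_n) : (chart a @` (dom a `&` fU i)) z -> \rank (Jac (frep i a) z) = q.
Proof. by move=> [x [dx Ux] <-]; rewrite JacE; exact: ff_submersion. Qed.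

Lemma ff_cont i x : fU i x -> {for x, continuous (ff i)}.
Proof.
move=> Ux; have [a da] := dom_cover x.
have iz : (chart a @` (dom a `&` fU i)) (chart a x) by exists x.
have c1 := smooth_cont (@frep_smooth i a) iz.
have c2 := chart_continuous da.
have : {for x, continuous (frep i a \o chart a)} by exact: continuous_comp.
apply: cont_near_eq; apply: filterS (open_near (dom_open a) da) => y dy.
by rewrite /frep /= chartK.
Qed.

Lemma ff_open i (V : set M) : open V -> open (ff i @` (fU i `&` V)).
Proof.
move=> oV.
have oUV : open (fU i `&` V) by exact: openI (fU_open i) oV.
have -> : ff i @` (fU i `&` V) = \bigcup_a (frep i a @` (chart a @` (dom a `&` (fU i `&` V)))).
  apply/seteqP; split=> [_ [x [Ux Vx] <-]|t [a _ [z [x [dx [Ux Vx]] <-] <-]]].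
    have [a da] := dom_cover x; exists a => //.
    by exists (chart a x); [exists x|rewrite /frep /= chartK].
  by exists x => //; rewrite /frep /= chartK.
apply: bigcup_open => a _; apply: submersion_open.
- exact: chart_image_open.
- move=> j; apply: smooth_sub (@frep_smooth i a j).
  by move=> _ [x [dx [Ux _]] <-]; exists x.
- by move=> _ [x [dx [Ux _]] <-]; apply: (frep_rank (i := i)); exists x.
Qed.

Lemma trans_open i : open (trans i).
Proof. by have := @ff_open i setT openT; rewrite setIT. Qed.

Lemma trans2_open i j : open (trans2 i j).
Proof. exact: ff_open (fU_open j). Qed.

Lemma trans2_l i j t : trans2 i j t -> trans i t.
Proof. by move=> [x [Ui Uj] <-]; exists x. Qed.

Lemma fh_trans2 i j t : trans2 i j t -> trans2 j i (fh i j t).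
Proof. by move=> [x [Ui Uj] <-]; rewrite fhE //; exists x. Qed.

Lemma fhK i j t : trans2 i j t -> fh j i (fh i j t) = t.
Proof. by move=> [x [Ui Uj] <-]; rewrite !fhE. Qed.

Lemma fh_id i t : trans i t -> fh i i t = t.
Proof. by move=> [x Ui <-]; rewrite fhE. Qed.

Lemma composite_dom i j O phi : composite i j O phi ->
  [/\ open O, O `<=` trans i, smooth_map_on O phi & forall t, O t -> trans j (phi t)].
Proof.
elim=> [|j' k O' phi' _ [oO sub sp im]].
  split=> //; first exact: trans_open.
  exact: smooth_coord.
have oO2 : open (O' `&` phi' @^-1` trans2 j' k).
  apply: open_from_near => t [Ot tt].
  have c := smooth_cont sp Ot.
  have nt : \forall s \near t, trans2 j' k (phi' s) by exact: (c _ (open_near (@trans2_open j' k) tt)).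
  exact: (near_and (open_near oO Ot) nt).
split=> //.
- by move=> t [/sub].
- apply: (smooth_map_comp oO2 (@trans2_open j' k)); last exact: fh_smooth.
    by move=> t [].
  by move=> l; apply: smooth_sub (sp l) => t [].
- by move=> t [_ /fh_trans2/trans2_l].
Qed.

Lemma composite_comp i j k O phi O' psi : composite i j O phi -> composite j k O' psi ->
  composite i k (O `&` phi @^-1` O') (psi \o phi).
Proof.
move=> H1; elim=> [|j' k' O2 psi2 _ IH].
  have [_ _ _ im] := composite_dom H1.
  suff -> : O `&` phi @^-1` trans j = O by [].
  by apply/seteqP; split=> t; [case|move=> Ot; split=> //; exact: im].
have := composite_step k' IH.
suff -> : O `&` phi @^-1` O2 `&` (psi2 \o phi) @^-1` trans2 j' k' =
   O `&` phi @^-1` (O2 `&` psi2 @^-1` trans2 j' k') by [].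
by apply/seteqP; split=> t /=; [move=> [[? ?] ?]|move=> [? [? ?]]].
Qed.

Lemma composite_fh i j : composite i j (trans2 i j) (fh i j).
Proof.
have := composite_step j (composite_id i).
suff -> : trans i `&` id @^-1` trans2 i j = trans2 i j by [].
by apply/seteqP; split=> t; [case|move=> H; split=> //; exact: trans2_l H].
Qed.

Lemma composite_inv i j O phi : composite i j O phi ->
  exists O' psi, [/\ composite j i O' psi, forall t, O t -> O' (phi t) /\ psi (phi t) = t &
    forall s : 'rV[R]_q, O' s -> O (psi s) /\ phi (psi s) = s].
Proof.
elim=> [|j' k O1 phi1 H1 [Op [psi [H2 H3 H4]]]].
  by exists (trans i), id; split=> //; exact: composite_id.
exists (trans2 k j' `&` fh k j' @^-1` Op), (psi \o fh k j'); split.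
- exact: composite_comp (composite_fh k j') H2.
- move=> t [Ot tt] /=; have [H5 H6] := H3 t Ot.
  have E : fh k j' (fh j' k (phi1 t)) = phi1 t by exact: fhK.
  by rewrite /= E; do 2?split=> //; exact: fh_trans2.
- move=> y [ty /= /H4[H5 H6]]; split=> /=; last by rewrite H6 fhK.
  by split=> //=; rewrite H6; exact: fh_trans2.
Qed.

Lemma composite_inj i j O phi : composite i j O phi -> {in O &, injective phi}.
Proof.
move=> H; have [Op [psi [_ Hp _]]] := composite_inv H.
move=> s t /set_mem Os /set_mem Ot E.
by rewrite -(Hp s Os).2 -(Hp t Ot).2 E.
Qed.

Lemma composite_leaf i j O phi x y : composite i j O phi -> fU i x -> O (ff i x) ->
  fU j y -> ff j y = phi (ff i x) -> leaf F x y.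
Proof.
move=> H; elim: H y => [|j' k O1 phi1 _ IH] y Ux.
  by move=> _ Uy E; apply: (leaf_step (i := i) (leaf_refl F x)).
move=> [Ox [z [Uz Uz'] zE]] Uy E.
have lz := IH z Ux Ox Uz zE.
apply: (leaf_step (i := k) lz) => //; split=> //=.
by rewrite E /= -zE fhE.
Qed.

(** With [composite_leaf], identifies the leaves with the orbits of the composites: each plaque of a
    chain contributes one transition map. *)
Lemma leaf_composite i j x y : leaf F x y -> fU i x -> fU j y ->
  exists O phi, [/\ composite i j O phi, O (ff i x) & phi (ff i x) = ff j y].
Proof.
move=> H; elim: H j => [|k y' z _ IH Uy [Uz E]] j Ux Uj.
  by exists (trans2 i j), (fh i j); split; [exact: composite_fh|exists x|rewrite fhE].
have [Om [phi [H1 H2 H3]]] := IH k Ux Uy.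
exists (Om `&` phi @^-1` trans2 k j), (fh k j \o phi); split.
- exact: composite_step.
- by split=> //=; rewrite /preimage /= H3 -E; exists z.
- by rewrite /= H3 -E fhE.
Qed.

(** Elements of the pseudogroup coincide locally with composites, and a 1-jet depends only on the
    germ. *)
Lemma holonomy_jetsP i j p : holonomy_jets i j p <->
  exists O phi t, [/\ composite i j O phi, O t & p = (t, phi t, Jac phi t)].
Proof.
split=> [[Om [phi [t [[oO sub inj loc] Ot ->]]]]|[Om [phi [t [H Ot ->]]]]].
  have [Op [phi' [H O't near_eq]]] := loc t Ot.
  exists Op, phi', t; split=> //.
  have [oO' _ sp _] := composite_dom H.
  have dp := smooth_map_diff oO' sp O't.
  have ne : \forall s \near t, phi' s = phi s by apply: filterS near_eq.
  by rewrite /jet1 -JacE (jac_near dp ne) (nbhs_singleton ne).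
have [oO sub sp im] := composite_dom H.
exists Om, phi, t; split=> //; last by rewrite /jet1 -JacE.
split=> // [|s Os]; first exact: composite_inj H.
by exists Om, phi; split=> //; near=> u.
Unshelve. all: by end_near.
Qed.

Variable (G : fidx F -> 'rV[R]_q -> 'M[R]_q).
Hypothesis tG : transverse_metric G.

Lemma tG_posdef i t : trans i t -> posdef (G i t).
Proof. by move: tG => [_ H1 H2 _] tt; split; [exact: H1|exact: H2]. Qed.

Lemma tG_fh i j t : trans2 i j t ->
  Jac (fh i j) t *m G j (fh i j t) *m (Jac (fh i j) t)^T = G i t.
Proof.
move: tG => [_ _ _ H] tt; apply: inner_inj => v w.
by rewrite -inner_mul JacE; exact: H.
Qed.

Lemma tG_composite i j O phi t : composite i j O phi -> O t ->
  Jac phi t *m G j (phi t) *m (Jac phi t)^T = G i t.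
Proof.
move=> H; elim: H t => [t _|j' k O1 phi1 H IH t [Ot tt]].
  by rewrite jac_id mul1mx trmx1 mulmx1.
have [oO _ sp _] := composite_dom H.
rewrite jac_comp; first last.
- by apply: (smooth_map_diff (@trans2_open j' k)) tt; exact: fh_smooth.
- exact: smooth_map_diff oO sp Ot.
rewrite trmx_mul !mulmxA -(mulmxA _ (Jac (fh j' k) _)) -(mulmxA _ _ (Jac (fh j' k) _)^T).
by rewrite tG_fh // IH.
Qed.

Lemma composite_isom i O phi (B : set 'rV[R]_q) : composite i i O phi -> B `<=` O ->
  isom (trans i) (G i) B phi.
Proof.
move=> H BO; have [oO sub sp im] := composite_dom H; split.
- by move=> j; apply: smooth_sub (sp j).
- by move=> t /BO/im.
- by move=> t /BO Ot; exact: tG_composite H Ot.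
Qed.

End FoliationBasics.

(** Near-covering compactness is applied to the filter on lists generated by the sets of all lists
    containing a given one; a list that works for every point of K gives the finite subcover. *)
Lemma finite_subcover (T : topologicalType) (K : set T) (N : T -> set T) : compact K ->
  (forall x, K x -> \forall y \near x, N x y) ->
  exists m (g : 'I_m -> T), (forall a, K (g a)) /\ forall y, K y -> exists a, N (g a) y.
Proof.
move=> cK HN.
pose FF : set_system (seq T) := fun P => exists s0 : seq T, forall s, {subset s0 <= s} -> P s.
have FFF : Filter FF.
  split.
  - by exists [::].
  - move=> P Q [s1 H1] [s2 H2]; exists (s1 ++ s2) => s Hs; split.
      by apply: H1 => z zs; apply: Hs; rewrite mem_cat zs.
    by apply: H2 => z zs; apply: Hs; rewrite mem_cat zs orbT.
  - by move=> P Q PQ [s1 H1]; exists s1 => s /H1/PQ.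
pose P (s : seq T) (y : T) := exists x, [/\ x \in s, K x & N x y].
have := (compact_near_coveringP K).1 cK _ FF P FFF _ => /(_ _)[].
  move=> x Kx; exists ([set y | N x y], [set s : seq T | x \in s]).
    by split=> /=; [exact: HN|exists [:: x] => s; apply; rewrite inE].
  by move=> [y s] [/= Ny xs]; exists x.
move=> s0 /(_ s0 (fun _ h => h)) H.
pose s1 := [seq x <- s0 | `[< K x >]].
exists (size s1), (tnth (in_tuple s1)); split.
  by move=> a; have := mem_tnth a (in_tuple s1); rewrite mem_filter => /andP[/asboolP].
move=> y Ky; have [x [xs Kx Nx]] := H y Ky.
have xs1 : x \in in_tuple s1 by rewrite mem_filter xs andbT; apply/asboolP.
by have /tnthP[a xa] := xs1; exists a; rewrite -xa.
Qed.

Lemma exists_small (R : realType) (I : finType) (P : I -> R -> Prop) :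
  (forall i, exists2 d : R, 0 < d & forall e, 0 < e -> e <= d -> P i e) ->
  exists2 d : R, 0 < d & forall e, 0 < e -> e <= d -> forall i, P i e.
Proof.
move=> /(_ _)/cid2 H; pose g i := s2val (H i).
have g0 i : 0 < g i by exact: (s2valP (H i)).
have S0 : 0 <= \sum_i (g i)^-1 by apply: sumr_ge0 => i _; rewrite invr_ge0 ltW.
exists (1 + \sum_i (g i)^-1)^-1; first by rewrite invr_gt0 ltr_wpDr.
move=> e e0 ed i; apply: (s2valP' (H i)) => //; apply: le_trans ed _.
have gi := g0 i; rewrite -/(g i) -[leRHS]invrK lef_pV2 ?posrE ?invr_gt0 ?ltr_wpDr //.
rewrite (bigD1 i) //= addrCA lerDl addr_ge0 // sumr_ge0 // => j _; by rewrite invr_ge0 ltW.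
Qed.

(** * Extension of holonomy germs to balls of uniform size *)

Section UniformExtension.
Variables (R : realType) (n q : nat) (M : manifold R n) (F : foliation M q).
Variable (G : fidx F -> 'rV[R]_q -> 'M[R]_q).
Hypothesis tG : transverse_metric G.
Hypothesis M_closed : closed_manifold M.
Implicit Types (i j : fidx F) (x y z w : M) (t s : 'rV[R]_q).

Lemma jac_lip (c : 'rV[R]_q) (r C : R) (phi : selfmap R q) : 0 <= C ->
  smooth_map_on (ball c r) phi -> (forall x : 'rV[R]_q, ball c r x -> `|Jac phi x| <= C) ->
  forall x y : 'rV[R]_q, ball c r x -> ball c r y -> `|phi y - phi x| <= q%:R * C * `|y - x|.
Proof.
move=> C0 sp H x y Bx By; apply: mx_norm_leB => [|i j]; first by rewrite !mulr_ge0.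
rewrite (ord1 i); apply: (smooth_ball_lip (sp j)) => // l z Bz.
rewrite -(jacE_smooth l j (@ball_open _ _ c r) sp Bz).
exact: le_trans (mx_entry_le _ _ _) (H z Bz).
Qed.

(* The constants do not depend on the length of the chains of plaques, because the
   isometries phi compose to isometries. *)
Lemma uniform_constants : exists m (ix : 'I_m -> fidx F) (N : 'I_m -> set M) (r0 C e2 : R),
  [/\ (forall a, open (N a)), (forall x, exists a, N a x) &
      (forall a, N a `<=` fU (ix a))] /\
  [/\ 0 < r0, 1 <= C, C * r0 <= e2, r0 <= e2 &
      [/\ (forall a x, N a x -> ball (ff (ix a) x) r0 `<=` trans (ix a)),
       (forall a b y, N a y -> N b y -> ball (ff (ix a) y) e2 `<=` trans2 (ix a) (ix b)) &
       (forall a b c x y (phi : selfmap R q), N a x -> N b y -> N c y ->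
          smooth_map_on (ball (ff (ix a) x) r0) phi ->
          (forall t, ball (ff (ix a) x) r0 t -> ball (ff (ix b) y) e2 (phi t)) ->
          (forall t, ball (ff (ix a) x) r0 t ->
             Jac phi t *m G (ix b) (phi t) *m (Jac phi t)^T = G (ix a) t) ->
          forall t t', ball (ff (ix a) x) r0 t -> ball (ff (ix a) x) r0 t' ->
             `|fh (ix b) (ix c) (phi t') - fh (ix b) (ix c) (phi t)| <= C * `|t' - t|)]].
Proof.
have [hM cM coM] := M_closed.
(* The covering is shrunk to open sets whose closures lie in foliation charts, so that the constants
   below come from continuity on compact closures. *)
have /choice[p Hp] : forall x, exists p : fidx F * set M, [/\ open p.2, p.2 x & closure p.2 `<=` fU p.1].
  move=> x; have [i Ui] := fU_cover F x.
  have nU : nbhs x (fU i) by exact: (open_near (fU_open i) Ui).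
  have nT : nbhs x setT by exact: filterT.
  have [V nV VU] := compact_regular hM cM nT nU.
  exists (i, V^°); split=> //=; first exact: open_interior.
  by apply: subset_trans VU; apply: closure_subset; exact: interior_subset.
have [m [g [_ Hg]]] := @finite_subcover M setT (fun x => (p x).2) cM
   (fun x _ => open_near (let: And3 a _ _ := Hp x in a) (let: And3 _ b _ := Hp x in b)).
pose ix a := (p (g a)).1; pose N a := (p (g a)).2.
have oN a : open (N a) by have [] := Hp (g a).
have clN a : closure (N a) `<=` fU (ix a) by have [] := Hp (g a).
have NU a : N a `<=` fU (ix a) by move=> x Nx; apply: clN; exact: subset_closure.
have cN a : compact (closure (N a)).
  by apply: (subclosed_compact _ cM) => //; exact: closed_closure.
have sG i (k l : 'I_q) : smooth_on (trans i) (fun t => G i t k l) by move: tG => [H _ _ _]; exact: H.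
have sI i := smooth_invmx (@trans_open _ _ _ _ F i) (fun t Tx => posdef_unit (tG_posdef tG Tx)) (sG i).
pose P1 a (e : R) x := forall t, `|t - ff (ix a) x| <= e -> trans (ix a) t /\
   forall k : 'I_q, `|G (ix a) t k k| <= e^-1 /\ `|invmx (G (ix a) t) k k| <= e^-1.
have [e1 e10 He1] : exists2 d : R, 0 < d & forall e, 0 < e -> e <= d -> forall a x, closure (N a) x -> P1 a e x.
  apply: exists_small => a; apply: compact_unif (cN a) _ => x /clN Ux.
  have tx : trans (ix a) (ff (ix a) x) by exists x.
  pose B := 1 + \sum_k (`|G (ix a) (ff (ix a) x) k k| + `|invmx (G (ix a) (ff (ix a) x)) k k|).
  have H (k : 'I_q) : \forall t \near ff (ix a) x, `|G (ix a) t k k| <= B /\ `|invmx (G (ix a) t) k k| <= B.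
    have c1 := (contP _ _).1 (Ck_cont (sG (ix a) k k 0%N) tx) 1 ltr01.
    have c2 := (contP _ _).1 (Ck_cont (sI (ix a) k k 0%N) tx) 1 ltr01.
    apply: filterS (near_and c1 c2) => t [/ltW/norm_step h1 /ltW/norm_step h2].
    have : `|G (ix a) (ff (ix a) x) k k| + `|invmx (G (ix a) (ff (ix a) x)) k k| + 1 <= B.
      rewrite /B addrC lerD2l (bigD1 k) //= lerDl; apply: sumr_ge0 => l _; exact: addr_ge0.
    have := normr_ge0 (G (ix a) (ff (ix a) x) k k); have := normr_ge0 (invmx (G (ix a) (ff (ix a) x)) k k).
    by split; lra.
  have B0 : 0 < B by rewrite ltr_wpDr // sumr_ge0 // => k _; exact: addr_ge0.
  have /near_normP[d d0 Hd] := near_and (open_near (@trans_open _ _ _ _ F (ix a)) tx) (near_all H).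
  exists (Num.min (d / 2) B^-1); first by rewrite lt_min divr_gt0 // invr_gt0.
  have d20 : 0 < d / 2 by rewrite divr_gt0.
  have := (contP _ _).1 (ff_cont Ux) _ d20; apply: filterS => y Hy e e0.
  rewrite le_min => /andP[ed eB] t te.
  have /Hd[h1 h2] : `|t - ff (ix a) x| < d.
    rewrite -(subrK (ff (ix a) y) t) -addrA (splitr d); apply: le_lt_trans (ler_normD _ _) _.
    by apply: ler_ltD => //; exact: le_trans te ed.
  have Be : B <= e^-1 by rewrite -[B]invrK lef_pV2 ?posrE ?invr_gt0.
  split=> // k; have [h3 h4] := h2 k.
  by split; [exact: le_trans h3 Be|exact: le_trans h4 Be].
pose Lam := e1^-1.
have Lam0 : 0 < Lam by rewrite invr_gt0.
pose C := q%:R * Lam + 1.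
have C1 : 1 <= C by rewrite lerDr mulr_ge0 // ltW.
have C0 : 0 < C by apply: lt_le_trans C1.
(* Near the image of x the transition map is defined and lands within [e1] of the image of x in the
   other chart, where the bounds of [P1] hold. *)
pose P2 (ab : 'I_m * 'I_m) (e : R) x := forall t, `|t - ff (ix ab.1) x| < e -> trans2 (ix ab.1) (ix ab.2) t /\
   `|fh (ix ab.1) (ix ab.2) t - ff (ix ab.2) x| <= e1.
have [e2' e20' He2] : exists2 d : R, 0 < d & forall e, 0 < e -> e <= d -> forall ab : 'I_m * 'I_m, forall x,
    (closure (N ab.1) `&` closure (N ab.2)) x -> P2 ab e x.
  apply: exists_small => -[a b]; apply: compact_unif.
    by apply: (subclosed_compact _ cM) => //; apply: closedI; exact: closed_closure.
  move=> x [/= /clN Ua /clN Ub].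
  have tx : trans2 (ix a) (ix b) (ff (ix a) x) by exists x.
  have e12 : 0 < e1 / 2 by rewrite divr_gt0.
  have c1 := (contP _ _).1 (smooth_cont (@fh_smooth _ _ _ _ F (ix a) (ix b)) tx) _ e12.
  have /near_normP[d d0 Hd] := near_and (open_near (@trans2_open _ _ _ _ F (ix a) (ix b)) tx) c1.
  exists (d / 2); first by rewrite divr_gt0.
  have d20 : 0 < d / 2 by rewrite divr_gt0.
  have h1 := (contP _ _).1 (ff_cont Ua) _ d20; have h2 := (contP _ _).1 (ff_cont Ub) _ e12.
  apply: filterS (near_and h1 h2) => y [{}h1 {}h2] e e0 ed t te.
  have /Hd[h3 h4] : `|t - ff (ix a) x| < d.
    rewrite -(subrK (ff (ix a) y) t) -addrA (splitr d); apply: le_lt_trans (ler_normD _ _) _.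
    by apply: ltrD => //; exact: lt_le_trans te ed.
  split=> //; rewrite fhE // in h4.
  rewrite -(subrK (ff (ix b) x) (fh _ _ _)) -addrA (splitr e1); apply: le_trans (ler_normD _ _) _.
  by rewrite lerD ?ltW // distrC.
pose e2 := e2'.
have bound2 a b y t : N a y -> N b y -> `|t - ff (ix a) y| < e2 -> trans2 (ix a) (ix b) t /\
   `|fh (ix a) (ix b) t - ff (ix b) y| <= e1.
  move=> Na Nb; apply: (He2 e2 _ _ (a, b) y) => //; by split; exact: subset_closure.
have bound1 a y t : N a y -> `|t - ff (ix a) y| <= e1 -> trans (ix a) t /\
   forall k : 'I_q, `|G (ix a) t k k| <= Lam /\ `|invmx (G (ix a) t) k k| <= Lam.
  by move=> Na; apply: (He1 e1 _ _ a y) => //; exact: subset_closure.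
(* [r0 <= e1] puts the source in the region where the metric is bounded; [C * r0 <= e2] puts a
   C-Lipschitz image in the domain of the next transition map. *)
pose r0 := Num.min e1 (e2 / C).
have r00 : 0 < r0 by rewrite lt_min e10 divr_gt0.
have r0e1 : r0 <= e1 by rewrite ge_min lexx.
have Cr0 : C * r0 <= e2 by rewrite mulrC -ler_pdivlMr // ge_min lexx orbT.
have r0e2 : r0 <= e2 by apply: le_trans Cr0; rewrite ler_peMl // ltW.
exists m, ix, N, r0, C, e2; split.
  split=> // x; have [a Na] := Hg x I; by exists a.
split=> //; split.
- by move=> a x Na t; rewrite ballE => tx; apply: (bound1 a x t Na _).1; rewrite ltW // (lt_le_trans tx).
- by move=> a b y Na Nb t; rewrite ballE => tx; exact: (bound2 a b y t Na Nb tx).1.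
move=> a b c x y phi Na Nb Nc sp im iso.
have oB := @ball_open _ _ (ff (ix a) x) r0.
have im2 t : ball (ff (ix a) x) r0 t -> trans2 (ix b) (ix c) (phi t).
  by move=> Bt; apply: (bound2 b c y _ Nb Nc _).1; rewrite -ballE; exact: im.
have sz : smooth_map_on (ball (ff (ix a) x) r0) (fh (ix b) (ix c) \o phi).
  exact: (smooth_map_comp oB (@trans2_open _ _ _ _ F _ _) im2 sp (@fh_smooth _ _ _ _ F _ _)).
(* Followed by one more transition map, phi is still an isometry between regions where the diagonal
   entries of G and of its inverse are at most [Lam], so its Jacobian is at most [Lam] whatever phi
   is. *)
have HJ t : ball (ff (ix a) x) r0 t -> `|Jac (fh (ix b) (ix c) \o phi) t| <= Lam.
  move=> Bt.
  have tt := im2 t Bt.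
  have E : Jac (fh (ix b) (ix c) \o phi) t *m G (ix c) (fh (ix b) (ix c) (phi t)) *m
     (Jac (fh (ix b) (ix c) \o phi) t)^T = G (ix a) t.
    rewrite jac_comp; first last.
    - exact: smooth_map_diff (@trans2_open _ _ _ _ F _ _) (@fh_smooth _ _ _ _ F _ _) tt.
    - exact: smooth_map_diff oB sp Bt.
    rewrite trmx_mul !mulmxA -(mulmxA _ (Jac (fh (ix b) (ix c)) _)) -(mulmxA _ _ (Jac (fh (ix b) (ix c)) _)^T).
    by rewrite (tG_fh tG tt) iso.
  have [h1 h2] : trans (ix a) t /\ forall k : 'I_q, `|G (ix a) t k k| <= Lam /\ `|invmx (G (ix a) t) k k| <= Lam.
    by apply: (bound1 a x t Na); move: Bt; rewrite ballE => /ltW/le_trans; apply.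
  have [h3 h4] : trans (ix c) (fh (ix b) (ix c) (phi t)) /\ forall k,
     `|G (ix c) (fh (ix b) (ix c) (phi t)) k k| <= Lam /\ `|invmx (G (ix c) (fh (ix b) (ix c) (phi t))) k k| <= Lam.
    apply: (bound1 c y _ Nc); apply: (bound2 b c y _ Nb Nc _).2.
    by rewrite -ballE; exact: im.
  apply/mx_norm_le => [|k l]; first exact: ltW.
  have := isometry_entry_le k l (tG_posdef tG h3) E.
  have := (h2 k).1; have := (h4 l).2.
  move: (normr_ge0 (Jac (fh (ix b) (ix c) \o phi) t k l)).
  rewrite -[_ ^+ 2]real_normK ?num_real //; move: (`|Jac _ t k l|) => v v0.
  move: (G (ix a) t k k) (invmx _ l l) => g1 g2 b2 b1 H.
  have {}H : v ^+ 2 <= Lam ^+ 2.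
    apply: le_trans H _; apply: le_trans (ler_norm _) _; rewrite normrM expr2; exact: ler_pM.
  by rewrite -(@ler_pXn2r _ 2) // nnegrE // ltW.
move=> t t' Bt Bt'; apply: le_trans (jac_lip (ltW Lam0) sz HJ Bt Bt') _.
by rewrite ler_wpM2r // lerDl.
Qed.

End UniformExtension.

Lemma near_comp (T T' : topologicalType) (f : T -> T') (x : T) (P : T' -> Prop) :
  {for x, continuous f} -> (\forall y \near f x, P y) -> \forall t \near x, P (f t).
Proof. by move=> cf; exact: cf. Qed.

Section Extension.
Variables (R : realType) (n q : nat) (M : manifold R n) (F : foliation M q).
Variable (G : fidx F -> 'rV[R]_q -> 'M[R]_q).
Hypothesis tG : transverse_metric G.
Implicit Types (i j k l : fidx F) (x y z w : M) (t s : 'rV[R]_q).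

Lemma fh_cocycle i j k x : fU i x -> fU j x -> fU k x ->
  \forall t \near ff i x, fh j k (fh i j t) = fh i k t.
Proof.
move=> Ui Uj Uk.
have oV : open (fU (f:=F) j `&` fU k) by apply: openI; exact: fU_open.
have := open_near (@ff_open _ _ _ _ F i _ oV) (_ : [set ff i z | z in fU i `&` (fU j `&` fU k)] (ff i x)).
move=> /(_ (ex_intro2 _ _ x (conj Ui (conj Uj Uk)) erefl)).
by apply: filterS => _ [z [zi [zj zk]] <-]; rewrite !fhE.
Qed.

Variables (m : nat) (ix : 'I_m -> fidx F) (N : 'I_m -> set M) (r0 C e2 : R).
Hypothesis oN : forall a, open (N a).
Hypothesis cN : forall x, exists a, N a x.
Hypothesis NU : forall a, N a `<=` fU (ix a).
Hypothesis r00 : 0 < r0.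
Hypothesis C1 : 1 <= C.
Hypothesis Cr0 : C * r0 <= e2.
Hypothesis Nr0 : forall a x, N a x -> ball (ff (ix a) x) r0 `<=` trans (ix a).
Hypothesis Ne2 : forall a b y, N a y -> N b y -> ball (ff (ix a) y) e2 `<=` trans2 (ix a) (ix b).
Hypothesis HC : forall a b c x y (phi : selfmap R q), N a x -> N b y -> N c y ->
  smooth_map_on (ball (ff (ix a) x) r0) phi ->
  (forall t, ball (ff (ix a) x) r0 t -> ball (ff (ix b) y) e2 (phi t)) ->
  (forall t, ball (ff (ix a) x) r0 t ->
     Jac phi t *m G (ix b) (phi t) *m (Jac phi t)^T = G (ix a) t) ->
  forall t t', ball (ff (ix a) x) r0 t -> ball (ff (ix a) x) r0 t' ->
     `|fh (ix b) (ix c) (phi t') - fh (ix b) (ix c) (phi t)| <= C * `|t' - t|.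

Let fa a x := ff (ix a) x.
Let C0 : 0 < C. Proof. exact: lt_le_trans C1. Qed.

(** A composite that transports the whole ball of radius [r0] about the image of x, stretching
    distances to the centre by at most C. The point y of the manifold is remembered because the next
    link has to start in a chart around y. *)
Definition ext_to (a : 'I_m) x (b : 'I_m) y (phi : selfmap R q) :=
  exists Om, [/\ composite (ix a) (ix b) Om phi, ball (fa a x) r0 `<=` Om, phi (fa a x) = fa b y &
    forall t, ball (fa a x) r0 t -> `|phi t - fa b y| <= C * `|t - fa a x|].

Lemma ext_to_id a x : N a x -> ext_to a x a x id.
Proof.
move=> Na; exists (trans (ix a)); split=> //.
- exact: composite_id.
- exact: Nr0.
- by move=> t _; rewrite ler_peMl.
Qed.

Lemma ext_to_e2 a x b y phi t : ext_to a x b y phi -> ball (fa a x) r0 t -> ball (fa b y) e2 (phi t).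
Proof.
move=> [Om [_ _ _ H]] Bt; rewrite ballE; apply: le_lt_trans (H t Bt) _.
by apply: lt_le_trans Cr0; rewrite ltr_pM2l // -ballE.
Qed.

(** The new bound is C again and not its square: [HC] estimates the isometry obtained after the link
    directly, which makes the radius independent of the number of links. *)
Lemma ext_to_link a x b y c phi : ext_to a x b y phi -> N a x -> N b y -> N c y ->
  ext_to a x c y (fh (ix b) (ix c) \o phi).
Proof.
move=> E Na Nb Nc; have [Om [cOm BOm px H]] := E.
have Bx : ball (fa a x) r0 (fa a x) by exact: ballxx.
have [_ _ sm _] := composite_dom cOm.
exists (Om `&` phi @^-1` trans2 (ix b) (ix c)); split.
- exact: composite_step.
- by move=> t Bt; split; [exact: BOm|apply: (Ne2 Nb Nc); exact: ext_to_e2 E Bt].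
- by rewrite /= px fhE //; exact: NU.
- move=> t Bt.
  have := HC Na Nb Nc (fun l0 : 'I_q => smooth_sub BOm (sm l0)) (fun t => @ext_to_e2 _ _ _ _ _ t E) _ Bx Bt.
  rewrite /= [phi (ff _ x)]px fhE; try exact: NU.
  by apply=> s Bs; apply: (tG_composite tG cOm); exact: BOm.
Qed.

Lemma ext_to_eq a x b y y' phi : ext_to a x b y phi -> fa b y = fa b y' -> ext_to a x b y' phi.
Proof. by move=> [Om [h1 h2 h3 h4]] E; exists Om; split; rewrite -?E. Qed.

Lemma ext_to_cont a x b y phi : ext_to a x b y phi -> {for fa a x, continuous phi}.
Proof.
move=> [Om [cOm BOm _ _]]; have [_ _ sm _] := composite_dom cOm.
by apply: smooth_cont sm _; apply: BOm; exact: ballxx.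
Qed.

(** Connectedness of the plaque: moving inside one set [N c0] along the plaque leaves the transverse
    coordinate unchanged, and changing the set is one [ext_to_link]. The cocycle relation keeps the
    germ equal to the one obtained by passing through chart i. *)
Lemma ext_to_plaque i a x b y z c phi : N a x -> N b y -> N c z -> ext_to a x b y phi ->
  fU i y -> plaque i y z ->
  exists psi, ext_to a x c z psi /\
    \forall t \near fa a x, psi t = fh i (ix c) (fh (ix b) i (phi t)).
Proof.
move=> Na Nb Nc E Ui pz.
pose P w := forall c, N c w -> exists psi, ext_to a x c w psi /\
    \forall t \near fa a x, psi t = fh i (ix c) (fh (ix b) i (phi t)).
have pxE : phi (fa a x) = fa b y by case: E => Om [].
have tyi : trans2 (ix b) i (fa b y) by exists y => //; split=> //; exact: NU.
have cphi : {for fa a x, continuous phi} := ext_to_cont E.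
have cbi : {for fa a x, continuous (fh (ix b) i \o phi)}.
  apply: continuous_comp cphi _; rewrite pxE.
  exact: smooth_cont (@fh_smooth _ _ _ _ F _ _) tyi.
have vbi : fh (ix b) i (phi (fa a x)) = ff i y by rewrite pxE /fa fhE //; exact: NU.
have step w w' c0 : N c0 w -> N c0 w' -> plaque i y w -> plaque i y w' -> P w -> P w'.
  move=> Nw Nw' [Uw ew] [Uw' ew'] /(_ c0 Nw)[psi [E1 H1]] c1 Nc1.
  have E2 : fa c0 w = fa c0 w'.
    rewrite /fa -(fhE Uw (NU Nw)) -(fhE Uw' (NU Nw')) /=; congr fh.
    by rewrite (ew : ff i w = ff i y) (ew' : ff i w' = ff i y).
  have E3 := ext_to_link (ext_to_eq E1 E2) Na Nw' Nc1.
  exists (fh (ix c0) (ix c1) \o psi); split=> //.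
  have co := fh_cocycle Uw' (NU Nw') (NU Nc1).
  rewrite (ew' : ff i w' = ff i y) -vbi in co.
  by apply: filterS (near_and H1 (near_comp cbi co)) => t [/= -> ].
have Py : P y.
  move=> c0 Nc0; exists (fh (ix b) (ix c0) \o phi); split; first exact: ext_to_link.
  have co := fh_cocycle (NU Nb) Ui (NU Nc0).
  rewrite -/(fa b y) -pxE in co.
  by apply: filterS (near_comp cphi co) => t /= ->.
have : P z; last by apply.
apply: (conn_ind (ff_connected (i := i) (t := ff i y))) (Py) => //.
move=> w pw; have [c0 Nc0] := cN w.
apply: filterS (open_near (oN c0) Nc0) => w' Nw' pw'.
by split; [apply: step Nw' Nc0 pw' pw|apply: step Nc0 Nw' pw pw'].
Qed.

Lemma ext_to_composite k l Om (h : selfmap R q) a x : composite k l Om h -> N a x -> fU k x ->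
  Om (ff k x) -> exists b y phi, [/\ N b y, fU l y, ff l y = h (ff k x), ext_to a x b y phi &
   \forall t \near fa a x, phi t = fh l (ix b) (h (fh (ix a) k t))].
Proof.
move=> cOm Na Uk; elim: cOm => {l Om h} [_|j l Om h cOm IH [Ox [y' [y'j y'l] ey']]].
  exists a, x, id; split=> //; first exact: ext_to_id.
  have tx : trans (ix a) (fa a x) by exists x => //; exact: NU.
  apply: filterS (near_and (fh_cocycle (NU Na) Uk (NU Na)) (open_near (@trans_open _ _ _ _ F _) tx)) => t [/= -> tt].
  by rewrite fh_id.
have [b [y [phi [Nb Uy ey E H]]]] := IH Ox.
have [c Nc] := cN y'.
have pl : plaque j y y' by split=> //; rewrite /= ey' ey.
have [psi [E' H']] := ext_to_plaque Na Nb Nc E Uy pl.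
exists c, y', psi; split=> //; first by rewrite /= -ey' fhE.
have [oOm _ sm _] := composite_dom cOm.
have fx : fh (ix a) k (fa a x) = ff k x by rewrite fhE //; exact: NU.
have txk : trans2 (ix a) k (fa a x) by exists x => //; split=> //; exact: NU.
have c1 : {for fa a x, continuous (fh (ix a) k)}.
  exact: smooth_cont (@fh_smooth _ _ _ _ F _ _) txk.
have c2 : {for fa a x, continuous (h \o fh (ix a) k)}.
  by apply: continuous_comp c1 _; rewrite fx; exact: smooth_cont sm Ox.
have n2 : \forall v \near h (fh (ix a) k (fa a x)), trans2 j (ix b) v.
  by apply: open_near (@trans2_open _ _ _ _ F _ _) _; rewrite fx -ey; exists y => //; split=> //; exact: NU.
have co := fh_cocycle y'j y'l (NU Nc).
have co2 : \forall v \near h (fh (ix a) k (fa a x)), fh l (ix c) (fh j l v) = fh j (ix c) v.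
  by rewrite fx -ey'.
apply: filterS (near_and (near_and H H') (near_and (near_comp c2 n2) (near_comp c2 co2))) => t.
move=> [[/= h1 ->] [/= h3 h4]].
by rewrite h4 h1 fhK.
Qed.

(** Near [t0] the germ is conjugated by the transition map between chart i and a chart [ix a] of the
    finite covering, extended there by [ext_to_composite] and [ext_to_plaque], and conjugated
    back. *)
Lemma uniform_extension_aux i t0 : trans i t0 -> forall Rr : R, 0 < Rr ->
  exists2 r : R, 0 < r & ball t0 r `<=` trans i /\
   forall Om (h : selfmap R q) s, composite i i Om h -> Om s -> ball t0 r s -> ball t0 r (h s) ->
   exists O' (phi : selfmap R q), [/\ composite i i O' phi, ball t0 r `<=` O',
     forall t, ball t0 r t -> ball t0 Rr (phi t) & \forall t \near s, phi t = h t].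
Proof.
move=> [x0 Ux0 ft0] Rr Rr0.
have [a Na] := cN x0.
have tia : trans2 i (ix a) t0 by exists x0 => //; split=> //; exact: NU.
have tai : trans2 (ix a) i (fa a x0) by exists x0 => //; split=> //; exact: NU.
have cai := smooth_cont (@fh_smooth _ _ _ _ F (ix a) i) tai.
have cia := smooth_cont (@fh_smooth _ _ _ _ F i (ix a)) tia.
have hia : fh i (ix a) t0 = fa a x0 by rewrite -ft0 fhE //; exact: NU.
have hai : fh (ix a) i (fa a x0) = t0 by rewrite fhE //; exact: NU.
have /near_normP[e e0 He] := near_and (open_near (@trans2_open _ _ _ _ F _ _) tai) ((contP _ _).1 cai Rr Rr0).
(* Two points of the small ball are at distance less than 2 eta <= r0 in chart [ix a]. The image
   then lies within C (2 eta) of a point itself within eta of the centre, hence within e of the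
   centre. *)
pose eta := Num.min (r0 / 2) (e / (2 * C + 1)).
have C20 : 0 < 2 * C + 1 by have := C0; lra.
have eta0 : 0 < eta by rewrite lt_min !divr_gt0.
have Ha := open_near (@ff_open _ _ _ _ F i _ (oN a)) (ex_intro2 _ _ x0 (conj Ux0 Na) ft0 : _ t0).
have /near_normP[r r_0 Hr] := near_and Ha (near_and (open_near (@trans2_open _ _ _ _ F _ _) tia) ((contP _ _).1 cia eta eta0)).
exists r => //; split.
  by move=> t; rewrite ballE => /Hr[_ [/trans2_l]].
move=> Om h s cOm Os; rewrite !ballE => /Hr[[x [Ux Nx] xs] [ts hs]] bhs; have [[y' [Uy' Ny'] ey'] _] := Hr _ bhs.
rewrite hia in hs.
have [|b [y [phi [Nb Uy ey E H]]]] := ext_to_composite cOm Nx Ux; first by rewrite xs.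
have pl : plaque i y y' by split=> //; rewrite /= ey ey' xs.
have [psi [E' H']] := ext_to_plaque Nx Nb Ny' E Uy pl.
have sx : fh i (ix a) s = fa a x by rewrite -xs fhE //; exact: NU.
have [Op [cOp BOp pE Hp]] := E'.
have eq_t t : ball t0 r t -> ball (fa a x) r0 (fh i (ix a) t) /\ `|fh i (ix a) t - fa a x| < 2 * eta.
  rewrite ballE => /Hr[_ [_]]; rewrite hia => ht.
  have h2 : `|fh i (ix a) t - fa a x| < 2 * eta.
    rewrite -sx -(subrK (fa a x0) (fh _ _ t)) -addrA; apply: le_lt_trans (ler_normD _ _) _.
    by rewrite [`|fa a x0 - _|]distrC; move: ht hs; lra.
  split=> //; rewrite ballE; apply: lt_le_trans h2 _.
  by rewrite mulrC -ler_pdivlMr // ge_min lexx.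
have hy' : `|fa a y' - fa a x0| < eta.
  have ty' : `|ff i y' - t0| < r by rewrite ey'.
  have [_ [_]] := Hr _ ty'; by rewrite hia fhE //; exact: NU.
have im t : ball t0 r t -> `|psi (fh i (ix a) t) - fa a x0| < e.
  move=> /eq_t[b1 b2]; have h1 := Hp _ b1.
  have h2 : C * `|fh i (ix a) t - fa a x| <= C * (2 * eta) by rewrite ler_pM2l // ltW.
  have h3 : (2 * C + 1) * eta <= e by rewrite mulrC -ler_pdivlMr // ge_min lexx orbT.
  rewrite -(subrK (fa a y') (psi _)) -addrA; apply: le_lt_trans (ler_normD _ _) _.
  move: hy' h1 h2 h3 => *; lra.
have cc := composite_comp (composite_comp (@composite_fh _ _ _ _ F i (ix a)) cOp) (@composite_fh _ _ _ _ F (ix a) i).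
eexists; eexists; split; first exact: cc.
- move=> t Bt; split; last by have [] := He _ (im t Bt).
  split; last by apply: BOp; exact: (eq_t t Bt).1.
  by move: Bt; rewrite ballE => /Hr[_ []].
- move=> t Bt; have [_] := He _ (im t Bt); by rewrite hai ballE.
have c0 := smooth_cont (@fh_smooth _ _ _ _ F i (ix a)) ts.
rewrite -sx in H H'.
have n1 := near_comp c0 H; have n2 := near_comp c0 H'.
have [oOm _ sm _] := composite_dom cOm.
have ch := smooth_cont sm Os.
have n3 : \forall v \near h s, trans2 i (ix b) v /\ trans2 i (ix a) v.
  rewrite -xs -ey; apply: near_and; apply: open_near (@trans2_open _ _ _ _ F _ _) _.
    by exists y => //; split=> //; exact: NU.
  by rewrite ey xs -ey'; exists y' => //; split=> //; exact: NU.
apply: filterS (near_and (near_and n1 n2) (near_and (near_comp ch n3) (open_near (@trans2_open _ _ _ _ F _ _) ts))).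
move=> t [[/= h1 ->] [/= [h3 h4] h5]].
by rewrite h1 (fhK h5) (fhK h3) fhK.
Qed.

End Extension.

(* Completeness of the holonomy pseudogroup: isometric balls are carried along chains of
   plaques, and the plaques are connected. *)
Lemma uniform_extension (R : realType) (n q : nat) (M : manifold R n) (F : foliation M q)
    (G : fidx F -> 'rV[R]_q -> 'M[R]_q) (i : fidx F) (t0 : 'rV[R]_q) :
  transverse_metric G -> closed_manifold M -> trans i t0 -> forall Rr : R, 0 < Rr ->
  exists2 r : R, 0 < r & ball t0 r `<=` trans i /\
   forall Om (h : selfmap R q) s, composite i i Om h -> Om s -> ball t0 r s -> ball t0 r (h s) ->
   exists O' (phi : selfmap R q), [/\ composite i i O' phi, ball t0 r `<=` O',
     forall t, ball t0 r t -> ball t0 Rr (phi t) & \forall t \near s, phi t = h t].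
Proof.
move=> tG Mc; have [m [ix [N [r0 [C [e2 [[oN cN NU] [r00 C1 Cr0 _ [Nr0 Ne2 HC]]]]]]]]] := uniform_constants tG Mc.
exact: (uniform_extension_aux tG oN cN NU r00 C1 Cr0 Nr0 Ne2 HC).
Qed.

(** * Central fields as limits of holonomy maps *)

Lemma inv_succ_scale (R : realType) (U : set_system nat) :
  (forall P : nat -> Prop, (\forall m \near \oo, P m) -> \forall m \near U, P m) ->
  (\forall m \near U, 0 < (m.+1%:R^-1 : R) <= 1) /\ m.+1%:R^-1 @[m --> U] --> (0 : R).
Proof.
move=> HU; split; first by apply: HU; apply: nearW => k; rewrite invr_gt0 ltr0n /= invf_le1 // ler1n.
move=> N N0; apply: HU; exact: (@cvg_harmonic R _ N0).
Qed.

Lemma cont_mx_entries (R : realType) (T : topologicalType) m r (A : T -> 'M[R]_(m, r)) (x : T) :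
  (forall a b, {for x, continuous (fun y => A y a b)}) -> {for x, continuous A}.
Proof.
move=> H; apply/contP => e e0.
have := @near_all T x ('I_m * 'I_r)%type (fun p y => `|A y p.1 p.2 - A x p.1 p.2| < e) (fun p => (contP _ _).1 (H p.1 p.2) e e0).
apply: filterS => y Hy; apply: mx_norm_lt => // a b; have := Hy (a, b); by rewrite !mxE.
Qed.

Lemma cont_jac (R : realType) p r (V : set 'rV[R]_p) (phi : 'rV[R]_p -> 'rV[R]_r) (x : 'rV[R]_p) :
  open V -> smooth_map_on V phi -> V x -> {for x, continuous (Jac phi)}.
Proof. by move=> oV sp Vx; apply: cont_mx_entries => a b; exact: Ck_cont (smooth_jac oV sp a b 0%N) Vx. Qed.

Lemma smooth_local (R : realType) p (V : set 'rV[R]_p) (f : 'rV[R]_p -> R) :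
  (forall x, V x -> exists2 W : set 'rV[R]_p, W x & smooth_on W f) -> smooth_on V f.
Proof.
move=> H k; elim: k f H => [|k IH] f H.
  by split=> // x Vx; have [W Wx /(_ 0%N)[]] := H x Vx => + _; apply.
split=> [x Vx|l]; first by have [W Wx /(_ 0%N)[]] := H x Vx => + _; apply.
split=> [x Vx|]; first by have [W Wx /(_ 1%N)[_ /(_ l)[]]] := H x Vx => + _; apply.
by apply: IH => x Vx; have [W Wx sW] := H x Vx; exists W => //; exact: smooth_pd.
Qed.

Lemma smooth_id (R : realType) p (V : set 'rV[R]_p) : smooth_map_on V (id : 'rV[R]_p -> 'rV[R]_p).
Proof. by move=> j; exact: smooth_coord. Qed.

Lemma mulmx_near (R : realType) m r s (A : 'M[R]_(m, r)) (B : 'M[R]_(r, s)) (e : R) : 0 < e ->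
  exists2 d : R, 0 < d & forall A' B', `|A' - A| < d -> `|B' - B| < d -> `|A' *m B' - A *m B| < e.
Proof.
move=> e0; pose K := r%:R * (`|A| + `|B| + 1) + 1.
have K0 : 0 < K by rewrite ltr_wpDl // mulr_ge0 // !addr_ge0.
exists (Num.min 1 (e / K)); first by rewrite lt_min ltr01 divr_gt0.
move=> A' B'; rewrite !lt_min => /andP[a1 ae] /andP[b1 be].
have -> : A' *m B' - A *m B = (A' - A) *m B' + A *m (B' - B).
  by rewrite mulmxBl mulmxBr addrA subrK.
apply: le_lt_trans (ler_normD _ _) _.
have h1 := mulmx_norm_le (A' - A) B'; have h2 := mulmx_norm_le A (B' - B).
have h3 : `|B'| <= `|B| + 1.
  by rewrite -(subrK B B') addrC; apply: le_trans (ler_normD _ _) _; rewrite lerD2l ltW.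
have h4 : r%:R * `|A' - A| * `|B'| <= r%:R * (e / K) * (`|B| + 1).
  by rewrite ler_pM // ?mulr_ge0 // ler_wpM2l // ltW.
have h5 : r%:R * `|A| * `|B' - B| <= r%:R * `|A| * (e / K) by rewrite ler_wpM2l ?mulr_ge0 // ltW.
have h6 : e / K * K = e by rewrite mulfVK // lt0r_neq0.
have eK : 0 < e / K by rewrite divr_gt0.
have h7 : r%:R * (e / K) * (`|B| + 1) + r%:R * `|A| * (e / K) = e / K * K - e / K by rewrite /K; ring.
by move: h1 h2 h4 h5; rewrite h6 in h7; move: h7 eK; lra.
Qed.

Lemma is_derive_curve (R : realType) (V : normedModType R) (c : R -> V) (g : R -> R) (r g' : R) (v : V) :
  is_derive r 1 g g' -> is_derive (g r) 1 c v -> is_derive r 1 (fun s => c (g s)) (g' *: v).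
Proof.
move=> [/derivable1_diffP dg Dg] [/derivable1_diffP dc Dc].
have dcg : differentiable (c \o g) r by exact: differentiable_comp.
split; first exact/derivable1_diffP.
have -> : 'D_1 (fun s => c (g s)) r = 'd (c \o g) r 1 by exact: deriveE.
rewrite diff_comp //=; have <- : 'D_1 g r = 'd g r 1 by exact: deriveE.
rewrite Dg -[X in 'd c (g r) X](mulr1 g') -[g' * 1]/(g' *: 1) linearZ /=; congr (_ *: _).
by rewrite -Dc; symmetry; exact: deriveE.
Qed.

Lemma is_derive_shift (R : realType) (u r : R) : is_derive r 1 (fun s : R => u + s) 1.
Proof.
have h : is_derive r (1:R) (cst u + id) (0 + 1) by exact: is_deriveD.
by rewrite add0r in h.
Qed.
Lemma is_derive_scale (R : realType) (u r : R) : is_derive r 1 (fun s : R => u * s) u.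
Proof.
have h : is_derive r (1:R) (u *: id) (u *: 1) by exact: is_deriveZ.
by rewrite [u *: 1]mulr1 in h.
Qed.

(** * Maps whose jets are limits of holonomy jets *)

Section Good.
Variables (R : realType) (n q : nat) (M : manifold R n) (F : foliation M q).
Variable (G : fidx F -> 'rV[R]_q -> 'M[R]_q).
Hypothesis tG : transverse_metric G.
Implicit Types (i j k : fidx F) (x y z : 'rV[R]_q) (A : 'M[R]_q) (phi psi : selfmap R q).

(* Limits of 1-jets of composites with the source kept fixed: unlike arbitrary
   elements of the closure of the jets, they compose for trivial reasons. *)
Definition ejet i j x y A := forall e : R, 0 < e -> exists Om (h : selfmap R q),
  [/\ composite i j Om h, Om x, `|h x - y| < e & `|Jac h x - A| < e].

Lemma ejet_composite i j Om (h : selfmap R q) x :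
  composite i j Om h -> Om x -> ejet i j x (h x) (Jac h x).
Proof. by move=> ch Ox e e0; exists Om, h; rewrite !subrr !normr0. Qed.

(** The second factor g is approximated first; its continuity then dictates how close the first one
    must be for its target to lie in the domain of g with nearly the same value and Jacobian. *)
Lemma ejet_comp i j k x y z A A' : ejet i j x y A -> ejet j k y z A' -> ejet i k x z (A *m A').
Proof.
move=> H1 H2 e e0; have [d d0 Hd] := mulmx_near A A' e0.
have m0 : 0 < Num.min (e / 2) (d / 2) by rewrite lt_min !divr_gt0.
have [Og [g [cg Oy]]] := H2 _ m0; rewrite !lt_min => /andP[g1 _] /andP[_ g2].
have [oOg _ sg _] := composite_dom cg.
have /near_normP[r r0 Hr] := near_and (open_near oOg Oy) (near_and ((contP _ _).1 (smooth_cont sg Oy) _ m0)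
   ((contP _ _).1 (cont_jac oOg sg Oy) _ m0)).
have m1 : 0 < Num.min r d by rewrite lt_min r0.
have [Oh [h [ch Ox]]] := H1 _ m1; rewrite !lt_min => /andP[h1 _] /andP[_ h2].
have [oOh _ sh _] := composite_dom ch.
have [Ohx []] := Hr _ h1; rewrite !lt_min => /andP[b1 _] /andP[_ b2].
exists (Oh `&` h @^-1` Og), (g \o h); split=> //=; first exact: composite_comp ch cg.
  rewrite -(subrK (g y) (g (h x))) -addrA (splitr e).
  by apply: le_lt_trans (ler_normD _ _) _; exact: ltrD.
rewrite jac_comp; first last.
- exact: smooth_map_diff oOg sg Ohx.
- exact: smooth_map_diff oOh sh Ox.
apply: Hd => //; rewrite -(subrK (Jac g y) (Jac g (h x))) -addrA (splitr d).
by apply: le_lt_trans (ler_normD _ _) _; exact: ltrD.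
Qed.

Lemma ejet_closure i j x y A : ejet i j x y A -> closure (holonomy_jets i j) (x, y, A).
Proof.
move=> H V [[V1 V2] /= [[[W1 W2] /= [w1 w2] WV] v2] HV].
have /near_normP[d1 d10 H1] := w2; have /near_normP[d2 d20 H2] := v2.
have m0 : 0 < Num.min d1 d2 by rewrite lt_min d10.
have [Om [h [ch Ox]]] := H _ m0; rewrite !lt_min => /andP[h1 _] /andP[_ h2].
exists (x, h x, Jac h x); split; first by apply/holonomy_jetsP; exists Om, h, x.
apply: HV; split=> /=; last exact: H2.
by apply: WV; split=> /=; [exact: nbhs_singleton|exact: H1].
Qed.

Lemma closure_jet i j x y A (e : R) : closure (holonomy_jets i j) (x, y, A) -> 0 < e ->
  exists Om (h : selfmap R q) s, [/\ composite i j Om h, Om s, `|s - x| < e, `|h s - y| < e &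
    `|Jac h s - A| < e].
Proof.
move=> H e0.
have nb (V : normedModType R) (v : V) : nbhs v [set w : V | `|w - v| < e].
  by apply/near_normP; exists e.
have /H : nbhs (x, y, A) [set p : jet_space R q | (`|p.1.1 - x| < e /\ `|p.1.2 - y| < e) /\ `|p.2 - A| < e].
  exists ([set p : 'rV[R]_q * 'rV[R]_q | `|p.1 - x| < e /\ `|p.2 - y| < e], [set A' : 'M[R]_q | `|A' - A| < e]) => //=.
  split=> /=; last exact: nb.
  by exists ([set w : 'rV[R]_q | `|w - x| < e], [set w : 'rV[R]_q | `|w - y| < e]).
move=> [p [/holonomy_jetsP[Om [h [s [ch Os ->]]]] /= [[h1 h2] h3]]].
by exists Om, h, s.
Qed.

Definition good_on i j (B : set 'rV[R]_q) phi :=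
  [/\ smooth_map_on B phi, forall x, B x -> trans j (phi x),
      forall x, B x -> Jac phi x *m G j (phi x) *m (Jac phi x)^T = G i x &
      forall x, B x -> ejet i j x (phi x) (Jac phi x)].

(** A germ condition stable under composition. It implies membership of the jet in the closure of
    the holonomy jets, and it carries the isometry relation and the smoothness needed to return to
    that closure after composing. *)
Definition good i j phi x := exists2 V : set 'rV[R]_q, [/\ open V, V `<=` trans i & V x] & good_on i j V phi.

Lemma good_composite i j Om phi x : composite i j Om phi -> Om x -> good i j phi x.
Proof.
move=> cp Ox; have [oO OT sp Tp] := composite_dom cp.
exists Om => //; split=> // y Oy; first exact: tG_composite cp Oy.
exact: ejet_composite cp Oy.
Qed.

Lemma good_cont i j phi x : good i j phi x -> {for x, continuous phi}.
Proof. by move=> [V [oV _ Vx] [sp _ _ _]]; exact: smooth_cont sp Vx. Qed.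

Lemma good_eq i j phi psi x : good i j phi x -> (\forall y \near x, phi y = psi y) -> good i j psi x.
Proof.
move=> [V [oV VT Vx] [sp Tp Gp ep]] /near_normP[d d0 Hd].
have oW : open (V `&` ball x d) by apply: openI => //; exact: ball_open.
have E y : (V `&` ball x d) y -> phi y = psi y by move=> [_]; rewrite ballE => /Hd.
have EJ y : (V `&` ball x d) y -> Jac psi y = Jac phi y.
  move=> Wy; apply: jac_near; first by apply: smooth_map_diff oV sp _; exact: Wy.1.
  by apply: filterS (open_near oW Wy) => z /E.
exists (V `&` ball x d); first by split=> //; [move=> y [/VT]|split=> //; exact: ballxx].
split=> [l|y Wy|y Wy|y Wy].
- apply: smooth_ext oW _ (smooth_sub _ (sp l)); last by move=> y [].
  by move=> y /set_mem/E ->.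
- by rewrite -E //; apply: Tp; exact: Wy.1.
- by rewrite EJ // -E //; apply: Gp; exact: Wy.1.
- by rewrite EJ // -E //; apply: ep; exact: Wy.1.
Qed.

Lemma good_comp i j k phi psi x : good i j phi x -> good j k psi (phi x) -> good i k (psi \o phi) x.
Proof.
move=> gp [V' [oV' VT' Vx'] [sp' Tp' Gp' ep']]; have cp := good_cont gp.
move: gp => [V [oV VT Vx] [sp Tp Gp ep]].
have /near_normP[d d0 Hd] := near_comp cp (open_near oV' Vx').
have oW : open (V `&` ball x d) by apply: openI => //; exact: ball_open.
have WV y : (V `&` ball x d) y -> V' (phi y) by move=> [_]; rewrite ballE => /Hd.
have EJ y : (V `&` ball x d) y -> Jac (psi \o phi) y = Jac phi y *m Jac psi (phi y).
  move=> Wy; rewrite jac_comp //; first by apply: smooth_map_diff oV sp _; exact: Wy.1.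
  by apply: smooth_map_diff oV' sp' _; exact: WV.
exists (V `&` ball x d); first by split=> //; [move=> y [/VT]|split=> //; exact: ballxx].
split=> [l|y Wy|y Wy|y Wy].
- apply: (smooth_map_comp oW oV' WV) => // l'; apply: smooth_sub (sp l'); by move=> y [].
- by apply: Tp'; exact: WV.
- rewrite EJ // trmx_mul !mulmxA -(mulmxA _ (Jac psi _)) -(mulmxA _ _ (Jac psi _)^T).
  by rewrite Gp' ?Gp //; [exact: Wy.1|exact: WV].
- by rewrite EJ //; apply: ejet_comp (ep _ Wy.1) (ep' _ (WV _ Wy)).
Qed.

Lemma good_id i x : trans i x -> good i i id x.
Proof. by move=> Tx; apply: good_composite Tx; exact: composite_id. Qed.

Lemma good_unit i j phi x : good i j phi x -> Jac phi x \in unitmx.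
Proof.
move=> [V [oV VT Vx] [_ _ /(_ x Vx) E _]].
have := posdef_unit (tG_posdef tG (VT _ Vx)).
by rewrite -E !unitmx_mul => /andP[/andP[]].
Qed.

(** A flow of X near x, inside O, all of whose maps are good; the radius and the time are common to
    the nearby starting points. *)
Definition flowbox i (O : set 'rV[R]_q) (X : selfmap R q) x :=
  exists tau rho (E : R -> selfmap R q), [/\ 0 < tau, 0 < rho &
    forall y, ball x rho y -> forall s : R, `|s| < tau ->
     [/\ O (E s y), is_derive s 1 (fun r : R => E r y) (X (E s y)), E 0 y = y & good i i (E s) y]].

(** A central section must satisfy its condition for every local flow [Phi], not for the one
    constructed. By uniqueness of solutions [Phi u'] equals the flow box at time u' - u after
    [Phi u] near the point, so goodness propagates along the interval of times. *)
Lemma flowbox_central i (O : set 'rV[R]_q) X : open O -> O `<=` trans i -> smooth_map_on O X ->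
  (forall x, O x -> flowbox i O X x) -> central_section i O X.
Proof.
move=> oO OT sX HF; split=> // V e Phi [oV VO P0 PP] s se.
have e0 : `|0 : R| < e by rewrite normr0; apply: le_lt_trans se.
have G0 t : V t -> forall s, `|s| < e -> good i i (Phi s) t.
  move=> Vt; have step (u u' tau rho : R) (E : R -> selfmap R q) (p : 'rV[R]_q) : 0 < tau -> 0 < rho ->
    (forall y, ball p rho y -> forall s : R, `|s| < tau ->
     [/\ O (E s y), is_derive s 1 (fun r : R => E r y) (X (E s y)), E 0 y = y & good i i (E s) y]) ->
    `|u| < e -> `|u'| < e -> ball p rho (Phi u t) -> `|u' - u| < Num.min tau (e - `|u|) ->
     good i i (Phi u) t -> good i i (Phi u') t.
    move=> tau0 rho0 HE ue u'e Bu uu' gu.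
    have oB := @ball_open _ _ p rho.
    have N1 := near_and (near_comp (good_cont gu) (open_near oB Bu)) (open_near oV Vt).
    have uu2 : `|u' - u| < tau by move: uu'; rewrite lt_min => /andP[].
    have gE := (HE _ Bu _ uu2).
    apply: good_eq (good_comp gu (let: And4 _ _ _ a := gE in a)) _.
    apply: filterS N1 => y [By Vy] /=.
    have := @ode_uniq R q O X (fun r => Phi (u + r) y) (fun r => E r (Phi u y)) (Num.min tau (e - `|u|)) 0 oO sX.
    have m0 : `|0 : R| < Num.min tau (e - `|u|) by rewrite normr0 lt_min tau0 subr_gt0.
    move=> /(_ _ _ m0 _ (u' - u) uu') <-; first by rewrite addrC subrK.
    - move=> r; rewrite lt_min => /andP[_ re].
      have ur : `|u + r| < e by apply: le_lt_trans (ler_normD _ _) _; move: re; lra.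
      have [h1 h2] := PP y (u + r) Vy ur; split=> //.
      have -> : (fun r => Phi (u + r) y) = (fun r => Phi r y) \o (fun r : R => u + r) by [].
      by have := is_derive_curve (is_derive_shift u r) h2; rewrite scale1r.
    - by move=> r; rewrite lt_min => /andP[rt _]; have [] := HE _ By _ rt.
    - by rewrite addr0; have [_ _ ->] := HE _ By _ uu2.
  move=> s1 s1e; apply: (@interval_ind R e (fun s => good i i (Phi s) t) _ 0 s1) => //; last first.
    apply: good_eq (good_id (OT _ (VO _ Vt))) _.
    by apply: filterS (open_near oV Vt) => y Vy; rewrite P0.
  move=> u ue; have [Ou Du] := PP t u Vt ue.
  have [tau [rho [E [tau0 rho0 HE]]]] := HF _ Ou.
  have r20 : 0 < rho / 2 by rewrite divr_gt0.
  have ct := (contP _ _).1 (is_derive_cont Du) _ rho0.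
  have /near_normP[d d0 Hd] := ct.
  pose mm := Num.min d (Num.min tau ((e - `|u|) / 2)).
  have e2 : 0 < (e - `|u|) / 2 by rewrite divr_gt0 // subr_gt0.
  exists mm; first by rewrite !lt_min d0 tau0.
  move=> u' u'e; rewrite !lt_min => /and3P[ud ut ue2]; split.
    apply: (step u' u tau rho E (Phi u t)) => //; first by rewrite ballE; exact: Hd.
    rewrite lt_min distrC ut /=; have := ler_normD (u' - u) u; rewrite subrK; lra.
  by apply: (step u u' tau rho E (Phi u t)) => //; [exact: ballxx|rewrite lt_min ut /=; lra].
have GG t Vt := G0 t Vt s se.
split; last by move=> t /GG[W [oW WT Wt] [_ _ _ /(_ t Wt)/ejet_closure]]; rewrite JacE.
split; split=> //.
- by move=> t /VO/OT.
- by move=> _ [t Vt <-]; have [/OT] := PP t s Vt se.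
- by move=> j; apply: smooth_local => t /GG[W [oW WT Wt] [/(_ j)]]; exists W.
- move=> t t' /set_mem Vt /set_mem Vt' tt'.
  have := @ode_uniq R q O X (fun r => Phi r t) (fun r => Phi r t') e s oO sX
    (fun r => PP t r Vt) (fun r => PP t' r Vt') se tt' 0 e0.
  by rewrite !P0.
- by move=> t /GG/good_unit; rewrite JacE.
Qed.

End Good.

Lemma jacD (R : realType) p r (f g : 'rV[R]_p -> 'rV[R]_r) (x : 'rV[R]_p) :
  differentiable f x -> differentiable g x -> Jac (fun y => f y + g y) x = Jac f x + Jac g x.
Proof.
move=> df dg; apply/row_matrixP => a; rewrite !rowE mulmxDr -!diff_jac.
exact: (congr1 (fun u : 'rV[R]_p -> 'rV[R]_r => u _) (diffD df dg)).
Qed.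

Lemma jac_near0 (R : realType) p r (f : 'rV[R]_p -> 'rV[R]_r) (x : 'rV[R]_p) :
  (\forall y \near x, f y = 0) -> Jac f x = 0.
Proof.
move=> H; rewrite (@jac_near _ _ _ (cst 0) f); first last.
- by apply: filterS H => y ->.
- exact: differentiable_cst.
apply/row_matrixP => a; rewrite !rowE -diff_jac diff_cst /= mulmx0.
by [].
Qed.

Section UltraAux.
Variables (R : realType) (U : set_system nat).
Context {UF : UltraFilter U}.

Lemma cvg_mulmx m r s (A : nat -> 'M[R]_(m, r)) (B : nat -> 'M[R]_(r, s)) (A0 : 'M[R]_(m, r)) (B0 : 'M[R]_(r, s)) :
  A n @[n --> U] --> A0 -> B n @[n --> U] --> B0 -> A n *m B n @[n --> U] --> A0 *m B0.
Proof.
move=> cA cB; apply/cvgrPdist_lt => e e0.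
have [d d0 Hd] := mulmx_near A0 B0 e0.
have h1 : \forall n \near U, `|A0 - A n| < d by exact: ((cvgrPdist_lt _ _).1 cA _ d0).
have h2 : \forall n \near U, `|B0 - B n| < d by exact: ((cvgrPdist_lt _ _).1 cB _ d0).
apply: (unear (filter_and _ h1 h2)) => n [a b].
by rewrite distrC; apply: Hd; rewrite distrC.
Qed.

Lemma cvg_trmx m r (A : nat -> 'M[R]_(m, r)) (A0 : 'M[R]_(m, r)) : A n @[n --> U] --> A0 -> (A n)^T @[n --> U] --> A0^T.
Proof.
move=> cA; apply: cvg_mx => a b; have := cvg_entry (UF := UF) (i := b) (j := a) cA.
have -> : (fun n => (A n)^T a b) = (fun n => A n b a) by apply/funext => n; rewrite mxE.
by rewrite mxE.
Qed.

Lemma cvg_comp_cont (V : normedModType R) (W : normedModType R) (u : nat -> V) (l : V) (f : V -> W) :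
  u n @[n --> U] --> l -> {for l, continuous f} -> f (u n) @[n --> U] --> f l.
Proof. by move=> cu cf; exact: (continuous_cvg _ cf cu). Qed.

Lemma not_near (P : nat -> Prop) : ~ (\forall n \near U, P n) -> \forall n \near U, ~ P n.
Proof. by move=> H; have [] := in_ultra_setVsetC P UF => //. Qed.

Lemma cvg0_le (V : normedModType R) (u : nat -> V) (b : nat -> R) :
  b n @[n --> U] --> (0 : R) -> (\forall n \near U, `|u n| <= b n) -> u n @[n --> U] --> (0 : V).
Proof.
move=> cb H; apply/cvgrPdist_lt => e e0.
have h1 : \forall n \near U, `|0 - b n| < e by exact: ((cvgrPdist_lt _ _).1 cb _ e0).
apply: (unear (filter_and _ h1 H)) => n [a b'].
rewrite sub0r normrN; apply: le_lt_trans b' (le_lt_trans (ler_norm _) _).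
by move: a; rewrite sub0r normrN.
Qed.

(** [h] supplies positive times and [k], which moves in direction -Z, negative ones. The last two
    clauses keep the flow maps available as limits of iterates, which is what makes them limits of
    holonomy maps. *)
Lemma euler_flow q (h k : nat -> selfmap R q) (delta : nat -> R) (Z : selfmap R q)
    (p0 : 'rV[R]_q) (rho rho' K L : R) : 0 <= K -> 0 <= L -> rho' < rho ->
  (\forall n \near U, 0 < delta n) -> delta n @[n --> U] --> (0 : R) ->
  (\forall n \near U, forall x, ball p0 rho x -> `|h n x - x| <= K * delta n) ->
  (\forall n \near U, forall x, ball p0 rho x -> `|k n x - x| <= K * delta n) ->
  (\forall n \near U, forall x y, ball p0 rho x -> ball p0 rho y ->
     `|(h n x - x) - (h n y - y)| <= L * delta n * `|x - y|) ->
  (\forall n \near U, forall x y, ball p0 rho x -> ball p0 rho y ->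
     `|(k n x - x) - (k n y - y)| <= L * delta n * `|x - y|) ->
  (forall x, ball p0 rho x -> (delta n)^-1 *: (h n x - x) @[n --> U] --> Z x) ->
  (forall x, ball p0 rho x -> (delta n)^-1 *: (k n x - x) @[n --> U] --> - Z x) ->
  exists tau (E : R -> selfmap R q), [/\ 0 < tau, rho' + K * tau < rho &
   forall x, ball p0 rho' x ->
     [/\ E 0 x = x, forall s, `|s| < tau -> [/\ ball p0 rho (E s x), `|E s x - x| <= K * `|s| &
          is_derive s 1 (fun r : R => E r x) (Z (E s x))],
       forall s, 0 <= s < tau -> euler_pt h delta x n s @[n --> U] --> E s x &
       forall s, 0 <= s < tau -> euler_pt k delta x n s @[n --> U] --> E (- s) x]].
Proof.
move=> K0 L0 rr d0 dc hK kK hL kL hZ kZ.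
(* A point of the ball of radius rho' moving at speed at most K stays in the ball of radius rho; K +
   1 avoids dividing by 0 and makes the inequality strict. *)
pose tau := (rho - rho') / (K + 1).
have K1 : 0 < K + 1 by rewrite ltr_wpDl.
have tau0 : 0 < tau by rewrite divr_gt0 // subr_gt0.
have tK : tau * (K + 1) = rho - rho' by rewrite mulfVK // lt0r_neq0.
have tl : rho' + K * tau < rho by move: tK tau0; rewrite mulrDr mulr1 [tau * K]mulrC; lra.
exists tau, (fun s x => if 0 <= s then euler_curve U h delta x s else euler_curve U k delta x (- s)).
split=> // x; rewrite ballE => Bx.
have pin : `|x - p0| + K * tau < rho by apply: lt_trans tl; rewrite ltrD2r.
have hc0 := euler_curve0 (UF := UF) K0 d0 hK tau0 pin; have kc0 := euler_curve0 (UF := UF) K0 d0 kK tau0 pin.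
have hc s (st : 0 <= s <= tau) := euler_cvg (UF := UF) K0 d0 hK pin st.
have kc s (st : 0 <= s <= tau) := euler_cvg (UF := UF) K0 d0 kK pin st.
have hq := euler_quad (UF := UF) K0 L0 d0 dc hK hL hZ pin.
have kq := euler_quad (UF := UF) K0 L0 d0 dc kK kL kZ pin.
have Zlip := euler_lip (UF := UF) d0 hL hZ; have Zb := euler_bound (UF := UF) d0 hK hZ.
split.
- by rewrite lexx.
- have LK0 : 0 <= L * K by exact: mulr_ge0.
  have lipc (c : R -> 'rV[R]_q) (Z' : selfmap R q) : (forall s, 0 <= s <= tau -> ball p0 rho (c s)) ->
    (forall y, ball p0 rho y -> `|Z' y| <= K) ->
    (forall s t, 0 <= s -> s <= t -> t <= tau -> `|c t - c s - (t - s) *: Z' (c s)| <= L * K * (t - s) ^+ 2) ->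
    forall s t, 0 <= s -> s <= t -> t <= tau -> `|c t - c s| <= (K + L * K * tau) * (t - s).
    move=> Bc Zk qc s t s0 st tt; rewrite -(subrK ((t - s) *: Z' (c s)) (c t - c s)).
    have ts0 : 0 <= t - s by rewrite subr_ge0.
    apply: le_trans (ler_normD _ _) _; rewrite addrC mulrDl lerD //.
      rewrite normrZ ger0_norm // mulrC ler_wpM2r // Zk //; apply: Bc; rewrite s0; exact: le_trans tt.
    by apply: le_trans (qc _ _ s0 st tt) _; rewrite -[leRHS]mulrA ler_wpM2l // expr2 ler_wpM2r // lerBlDr; lra.
  have K2 : 0 <= K by [].
  have Bh s (st : 0 <= s <= tau) : ball p0 rho (euler_curve U h delta x s) by have [] := hc s st.
  have Bk s (st : 0 <= s <= tau) : ball p0 rho (euler_curve U k delta x s) by have [] := kc s st.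
  have Zb' y : ball p0 rho y -> `|- Z y| <= K by rewrite normrN; exact: Zb.
  have kq' s t : 0 <= s -> s <= t -> t <= tau ->
    `|euler_curve U k delta x t - euler_curve U k delta x s + (t - s) *: Z (euler_curve U k delta x s)| <= L * K * (t - s) ^+ 2.
    by move=> h1 h2 h3; have := kq s t h1 h2 h3; rewrite scalerN opprK.
  have GC := @glue_curve R q (ball p0 rho) Z L (K + L * K * tau) (L * K) tau (euler_curve U h delta x) (euler_curve U k delta x) L0 LK0
     Zlip Bh Bk hq kq' (lipc _ _ Bh Zb hq) (lipc _ _ Bk Zb' kq) (etrans hc0 (esym kc0)).
  move=> s st; have Ds := GC s st; split=> //.
    have [s0|s0] := leP 0 s; first by apply: Bh; rewrite s0 ltW // -(ger0_norm s0).
    by apply: Bk; rewrite oppr_ge0 ltW //= -(ltr0_norm s0) ltW.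
  have [s0|s0] := leP 0 s; first by have [] := hc s; rewrite ?(ger0_norm s0) ?s0 // ltW // -(ger0_norm s0).
  by have [] := kc (- s); rewrite ?(ltr0_norm s0) // oppr_ge0 ltW //= -(ltr0_norm s0) ltW.
- move=> s /andP[s0 st]; have ss : 0 <= s <= tau by rewrite s0 (ltW st).
  by rewrite s0; have [] := hc s ss.
- move=> s /andP[s0 st]; have ss : 0 <= s <= tau by rewrite s0 (ltW st).
  have s00 : 0 <= (0 : R) <= tau by rewrite lexx (ltW tau0).
  rewrite oppr_ge0 opprK.
  have [_|s1] := ltP 0 s; first by have [] := kc s ss.
  have -> : s = 0 by apply/eqP; rewrite eq_le s1.
  rewrite oppr0 hc0 -[X in _ --> X]kc0; by have [] := kc 0 s00.
Qed.
End UltraAux.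

(** * Local holonomy maps and their limits *)

Section Local.
Variables (R : realType) (n q : nat) (M : manifold R n) (F : foliation M q).
Variable (G : fidx F -> 'rV[R]_q -> 'M[R]_q).
Hypothesis tG : transverse_metric G.
Variable U : set_system nat.
Context {UF : UltraFilter U}.
Variable dl : nat -> R.
Variables (i : fidx F) (t0 : 'rV[R]_q) (rT r0 : R).
Implicit Types (x y : 'rV[R]_q) (A : 'M[R]_q) (phi psi : selfmap R q).

Notation B := (ball t0 r0).
Notation D := (ball t0 rT).
Notation isoT := (isom (trans i) (G i)).

Definition local_hol phi := exists Om, [/\ composite i i Om phi, B `<=` Om & forall x, B x -> D (phi x)].

(* At t0: a ball where isometries are controlled by their 1-jets and to which the germs of
   holonomy extend, an ultrafilter U for all limits, and a scale dl -> 0. *)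
Definition local_ctx := [/\ cball t0 rT `<=` trans i, 0 < r0 < rT,
  forall (c : 'rV[R]_q) r h k, ball c r `<=` D -> r <= r0 -> isoT (ball c r) h -> isoT (ball c r) k ->
    (forall x, ball c r x -> D (h x)) -> (forall x, ball c r x -> D (k x)) ->
    forall x x', ball c r x -> ball c r x' -> jd h k x <= 2 * jd h k x',
  forall Om (h : selfmap R q) s, composite i i Om h -> Om s -> B s -> B (h s) ->
    exists2 phi, local_hol phi & \forall t \near s, phi t = h t &
  [/\ forall P : nat -> Prop, (\forall n \near \oo, P n) -> \forall n \near U, P n,
      (\forall n \near U, 0 < dl n <= 1) & dl n @[n --> U] --> (0 : R)]].

Hypothesis LC : local_ctx.

Lemma lc_pos : [/\ 0 < r0, r0 < rT & 0 < rT].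
Proof. by have [_ /andP[r00 r0T] _ _ _] := LC; split=> //; exact: lt_trans r0T. Qed.

Lemma lc_BD : B `<=` D.
Proof. by move=> x; rewrite !ballE => /lt_trans; apply; have [] := lc_pos. Qed.

Lemma lc_cD : cball t0 rT `<=` trans i. Proof. by case: LC. Qed.

Lemma lc_DT : D `<=` trans i.
Proof. by move=> x; rewrite ballE => /ltW; exact: lc_cD. Qed.

Let sG k l : smooth_on (trans i) (fun t => G i t k l).
Proof. by case: tG => H _ _ _; exact: H. Qed.

Let pG t : trans i t -> posdef (G i t).
Proof. exact: tG_posdef. Qed.

Lemma local_hol_isom phi : local_hol phi -> isoT B phi.
Proof. by move=> [Om [co BO _]]; exact: composite_isom co BO. Qed.

Lemma local_hol_D phi x : local_hol phi -> B x -> D (phi x).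
Proof. by move=> [Om [_ _ H]]; exact: H. Qed.

Lemma jet_id phi psi (c : 'rV[R]_q) r x x' : ball c r `<=` B -> r <= r0 -> isoT (ball c r) phi -> isoT (ball c r) psi ->
  (forall x, ball c r x -> D (phi x)) -> (forall x, ball c r x -> D (psi x)) ->
  ball c r x -> ball c r x' -> jd phi psi x <= 2 * jd phi psi x'.
Proof. by move=> cB rr h1 h2 h3 h4; have [_ _ H _ _] := LC; apply: H => // y /cB/lc_BD. Qed.

Lemma dl_le1 : \forall n \near U, 0 < dl n <= 1.
Proof. by have [_ _ _ _ []] := LC. Qed.

Lemma dl_gt0 : \forall n \near U, 0 < dl n.
Proof. by apply: (unear dl_le1) => k /andP[]. Qed.

Lemma dl_cvg : dl n @[n --> U] --> (0 : R).
Proof. by have [_ _ _ _ []] := LC. Qed.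

Lemma dl_small (C e : R) : 0 < e -> \forall n \near U, C * dl n < e.
Proof.
move=> e0; have C1 : 0 < `|C| + 1 by rewrite ltr_wpDl.
have H : \forall n \near U, `|0 - dl n| < e / (`|C| + 1).
  by exact: ((cvgrPdist_lt _ _).1 dl_cvg _ (divr_gt0 e0 C1)).
apply: (unear (filter_and _ dl_gt0 H)) => k [k0]; rewrite sub0r normrN gtr0_norm // ltr_pdivlMr //.
apply: le_lt_trans; rewrite mulrC ler_wpM2l //; first exact: ltW.
have := ler_norm C; lra.
Qed.

Lemma lc_jac_bound : exists2 C : R, 0 < C & forall (c : 'rV[R]_q) r phi x, ball c r `<=` D ->
  isoT (ball c r) phi -> (forall x, ball c r x -> D (phi x)) -> ball c r x -> `|Jac phi x| <= C.
Proof.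
have [C C0 HC] := isom_jac_bound (@trans_open _ _ _ _ F i) sG pG lc_cD.
exists C => // c r phi x cD [_ _ iso] pD Bx; apply: HC (iso x Bx); [exact: cD|exact: pD].
Qed.

Lemma lc_family_limit (c : 'rV[R]_q) rho (h : nat -> selfmap R q) (eps : nat -> R) (C : R) : ball c rho `<=` D ->
  (\forall n \near U, 0 < eps n <= 1) ->
  (\forall n \near U, isoT (ball c rho) (h n)) -> (\forall n \near U, forall x, ball c rho x -> D (h n x)) ->
  (\forall n \near U, forall x, ball c rho x -> jd (h n) id x <= C * eps n) ->
  [/\ smooth_map_on (ball c rho) (rescaled_limit U h eps),
    forall x, ball c rho x -> (eps n)^-1 *: (h n x - x) @[n --> U] --> rescaled_limit U h eps x &
    forall x, ball c rho x -> (eps n)^-1 *: (Jac (h n) x - 1%:M) @[n --> U] --> Jac (rescaled_limit U h eps) x].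
Proof. exact: (family_limit (@trans_open _ _ _ _ F i) sG pG lc_cD). Qed.

(** The family estimates at the constant scale 1: the 1-jets of the isometries [g n] stay at bounded
    distance from that of the identity, so a pointwise limit is automatically smooth and the
    Jacobians converge. *)
Lemma lc_limit (c : 'rV[R]_q) rho (g : nat -> selfmap R q) (E : selfmap R q) : ball c rho `<=` D ->
  (\forall n \near U, isoT (ball c rho) (g n)) -> (\forall n \near U, forall x, ball c rho x -> D (g n x)) ->
  (forall x, ball c rho x -> g n x @[n --> U] --> E x) ->
  [/\ smooth_map_on (ball c rho) E, forall x, ball c rho x -> cball t0 rT (E x) &
   forall x, ball c rho x -> Jac (g n) x @[n --> U] --> Jac E x].
Proof.
move=> BD iso gD gE.
have [C1 C10 HC1] := lc_jac_bound.
have p1 : (0 : R) < (1 : R) <= (1 : R) by rewrite ltr01 lexx.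
have one : \forall n \near U, 0 < (fun _ : nat => 1 : R) n <= 1  by apply: filterE => ?; exact: p1.
have jb : \forall n \near U, forall x, ball c rho x -> jd (g n) id x <= (2 * rT + C1 + `|1%:M : 'M[R]_q|) * 1.
  apply: (unear (filter_and _ iso gD)) => k [h1 h2] x Bx; rewrite /jd mulr1 jac_id -addrA; apply: lerD.
    have := h2 x Bx; have := BD x Bx; rewrite !ballE => a b.
    rewrite -(subrK t0 (g k x)) -addrA; apply: le_trans (ler_normD _ _) _.
    by rewrite [`|t0 - x|]distrC; move: a b; lra.
  by apply: le_trans (ler_normB _ _) _; rewrite lerD2r; exact: HC1 BD h1 h2 Bx.
have [s1 s2 s3] := lc_family_limit BD one iso gD jb.
set Z := rescaled_limit _ _ _ in s1 s2 s3; clearbody Z.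
have EZ x : ball c rho x -> E x = x + Z x.
  move=> Bx; have h := s2 x Bx; rewrite invr1 in h.
  have : x + 1 *: (g n x - x) @[n --> U] --> x + Z x by apply: cvgD h; exact: cvg_cst.
  have -> : (fun n => x + 1 *: (g n x - x)) = (fun n => g n x) by apply/funext => k; rewrite scale1r addrC subrK.
  by move=> h'; apply: cvg_unique (gE x Bx) h'; exact: norm_hausdorff.
have oB := @ball_open _ _ c rho.
split.
- move=> j; apply: (@smooth_ext _ _ _ (fun x => x 0 j + Z x 0 j)) => //.
    by move=> x /set_mem/EZ ->; rewrite mxE.
  by apply: smooth_add => //; exact: smooth_coord.
- move=> x Bx; apply: (@lim_le_norm _ _ _ _ (fun n => g n x - t0)).
    by apply: cvgB (gE x Bx) _; exact: cvg_cst.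
  by apply: (unear gD) => k /(_ x Bx); rewrite ballE => /ltW.
- move=> x Bx.
  have -> : Jac E x = 1%:M + Jac Z x.
    have dZ := smooth_map_diff oB s1 Bx.
    have di : differentiable (id : selfmap R q) x by exact: (smooth_map_diff oB (@smooth_id _ _ (ball c rho)) Bx).
    rewrite -[1%:M](jac_id x) -(jacD di dZ); apply: jac_near.
      by apply: differentiableD.
    by apply: filterS (open_near oB Bx) => y /EZ ->.
  have h := s3 x Bx; rewrite invr1 in h.
  have : 1%:M + 1 *: (Jac (g n) x - 1%:M) @[n --> U] --> 1%:M + Jac Z x by apply: cvgD h; exact: cvg_cst.
  have -> // : (fun n => 1%:M + 1 *: (Jac (g n) x - 1%:M)) = (fun n => Jac (g n) x).
  by apply/funext => k; rewrite scale1r addrC subrK.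
Qed.

Lemma lc_limit_good (c : 'rV[R]_q) rho (g : nat -> selfmap R q) (E : selfmap R q) : ball c rho `<=` D ->
  (\forall n \near U, exists2 Om, composite i i Om (g n) & ball c rho `<=` Om) ->
  (\forall n \near U, forall x, ball c rho x -> D (g n x)) ->
  (forall x, ball c rho x -> g n x @[n --> U] --> E x) ->
  forall x, ball c rho x -> good G i i E x.
Proof.
move=> BD gc gD gE x Bx.
have iso : \forall n \near U, isoT (ball c rho) (g n).
  by apply: (unear gc) => k [Om co BO]; exact: composite_isom co BO.
have [sE ET EJ] := lc_limit BD iso gD gE.
exists (ball c rho); first by split=> //; [exact: ball_open|exact: subset_trans BD lc_DT].
have TE y : ball c rho y -> trans i (E y) by move=> By; apply: lc_cD; exact: ET.
split=> // y By.
  have cG : {for E y, continuous (G i)}.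
    by apply: cont_mx_entries => a b; exact: Ck_cont (sG a b 0%N) (TE y By).
  have h1 := cvg_comp_cont (UF := UF) (gE y By) cG.
  have h2 := cvg_mulmx (UF := UF) (cvg_mulmx (UF := UF) (EJ y By) h1) (cvg_trmx (UF := UF) (EJ y By)).
  have h3 : Jac (g n) y *m G i (g n y) *m (Jac (g n) y)^T @[n --> U] --> G i y.
    apply: (@cvg_trans _ (G i y @[_ --> U])); last exact: cvg_cst.
    apply: near_eq_cvg; apply: (unear iso) => k [_ _ /(_ y By) ->//].
  by apply: cvg_unique h2 h3; exact: norm_hausdorff.
move=> e e0.
have a1 : \forall n \near U, `|E y - g n y| < e by exact: ((cvgrPdist_lt _ _).1 (gE y By) e e0).
have a2 : \forall n \near U, `|Jac E y - Jac (g n) y| < e by exact: ((cvgrPdist_lt _ _).1 (EJ y By) e e0).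
have [k [[Om co BO] [b1 b2]]] := proper_ex _ (filter_and _ gc (filter_and _ a1 a2)).
by exists Om, (g k); split=> //; rewrite 1?distrC //; exact: BO.
Qed.
End Local.

Lemma jacN (R : realType) p r (f : 'rV[R]_p -> 'rV[R]_r) (x : 'rV[R]_p) :
  differentiable f x -> Jac (fun y => - f y) x = - Jac f x.
Proof.
move=> df; apply/row_matrixP => a; rewrite !rowE mulmxN -!diff_jac.
exact: (congr1 (fun u : 'rV[R]_p -> 'rV[R]_r => u _) (diffN df)).
Qed.

Section Families.
Variables (R : realType) (n q : nat) (M : manifold R n) (F : foliation M q).
Variable (G : fidx F -> 'rV[R]_q -> 'M[R]_q).
Hypothesis tG : transverse_metric G.
Variable U : set_system nat.
Context {UF : UltraFilter U}.
Variable dl : nat -> R.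
Variables (i : fidx F) (t0 : 'rV[R]_q) (rT r0 : R).
Implicit Types (x y : 'rV[R]_q) (A : 'M[R]_q) (phi psi : selfmap R q).
Implicit Types (h : nat -> selfmap R q).

Notation B := (ball t0 r0).
Notation D := (ball t0 rT).
Notation isoT := (isom (trans i) (G i)).
Notation hol := (local_hol i t0 rT r0).
Hypothesis LC : local_ctx G U dl i t0 rT r0.

(* If the derivatives were much larger than the displacements, the limit
   rescaled by the former would be 0 with nonzero 1-jets. *)
Lemma jd_of_C0 (c : 'rV[R]_q) rho h (eps : nat -> R) (K : R) : ball c rho `<=` B -> 0 < rho -> rho <= r0 -> 0 <= K ->
  (\forall n \near U, 0 < eps n) -> eps n @[n --> U] --> (0 : R) ->
  (\forall n \near U, isoT (ball c rho) (h n)) ->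
  (\forall n \near U, forall x, ball c rho x -> D (h n x)) ->
  (\forall n \near U, forall x, ball c rho x -> `|h n x - x| <= K * eps n) ->
  exists2 C : R, 0 < C & \forall n \near U, forall x, ball c rho x -> jd (h n) id x <= C * eps n.
Proof.
move=> cB rho0 rhor K0 e0 ec iso hD hK.
have cD := subset_trans cB (lc_BD LC).
have Bc : ball c rho c by exact: ballxx.
have jI : \forall n \near U, forall x, ball c rho x -> jd (h n) id x <= 2 * jd (h n) id c.
  apply: (unear (filter_and _ iso hD)) => k [h1 h2] x Bx; apply: (jet_id LC cB) => //.
    by apply: isom_id; exact: subset_trans cD (lc_DT LC).
pose eta m := jd (h m) id c.
have eta0 m : 0 <= eta m by rewrite addr_ge0.
have [[C HC]|nC] := pselect (exists C, \forall n \near U, eta n <= C * eps n).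
  exists (2 * (`|C| + 1)); first by rewrite mulr_gt0 // ltr_wpDl.
  apply: (unear (filter_and _ jI (filter_and _ HC e0))) => k [h1 [h2 h3]] x Bx.
  apply: le_trans (h1 x Bx) _; rewrite -mulrA ler_pM2l //; apply: le_trans h2 _.
  by rewrite ler_pM2r //; have := ler_norm C; lra.
exfalso.
(* If no constant works on a set of [U], then for each C the reverse inequality holds on a set of
   [U], since [U] is an ultrafilter. *)
have big C : \forall n \near U, C * eps n < eta n.
  have : ~ (\forall n \near U, eta n <= C * eps n) by move=> H; apply: nC; exists C.
  by move=> /not_near H; apply: (unear H) => k /negP; rewrite -ltNge.
have small x : ball c rho x -> h n x @[n --> U] --> x.
  move=> Bx; have -> : (fun n => h n x) = (fun n => (h n x - x) + x) by apply/funext => k; rewrite subrK.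
  rewrite -[X in _ --> X]add0r; apply: cvgD; last exact: cvg_cst.
  apply: (@cvg0_le _ _ _ _ _ (fun n => K * eps n)).
    by rewrite -(mulr0 K); apply: cvgMr.
  by apply: (unear hK) => k; exact.
have [_ _ J1] := lc_limit tG LC cD iso hD (E := id) small.
have etac : eta n @[n --> U] --> (0 : R).
  rewrite (_ : 0 = `|c - c| + `|Jac id c - Jac id c| :> R); last by rewrite !subrr !normr0 addr0.
  apply: cvgD; apply: cvg_norm; apply: cvgB; try exact: cvg_cst; [exact: small|exact: J1].
have eta1 : \forall n \near U, 0 < eta n <= 1.
  have a1 : \forall n \near U, `|0 - eta n| < 1 by exact: ((cvgrPdist_lt _ _).1 etac _ ltr01).
  apply: (unear (filter_and _ (filter_and _ (big 0) a1) e0)) => k [[h1 h2] h3].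
  by rewrite mul0r in h1; rewrite h1 /= ltW // -(ger0_norm (eta0 k)) -normrN -sub0r.
have jI2 : \forall n \near U, forall x, ball c rho x -> jd (h n) id x <= 2 * eta n by [].
have [s1 s2 s3] := lc_family_limit tG LC cD eta1 iso hD jI2.
set Z := rescaled_limit _ _ _ in s1 s2 s3; clearbody Z.
have Z0 x : ball c rho x -> Z x = 0.
  move=> Bx; apply: cvg_unique (s2 x Bx) _; first exact: norm_hausdorff.
  apply/cvgrPdist_le => e e_gt0.
  apply: (unear (filter_and _ (filter_and _ hK e0) (filter_and _ eta1 (big (K / e))))) => k [[h1 h2] [/andP[h3 _] h4]].
  rewrite sub0r normrN normrZ gtr0_norm ?invr_gt0 // mulrC ler_pdivrMr //.
  apply: le_trans (h1 x Bx) _; rewrite [e * _]mulrC -ler_pdivrMr //.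
  by apply: ltW; move: h4; rewrite mulrAC.
have JZ : Jac Z c = 0.
  by apply: jac_near0; apply: filterS (open_near (@ball_open _ _ c rho) Bc) => y /Z0.
(* The field rescaled by [eta] vanishes on the ball, and so does its Jacobian at c; hence the 1-jet
   distance divided by [eta], which is 1, would tend to 0. *)
have L1 : (eta n)^-1 * eta n @[n --> U] --> (0 : R).
  have -> : (fun n => (eta n)^-1 * eta n) =
    (fun n => `|(eta n)^-1 *: (h n c - c)| + `|(eta n)^-1 *: (Jac (h n) c - 1%:M)|).
    by apply/funext => k; rewrite !normrZ normfV (ger0_norm (eta0 k)) -mulrDr /eta /jd jac_id.
  rewrite (_ : 0 = `|Z c| + `|Jac Z c| :> R); last by rewrite Z0 // JZ !normr0 addr0.
  by apply: cvgD; apply: cvg_norm; [exact: s2|exact: s3].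
have L2 : (eta n)^-1 * eta n @[n --> U] --> (1 : R).
  apply: (@cvg_trans _ ((1 : R) @[_ --> U])); last exact: cvg_cst.
  by apply: near_eq_cvg; apply: (unear eta1) => k /andP[h3 _]; rewrite mulVf // lt0r_neq0.
have : (1 : R) = 0 by apply: cvg_unique L2 L1; exact: norm_hausdorff.
by move=> /eqP; rewrite oner_eq0.
Qed.

(** Sequences of holonomy maps on the whole ball whose 1-jets are O(dl n) from the identity. Their
    rescaled limits are central ([fam_central]), and every central germ arises from one of them
    ([germ_fam]). *)
Definition local_fam h := (\forall n \near U, hol (h n)) /\
  exists2 C : R, 0 < C & \forall n \near U, forall x, B x -> jd (h n) id x <= C * dl n.

Lemma fam_isom h : local_fam h -> \forall n \near U, isoT B (h n).
Proof. by move=> [H _]; apply: (unear H) => k; exact: (local_hol_isom tG). Qed.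

Lemma fam_D h : local_fam h -> \forall n \near U, forall x, B x -> D (h n x).
Proof. by move=> [H _]; apply: (unear H) => k Hk x; exact: (local_hol_D Hk). Qed.

Lemma fam_limit h : local_fam h -> [/\ smooth_map_on B (rescaled_limit U h dl),
  forall x, B x -> (dl n)^-1 *: (h n x - x) @[n --> U] --> rescaled_limit U h dl x &
  forall x, B x -> (dl n)^-1 *: (Jac (h n) x - 1%:M) @[n --> U] --> Jac (rescaled_limit U h dl) x].
Proof.
move=> Hf; have [_ [C C0 HC]] := Hf.
exact: (lc_family_limit tG LC (lc_BD LC) (dl_le1 LC) (fam_isom Hf) (fam_D Hf) HC).
Qed.

Lemma fam_lip h : local_fam h -> exists2 L : R, 0 <= L & \forall n \near U, forall x y, B x -> B y ->
  `|(h n x - x) - (h n y - y)| <= L * dl n * `|x - y|.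
Proof.
move=> Hf; have [_ [C C0 HC]] := Hf; exists (q%:R * C); first by rewrite mulr_ge0 // ltW.
apply: (unear (filter_and _ HC (filter_and _ (fam_isom Hf) (dl_gt0 LC)))) => k [h1 [[sh _ _] h3]] x y Bx By.
have oB := @ball_open _ _ t0 r0.
have Ej z : B z -> Jac (fun y => h k y + - y) z = Jac (h k) z + - 1%:M.
  move=> Bz; rewrite (jacD (g := fun y => - y)).
  - by rewrite -[1%:M](jac_id z) -jacN //; exact: (smooth_map_diff oB (@smooth_id _ _ B) Bz).
  - exact: smooth_map_diff oB sh Bz.
  - have di : differentiable (id : selfmap R q) z by exact: (smooth_map_diff oB (@smooth_id _ _ B) Bz).
    exact: differentiableN di.
rewrite -mulrA distrC.
apply: le_trans (@jac_lip R q t0 r0 (C * dl k) (fun y => h k y + - y) _ _ _ x y Bx By) _.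
- by rewrite mulr_ge0 // ltW.
- move=> j; apply: (@smooth_ext _ _ _ (fun y => h k y 0 j - y 0 j)) => //.
    by move=> z _; rewrite !mxE.
  by apply: smooth_sub2 => //; exact: smooth_coord.
- move=> z Bz; rewrite Ej //; apply: le_trans (h1 z Bz).
  by rewrite /jd jac_id lerDr.
- by rewrite distrC !mulrA.
Qed.

Lemma comp_iter Om phi (W : set 'rV[R]_q) m : composite i i Om phi -> W `<=` trans i ->
  (forall k x, (k < m)%N -> W x -> Om (iter k phi x)) ->
  exists2 Om', composite i i Om' (iter m phi) & W `<=` Om'.
Proof.
move=> co WT; elim: m => [|m IH] H; first by exists (trans i) => //; exact: composite_id.
have [|Om' co' WO] := IH; first by move=> k x km; apply: H; exact: ltn_trans km _.
exists (Om' `&` iter m phi @^-1` Om).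
  have -> : iter m.+1 phi = phi \o iter m phi by apply/funext.
  exact: composite_comp co' co.
by move=> x Wx; split; [exact: WO|exact: H].
Qed.
End Families.

Section LimitFields.
Variables (R : realType) (n q : nat) (M : manifold R n) (F : foliation M q).
Variable (G : fidx F -> 'rV[R]_q -> 'M[R]_q).
Hypothesis tG : transverse_metric G.
Variable U : set_system nat.
Context {UF : UltraFilter U}.
Variable dl : nat -> R.
Variables (i : fidx F) (t0 : 'rV[R]_q) (rT r0 : R).
Implicit Types (x y : 'rV[R]_q) (A : 'M[R]_q) (phi psi : selfmap R q).
Implicit Types (h : nat -> selfmap R q).

Notation B := (ball t0 r0).
Notation D := (ball t0 rT).
Notation isoT := (isom (trans i) (G i)).
Notation hol := (local_hol i t0 rT r0).
Notation fam := (local_fam U dl i t0 rT r0).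
Notation lim_field h := (rescaled_limit U h dl).
Hypothesis LC : local_ctx G U dl i t0 rT r0.

(** The inverse of the germ of [h m] at [t0] extends to the ball by completeness. On a smaller ball
    h m o k m is an isometry with the 1-jet of the identity at [h m t0], hence the identity by jet
    control. *)
Lemma fam_inv h : fam h -> exists2 k : nat -> selfmap R q, fam k &
  forall r, r < r0 -> \forall m \near U, forall x, ball t0 r x -> B (k m x) /\ h m (k m x) = x.
Proof.
move=> Hf; have [hH [C C0 HC]] := Hf; have [r00 r0T rT0] := lc_pos LC.
have B0 : B t0 by exact: ballxx.
have D0 : D t0 by exact: (lc_BD LC B0).
pose P m (k : selfmap R q) := hol (h m) -> B (h m t0) ->
  [/\ hol k, k (h m t0) = t0 & \forall x \near t0, k (h m x) = x].
have /choice[k Hk] : forall m, exists k, P m k.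
  move=> m; have [[a b]|nab] := pselect (hol (h m) /\ B (h m t0)); last first.
    by exists id => a b; exfalso; apply: nab.
  have [Om [co BO hD]] := a.
  have [Op [psi [co' Hpsi _]]] := composite_inv co.
  have [p1 p2] := Hpsi t0 (BO _ B0).
  have [_ _ _ HUE _] := LC.
  have [||| phi ph1 ph2] := HUE _ _ (h m t0) co' => //; first by rewrite p2.
  exists phi => _ _; split=> //; first by rewrite (nbhs_singleton ph2).
  have [oOm _ sh _] := composite_dom co.
  have ch := smooth_cont sh (BO _ B0).
  apply: filterS (near_and (near_comp ch ph2) (open_near oOm (BO _ B0))) => x [/= -> Ox].
  by have [] := Hpsi x Ox.
have [C1 C10 HC1] := lc_jac_bound tG LC.
have BD := lc_BD LC; have BT := subset_trans BD (lc_DT LC).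
have main : \forall m \near U, [/\ hol (k m), k m (h m t0) = t0, B (h m t0),
    `|h m t0 - t0| <= C * dl m & Jac (h m) t0 *m Jac (k m) (h m t0) = 1%:M].
  apply: (unear (filter_and _ hH (filter_and _ HC (dl_small LC C r00)))) => m [h1 [h2 h3]].
  have h4 : `|h m t0 - t0| <= C * dl m by apply: le_trans (h2 _ B0); rewrite /jd lerDl.
  have h5 : B (h m t0) by rewrite ballE; exact: le_lt_trans h4 h3.
  have [k1 k2 k3] := Hk m h1 h5; split=> //.
  rewrite -jac_comp; first last.
  - have [Om [co BO _]] := k1; have [oOm _ sk _] := composite_dom co.
    by apply: smooth_map_diff oOm sk _; exact: BO.
  - have [Om [co BO _]] := h1; have [oOm _ sk _] := composite_dom co.
    by apply: smooth_map_diff oOm sk _; exact: BO.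
  rewrite -(jac_id t0); apply: jac_near.
    exact: (smooth_map_diff (@ball_open _ _ t0 r0) (@smooth_id _ _ B) B0).
  by apply: filterS k3 => x /= ->.
(* At [h m t0] the map [k m] moves by as much as [h m] at [t0], and its Jacobian minus 1 is Jac k (1
   - Jac h); the factor 2 spreads this bound over the ball. *)
pose C2 := 2 * (C + q%:R * C1 * C).
have C20 : 0 < C2 by rewrite mulr_gt0 // ltr_wpDr // !mulr_ge0 // ltW.
have kfam : fam k.
  split; first by apply: (unear main) => m [].
  exists C2 => //.
  apply: (unear (filter_and _ main (filter_and _ HC hH))) => m [[m1 m2 m3 m4 m5] [m6 m7]] x Bx.
  have iso := local_hol_isom tG m1.
  apply: le_trans (jet_id LC (c := t0) (r := r0) (x' := h m t0) _ _ iso (isom_id (G i) BT) _ _ Bx m3) _ => //.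
    by move=> y; exact: (local_hol_D m1).
  rewrite /C2 -mulrA ler_pM2l // mulrDl /jd jac_id m2 /= distrC; apply: lerD => //.
  have -> : Jac (k m) (h m t0) - 1%:M = Jac (k m) (h m t0) *m (1%:M - Jac (h m) t0).
    by rewrite mulmxBr mulmx1 (mulmx1C m5).
  apply: le_trans (mulmx_norm_le _ _) _.
  rewrite -[X in _ <= X]mulrA; apply: ler_pM; rewrite ?mulr_ge0 //.
    by rewrite ler_wpM2l //; apply: (HC1 t0 r0 (k m)) => // y; exact: (local_hol_D m1).
  by rewrite distrC; apply: le_trans (m6 _ B0); rewrite /jd jac_id lerDr.
exists k => // r1 r1r.
pose r := Num.max r1 (r0 / 2).
have rr : r < r0 by rewrite gt_max r1r /=; lra.
have rp : 0 < r by rewrite lt_max; apply/orP; right; lra.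
suff : \forall m \near U, forall x, ball t0 r x -> B (k m x) /\ h m (k m x) = x.
  move=> HH; apply: (unear HH) => m H x; rewrite ballE => xr; apply: H; rewrite ballE; apply: lt_le_trans xr _.
  by rewrite le_max lexx.
have [_ [C3 C30 HC3]] := kfam.
have e1 : 0 < r0 - r by rewrite subr_gt0.
apply: (unear (filter_and _ (filter_and _ main HC3) (filter_and _ (filter_and _ (dl_small LC C3 e1) (dl_small LC C rp)) hH))).
move=> m [[[m1 m2 m3 m4 m5] m6] [[m7 m8] m9]].
have kB x : ball t0 r x -> B (k m x).
  move=> Br; have Bx : B x by move: Br; rewrite !ballE => /lt_trans; apply.
  rewrite ballE -(subrK x (k m x)) -addrA; apply: le_lt_trans (ler_normD _ _) _.
  have := m6 x Bx; rewrite /jd; have := normr_ge0 (Jac (k m) x - Jac id x); move: Br m7; rewrite ballE /=; lra.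
have rB : ball t0 r `<=` B by move=> x; rewrite !ballE => /lt_trans; apply.
have s0 : ball t0 r (h m t0) by rewrite ballE; exact: le_lt_trans m4 m8.
have [_ _ iso3] := local_hol_isom tG m9.
have isoC : isoT (ball t0 r) (h m \o k m).
  apply: (isom_comp (@ball_open _ _ t0 r) (@ball_open _ _ t0 r0) kB).
    exact: isom_sub rB (local_hol_isom tG m1).
  exact: (local_hol_isom tG m9).
move=> x Br; split; first exact: kB.
have := jet_id LC (c := t0) (r := r) (x := x) (x' := h m t0) rB (ltW rr) isoC (isom_id (G i) (subset_trans rB BT)) _ _ Br s0.
have -> : jd (h m \o k m) id (h m t0) = 0.
  rewrite /jd /= m2 subrr normr0 add0r jac_id jac_comp; first last.
  - rewrite m2; have [Om [co BO _]] := m9; have [oOm _ sk _] := composite_dom co.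
    by apply: smooth_map_diff oOm sk _; exact: BO.
  - have [Om [co BO _]] := m1; have [oOm _ sk _] := composite_dom co.
    by apply: smooth_map_diff oOm sk _; exact: BO.
  by rewrite m2 (mulmx1C m5) subrr normr0.
rewrite mulr0 => /(_ (fun y By => local_hol_D m9 (kB y By)) (fun y By => BD y (rB y By))) H.
apply/eqP; rewrite -subr_eq0 -normr_le0; apply: le_trans H.
by rewrite /jd /= lerDl.
Qed.

Lemma fam_inv_limit h k : fam h -> fam k ->
  (forall r, r < r0 -> \forall m \near U, forall x, ball t0 r x -> B (k m x) /\ h m (k m x) = x) ->
  forall x, B x -> (dl m)^-1 *: (k m x - x) @[m --> U] --> - lim_field h x.
Proof.
move=> hf kf H x Bx; have [L L0 HL] := fam_lip tG LC hf.
have [_ hl _] := fam_limit tG LC hf; have [_ [C C0 HC]] := kf.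
have [r xr rr] : exists2 r, ball t0 r x & r < r0.
  move: Bx; rewrite ballE => b; exists ((`|x - t0| + r0) / 2); rewrite ?ballE; lra.
have -> : (fun m => (dl m)^-1 *: (k m x - x)) =
   (fun m => - ((dl m)^-1 *: (h m x - x)) + (dl m)^-1 *: (h m x - x + (k m x - x))).
  by apply/funext => m; rewrite [(dl m)^-1 *: (_ + (k m x - x))]scalerDr addKr.
rewrite -[X in _ --> X]addr0; apply: cvgD; first by apply: cvgN; exact: hl.
apply: (@cvg0_le _ _ _ _ _ (fun m => L * C * dl m)).
  by rewrite -(mulr0 (L * C)); apply: cvgMr; exact: dl_cvg LC.
apply: (unear (filter_and _ (filter_and _ HL HC) (filter_and _ (H r rr) (dl_gt0 LC)))) => m [[h1 h2] [h3 h4]].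
have [h5 h6] := h3 x xr.
have := h1 x (k m x) Bx h5; rewrite h6.
have -> : h m x - x - (x - k m x) = h m x - x + (k m x - x) by rewrite opprB.
move=> h7; rewrite normrZ gtr0_norm ?invr_gt0 // ler_pdivrMl //; apply: le_trans h7 _.
have := h2 x Bx; rewrite /jd /= => h8.
have h9 : `|x - k m x| <= C * dl m by rewrite distrC; apply: le_trans h8; rewrite lerDl.
apply: le_trans (ler_wpM2l _ h9) _; first by rewrite mulr_ge0 // ltW.
by rewrite le_eqVlt; apply/orP; left; apply/eqP; ring.
Qed.

(** The Euler iterates remain in the ball, so each is a composite defined on a neighbourhood
    independent of m; [lc_limit_good] then applies to their limit. *)
Lemma fam_flow_good h (K : R) (p y : 'rV[R]_q) rho rho' tau s E : 0 <= K -> fam h -> ball p rho `<=` B -> rho' + K * tau < rho ->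
  (\forall m \near U, forall x, ball p rho x -> `|h m x - x| <= K * dl m) -> 0 <= s < tau ->
  (forall x, ball p rho' x -> euler_pt h dl x m s @[m --> U] --> E x) ->
  forall x, ball p rho' x -> good G i i E x.
Proof.
move=> K0 hf pB rt hK /andP[s0 st] hE; have [hH _] := hf.
have tau0 : 0 < tau by apply: le_lt_trans st.
have BD := lc_BD LC.
have p'B : ball p rho' `<=` ball p rho.
  move=> x; rewrite !ballE => xr; apply: lt_trans xr _; apply: le_lt_trans rt.
  by rewrite lerDl mulr_ge0 // ltW.
have key : \forall m \near U, forall x k, ball p rho' x -> (k <= euler_steps dl m s)%N -> ball p rho (iter k (h m) x).
  apply: (unear (filter_and _ (filter_and _ hK (dl_gt0 LC)) (euler_stepsP (UF := UF) (dl_gt0 LC) s0))).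
  move=> m [[h1 h2] [h3 h4]] x k; rewrite ballE => xr ks.
  (* [euler_iter] holds for almost all indices; applied to the constant sequences [h m] and [dl m]
     it gives the bound at this very m. *)
  have c1 : \forall m' \near U, 0 < (fun _ : nat => dl m) m' by apply: filterE.
  have c2 : \forall m' \near U, forall x, ball p rho x -> `|(fun _ => h m) m' x - x| <= K * (fun _ : nat => dl m) m'.
    by apply: filterE.
  have c3 : `|x - p| + K * tau < rho by apply: lt_trans rt; rewrite ltrD2r.
  have [m' H] := proper_ex _ (euler_iter (UF := UF) K0 c1 c2 c3).
  have [|_] := H k; last by [].
  apply: le_trans (ltW st); apply: le_trans h3; by rewrite ler_pM2r // ler_nat.
apply: (lc_limit_good tG LC (c := p) (rho := rho') (g := fun m => iter (euler_steps dl m s) (h m))) => //.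
- by move=> x /p'B/pB/BD.
- apply: (unear (filter_and _ hH key)) => m [[Om [co BO _]] h2].
  apply: (comp_iter co); first by move=> x /p'B/pB/BD/(lc_DT LC).
  by move=> k x km xr; apply/BO/pB; apply: h2 => //; exact: ltnW.
- by apply: (unear key) => m h2 x xr; apply/BD/pB; exact: h2.
Qed.

(** Positive times come from iterating [h], negative times from iterating its approximate inverse
    [k] of [fam_inv], whose rescaled limit is the opposite field. *)
Lemma fam_flowbox h (O : set 'rV[R]_q) p : fam h -> open O -> O `<=` B -> O p -> flowbox G i O (lim_field h) p.
Proof.
move=> hf oO OB Op; have Bp := OB _ Op; have [k kf Hk] := fam_inv hf.
have kl := fam_inv_limit hf kf Hk.
have [_ hl _] := fam_limit tG LC hf.
have [L1 L10 HL1] := fam_lip tG LC hf; have [L2 L20 HL2] := fam_lip tG LC kf.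
have [_ [C1 C10 HC1]] := hf; have [_ [C2 C20 HC2]] := kf.
have /near_normP[rho rho0 Hrho] := open_near oO Op.
have pO : ball p rho `<=` O by move=> x; rewrite ballE; exact: Hrho.
have pB := subset_trans pO OB.
have K0 : 0 <= C1 + C2 by rewrite addr_ge0 // ltW.
have L0 : 0 <= L1 + L2 by exact: addr_ge0.
have d0 : \forall m \near U, 0 < dl m by exact: (dl_gt0 LC).
have hK : \forall m \near U, forall x, ball p rho x -> `|h m x - x| <= (C1 + C2) * dl m.
  apply: (unear (filter_and _ HC1 d0)) => m [H dm] x /pB Bx; have := H x Bx; rewrite /jd mulrDl => h1.
  by apply: le_trans (ler_wpDr _ h1); rewrite ?lerDl // mulr_ge0 // ltW.
have kK : \forall m \near U, forall x, ball p rho x -> `|k m x - x| <= (C1 + C2) * dl m.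
  apply: (unear (filter_and _ HC2 d0)) => m [H dm] x /pB Bx; have := H x Bx; rewrite /jd mulrDl => h1.
  by apply: le_trans (ler_wpDl _ h1); rewrite ?lerDl // mulr_ge0 // ltW.
have hL : \forall m \near U, forall x y, ball p rho x -> ball p rho y ->
     `|(h m x - x) - (h m y - y)| <= (L1 + L2) * dl m * `|x - y|.
  apply: (unear (filter_and _ HL1 d0)) => m [H dm] x y /pB Bx /pB By; apply: le_trans (H x y Bx By) _.
  by rewrite ler_wpM2r // ler_pM2r // lerDl.
have kL : \forall m \near U, forall x y, ball p rho x -> ball p rho y ->
     `|(k m x - x) - (k m y - y)| <= (L1 + L2) * dl m * `|x - y|.
  apply: (unear (filter_and _ HL2 d0)) => m [H dm] x y /pB Bx /pB By; apply: le_trans (H x y Bx By) _.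
  by rewrite ler_wpM2r // ler_pM2r // lerDr.
have rr : rho / 2 < rho by lra.
have [tau [E [tau0 tr HE]]] := euler_flow (UF := UF) K0 L0 rr d0 (dl_cvg LC) hK kK hL kL
  (fun x Bx => hl x (pB _ Bx)) (fun x Bx => kl x (pB _ Bx)).
exists tau, (rho / 2), E; split=> //; first lra.
move=> y By s st; have [h1 h2 h3 h4] := HE y By; have [h5 h6 h7] := h2 s st.
split=> //; first exact: pO.
have [s0|s0] := leP 0 s.
  have ss : 0 <= s < tau by rewrite s0 -(ger0_norm s0).
  by apply: (fam_flow_good y K0 hf pB tr hK ss _ By) => x Bx; have [_ _ + _] := HE x Bx; apply.
have ss : 0 <= - s < tau by rewrite oppr_ge0 ltW //= -(ltr0_norm s0).
apply: (fam_flow_good y K0 kf pB tr kK ss _ By) => x Bx; have [_ _ _ /(_ _ ss)] := HE x Bx.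
by rewrite opprK.
Qed.

Lemma fam_central h : fam h -> central_section i B (lim_field h).
Proof.
move=> hf; have [sZ _ _] := fam_limit tG LC hf.
apply: (flowbox_central tG) => //; first exact: ball_open.
  by move=> x /(lc_BD LC)/(lc_DT LC).
by move=> x Bx; apply: fam_flowbox => //; exact: ball_open.
Qed.
End LimitFields.

Lemma derive_seq (R : realType) (V : normedModType R) (c : R -> V) (s : R) (v : V) (U : set_system nat) (UF : UltraFilter U)
    (d : nat -> R) : is_derive s 1 c v -> (\forall m \near U, 0 < d m) -> d m @[m --> U] --> (0 : R) ->
  (d m)^-1 *: (c (s + d m) - c s) @[m --> U] --> v.
Proof.
move=> [Dc <-] d0 dc.
have H : (fun h : R => h^-1 *: ((c \o shift s) (h *: 1) - c s)) @ 0^' --> 'D_1 c s by exact: Dc.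
have dn : d m @[m --> U] --> 0^'.
  move=> P [e /= e0 He]; have h1 : \forall m \near U, `|0 - d m| < e by exact: ((cvgrPdist_lt _ _).1 dc _ e0).
  by apply: (unear (filter_and _ h1 d0)) => m [a b]; apply: He => //; rewrite lt0r_neq0.
have E : (fun m => (d m)^-1 *: (c (s + d m) - c s)) = (fun h : R => h^-1 *: ((c \o shift s) (h *: 1) - c s)) \o d.
  by apply/funext => m /=; rewrite [_ *: 1]mulr1 [d m + s]addrC.
by rewrite E; exact: cvg_comp dn H.
Qed.

(** * Central germs as limit fields *)

Section Germs.
Variables (R : realType) (n q : nat) (M : manifold R n) (F : foliation M q).
Variable (G : fidx F -> 'rV[R]_q -> 'M[R]_q).
Hypothesis tG : transverse_metric G.
Implicit Types (i j : fidx F) (x y : 'rV[R]_q) (O : set 'rV[R]_q).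

Lemma central_sub i O O' (X : selfmap R q) : central_section i O X -> open O' -> O' `<=` O ->
  central_section i O' X.
Proof.
move=> [oO OT sX H] oO' OO; split=> //; first exact: subset_trans OT.
  by move=> j; exact: smooth_sub (sX j).
move=> V e Phi [h1 h2 h3 h4]; apply: (H V); split=> //; first exact: subset_trans OO.
by move=> t s Vt se; have [a b] := h4 t s Vt se; split=> //; exact: OO.
Qed.

Lemma flowbox_mono i O O' (X X' : selfmap R q) x : flowbox G i O X x -> O `<=` O' ->
  (forall y, O y -> X y = X' y) -> flowbox G i O' X' x.
Proof.
move=> [tau [rho [E [tau0 rho0 H]]]] OO XX; exists tau, rho, E; split=> // y By s st.
by have [h1 h2 h3 h4] := H y By s st; split=> //; [exact: OO|rewrite -XX].
Qed.

Lemma flowbox_scale i O (X : selfmap R q) x (c : R) : flowbox G i O X x ->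
  flowbox G i O (fun y => c *: X y) x.
Proof.
move=> [tau [rho [E [tau0 rho0 H]]]]; have c1 : 0 < `|c| + 1 by rewrite ltr_wpDl.
exists (tau / (`|c| + 1)), rho, (fun s => E (c * s)); split=> //; first by rewrite divr_gt0.
move=> y By s; rewrite ltr_pdivlMr // => st.
have cs : `|c * s| < tau.
  by rewrite normrM; apply: le_lt_trans st; rewrite mulrC ler_wpM2l // lerDl.
have [h1 h2 h3 h4] := H y By _ cs; split=> //; last by rewrite mulr0.
exact: (is_derive_curve (is_derive_scale c s) h2).
Qed.

(** The approximating jets have moving sources as well as moving targets, so the isometry relation
    passes to the limit through continuity of G at both ends. *)
Lemma closure_isometry i j x y A (U : set_system nat) (UF : UltraFilter U) :
  (forall P : nat -> Prop, (\forall n \near \oo, P n) -> \forall n \near U, P n) ->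
  closure (holonomy_jets i j) (x, y, A) -> trans i x -> trans j y -> A *m G j y *m A^T = G i x.
Proof.
move=> HU cl Tx Ty.
have sG k (a b : 'I_q) : smooth_on (trans k) (fun t => G k t a b) by case: tG => H _ _ _; exact: H.
have cG k t : trans k t -> {for t, continuous (G k)}.
  by move=> Tt; apply: cont_mx_entries => a b; exact: Ck_cont (sG k a b 0%N) Tt.
pose P (m : nat) (p : 'rV[R]_q * ('rV[R]_q * 'M[R]_q)) := [/\ p.2.2 *m G j p.2.1 *m p.2.2^T = G i p.1,
  `|p.1 - x| <= m.+1%:R^-1, `|p.2.1 - y| <= m.+1%:R^-1 & `|p.2.2 - A| <= m.+1%:R^-1].
have /choice[p Hp] : forall m, exists p, P m p.
  move=> m; have m0 : 0 < m.+1%:R^-1 :> R by rewrite invr_gt0.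
  have [Om [h [s [co Os h1 h2 h3]]]] := closure_jet cl m0.
  by exists (s, (h s, Jac h s)); split=> //=; [exact: tG_composite co Os| | |]; exact: ltW.
have [_ d0] := inv_succ_scale R HU.
have cv (V : normedModType R) (u : nat -> V) (l : V) : (forall m, `|u m - l| <= m.+1%:R^-1) -> u m @[m --> U] --> l.
  move=> H; have -> : u = (fun m => (u m - l) + l) by apply/funext => m; rewrite subrK.
  rewrite -[X in _ --> X]add0r; apply: cvgD; last exact: cvg_cst.
  by apply: (@cvg0_le _ _ _ _ _ _ d0); apply: filterE.
have c1 : (p m).1 @[m --> U] --> x by apply: cv => m; have [] := Hp m.
have c2 : (p m).2.1 @[m --> U] --> y by apply: cv => m; have [] := Hp m.
have c3 : (p m).2.2 @[m --> U] --> A by apply: cv => m; have [] := Hp m.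
have c4 := cvg_mulmx (UF := UF) (cvg_mulmx (UF := UF) c3 (cvg_comp_cont (UF := UF) c2 (cG _ _ Ty))) (cvg_trmx (UF := UF) c3).
have c5 := cvg_comp_cont (UF := UF) c1 (cG _ _ Tx).
have E : (fun m => (p m).2.2 *m G j (p m).2.1 *m (p m).2.2^T) = (fun m => G i (p m).1).
  by apply/funext => m; have [] := Hp m.
by rewrite E in c4; apply: cvg_unique c4 c5; exact: norm_hausdorff.
Qed.

(** The clauses of [local_ctx] persist when [r0] shrinks, so the minimum of the radii of
    [jet_control] and [uniform_extension] serves, for any ultrafilter and any scale. *)
Lemma local_ctx_exists (U : set_system nat) (UF : UltraFilter U) (dl : nat -> R) i x d : closed_manifold M ->
  (forall P : nat -> Prop, (\forall n \near \oo, P n) -> \forall n \near U, P n) ->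
  (\forall m \near U, 0 < dl m <= 1) -> dl m @[m --> U] --> (0 : R) ->
  trans i x -> 0 < d -> exists rT r0 : R, r0 < d /\ local_ctx G U dl i x rT r0.
Proof.
move=> cM HU dl1 dlc Tx d0.
have sG (a b : 'I_q) : smooth_on (trans i) (fun t => G i t a b) by case: tG => H _ _ _; exact: H.
have /near_normP[r r_0 Hr] := open_near (@trans_open _ _ _ _ F i) Tx.
have rT0 : 0 < r / 2 by rewrite divr_gt0.
have cT : cball x (r / 2) `<=` trans i by move=> y /= yr; apply: Hr; apply: le_lt_trans yr _; lra.
have [r1 /andP[r10 r1T] JC] := jet_control (@trans_open _ _ _ _ F i) sG (fun t => tG_posdef tG (t := t)) rT0 cT.
have [r2 r20 [r2T HUE]] := uniform_extension tG cM Tx rT0.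
pose r0 := Num.min (d / 2) (Num.min r1 r2).
have r00 : 0 < r0 by rewrite !lt_min r10 r20 divr_gt0.
have r0d : r0 < d by rewrite gt_min; apply/orP; left; lra.
have r01 : r0 <= r1 by rewrite !ge_min lexx !orbT.
have r02 : r0 <= r2 by rewrite !ge_min lexx !orbT.
exists (r / 2), r0; split=> //; split=> //.
- by rewrite r00; exact: le_lt_trans r1T.
- move=> c rho h k cB rr; apply: JC => //; exact: le_trans r01.
move=> Om h s co Os; rewrite !ballE => Bs Bhs.
have [|| O' [phi [co' BO Bphi E]]] := HUE Om h s co Os.
- by rewrite ballE; exact: lt_le_trans r02.
- by rewrite ballE; exact: lt_le_trans r02.
have sub : ball x r0 `<=` ball x r2 by move=> y; rewrite !ballE => /lt_le_trans; apply.
exists phi => //; exists O'; split=> //; first exact: subset_trans BO.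
by move=> y /sub; exact: Bphi.
Qed.
End Germs.

Section Extensions.
Variables (R : realType) (n q : nat) (M : manifold R n) (F : foliation M q).
Variable (G : fidx F -> 'rV[R]_q -> 'M[R]_q).
Hypothesis tG : transverse_metric G.
Variable U : set_system nat.
Context {UF : UltraFilter U}.
Variable dl : nat -> R.
Variables (i : fidx F) (t0 : 'rV[R]_q) (rT r0 : R).
Implicit Types (x y : 'rV[R]_q) (A : 'M[R]_q) (phi psi : selfmap R q).
Implicit Types (h : nat -> selfmap R q).

Notation B := (ball t0 r0).
Notation isoT := (isom (trans i) (G i)).
Notation hol := (local_hol i t0 rT r0).
Notation fam := (local_fam U dl i t0 rT r0).
Notation lim_field h := (rescaled_limit U h dl).
Hypothesis LC : local_ctx G U dl i t0 rT r0.

Let BT : B `<=` trans i. Proof. exact: subset_trans (lc_BD LC) (lc_DT LC). Qed.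
Let HU : forall P : nat -> Prop, (\forall m \near \oo, P m) -> \forall m \near U, P m. Proof. by have [_ _ _ _ []] := LC. Qed.

Lemma local_hol_diff phi x : hol phi -> B x -> differentiable phi x.
Proof.
move=> [Om [co BO _]] Bx; have [oOm _ sp _] := composite_dom co.
by apply: smooth_map_diff oOm sp _; exact: BO.
Qed.

Lemma jd_triangle phi psi chi x : jd phi psi x <= jd phi chi x + jd chi psi x.
Proof.
by rewrite /jd addrACA; apply: lerD; exact: ler_distD.
Qed.

(** By jet control a bound on the 1-jets at a single point already gives one on the whole ball. *)
Lemma fam_of_jd h (C : R) x : 0 <= C -> B x -> (\forall m \near U, hol (h m)) ->
  (\forall m \near U, jd (h m) id x <= C * dl m) -> fam h.
Proof.
move=> C0 Bx H HC; split=> //; exists (2 * C + 1); first by rewrite ltr_wpDl // mulr_ge0.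
apply: (unear (filter_and _ (filter_and _ H (dl_gt0 LC)) HC)) => m [[h1 h0] h2] y By.
have := jet_id LC (c := t0) (r := r0) (x := y) (x' := x) (fun z Bz => Bz) (lexx _) (local_hol_isom tG h1) (isom_id (G i) BT)
  (fun z Bz => local_hol_D h1 Bz) (lc_BD LC) By Bx.
move=> h3; apply: le_trans h3 _; rewrite [X in _ <= X]mulrDl -mulrA; apply: ler_wpDr; first by rewrite mul1r ltW.
by rewrite ler_pM2l.
Qed.

Lemma fam_id : fam (fun _ => id).
Proof.
have [r00 _ _] := lc_pos LC.
apply: (@fam_of_jd _ 0 t0) => //; first exact: ballxx.
  apply: filterE => _; exists (trans i); split=> //; first exact: composite_id.
  exact: lc_BD LC.
by apply: filterE => m; rewrite mul0r /jd !subrr !normr0 addr0.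
Qed.

Lemma fam_id_limit x : B x -> lim_field (fun _ => id) x = 0.
Proof.
move=> Bx; have [_ hl _] := fam_limit tG LC fam_id.
apply: cvg_unique (hl x Bx) _; first exact: norm_hausdorff.
have -> : (fun m => (dl m)^-1 *: (x - x)) = (fun _ => 0) by apply/funext => m; rewrite subrr scaler0.
exact: cvg_cst.
Qed.

(* The control of the distance of two isometries by their 1-jets at one point
   passes to the limit fields. *)
Lemma fam_eq h h' x : fam h -> fam h' -> B x -> lim_field h x = lim_field h' x ->
  Jac (lim_field h) x = Jac (lim_field h') x -> forall y, B y -> lim_field h y = lim_field h' y.
Proof.
move=> hf hf' Bx e1 e2 y By.
have [s1 l1 j1] := fam_limit tG LC hf; have [s2 l2 j2] := fam_limit tG LC hf'.
pose b m := 2 * (`|(dl m)^-1 *: (h m x - x) - (dl m)^-1 *: (h' m x - x)| +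
   `|(dl m)^-1 *: (Jac (h m) x - 1%:M) - (dl m)^-1 *: (Jac (h' m) x - 1%:M)|).
have bc : b m @[m --> U] --> (0 : R).
  rewrite (_ : 0 = 2 * (`|lim_field h x - lim_field h' x| + `|Jac (lim_field h) x - Jac (lim_field h') x|) :> R); last first.
    by rewrite e1 e2 !subrr !normr0 addr0 mulr0.
  apply: cvgMr; apply: cvgD; apply: cvg_norm; apply: cvgB; [exact: l1|exact: l2|exact: j1|exact: j2].
apply/eqP; rewrite -subr_eq0 -normr_le0.
apply: (lim_le_lim (UF := UF) (u := fun m => (dl m)^-1 *: (h m y - y) - (dl m)^-1 *: (h' m y - y)) (b := b)) => //.
    by apply: cvgB; [exact: l1|exact: l2].
  apply: (unear (filter_and _ (filter_and _ hf.1 hf'.1) (dl_gt0 LC))) => m [[h1 h2] d0].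
  have := jet_id LC (c := t0) (r := r0) (x := y) (x' := x) (fun z Bz => Bz) (lexx _) (local_hol_isom tG h1) (local_hol_isom tG h2)
    (fun z Bz => local_hol_D h1 Bz) (fun z Bz => local_hol_D h2 Bz) By Bx.
  rewrite /jd /b -!scalerBr !normrZ !gtr0_norm ?invr_gt0 // -mulrDr mulrCA.
  have E (p : nat) (u v w : 'M[R]_(p, q)) : u - w - (v - w) = u - v by rewrite opprB addrA subrK.
  rewrite !E => H; rewrite ler_pM2l ?invr_gt0 //; apply: le_trans H; by rewrite lerDl.
Qed.

(** The germ at [t0] of the composite h m o h' m extends to the ball as [f m], and agrees with the
    composite on smaller balls by jet control. The rescaled displacement of a composite is the sum
    of the two up to O(dl m). *)
Lemma fam_add h h' : fam h -> fam h' -> exists2 f, fam f &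
  forall x, B x -> lim_field f x = lim_field h x + lim_field h' x.
Proof.
move=> hf hf'; have [r00 r0T rT0] := lc_pos LC.
have B0 : B t0 by exact: ballxx.
have [C1 C10 HC1] := lc_jac_bound tG LC.
have [hH [C C0 HC]] := hf; have [hH' [C' C0' HC']] := hf'.
pose P m (f : selfmap R q) := hol (h m) -> hol (h' m) -> B (h' m t0) -> B (h m (h' m t0)) ->
  hol f /\ \forall x \near t0, f x = h m (h' m x).
have /choice[f Hf] : forall m, exists f, P m f.
  move=> m; have [[[a b] [c d]]|nab] := pselect ((hol (h m) /\ hol (h' m)) /\ (B (h' m t0) /\ B (h m (h' m t0)))); last first.
    by exists id => a b c d; exfalso; apply: nab.
  have [Om [co BO _]] := a; have [Op [co' BO' _]] := b.
  have [_ _ _ HUE _] := LC.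
  have [|||phi h1 h2] := HUE _ _ t0 (composite_comp co' co) => //.
    by split; [exact: BO'|exact: BO].
  by exists phi.
have jd0 : \forall m \near U, [/\ hol (h m), hol (h' m), `|h' m t0 - t0| <= C' * dl m,
    `|h m (h' m t0) - t0| <= (C + C') * dl m & B (h' m t0) /\ B (h m (h' m t0))].
  apply: (unear (filter_and _ (filter_and _ (filter_and _ hH hH') (filter_and _ HC HC'))
    (filter_and _ (dl_small LC C' r00) (dl_small LC (C + C') r00)))) => m [[[h1 h2] [h3 h4]] [h5 h6]].
  have h7 : `|h' m t0 - t0| <= C' * dl m by apply: le_trans (h4 _ B0); rewrite /jd lerDl.
  have h8 : B (h' m t0) by rewrite ballE; exact: le_lt_trans h5.
  have h9 : `|h m (h' m t0) - t0| <= (C + C') * dl m.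
    rewrite -(subrK (h' m t0) (h m _)) -addrA mulrDl; apply: le_trans (ler_normD _ _) _; apply: lerD => //.
    by apply: le_trans (h3 _ h8); rewrite /jd lerDl.
  by split=> //; split=> //; rewrite ballE; exact: le_lt_trans h6.
have main : \forall m \near U, [/\ hol (f m), jd (f m) id t0 <= (C + C' + q%:R * C' * C1 + C) * dl m,
   f m t0 = h m (h' m t0) & Jac (f m) t0 = Jac (h' m) t0 *m Jac (h m) (h' m t0)].
  apply: (unear (filter_and _ jd0 (filter_and _ HC HC'))) => m [[h1 h2 h3 h4 [h5 h6]] [h7 h8]].
  have [f1 f2] := Hf m h1 h2 h5 h6.
  have f3 : f m t0 = h m (h' m t0) by exact: (nbhs_singleton f2).
  have f4 : Jac (f m) t0 = Jac (h' m) t0 *m Jac (h m) (h' m t0).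
    rewrite -jac_comp; [|exact: local_hol_diff|exact: local_hol_diff].
    symmetry; apply: jac_near f2; exact: local_hol_diff.
  split=> //; rewrite /jd f3 f4 jac_id.
  have -> : Jac (h' m) t0 *m Jac (h m) (h' m t0) - 1%:M =
     (Jac (h' m) t0 - 1%:M) *m Jac (h m) (h' m t0) + (Jac (h m) (h' m t0) - 1%:M).
    by rewrite mulmxBl mul1mx addrA subrK.
  rewrite -[_ + C' + _ + _]addrA mulrDl; apply: lerD => //; rewrite mulrDl.
  apply: le_trans (ler_normD _ _) _; apply: lerD; last first.
    by apply: le_trans (h7 _ h5); rewrite /jd jac_id lerDr.
  apply: le_trans (mulmx_norm_le _ _) _.
  have a1 : `|Jac (h m) (h' m t0)| <= C1.
    apply: (HC1 t0 r0 (h m)) => //; [exact: lc_BD LC|exact: (local_hol_isom tG h1)|by move=> z; exact: (local_hol_D h1)].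
  have a2 : `|Jac (h' m) t0 - 1%:M| <= C' * dl m by apply: le_trans (h8 _ B0); rewrite /jd jac_id lerDr.
  have -> : q%:R * C' * C1 * dl m = q%:R * (C' * dl m) * C1 by ring.
  by apply: ler_pM; rewrite ?mulr_ge0 // ler_wpM2l.
have ff : fam f.
  apply: (@fam_of_jd _ (C + C' + q%:R * C' * C1 + C) t0) => //.
  - by rewrite !addr_ge0 // ?mulr_ge0 // ltW.
  - by apply: (unear main) => m [].
  - by apply: (unear main) => m [].
exists f => // x Bx.
have [_ lf _] := fam_limit tG LC ff; have [_ lh _] := fam_limit tG LC hf; have [_ lh' _] := fam_limit tG LC hf'.
have [r [xr rr rp]] : exists r, [/\ ball t0 r x, r < r0 & 0 < r].
  move: Bx; rewrite ballE => b; exists ((`|x - t0| + r0) / 2); rewrite ballE.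
  by have := normr_ge0 (x - t0); split; lra.
have rB : ball t0 r `<=` B by move=> y; rewrite !ballE => /lt_trans; apply.
have [L L0 HL] := fam_lip tG LC hf.
have e1 : 0 < r0 - r by rewrite subr_gt0.
have h'B : \forall m \near U, forall y, ball t0 r y -> B (h' m y).
  apply: (unear (filter_and _ HC' (dl_small LC C' e1))) => m [h1 h2] y yr.
  rewrite ballE -(subrK y (h' m y)) -addrA; apply: le_lt_trans (ler_normD _ _) _.
  have := h1 y (rB _ yr); rewrite /jd; have := normr_ge0 (Jac (h' m) y - Jac id y); move: yr h2; rewrite ballE /=; lra.
have Ef : \forall m \near U, f m x = h m (h' m x).
  apply: (unear (filter_and _ main (filter_and _ jd0 h'B))) => m [[m1 m2 m3 m4] [[h1 h2 _ _ [h5 h6]] h3]].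
  have isoC : isoT (ball t0 r) (h m \o h' m).
    apply: (isom_comp (@ball_open _ _ t0 r) (@ball_open _ _ t0 r0) h3).
      exact: isom_sub rB (local_hol_isom tG h2).
    exact: (local_hol_isom tG h1).
  have isoF : isoT (ball t0 r) (f m) by apply: isom_sub rB _; exact: (local_hol_isom tG m1).
  have := jet_id LC (c := t0) (r := r) (x := x) (x' := t0) rB (ltW rr) isoF isoC
    (fun z Bz => local_hol_D m1 (rB _ Bz)) (fun z Bz => local_hol_D h1 (h3 _ Bz)) xr (ballxx _ rp).
  have -> : jd (f m) (h m \o h' m) t0 = 0.
    rewrite /jd /= m3 subrr normr0 add0r jac_comp; [|exact: local_hol_diff|exact: local_hol_diff].
    by rewrite m4 subrr normr0.
  rewrite mulr0 => H; apply/eqP; rewrite -subr_eq0 -normr_le0; apply: le_trans H.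
  by rewrite /jd /= lerDl.
apply: cvg_unique (lf x Bx) _; first exact: norm_hausdorff.
have key : ((dl m)^-1 *: (f m x - x) - ((dl m)^-1 *: (h m x - x) + (dl m)^-1 *: (h' m x - x))) @[m --> U] --> (0 : 'rV[R]_q).
  apply: (@cvg0_le _ _ _ _ _ (fun m => L * C' * dl m)).
    by rewrite -(mulr0 (L * C')); apply: cvgMr; exact: dl_cvg LC.
  apply: (unear (filter_and _ (filter_and _ Ef h'B) (filter_and _ (filter_and _ HL HC') (dl_gt0 LC)))).
  move=> m [[h1 h2] [[h3 h4] d0]].
  have := h3 (h' m x) x (h2 _ xr) Bx; rewrite -!scalerDr -scalerBr h1.
  have -> : h m (h' m x) - h' m x - (h m x - x) = h m (h' m x) - x - (h m x - x + (h' m x - x)).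
    by apply/rowP => a; rewrite !mxE; ring.
  rewrite normrZ gtr0_norm ?invr_gt0 // => h5.
  rewrite ler_pdivrMl //; apply: le_trans h5 _.
  have h6 : `|h' m x - x| <= C' * dl m by apply: le_trans (h4 _ Bx); rewrite /jd lerDl.
  apply: le_trans (ler_wpM2l _ h6) _; first by rewrite mulr_ge0 // ltW.
  by rewrite le_eqVlt; apply/orP; left; apply/eqP; ring.
have -> : (fun m => (dl m)^-1 *: (f m x - x)) = (fun m => ((dl m)^-1 *: (f m x - x) -
   ((dl m)^-1 *: (h m x - x) + (dl m)^-1 *: (h' m x - x))) + ((dl m)^-1 *: (h m x - x) + (dl m)^-1 *: (h' m x - x))).
  by apply/funext => m; rewrite subrK.
rewrite -[lim_field h x + _]add0r; apply: cvgD => //; apply: cvgD; [exact: lh|exact: lh'].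
Qed.
End Extensions.

Section Ext.
Variables (R : realType) (n q : nat) (M : manifold R n) (F : foliation M q).
Variable (G : fidx F -> 'rV[R]_q -> 'M[R]_q).
Hypothesis tG : transverse_metric G.
Variable U : set_system nat.
Context {UF : UltraFilter U}.
Variable dl : nat -> R.
Variables (i : fidx F) (t0 : 'rV[R]_q) (rT r0 : R).
Implicit Types (x y : 'rV[R]_q) (A : 'M[R]_q) (phi psi : selfmap R q).
Implicit Types (h : nat -> selfmap R q).

Notation B := (ball t0 r0).
Notation isoT := (isom (trans i) (G i)).
Notation hol := (local_hol i t0 rT r0).
Notation fam := (local_fam U dl i t0 rT r0).
Notation lim_field h := (rescaled_limit U h dl).
Hypothesis LC : local_ctx G U dl i t0 rT r0.

Let BT : B `<=` trans i. Proof. exact: subset_trans (lc_BD LC) (lc_DT LC). Qed.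
Let HU : forall P : nat -> Prop, (\forall m \near \oo, P m) -> \forall m \near U, P m. Proof. by have [_ _ _ _ []] := LC. Qed.

(** The converse of [fam_central]: the flow of X at time [dl m] has its jets in the closure of the
    holonomy jets, hence is followed closely by a holonomy map, whose rescaled limit is X.
    Completeness extends that map to the fixed ball, so a field on a small ball continues to all of
    it. *)
Lemma fam_ext (s : 'rV[R]_q) rho rho' (X : selfmap R q) : central_section i (ball s rho) X ->
  ball s rho `<=` B -> 0 < rho' < rho -> rho <= r0 ->
  exists2 h, fam h & forall x, ball s rho' x -> lim_field h x = X x.
Proof.
move=> [oO OT sX HX] sB /andP[r'0 r'r] rr0.
have d0 : \forall m \near U, 0 < dl m by exact: (dl_gt0 LC).
pose rho1 := (rho + rho') / 2.
have r1r : rho1 < rho by rewrite /rho1; lra.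
have r'r1 : rho' < rho1 by rewrite /rho1; lra.
have csub : cball s rho1 `<=` ball s rho by move=> x /= xr; rewrite ballE; exact: le_lt_trans xr r1r.
have bsub : ball s rho1 `<=` ball s rho by move=> x; rewrite !ballE => /lt_trans; apply.
have psub : ball s rho' `<=` ball s rho1 by move=> x; rewrite !ballE => /lt_trans; apply.
have [C C0 [XC XL]] := smooth_map_cball oO sX csub.
have XC1 x : ball s rho1 x -> `|X x| <= C by rewrite ballE => /ltW; exact: XC.
(* The Euler maps of X itself: [euler_flow] is used here as the existence theorem for the flow of
   X. *)
pose hh m x := x + dl m *: X x; pose kk m x := x - dl m *: X x.
have hK : \forall m \near U, forall x, ball s rho1 x -> `|hh m x - x| <= C * dl m.
  by apply: (unear d0) => m dm x /XC1 Bx; rewrite /hh addrC addKr normrZ gtr0_norm // mulrC ler_pM2r.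
have kK : \forall m \near U, forall x, ball s rho1 x -> `|kk m x - x| <= C * dl m.
  by apply: (unear d0) => m dm x /XC1 Bx; rewrite /kk addrC addKr normrN normrZ gtr0_norm // mulrC ler_pM2r.
have hL : \forall m \near U, forall x y, ball s rho1 x -> ball s rho1 y ->
   `|(hh m x - x) - (hh m y - y)| <= C * dl m * `|x - y|.
  apply: (unear d0) => m dm x y Bx By; rewrite /hh ![_ + dl m *: _ - _]addrC !addKr -scalerBr normrZ gtr0_norm //.
  by rewrite mulrAC mulrC ler_pM2r //; exact: XL.
have kL : \forall m \near U, forall x y, ball s rho1 x -> ball s rho1 y ->
   `|(kk m x - x) - (kk m y - y)| <= C * dl m * `|x - y|.
  apply: (unear d0) => m dm x y Bx By.
  have -> : kk m x - x - (kk m y - y) = dl m *: (X y - X x) by apply/rowP => a; rewrite !mxE; ring.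
  by rewrite normrZ gtr0_norm // mulrAC mulrC ler_pM2r // distrC; exact: XL.
have hZ x : ball s rho1 x -> (dl m)^-1 *: (hh m x - x) @[m --> U] --> X x.
  move=> _; apply: (@cvg_trans _ (X x @[_ --> U])); last exact: cvg_cst.
  by apply: near_eq_cvg; apply: (unear d0) => m dm; rewrite /hh addrC addKr scalerA mulVf ?scale1r // lt0r_neq0.
have kZ x : ball s rho1 x -> (dl m)^-1 *: (kk m x - x) @[m --> U] --> - X x.
  move=> _; apply: (@cvg_trans _ (- X x @[_ --> U])); last exact: cvg_cst.
  by apply: near_eq_cvg; apply: (unear d0) => m dm; rewrite /kk addrC addKr scalerN scalerA mulVf ?scale1r // lt0r_neq0.
have [tau [E [tau0 tr HE]]] := euler_flow (UF := UF) (ltW C0) (ltW C0) r'r1 d0 (dl_cvg LC) hK kK hL kL hZ kZ.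
have LF : local_flow (ball s rho) X (ball s rho') tau E.
  split; first exact: ball_open.
  - by move=> x /psub/bsub.
  - by move=> x /HE[].
  - by move=> x t /HE[_ H _ _] tt; have [h1 _ h3] := H t tt; split=> //; exact: bsub.
have HE1 := HX _ _ _ LF.
pose e m := E (dl m).
have small : \forall m \near U, `|dl m| < tau.
  apply: (unear (filter_and _ d0 (dl_small LC 1 tau0))) => m [h1 h2]; by rewrite gtr0_norm // -(mul1r (dl m)).
have s0 : ball s rho' s by exact: ballxx.
have eD : \forall m \near U, forall x, ball s rho' x -> B (e m x).
  apply: (unear small) => m h1 x /HE[_ H _ _]; have [h2 _ _] := H _ h1; exact: (sB _ (bsub _ h2)).
have eiso : \forall m \near U, isoT (ball s rho') (e m).
  apply: (unear (filter_and _ small eD)) => m [h1 h2].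
  have [[[h3 h4 h5] [h6 h7 h8]] h9] := HE1 _ h1.
  have h10 x : ball s rho' x -> trans i (e m x) by move=> Bx; exact: (BT (h2 x Bx)).
  split=> // x Bx; have h11 := h9 x Bx; rewrite /jet1 -JacE in h11.
  exact: closure_isometry UF HU h11 (h4 _ Bx) (h10 _ Bx).
have [C1 C10 HC1] : exists2 C1 : R, 0 < C1 & \forall m \near U, forall x, ball s rho' x -> jd (e m) id x <= C1 * dl m.
  apply: (jd_of_C0 tG LC (K := C)) => //.
  - by move=> x /psub/bsub/sB.
  - by apply: le_trans rr0; exact: ltW.
  - exact: ltW.
  - exact: dl_cvg LC.
  - by apply: (unear eD) => m H x Bx; apply: (lc_BD LC); exact: H.
  - apply: (unear (filter_and _ small d0)) => m [h1 h2] x /HE[_ H _ _].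
    by have [_ h3 _] := H _ h1; rewrite gtr0_norm in h3.
(* An error of order dl^2 disappears after division by dl. Target and Jacobian at the point s' near
   s contribute 2 dl^2 each, and jet control doubles the sum, hence 8. *)
pose P m (f : selfmap R q) := `|dl m| < tau -> 0 < dl m -> (forall x, ball s rho' x -> B (e m x)) ->
  isoT (ball s rho') (e m) -> hol f /\ forall x, ball s rho' x -> jd f (e m) x <= 8 * dl m ^+ 2.
have s'B : ball s rho' `<=` B by move=> x /psub/bsub/sB.
have /choice[f Hf] : forall m, exists f, P m f.
  move=> m; have [[[a b] [c d]]|nab] := pselect ((`|dl m| < tau /\ 0 < dl m) /\
     ((forall x, ball s rho' x -> B (e m x)) /\ isoT (ball s rho') (e m))); last first.
    by exists id => a b c d; exfalso; apply: nab.
  have [_ cl] := HE1 _ a; have {cl}:= cl s s0; rewrite /jet1 -JacE => cl.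
  have [se _ _] := d.
  have oB := @ball_open _ _ s rho'.
  have dd0 : 0 < dl m ^+ 2 by rewrite exprn_gt0.
  have N1 : \forall y \near e m s, B y by apply: open_near (c _ s0); exact: ball_open.
  have /near_normP[d1 d10 H1] := near_and (open_near oB s0) (near_and ((contP _ _).1 (smooth_cont se s0) _ dd0)
     ((contP _ _).1 (cont_jac oB se s0) _ dd0)).
  have /near_normP[d2 d20 H2] := N1.
  have mn0 : 0 < Num.min (dl m ^+ 2) (Num.min d1 d2) by rewrite !lt_min dd0 d10.
  have [Om [k [s' [co Os]]]] := closure_jet cl mn0.
  rewrite !lt_min => /and3P[_ a2 _] /and3P[b1 _ b3] /and3P[c1 _ _].
  have [Bs' [e1 e2]] := H1 _ a2.
  have [_ _ _ HUE _] := LC.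
  have [||phi p1 p2] := HUE _ _ s' co Os; first exact: s'B.
    exact: H2.
  exists phi => _ _ _ _; split=> // x Bx.
  have iphi : isoT (ball s rho') phi by apply: isom_sub s'B _; exact: (local_hol_isom tG p1).
  have := jet_id LC (c := s) (r := rho') (x := x) (x' := s') s'B _ iphi d
    (fun z Bz => local_hol_D p1 (s'B _ Bz)) (fun z Bz => lc_BD LC (c z Bz)) Bx Bs'.
  move=> /(_ (le_trans (ltW r'r) rr0)) H; apply: le_trans H _.
  have [oOm _ sk _] := composite_dom co.
  have -> : jd phi (e m) s' = jd k (e m) s'.
    rewrite /jd (nbhs_singleton p2).
    have -> // : Jac phi s' = Jac k s'.
    symmetry; apply: jac_near; first exact: (local_hol_diff p1 (s'B _ Bs')).
    exact: p2.
  have h1 := ler_distD (e m s) (k s') (e m s'); have h2 := ler_distD (Jac (e m) s) (Jac k s') (Jac (e m) s').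
  rewrite [`|e m s - _|]distrC in h1; rewrite [`|Jac (e m) s - _|]distrC in h2.
  by rewrite /jd; move: b1 c1 e1 e2 h1 h2 => *; lra.
have main : \forall m \near U, hol (f m) /\ forall x, ball s rho' x -> jd (f m) (e m) x <= 8 * dl m ^+ 2.
  by apply: (unear (filter_and _ (filter_and _ small d0) (filter_and _ eD eiso))) => m [[a b] [c d]]; exact: Hf.
have ff : fam f.
  apply: (fam_of_jd tG LC (C := 8 + C1) (x := s)).
  - by rewrite addr_ge0 // ltW.
  - exact: s'B.
  - by apply: (unear main) => m [].
  - apply: (unear (filter_and _ main (filter_and _ HC1 (dl_le1 LC)))) => m [[h1 h2] [h3 /andP[h4 h5]]].
    apply: le_trans (jd_triangle _ _ (e m) _) _; rewrite mulrDl; apply: lerD; last exact: h3.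
    by apply: le_trans (h2 _ s0) _; rewrite ler_pM2l // expr2 ger_pMr.
exists f => // x Bx; have [_ lf _] := fam_limit tG LC ff.
apply: cvg_unique (lf x (s'B _ Bx)) _; first exact: norm_hausdorff.
have [E0 HEx _ _] := HE x Bx.
have t00 : `|0 : R| < tau by rewrite normr0.
have [_ _ DE] := HEx 0 t00; rewrite E0 in DE.
have L1 := derive_seq UF DE d0 (dl_cvg LC); rewrite E0 in L1.
have -> : (fun m => (dl m)^-1 *: (f m x - x)) = (fun m => (dl m)^-1 *: (f m x - e m x) + (dl m)^-1 *: (E (0 + dl m) x - x)).
  by apply/funext => m; rewrite -scalerDr add0r addrA subrK.
rewrite -[X x]add0r; apply: cvgD => //.
apply: (@cvg0_le _ _ _ _ _ (fun m => 8 * dl m)).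
  by rewrite -(mulr0 8); apply: cvgMr; exact: dl_cvg LC.
apply: (unear (filter_and _ main d0)) => m [[h1 h2] h3].
rewrite normrZ gtr0_norm ?invr_gt0 // ler_pdivrMl //.
have := h2 _ Bx; rewrite /jd => h4; rewrite mulrCA -expr2; apply: le_trans h4; by rewrite lerDl.
Qed.

(** Multiplying a field by c changes the speed of its flow and not the scale [dl]. So c X is first
    shown to be central and then realised anew by [fam_ext], which is why the equality is on a
    smaller ball. *)
Lemma fam_lin h h' (c : R) rho : fam h -> fam h' -> 0 < rho < r0 -> exists2 f, fam f &
  forall x, ball t0 rho x -> lim_field f x = c *: lim_field h x + lim_field h' x.
Proof.
move=> hf hf' /andP[p1 p2].
have [sZ _ _] := fam_limit tG LC hf.
have cZ : central_section i B (fun x => c *: lim_field h x).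
  apply: (flowbox_central tG) => //; first exact: ball_open.
    move=> j; apply: (@smooth_ext _ _ _ (fun x => c * lim_field h x 0 j)).
    - exact: ball_open.
    - by move=> x _; rewrite [RHS]mxE.
    - by apply: smooth_mul => //; [exact: ball_open|exact: smooth_cst].
  by move=> x Bx; apply: flowbox_scale; exact: (fam_flowbox tG LC hf (@ball_open _ _ t0 r0) (fun x Bx => Bx) Bx).
have [||| f1 ff1 E1] := fam_ext (rho' := rho) cZ => //; first by rewrite p1.
have [f ff E] := fam_add tG LC ff1 hf'.
exists f => // x Bx; rewrite E ?E1 //.
by move: Bx; rewrite !ballE => /lt_trans; apply.
Qed.

Lemma fam_sum (m : nat) (h : 'I_m -> nat -> selfmap R q) (c : 'I_m -> R) rho : (forall a, fam (h a)) ->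
  0 < rho < r0 -> exists2 f, fam f & forall x, ball t0 rho x -> lim_field f x = \sum_a c a *: lim_field (h a) x.
Proof.
move=> hf rr; elim: (index_enum _) => [|a s [f ff E]].
  exists (fun _ => id); first exact: (fam_id tG LC).
  move=> x Bx; rewrite big_nil (fam_id_limit tG LC) //.
  by move: rr Bx => /andP[_ rr]; rewrite !ballE => /lt_trans; apply.
have [f' ff' E'] := fam_lin (c a) (hf a) ff rr.
by exists f' => // x Bx; rewrite big_cons E' // E.
Qed.
End Ext.

Lemma row_freeE (R : fieldType) m r (A : 'M[R]_(m, r)) :
  (forall c : 'rV_m, c *m A = 0 -> c = 0) -> row_free A.
Proof.
move=> H; rewrite -kermx_eq0; apply/rowV0P => v /sub_kermxP; exact: H.
Qed.

Lemma jacZ (R : realType) p r (c : R) (f : 'rV[R]_p -> 'rV[R]_r) (x : 'rV[R]_p) :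
  differentiable f x -> Jac (fun y => c *: f y) x = c *: Jac f x.
Proof.
move=> df; apply/row_matrixP => a; rewrite !rowE -scalemxAr -!diff_jac.
exact: (congr1 (fun u : 'rV[R]_p -> 'rV[R]_r => u _) (diffZ c df)).
Qed.

Lemma jac_lincomb (R : realType) p r (I : Type) (s : seq I) (c : I -> R) (e : I -> 'rV[R]_p -> 'rV[R]_r) (x : 'rV[R]_p) :
  (forall a, differentiable (e a) x) -> differentiable (fun y => \sum_(a <- s) c a *: e a y) x /\
  Jac (fun y => \sum_(a <- s) c a *: e a y) x = \sum_(a <- s) c a *: Jac (e a) x.
Proof.
move=> de; elim: s => [|a s [IH1 IH2]].
  have -> : (fun y => \sum_(a <- [::]) c a *: e a y) = cst 0 by apply/funext => y; rewrite big_nil.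
  split; first exact: differentiable_cst.
  by rewrite big_nil jac_near0 //; apply: filterE.
have -> : (fun y => \sum_(b <- a :: s) c b *: e b y) = (fun y => c a *: e a y + \sum_(b <- s) c b *: e b y).
  by apply/funext => y; rewrite big_cons.
have da : differentiable (fun y => c a *: e a y) x by apply: differentiableZ.
by split; [exact: differentiableD|rewrite big_cons jacD // jacZ // IH2].
Qed.

(** * Finite dimension of the stalks and parallel frames *)

Section Frames.
Variables (R : realType) (n q : nat) (M : manifold R n) (F : foliation M q).
Variable (G : fidx F -> 'rV[R]_q -> 'M[R]_q).
Hypothesis tG : transverse_metric G.
Variable U : set_system nat.
Context {UF : UltraFilter U}.
Variable dl : nat -> R.
Implicit Types (i : fidx F) (x y : 'rV[R]_q).
Notation lim_field h := (rescaled_limit U h dl).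

Lemma central_eq i (O : set 'rV[R]_q) (X Y : selfmap R q) : central_section i O X -> (forall x, O x -> X x = Y x) ->
  central_section i O Y.
Proof.
move=> [oO OT sX H] E; split=> //.
  by move=> j; apply: smooth_ext oO _ (sX j) => x /set_mem/E ->.
move=> V e Phi [h1 h2 h3 h4]; apply: H; split=> // t s Vt se.
by have [a b] := h4 t s Vt se; split=> //; rewrite E.
Qed.

Lemma central_diff i (O : set 'rV[R]_q) (X : selfmap R q) x : central_section i O X -> O x -> differentiable X x.
Proof. by move=> [oO _ sX _] Ox; exact: smooth_map_diff oO sX Ox. Qed.

Section Chart.
Variables (i : fidx F) (t0 : 'rV[R]_q) (rT r0 : R).
Notation B := (ball t0 r0).
Notation fam := (local_fam U dl i t0 rT r0).
Hypothesis LC : local_ctx G U dl i t0 rT r0.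

Lemma germ_fam s (X : selfmap R q) : central_germ i s X -> B s ->
  exists2 f, fam f & germ_eq s X (lim_field f).
Proof.
move=> [Om Os cX] Bs; have [oO _ _ _] := cX; have [r00 r0T rT0] := lc_pos LC.
have oOB : open (Om `&` B) by apply: openI => //; exact: ball_open.
have /near_normP[d d0 Hd] := open_near oOB (conj Os Bs).
pose rho := Num.min d r0.
have rho0 : 0 < rho by rewrite lt_min d0.
have sub : ball s rho `<=` Om `&` B.
  by move=> y; rewrite ballE lt_min => /andP[yd _]; exact: Hd.
have cX' := central_sub cX (@ball_open _ _ s rho) (fun y h => (sub y h).1).
have rr : 0 < rho / 2 < rho by apply/andP; split; lra.
have [||f ff E] := fam_ext tG LC cX' _ rr.
- by move=> y /sub[].
- by rewrite ge_min lexx orbT.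
exists f => //; have Bs2 : ball s (rho / 2) s by apply: ballxx; case/andP: rr.
by apply: filterS (open_near (@ball_open _ _ s _) Bs2) => y /E.
Qed.

Let jetv (f : selfmap R q) : 'rV[R]_(q + q * q) := row_mx (f t0) (mxvec (Jac f t0)).

Let jetv_lincomb m (c : 'I_m -> R) (e : 'I_m -> selfmap R q) (f : selfmap R q) :
  (forall a, differentiable (e a) t0) -> (\forall y \near t0, f y = \sum_a c a *: e a y) ->
  jetv f = \sum_a c a *: jetv (e a).
Proof.
move=> de E; have [d1 j1] := jac_lincomb (index_enum 'I_m) c de.
have JE : Jac f t0 = \sum_a c a *: Jac (e a) t0.
  rewrite -j1; apply: jac_near => //; by apply: filterS E => y ->.
rewrite /jetv JE (nbhs_singleton E) linear_sum /=.
elim/big_rec3: _ => [|a u v w _ <-]; first by rewrite row_mx0.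
by rewrite scale_row_mx add_row_mx linearZ.
Qed.

Let indep m (h : 'I_m -> nat -> selfmap R q) :=
  forall c : 'I_m -> R, \sum_a c a *: jetv (lim_field (h a)) = 0 -> forall a, c a = 0.

(** By [fam_eq] a limit field is determined by its 1-jet at [t0], a vector with q + q^2 entries. A
    family with independent jets and the largest possible number of members therefore spans, and
    independence at [t0] implies independence of the germs at every point. *)
Lemma fam_basis : exists m (h : 'I_m -> nat -> selfmap R q), (forall a, fam (h a)) /\
  forall rho, 0 < rho < r0 -> (forall f, fam f -> exists c : 'I_m -> R, forall x, ball t0 rho x ->
      lim_field f x = \sum_a c a *: lim_field (h a) x) /\
   forall (c : 'I_m -> R) x, ball t0 rho x -> (\forall y \near x, \sum_a c a *: lim_field (h a) y = 0) -> forall a, c a = 0.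
Proof.
have [r00 r0T rT0] := lc_pos LC.
have B0 : B t0 by exact: ballxx.
have dfam f : fam f -> differentiable (lim_field f) t0.
  by move=> ff; have [sZ _ _] := fam_limit tG LC ff; exact: smooth_map_diff (@ball_open _ _ t0 r0) sZ B0.
pose P m := `[< exists h : 'I_m -> nat -> selfmap R q, (forall a, fam (h a)) /\ indep h >].
have P0 : exists m, P m.
  by exists 0%N; apply/asboolP; exists (fun=> fun=> id); split=> [[]|c _ []].
have Pb m : P m -> (m <= q + q * q)%N.
  move=> /asboolP[h [_ ih]].
  have : row_free (\matrix_(a < m) jetv (lim_field (h a))).
    apply: row_freeE => c; rewrite mulmx_sum_row => E; apply/rowP => a; rewrite mxE.
    by apply: (ih (fun a => c 0 a)); rewrite -[RHS]E; apply: eq_bigr => b _; rewrite rowK.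
  by rewrite /row_free => /eqP <-; exact: rank_leq_col.
case: (ex_maxnP P0 Pb) => m /asboolP[h [hf ih]] mmax.
exists m, h; split=> // rho rr; have /andP[rho0 rhor] := rr.
have rB : ball t0 rho `<=` B by move=> x; rewrite !ballE => /lt_trans; apply.
have Br0 : ball t0 rho t0 by exact: ballxx.
have oR := @ball_open _ _ t0 rho.
have jsum (c : 'I_m -> R) f : (forall x, ball t0 rho x -> lim_field f x = \sum_a c a *: lim_field (h a) x) ->
    jetv (lim_field f) = \sum_a c a *: jetv (lim_field (h a)).
  move=> E; apply: jetv_lincomb; first by move=> a; exact: dfam.
  by apply: filterS (open_near oR Br0) => y /E.
have jeq f f' : fam f -> fam f' -> jetv (lim_field f) = jetv (lim_field f') -> forall x, B x -> lim_field f x = lim_field f' x.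
  move=> ff ff' /eq_row_mx[e1 e2]; apply: (fam_eq tG LC ff ff' B0 e1).
  by rewrite -[LHS]mxvecK e2 mxvecK.
split=> [f ff|c x Bx E].
  have [c Ec] : exists c : 'I_m -> R, jetv (lim_field f) = \sum_a c a *: jetv (lim_field (h a)).
    apply: contrapT => nc.
    suff /mmax : P m.+1 by rewrite ltnn.
    apply/asboolP; exists (fun a => if unlift ord0 a is Some b then h b else f); split.
      by move=> a; case: unliftP.
    move=> c; rewrite big_ord_recl unlift_none.
    under eq_bigr do rewrite liftK.
    move=> E; have c0 : c ord0 = 0.
      apply: contrapT => /eqP nz; apply: nc; exists (fun a => - (c ord0)^-1 * c (lift ord0 a)).
      have : (c ord0)^-1 *: (c ord0 *: jetv (lim_field f) + \sum_(a < m) c (lift ord0 a) *: jetv (lim_field (h a))) = 0.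
        by rewrite E scaler0.
      rewrite scalerDr scalerA mulVf // scale1r => /eqP; rewrite addr_eq0 => /eqP ->.
      rewrite scaler_sumr -sumrN; apply: eq_bigr => a _; by rewrite scalerA mulNr scaleNr.
    move=> a; case: (unliftP ord0 a) => [b ->|->] //.
    by apply: (ih (fun b => c (lift ord0 b))); move: E; rewrite c0 scale0r add0r.
  have [g fg Eg] := fam_sum tG LC c hf rr.
  exists c => x Bx; rewrite -Eg //; apply: jeq => //; last exact: rB.
  by rewrite Ec -(jsum c g Eg).
have [g fg Eg] := fam_sum tG LC c hf rr.
have gx : forall y, B y -> lim_field g y = lim_field (fun _ => id) y.
  have E2 : \forall y \near x, lim_field g y = lim_field (fun _ => id) y.
    apply: filterS (near_and E (open_near oR Bx)) => y [e1 By].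
    by rewrite Eg // e1 (fam_id_limit tG LC) //; exact: rB.
  have Bx' := rB _ Bx.
  apply: (fam_eq tG LC fg (fam_id tG LC) Bx' (nbhs_singleton E2)).
  have [sg _ _] := fam_limit tG LC fg.
  symmetry; apply: jac_near => //; exact: smooth_map_diff (@ball_open _ _ t0 r0) sg Bx'.
apply: ih; rewrite -(jsum c g Eg) /jetv.
have g0 y : B y -> lim_field g y = 0 by move=> By; rewrite gx // (fam_id_limit tG LC).
rewrite g0 // jac_near0 ?linear0 ?row_mx0 //.
by apply: filterS (open_near (@ball_open _ _ t0 r0) B0) => y /g0.
Qed.

Lemma fam_frame m (h : 'I_m -> nat -> selfmap R q) rho (W : set 'rV[R]_q) : (forall a, fam (h a)) -> 0 < rho < r0 ->
  (forall f, fam f -> exists c : 'I_m -> R, forall x, ball t0 rho x ->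
      lim_field f x = \sum_a c a *: lim_field (h a) x) ->
  (forall (c : 'I_m -> R) x, ball t0 rho x -> (\forall y \near x, \sum_a c a *: lim_field (h a) y = 0) -> forall a, c a = 0) ->
  open W -> W `<=` ball t0 rho -> parallel_frame i W (fun a => lim_field (h a)).
Proof.
move=> hf /andP[rho0 rhor] span free oW Wr.
have rB : ball t0 rho `<=` B by move=> x; rewrite !ballE => /lt_trans; apply.
split=> //; first by move=> x /Wr/rB/(lc_BD LC)/(lc_DT LC).
  by move=> a; apply: central_sub (fam_central tG LC (hf a)) oW _ => x /Wr/rB.
move=> t X Wt gX; have [f ff E] := germ_fam gX (rB _ (Wr _ Wt)).
have [c Hc] := span f ff; exists (\row_a c a); split.
  apply: filterS (near_and E (open_near oW Wt)) => y [-> /Wr/Hc ->].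
  by apply: eq_bigr => a _; rewrite mxE.
move=> c' E'; apply/rowP => a; rewrite mxE; apply/eqP; rewrite -subr_eq0; apply/eqP.
apply: (free (fun a => c a - c' 0 a) t (Wr _ Wt)).
apply: filterS (near_and (near_and E E') (open_near oW Wt)) => y [[e1 e2] Wy].
have := Hc y (Wr _ Wy); rewrite -e1 e2 => e3; apply/eqP.
under eq_bigr do rewrite scalerBl; by rewrite sumrB -e3 subrr.
Qed.
End Chart.

(** Linear combinations of central sections are not visibly central from the flows of the summands;
    near each point both are realised by sequences of holonomy maps, where [fam_lin] applies. *)
Lemma central_lin i (O : set 'rV[R]_q) (X Y : selfmap R q) (c : R) : closed_manifold M ->
  (forall P : nat -> Prop, (\forall m \near \oo, P m) -> \forall m \near U, P m) ->
  (\forall m \near U, 0 < dl m <= 1) -> dl m @[m --> U] --> (0 : R) ->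
  central_section i O X -> central_section i O Y -> central_section i O (fun x => c *: X x + Y x).
Proof.
move=> cM HU dl1 dlc cX cY; have [oO OT sX _] := cX; have [_ _ sY _] := cY.
apply: (flowbox_central tG) => //.
  move=> j; apply: (@smooth_ext _ _ _ (fun x => c * X x 0 j + Y x 0 j)) => //.
    by move=> x _; rewrite !mxE.
  by apply: smooth_add => //; apply: smooth_mul => //; exact: smooth_cst.
move=> p Op; have [rT [r0 [_ LC]]] := local_ctx_exists tG UF cM HU dl1 dlc (OT _ Op) ltr01.
have [r00 r0T rT0] := lc_pos LC.
have Bp : ball p r0 p by exact: ballxx.
have [f ff Ef] : exists2 f, local_fam U dl i p rT r0 f & germ_eq p X (lim_field f) by apply: germ_fam LC _ _ _ Bp; exists O.
have [g gg Eg] : exists2 f, local_fam U dl i p rT r0 f & germ_eq p Y (lim_field f) by apply: germ_fam LC _ _ _ Bp; exists O.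
have rr : 0 < r0 / 2 < r0 by apply/andP; split; lra.
have Bp2 : ball p (r0 / 2) p by apply: ballxx; case/andP: rr.
have [k kk Ek] := fam_lin tG LC c ff gg rr.
have /near_normP[d d0 Hd] := near_and (near_and Ef Eg) (near_and (open_near oO Op) (open_near (@ball_open _ _ p _) Bp2)).
have sub : ball p d `<=` ball p r0.
  move=> y; rewrite ballE => /Hd[_ [_]]; rewrite !ballE => /lt_trans; apply; by case/andP: rr.
apply: flowbox_mono (fam_flowbox tG LC kk (@ball_open _ _ p d) sub (ballxx _ d0)) _ _.
  by move=> y; rewrite ballE => /Hd[_ []].
by move=> y; rewrite ballE => /Hd[[-> ->] [_ By]]; exact: Ek.
Qed.
End Frames.

Lemma is_derive_map (R : realType) p r (psi : 'rV[R]_p -> 'rV[R]_r) (c : R -> 'rV[R]_p) (s : R) (v : 'rV[R]_p) :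
  is_derive s 1 c v -> differentiable psi (c s) -> is_derive s 1 (fun u => psi (c u)) (v *m Jac psi (c s)).
Proof.
move=> [/derivable1_diffP dc Dc] dp.
have dpc : differentiable (psi \o c) s by exact: differentiable_comp.
split; first exact/derivable1_diffP.
have -> : 'D_1 (fun u => psi (c u)) s = 'd (psi \o c) s 1 by exact: deriveE.
rewrite diff_comp //= -diff_jac -Dc; congr ('d psi (c s) _).
by symmetry; exact: deriveE.
Qed.

(** Tangent vectors are rows and the differential is v |-> v Jac h, so the inverse Jacobian stands
    on the right. *)
Definition pull (R : realType) q (h X : selfmap R q) (x : 'rV[R]_q) := X (h x) *m invmx (Jac h x).

(** * Invariance of central sections under holonomy *)

Section Pull.
Variables (R : realType) (n q : nat) (M : manifold R n) (F : foliation M q).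
Variable (G : fidx F -> 'rV[R]_q -> 'M[R]_q).
Hypothesis tG : transverse_metric G.
Hypothesis cM : closed_manifold M.
Implicit Types (i j k : fidx F) (x y : 'rV[R]_q) (X Y : selfmap R q).

Lemma default_ctx i x d : trans i x -> 0 < d -> exists (U : set_system nat) (dl : nat -> R) (rT r0 : R),
  [/\ UltraFilter U, r0 < d & local_ctx G U dl i x rT r0].
Proof.
move=> Tx d0; have [U [UF HU]] := nat_ultra.
exists U, (fun m => m.+1%:R^-1).
have [dl1 dlc] := inv_succ_scale R HU.
have [rT [r0 [h1 h2]]] := local_ctx_exists tG UF cM HU dl1 dlc Tx d0.
by exists rT, r0.
Qed.

Lemma central_add i (O : set 'rV[R]_q) X Y (c : R) : central_section i O X -> central_section i O Y ->
  central_section i O (fun x => c *: X x + Y x).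
Proof.
have [U [UF HU]] := nat_ultra.
have [dl1 dlc] := inv_succ_scale R HU.
exact: (central_lin tG c cM HU dl1 dlc).
Qed.

(** The converse of [flowbox_central]. A flow exists at all because the germ is the limit field of a
    sequence of holonomy maps. *)
Lemma central_flowbox i (O : set 'rV[R]_q) X x : central_section i O X -> O x -> flowbox G i O X x.
Proof.
move=> cX Ox; have [oO OT _ _] := cX.
have [U [dl [rT [r0 [UF _ LC]]]]] := default_ctx (OT _ Ox) ltr01.
have [r00 r0T rT0] := lc_pos LC.
have Bx : ball x r0 x by exact: ballxx.
have [f ff Ef] : exists2 f, local_fam U dl i x rT r0 f & germ_eq x X (rescaled_limit U f dl).
  by apply: (germ_fam tG LC) => //; exists O.
have /near_normP[d d0 Hd] := near_and Ef (near_and (open_near oO Ox) (open_near (@ball_open _ _ x _) Bx)).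
have sub : ball x d `<=` ball x r0 by move=> y; rewrite ballE => /Hd[_ []].
apply: flowbox_mono (fam_flowbox tG LC ff (@ball_open _ _ x d) sub (ballxx _ d0)) _ _.
  by move=> y; rewrite ballE => /Hd[_ []].
by move=> y; rewrite ballE => /Hd[->].
Qed.

Lemma composite_unit i j Om (h : selfmap R q) x : composite i j Om h -> Om x -> Jac h x \in unitmx.
Proof. by move=> co Ox; exact: (good_unit tG (good_composite tG co Ox)). Qed.

Lemma smooth_pull i j Om (h : selfmap R q) (V O : set 'rV[R]_q) X : composite i j Om h -> open V -> open O -> V `<=` Om ->
  (forall x, V x -> O (h x)) -> smooth_map_on O X -> smooth_map_on V (pull h X).
Proof.
move=> co oV oO VO hO sX l; have [oOm _ sh _] := composite_dom co.
have shV a : smooth_on V (fun x => h x 0 a) by exact: smooth_sub (sh a).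
apply: (smooth_mulmx (A := fun x => X (h x)) (A' := fun x => invmx (Jac h x)) oV).
  by move=> a b; rewrite (ord1 a); exact: (smooth_map_comp oV oO hO shV sX).
move=> a b; apply: (smooth_invmx oV); first by move=> x /VO Ox; exact: composite_unit co Ox.
by move=> c d; exact: (smooth_jac oV shV).
Qed.

(** The flow of the pulled-back field is the flow of X conjugated by h, and conjugation by a
    composite preserves good maps. *)
Lemma pull_central i j Om (h : selfmap R q) (V O : set 'rV[R]_q) X : composite i j Om h -> open V -> V `<=` Om ->
  (forall x, V x -> O (h x)) -> central_section j O X -> central_section i V (pull h X).
Proof.
move=> co oV VO hO cX; have [oO OT sX _] := cX; have [oOm OmT sh _] := composite_dom co.
apply: (flowbox_central tG) => //.
- exact: subset_trans OmT.
- exact: smooth_pull co oV oO VO hO sX.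
move=> p Vp; have [Op [psi [co' H1 H2]]] := composite_inv co.
have [oOp _ spsi _] := composite_dom co'.
have [Php psip] := H1 p (VO _ Vp).
pose N := [set y | (Op y /\ O y) /\ V (psi y)].
have oN : open N.
  apply: open_from_near => y [[Py Oy] Vy].
  have cpsi := smooth_cont spsi Py.
  exact: near_and (near_and (open_near oOp Py) (open_near oO Oy)) (near_comp cpsi (open_near oV Vy)).
have Np : N (h p) by split; [split=> //; exact: hO|rewrite psip].
have cN := central_sub cX oN (fun y (Ny : N y) => Ny.1.2).
have [tau [rho [E [tau0 rho0 HE]]]] := central_flowbox cN Np.
have ch := smooth_cont sh (VO _ Vp).
have /near_normP[d d0 Hd] := near_and (open_near oV Vp) (near_comp ch (open_near (@ball_open _ _ (h p) rho) (ballxx _ rho0))).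
exists tau, d, (fun s x => psi (E s (h x))); split=> // x; rewrite ballE => /Hd[Vx Bx] s st.
have [[[h1 h2] h3] h4 h5 h6] := HE _ Bx s st.
have dpsi := smooth_map_diff oOp spsi h1.
have [Opsi hpsi] := H2 _ h1.
split=> //; last 2 first.
- by rewrite h5; have [_ ->] := H1 x (VO _ Vx).
- have g1 := good_comp (good_composite tG co (VO _ Vx)) h6.
  exact: good_comp g1 (good_composite tG co' h1).
have := is_derive_map h4 dpsi.
suff -> : pull h X (psi (E s (h x))) = X (E s (h x)) *m Jac psi (E s (h x)) by [].
rewrite /pull hpsi; congr (_ *m _).
have dh := smooth_map_diff oOm sh Opsi.
have e1 : Jac h (psi (E s (h x))) *m Jac psi (E s (h x)) = 1%:M.
  rewrite -[in Jac psi _]hpsi -jac_comp //; last by rewrite hpsi.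
  rewrite -(jac_id (psi (E s (h x)))); apply: jac_near.
    exact: (smooth_map_diff oOm (@smooth_id _ _ Om) Opsi).
  by apply: filterS (open_near oOm Opsi) => y Oy /=; have [_ ->] := H1 y Oy.
have u := composite_unit co Opsi.
by rewrite -[LHS]mulmx1 -e1 mulmxA mulVmx // mul1mx.
Qed.
End Pull.

(** * Gram determinants of parallel frames *)

(** The determinant does not vanish along a path of positive definite matrices from the identity to
    A. The coefficients (1 - s)^2 and s^2 keep the path positive definite for all real s, so the
    open interval |s| < 2 can be used. *)
Lemma posdef_det_gt0 (R : realType) m (A : 'M[R]_m) : posdef A -> 0 < \det A.
Proof.
move=> [sA pA].
pose C (x : 'rV[R]_1) := (1 - x 0 0) ^+ 2 *: 1%:M + x 0 0 ^+ 2 *: A.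
have pC x : posdef (C x).
  split; first by rewrite /C linearD /= !linearZ /= trmx1 sA.
  move=> v v0; have -> : inner (C x) v v = (1 - x 0 0) ^+ 2 * (v *m v^T) 0 0 + x 0 0 ^+ 2 * (v *m A *m v^T) 0 0.
    rewrite /inner /C mulmxDr mulmxDl -!scalemxAr -!scalemxAl mulmx1.
    move: (v *m v^T) (v *m A *m v^T) => P Q; by rewrite !mxE.
  have v1 : 0 < (v *m v^T) 0 0.
    rewrite mxE; under eq_bigr do rewrite mxE -expr2.
    rewrite lt_neqAle sumr_ge0 ?andbT; last by move=> k _; exact: sqr_ge0.
    apply: contra v0; rewrite eq_sym psumr_eq0; last by move=> k _; exact: sqr_ge0.
    move=> /allP H; apply/eqP/rowP => k; apply/eqP; rewrite mxE -(sqrf_eq0 (v 0 k)).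
    by have := H k; rewrite mem_index_enum => /(_ isT).
  have v2 : 0 < (v *m A *m v^T) 0 0 by exact: pA.
  have [x1|x1] := eqVneq (x 0 0) 0.
    by rewrite x1 subr0 expr1n expr0n /= mul1r mul0r addr0.
  apply: ltr_wpDl; first by apply: mulr_ge0; [exact: sqr_ge0|exact: ltW].
  by apply: mulr_gt0 => //; rewrite exprn_even_gt0.
have sC (a b : 'I_m) : smooth_on setT (fun x => C x a b).
  have oT : open [set: 'rV[R]_1] by exact: openT.
  have c0 : smooth_on setT (fun x : 'rV[R]_1 => x 0 0) by exact: smooth_coord.
  apply: (@smooth_ext _ _ _ (fun x : 'rV[R]_1 => (1 - x 0 0) * (1 - x 0 0) * (1%:M : 'M[R]_m) a b + x 0 0 * x 0 0 * A a b)) => //.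
    by move=> x _; rewrite !mxE !expr2.
  have c1 : smooth_on setT (fun x : 'rV[R]_1 => 1 - x 0 0) by apply: smooth_sub2 => //; exact: smooth_cst.
  by apply: smooth_add => //; apply: smooth_mul => //; try exact: smooth_cst; exact: smooth_mul.
have sD := smooth_det openT sC.
have := @interval_ind R 2 (fun s => 0 < \det (C (const_mx s))) _ 0 1.
have -> : C (const_mx 0) = 1%:M by rewrite /C mxE subr0 expr1n expr0n /= scale1r scale0r addr0.
have -> : C (const_mx 1) = A by rewrite /C mxE subrr expr1n expr0n /= scale1r scale0r add0r.
have n0 : `|0 : R| < 2 by rewrite normr0; lra.
have n1 : `|1 : R| < 2 by rewrite normr1; lra.
move=> H; apply: H n0 n1 _; last by rewrite det1 ltr01.
move=> x _; have := posdef_unit (pC (const_mx x)); rewrite unitmxE unitfE => nz.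
have nz' : 0 < `|\det (C (const_mx x))| by rewrite normr_gt0.
have /near_normP[d d0 Hd] := (contP _ _).1 (Ck_cont (sD 0%N) (I : setT (const_mx x))) _ nz'.
exists d => // y _ yx.
have /Hd : `|(const_mx y : 'rV[R]_1) - const_mx x| < d by apply: mx_norm_lt => // a b; rewrite !mxE.
move: (\det _) (\det _) nz => u v nz.
have [v0|v0|v0] := ltgtP 0 v; last by rewrite v0 eqxx in nz.
  by rewrite (gtr0_norm v0) ltr_norml => /andP[h1 h2]; split=> // _; lra.
rewrite (ltr0_norm v0) ltr_norml => /andP[h1 h2]; have u0 : u < 0 by lra.
by split=> //; rewrite ltNge (ltW u0).
Qed.

Section Gram.
Variables (R : realType) (n q : nat) (M : manifold R n) (F : foliation M q).
Variable (G : fidx F -> 'rV[R]_q -> 'M[R]_q).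
Hypothesis tG : transverse_metric G.
Hypothesis cM : closed_manifold M.
Variable B : fibre_metric F.
Hypothesis bB : basic_metric B.
Implicit Types (i j k : fidx F) (t x y : 'rV[R]_q) (X Y Z : selfmap R q) (O V : set 'rV[R]_q).

Lemma central_germ_eq i t X Y : central_germ i t X -> germ_eq t X Y -> central_germ i t Y.
Proof.
move=> [Om Ot cX] E; have [oO _ _ _] := cX.
have /near_normP[d d0 Hd] := near_and E (open_near oO Ot).
exists (ball t d); first exact: ballxx.
have sub : ball t d `<=` Om by move=> y; rewrite ballE => /Hd[].
by apply: central_eq (central_sub cX (@ball_open _ _ t d) sub) _ => y; rewrite ballE => /Hd[].
Qed.

Lemma metric_sym i t X Y : trans i t -> central_germ i t X -> central_germ i t Y -> B i t X Y = B i t Y X.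
Proof. by move=> Tt cX cY; have [H _ _] := bB; have [_ H2 _ _] := H i t Tt; exact: H2. Qed.

Lemma metric_germ i t X X' Y Y' : trans i t -> central_germ i t X -> central_germ i t Y ->
  germ_eq t X X' -> germ_eq t Y Y' -> B i t X Y = B i t X' Y'.
Proof.
move=> Tt cX cY EX EY; have [H _ _] := bB; have [H1 _ _ _] := H i t Tt.
have cX' := central_germ_eq cX EX; have cY' := central_germ_eq cY EY.
rewrite (H1 X X' Y) // metric_sym // (H1 Y Y' X') // metric_sym //.
Qed.

(** [basic_metric] gives invariance under one transition map; the induction needs that the
    pulled-back germs are again central, so both facts are proved together. *)
Lemma metric_pull i j Om (h : selfmap R q) t X Y : composite i j Om h -> Om t ->
  central_germ j (h t) X -> central_germ j (h t) Y ->
  [/\ central_germ i t (pull h X), central_germ i t (pull h Y) & B i t (pull h X) (pull h Y) = B j (h t) X Y].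
Proof.
have pgerm i' j' Om' (h' : selfmap R q) t' X' : composite i' j' Om' h' -> Om' t' -> central_germ j' (h' t') X' ->
    central_germ i' t' (pull h' X').
  move=> co Ot [Op Oht cX']; have [oOm _ sh _] := composite_dom co; have [oOp _ _ _] := cX'.
  have ch := smooth_cont sh Ot.
  pose V := Om' `&` h' @^-1` Op.
  have oV : open V.
    apply: open_from_near => y [Oy Ohy].
    exact: near_and (open_near oOm Oy) (near_comp (smooth_cont sh Oy) (open_near oOp Ohy)).
  exists V; first by split.
  by apply: (pull_central tG cM co oV _ _ cX'); move=> y [].
move=> co; elim: co t X Y => {j Om h} [|j k Om h co IH] t X Y Ot gX gY.
  have Tt : trans i t by [].
  have E Z : germ_eq t Z (pull id Z).
    by apply: filterE => y; rewrite /pull jac_id invmx1 mulmx1.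
  split; [exact: central_germ_eq gX (E X)|exact: central_germ_eq gY (E Y)|].
  by rewrite (metric_germ Tt gX gY (E X) (E Y)).
have [Oh th] := Ot; rewrite /= in th.
have cf := @composite_fh _ _ _ _ F j k.
have gX1 := pgerm _ _ _ _ _ _ cf th gX; have gY1 := pgerm _ _ _ _ _ _ cf th gY.
have [p1 p2 p3] := IH t _ _ Oh gX1 gY1.
have [oOm _ sh _] := composite_dom co.
have ch := smooth_cont sh Oh.
have ot2 := @trans2_open _ _ _ _ F j k.
have E Z : germ_eq t (pull h (pull (fh j k) Z)) (pull (fh j k \o h) Z).
  apply: filterS (near_and (open_near oOm Oh) (near_comp ch (open_near ot2 th))) => y [Oy ty].
  have u1 := composite_unit tG co Oy; have u2 := composite_unit tG cf ty.
  rewrite /pull jac_comp; first last.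
  - exact: smooth_map_diff ot2 (@fh_smooth _ _ _ _ F j k) ty.
  - exact: smooth_map_diff oOm sh Oy.
  rewrite -mulmxA; congr (_ *m _).
  have : (invmx (Jac (fh j k) (h y)) *m invmx (Jac h y)) *m (Jac h y *m Jac (fh j k) (h y)) = 1%:M.
    by rewrite -mulmxA (mulmxA (invmx (Jac h y))) mulVmx // mul1mx mulVmx.
  move=> H; rewrite -[LHS]mulmx1 -[in LHS](mulmxV (_ : Jac h y *m Jac (fh j k) (h y) \in unitmx)).
    by rewrite mulmxA H mul1mx.
  by rewrite unitmx_mul u1 u2.
have Tt : trans i t by have [_ H _ _] := composite_dom co; exact: H.
split; [exact: central_germ_eq p1 (E X)|exact: central_germ_eq p2 (E Y)|].
rewrite -(metric_germ Tt p1 p2 (E X) (E Y)) p3; have [_ _ H] := bB; symmetry.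
have inv Z : \forall s \near h t, Z (fh j k s) = pull (fh j k) Z s *m 'J (fh j k) s.
  apply: filterS (open_near ot2 th) => s ts; have u := composite_unit tG cf ts.
  by rewrite /pull -JacE -mulmxA mulVmx // mulmx1.
exact: H th gX1 gY1 gX gY (inv X) (inv Y).
Qed.

Lemma metric_sum i O (I : Type) (s : seq I) (c : I -> R) (e : I -> selfmap R q) Z t :
  (forall a, central_section i O (e a)) -> central_section i O Z -> O t ->
  central_section i O (fun x => \sum_(a <- s) c a *: e a x) /\
  B i t (fun x => \sum_(a <- s) c a *: e a x) Z = \sum_(a <- s) c a * B i t (e a) Z.
Proof.
move=> ce cZ Ot; have [oO OT _ _] := cZ; have Tt := OT _ Ot.
have [Hb _ _] := bB; have [_ _ lin _] := Hb i t Tt.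
have germ Y : central_section i O Y -> central_germ i t Y by move=> cY; exists O.
elim: s => [|a s [IH1 IH2]].
  (* The zero field is written as -Z + Z, so that its centrality and its product with Z come from
     the linear case. *)
  have c0 := central_add tG cM (-1) cZ cZ.
  have E : (fun x => \sum_(a <- [::]) c a *: e a x) = (fun x => -1 *: Z x + Z x).
    by apply/funext => x; rewrite big_nil scaleN1r addNr.
  rewrite E; split=> //; rewrite lin ?big_nil; try exact: germ.
  by rewrite mulN1r addNr.
have E : (fun x => \sum_(b <- a :: s) c b *: e b x) = (fun x => c a *: e a x + \sum_(b <- s) c b *: e b x).
  by apply/funext => x; rewrite big_cons.
rewrite E; split; first exact: (central_add tG cM).
by rewrite lin ?big_cons ?IH2 //; exact: germ.
Qed.

Definition gram m i (e : 'I_m -> selfmap R q) t : 'M[R]_m := \matrix_(a, b) B i t (e a) (e b).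

Lemma gram_lin m i O (e X : 'I_m -> selfmap R q) (P : 'M[R]_m) t : (forall a, central_section i O (e a)) -> O t ->
  (forall a x, O x -> X a x = \sum_b P a b *: e b x) -> gram i X t = P *m gram i e t *m P^T.
Proof.
move=> ce Ot E; apply/matrixP => a b; have [oO OT _ _] := ce a; have Tt := OT _ Ot.
pose S c := (fun x => \sum_d P c d *: e d x).
have cS c : central_section i O (S c) by have [] := metric_sum (index_enum 'I_m) (P c) ce (ce c) Ot.
have gS c : central_germ i t (S c) by exists O.
have ES c : germ_eq t (S c) (X c) by apply: filterS (open_near oO Ot) => y Oy; rewrite E.
rewrite mxE -(metric_germ Tt (gS a) (gS b) (ES a) (ES b)).
have [_ ->] := metric_sum (index_enum 'I_m) (P a) ce (cS b) Ot.
rewrite !mxE; under [RHS]eq_bigr do rewrite mxE big_distrl /=.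
rewrite exchange_big /=; apply: eq_bigr => d _.
rewrite metric_sym //; last by exists O.
have [_ ->] := metric_sum (index_enum 'I_m) (P b) ce (ce d) Ot.
rewrite big_distrr /=; apply: eq_bigr => c _; rewrite !mxE (metric_sym (X := e c)) //; try by exists O.
by ring.
Qed.

Lemma gram_sym m i O (e : 'I_m -> selfmap R q) t : (forall a, central_section i O (e a)) -> O t ->
  (gram i e t)^T = gram i e t.
Proof.
move=> ce Ot; apply/matrixP => a b; rewrite !mxE metric_sym //; try by exists O.
by have [_ OT _ _] := ce a; exact: OT.
Qed.

Lemma gram_smooth m i O (e : 'I_m -> selfmap R q) a b : (forall a, central_section i O (e a)) ->
  smooth_on O (fun t => gram i e t a b).
Proof.
move=> ce; have [oO _ _ _] := ce a; have [_ H _] := bB.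
apply: smooth_ext oO _ (H i O (e a) (e b) (ce a) (ce b)) => x _; by rewrite mxE.
Qed.

Lemma gram_det_smooth m i O (e : 'I_m -> selfmap R q) : open O -> (forall a, central_section i O (e a)) ->
  smooth_on O (fun t => \det (gram i e t)).
Proof. by move=> oO ce; apply: smooth_det oO _ => a b; exact: gram_smooth. Qed.

Lemma gram_det_gt0 m i O (e : 'I_m -> selfmap R q) t : (forall a, central_section i O (e a)) -> O t ->
  (forall c : 'I_m -> R, (\forall y \near t, \sum_a c a *: e a y = 0) -> forall a, c a = 0) ->
  0 < \det (gram i e t).
Proof.
move=> ce Ot free; apply: posdef_det_gt0; split; first exact: gram_sym ce Ot.
move=> v v0.
case: m e ce free v v0 => [|m] e ce free v v0.
  by rewrite (_ : v = 0) ?eqxx // in v0; apply/rowP => -[].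
have [oO OT _ _] := ce ord0; have Tt := OT _ Ot.
pose X x := \sum_a v 0 a *: e a x.
have [cX _] := metric_sum (index_enum 'I_m.+1) (v 0) ce (ce ord0) Ot.
have -> : inner (gram i e t) v v = B i t X X.
  have [_ ->] := metric_sum (index_enum 'I_m.+1) (v 0) ce cX Ot.
  rewrite /inner -mulmxA mxE; apply: eq_bigr => a _; congr (_ * _).
  rewrite metric_sym //; [|by exists O|by exists O].
  have [_ ->] := metric_sum (index_enum 'I_m.+1) (v 0) ce (ce a) Ot.
  rewrite mxE; apply: eq_bigr => b _; rewrite !mxE mulrC metric_sym //; by exists O.
have [H _ _] := bB; have [_ _ _ pos] := H i t Tt; apply: pos; first by exists O.
move=> E; move/negP: v0; apply; apply/eqP/rowP => a; rewrite mxE.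
exact: (free (v 0) E).
Qed.
End Gram.

(** * First-order expansions along a sequence *)

Section Rescaled.
Variables (R : realType) (U : set_system nat).
Context {UF : UltraFilter U}.
Variable dl : nat -> R.
Hypothesis d0 : \forall m \near U, 0 < dl m.
Hypothesis dc : dl m @[m --> U] --> (0 : R).

Lemma rescaled_cvg (V : normedModType R) (y : nat -> V) (x z : V) :
  (dl m)^-1 *: (y m - x) @[m --> U] --> z -> y m @[m --> U] --> x.
Proof.
move=> H; have H1 : dl m *: ((dl m)^-1 *: (y m - x)) @[m --> U] --> 0 *: z by exact: cvgZ.
rewrite scale0r in H1.
have H2 : y m - x @[m --> U] --> (0 : V).
  apply: cvg_trans H1; apply: near_eq_cvg; apply: (unear d0) => m dm.
  by rewrite scalerA mulfV ?scale1r // lt0r_neq0.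
have -> : y = (fun m => (y m - x) + x) by apply/funext => m; rewrite subrK.
by rewrite -[X in _ --> X]add0r; apply: cvgD => //; exact: cvg_cst.
Qed.

Lemma rescaled_diff (V W : normedModType R) (g : V -> W) (y : nat -> V) (x z : V) : differentiable g x ->
  (dl m)^-1 *: (y m - x) @[m --> U] --> z -> (dl m)^-1 *: (g (y m) - g x) @[m --> U] --> 'd g x z.
Proof.
move=> dg H; have yx := rescaled_cvg H.
have -> : (fun m => (dl m)^-1 *: (g (y m) - g x)) = (fun m => (dl m)^-1 *: (g (y m) - g x - 'd g x (y m - x)) +
   'd g x ((dl m)^-1 *: (y m - x))).
  by apply/funext => m; rewrite linearZ -scalerDr subrK.
rewrite -['d g x z]add0r; apply: cvgD; last first.
  by apply: (cvg_comp_cont (UF := UF) H); exact: diff_continuous.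
apply/cvgrPdist_le => e e0.
have z1 : 0 < `|z| + 1 by rewrite ltr_wpDl.
have /near_normP[d d_0 Hd] := diff_eps dg (divr_gt0 e0 z1).
have h1 : \forall m \near U, `|x - y m| < d by exact: ((cvgrPdist_lt _ _).1 yx _ d_0).
have h2 : \forall m \near U, `|z - (dl m)^-1 *: (y m - x)| <= 1 by exact: ((cvgrPdist_le _ _).1 H _ ltr01).
apply: (unear (filter_and _ (filter_and _ h1 h2) d0)) => m [[a1 a2] dm].
rewrite sub0r normrN normrZ gtr0_norm ?invr_gt0 // ler_pdivrMl //.
have := Hd (y m - x); rewrite subr0 distrC => /(_ a1); rewrite [x + _]addrC subrK => a3.
apply: le_trans a3 _; rewrite mulrAC ler_pdivrMr //.
have a4 : `|(dl m)^-1 *: (y m - x)| <= `|z| + 1.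
  by rewrite -(subrK z ((dl m)^-1 *: _)) addrC; apply: le_trans (ler_normD _ _) _; rewrite lerD2l distrC.
move: a4; rewrite normrZ gtr0_norm ?invr_gt0 // ler_pdivrMl // => a4.
by rewrite distrC [dl m * e]mulrC -mulrA ler_pM2l.
Qed.

Lemma cvg_bigsum (I : Type) (s : seq I) (P : pred I) (u : I -> nat -> R) (l : I -> R) :
  (forall k, u k m @[m --> U] --> l k) -> \sum_(k <- s | P k) u k m @[m --> U] --> \sum_(k <- s | P k) l k.
Proof.
move=> H; elim: s => [|a s IH].
  by rewrite big_nil; under [X in X @ _]funext do rewrite big_nil; exact: cvg_cst.
rewrite big_cons; under [X in X @ _]funext do rewrite big_cons.
by case: (P a) => //; exact: cvgD.
Qed.

Lemma cvg_bigprod (I : Type) (s : seq I) (P : pred I) (u : I -> nat -> R) (l : I -> R) :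
  (forall k, u k m @[m --> U] --> l k) -> \prod_(k <- s | P k) u k m @[m --> U] --> \prod_(k <- s | P k) l k.
Proof.
move=> H; elim: s => [|a s IH].
  by rewrite big_nil; under [X in X @ _]funext do rewrite big_nil; exact: cvg_cst.
rewrite big_cons; under [X in X @ _]funext do rewrite big_cons.
by case: (P a) => //; exact: cvgM.
Qed.

Lemma rescaled_prod (I : Type) (s : seq I) (u : I -> nat -> R) (b : I -> R) :
  (forall k, (dl m)^-1 *: (u k m - 1) @[m --> U] --> b k) ->
  (dl m)^-1 *: (\prod_(k <- s) u k m - 1) @[m --> U] --> \sum_(k <- s) b k.
Proof.
move=> H; elim: s => [|a s IH].
  have -> : (fun m => (dl m)^-1 *: (\prod_(k <- [::]) u k m - 1)) = (fun _ => 0).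
    by apply/funext => m; rewrite big_nil subrr scaler0.
  by rewrite big_nil; exact: cvg_cst.
have -> : (fun m => (dl m)^-1 *: (\prod_(k <- a :: s) u k m - 1)) =
   (fun m => ((dl m)^-1 *: (u a m - 1)) * \prod_(k <- s) u k m + (dl m)^-1 *: (\prod_(k <- s) u k m - 1)).
  by apply/funext => m; rewrite big_cons -scalerAl -scalerDr mulrBl mul1r addrA subrK.
rewrite big_cons; apply: cvgD => //; rewrite -[b a]mulr1; apply: cvgM => //.
exact: rescaled_cvg IH.
Qed.

(** In the expansion of the determinant a permutation other than the identity moves at least two
    indices. One of these off-diagonal factors stays bounded after division by [dl], the other tends
    to 0, so only the diagonal product contributes. *)
Lemma rescaled_det m (A : nat -> 'M[R]_m) (b : 'M[R]_m) :
  (dl k)^-1 *: (A k - 1%:M) @[k --> U] --> b -> (dl k)^-1 *: (\det (A k) - 1) @[k --> U] --> \tr b.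
Proof.
move=> H; have cA := rescaled_cvg H.
have ce i j : A k i j @[k --> U] --> (1%:M : 'M[R]_m) i j by exact: cvg_entry cA.
have cb i j : (dl k)^-1 *: (A k i j - (1%:M : 'M[R]_m) i j) @[k --> U] --> b i j.
  have := cvg_entry (UF := UF) (i := i) (j := j) H.
  by have -> : (fun k => ((dl k)^-1 *: (A k - 1%:M)) i j) = (fun k => (dl k)^-1 *: (A k i j - (1%:M : 'M[R]_m) i j))
    by apply/funext => k; rewrite !mxE.
pose T (s : 'S_m) k := (dl k)^-1 *: ((-1) ^+ s * \prod_i A k i (s i) - (s == 1%g)%:R).
have -> : (fun k => (dl k)^-1 *: (\det (A k) - 1)) = (fun k => \sum_s T s k).
  apply/funext => k; rewrite /T -scaler_sumr sumrB /determinant; congr (_ *: (_ - _)).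
  by rewrite (bigD1 1%g) //= eqxx big1 ?addr0 // => s /negPf ->.
have -> : \tr b = \sum_(s : 'S_m) (if s == 1%g then \tr b else 0).
  by rewrite (bigD1 1%g) //= eqxx big1 ?addr0 // => s /negPf ->.
apply: cvg_bigsum => s; rewrite /T; have [->|s1] := eqVneq s 1%g.
  have -> : (fun k => (dl k)^-1 *: ((-1) ^+ (1%g : 'S_m) * \prod_i A k i ((1%g : 'S_m) i) - true%:R)) =
    (fun k => (dl k)^-1 *: (\prod_i A k i i - 1)).
    by apply/funext => k; rewrite odd_perm1 mul1r; under eq_bigr do rewrite perm1.
  apply: rescaled_prod => i; have := cb i i; by rewrite mxE eqxx.
have [i si] : exists i, s i != i.
  apply/existsP; apply: contraR s1; rewrite negb_exists => /forallP H1.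
  by apply/eqP/permP => i; rewrite perm1; apply/eqP; have := H1 i; rewrite negbK.
pose j := s i; have sj : s j != j by rewrite (inj_eq perm_inj).
have ji : j != i by [].
have -> : (fun k => (dl k)^-1 *: ((-1) ^+ s * \prod_i A k i (s i) - false%:R)) =
  (fun k => (-1) ^+ s * (((dl k)^-1 *: (A k i (s i) - (1%:M : 'M[R]_m) i (s i))) *
     (A k j (s j) * \prod_(l | (l != i) && (l != j)) A k l (s l)))).
  apply/funext => k; rewrite subr0 (bigD1 i) //= (bigD1 j) //= [(1%:M : 'M[R]_m) i _]mxE eq_sym (negPf si) subr0.
  by rewrite scalerAr -scalerAl.
have p0 : A k j (s j) @[k --> U] --> (0 : R).
  by have := ce j (s j); rewrite mxE eq_sym (negPf sj).
have -> : 0 = (-1) ^+ s * (b i (s i) * (0 * \prod_(l | (l != i) && (l != j)) (1%:M : 'M[R]_m) l (s l))) :> R by rewrite mul0r !mulr0.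
apply: cvgMr; apply: cvgM => //; apply: cvgM => //.
apply: cvg_bigprod => l; exact: ce.
Qed.
End Rescaled.

(** The rows are found one by one: with fewer than m rows the matrix kills a nonzero vector c, the
    combination of the functions with coefficients c is nonzero at some point and coordinate, and
    that evaluation is independent of the earlier rows. *)
Lemma evaluation_points (R : realType) p r m (S : set 'rV[R]_p) (e : 'I_m -> 'rV[R]_p -> 'rV[R]_r) :
  (forall c : 'I_m -> R, (forall x, S x -> \sum_a c a *: e a x = 0) -> forall a, c a = 0) ->
  exists (x : 'I_m -> 'rV[R]_p) (j : 'I_m -> 'I_r), (forall k, S (x k)) /\
    \matrix_(k, a) e a (x k) 0 (j k) \in unitmx.
Proof.
move=> free.
suff H k : (k <= m)%N -> exists (x : 'I_k -> 'rV[R]_p) (j : 'I_k -> 'I_r), (forall l, S (x l)) /\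
    row_free (\matrix_(l < k, a < m) e a (x l) 0 (j l)).
  have [x [j [Sx rf]]] := H m (leqnn m); exists x, j; split=> //; by rewrite -row_free_unit.
elim: k => [|k IH] km.
  exists (fun a : 'I_0 => let: Ordinal m' Hm' := a in match (Bool.diff_false_true Hm') with end).
  exists (fun a : 'I_0 => let: Ordinal m' Hm' := a in match (Bool.diff_false_true Hm') with end).
  by split; [case|apply: row_freeE => c _; apply/rowP => -[]].
have [x [j [Sx rf]]] := IH (ltnW km).
set A := \matrix_(_, _) _ in rf.
have [c [c0 Ac]] : exists c : 'cV[R]_m, c != 0 /\ A *m c = 0.
  have : kermx A^T != 0.
    rewrite kermx_eq0 /row_free mxrank_tr; move: rf; rewrite /row_free => /eqP ->.
    by rewrite neq_ltn km.
  move=> /rowV0Pn[v /sub_kermxP v1 v0]; exists v^T; split.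
    by apply: contra v0 => /eqP E; rewrite -[v]trmxK E trmx0.
  by rewrite -[A]trmxK -trmx_mul v1 trmx0.
have [y [l [Sy nz]]] : exists y l, S y /\ \sum_a c a 0 * e a y 0 l != 0.
  apply: contrapT => H; move/negP: c0; apply; apply/eqP/colP => a; rewrite mxE.
  apply: (free (fun a => c a 0)) => y Sy; apply/rowP => l; rewrite summxE mxE.
  apply: contrapT => /eqP nz; apply: H; exists y, l; split=> //.
  by rewrite (eq_bigr (fun k => (c k 0 *: e k y) 0 l)) // => b _; rewrite mxE.
exists (fun a => if unlift ord0 a is Some b then x b else y), (fun a => if unlift ord0 a is Some b then j b else l).
split; first by move=> a; case: unliftP.
apply: row_freeE => u uA.
have E a : u 0 ord0 * e a y 0 l + \sum_b u 0 (lift ord0 b) * A b a = 0.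
  have := congr1 (fun v : 'rV[R]_m => v 0 a) uA; rewrite [LHS]mxE [RHS]mxE big_ord_recl [X in _ * X + _]mxE unlift_none => E1.
  rewrite -[RHS]E1; apply: (congr1 (+%R _)); apply: eq_bigr => b _; by rewrite !mxE liftK.
have u0 : u 0 ord0 = 0.
  have : \sum_a (u 0 ord0 * e a y 0 l + \sum_b u 0 (lift ord0 b) * A b a) * c a 0 = 0.
    by apply: big1 => a _; rewrite E mul0r.
  under eq_bigr do rewrite mulrDl -mulrA big_distrl /=.
  rewrite big_split /= exchange_big /= [X in _ + X]big1 ?addr0; last first.
    move=> b _; under eq_bigr do rewrite -mulrA; rewrite -mulr_sumr.
    have := congr1 (fun v : 'cV[R]_k => v b 0) Ac; rewrite !mxE => ->; by rewrite mulr0.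
  rewrite -mulr_sumr; under eq_bigr do rewrite mulrC.
  by move=> /eqP; rewrite mulf_eq0 (negPf nz) orbF => /eqP.
have := rf; rewrite -kermx_eq0 => /eqP K0.
have : (\row_b u 0 (lift ord0 b)) *m A = 0.
  apply/rowP => a; have E2 := E a; rewrite u0 mul0r add0r in E2; rewrite [RHS]mxE -[RHS]E2 [LHS]mxE.
  by apply: eq_bigr => b _; rewrite mxE.
move=> /sub_kermxP; rewrite K0 submx0 => /eqP/rowP H.
apply/rowP => a; rewrite [RHS]mxE; case: (unliftP ord0 a) => [b ->|->] //.
by have := H b; rewrite !mxE.
Qed.

Lemma near_choice (U : set_system nat) (UF : UltraFilter U) (T : Type) (p0 : T) (Q : nat -> T -> Prop) :
  (\forall k \near U, exists p, Q k p) -> exists p : nat -> T, \forall k \near U, Q k (p k).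
Proof.
move=> H; have /choice[p Hp] : forall k, exists p, (exists p, Q k p) -> Q k p.
  by move=> k; have [[p Hp]|nH] := pselect (exists p, Q k p); [exists p|exists p0 => /nH].
by exists p; apply: (unear H) => k; exact: Hp.
Qed.

(** Evaluated at the points of [evaluation_points], the transformation law is a linear system for
    [P k] whose matrix tends to an invertible one. So (P k - 1) / dl k converges, and
    differentiating the law gives the bracket formula with the limit b. *)
Lemma frame_derivative (R : realType) (U : set_system nat) (UF : UltraFilter U) (dl : nat -> R) q m (S0 : set 'rV[R]_q)
    (e : 'I_m -> selfmap R q) (f : nat -> selfmap R q) (Z : selfmap R q)
    (J : 'rV[R]_q -> 'M[R]_q) (P : nat -> 'M[R]_m) :
  (\forall k \near U, 0 < dl k) -> dl k @[k --> U] --> (0 : R) ->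
  (forall c : 'I_m -> R, (forall x, S0 x -> \sum_a c a *: e a x = 0) -> forall a, c a = 0) ->
  (forall a x, S0 x -> differentiable (e a) x) ->
  (forall x, S0 x -> (dl k)^-1 *: (f k x - x) @[k --> U] --> Z x) ->
  (forall x, S0 x -> (dl k)^-1 *: (Jac (f k) x - 1%:M) @[k --> U] --> J x) ->
  (\forall k \near U, forall x, S0 x -> forall b, e b (f k x) = \sum_c P k b c *: (e c x *m Jac (f k) x)) ->
  exists2 b : 'M[R]_m, (dl k)^-1 *: (P k - 1%:M) @[k --> U] --> b &
    forall x a, S0 x -> Z x *m Jac (e a) x = \sum_c b a c *: e c x + e a x *m J x.
Proof.
move=> d0 dc free dfe fZ fJ HP.
have [p [j [Sp uA]]] := evaluation_points free.
set A0 := \matrix_(_, _) _ in uA.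
have cJ x : S0 x -> Jac (f k) x @[k --> U] --> (1%:M : 'M[R]_q) by move=> Sx; exact: (rescaled_cvg (UF := UF) d0 dc (fJ x Sx)).
pose L k := \matrix_(l, c) (e c (p l) *m Jac (f k) (p l)) 0 (j l).
pose N k := \matrix_(l, b) e b (f k (p l)) 0 (j l).
have NL : \forall k \near U, N k = L k *m (P k)^T.
  apply: (unear HP) => k H; apply/matrixP => l b.
  by rewrite !mxE H // summxE; apply: eq_bigr => c _; rewrite !mxE mulrC.
have cL : L k @[k --> U] --> A0.
  apply: cvg_mx => l c.
  have h1 : e c (p l) *m Jac (f k) (p l) @[k --> U] --> e c (p l) *m (1%:M : 'M[R]_q).
    by apply: cvg_mulmx; [exact: cvg_cst|exact: cJ].
  have h2 := cvg_entry (UF := UF) (i := 0) (j := j l) h1.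
  rewrite mulmx1 in h2; rewrite [A0 l c]mxE.
  have -> // : (fun k => L k l c) = (fun k => (e c (p l) *m Jac (f k) (p l)) 0 (j l)).
  by apply/funext => k; rewrite mxE.
have cs a x : S0 x -> (dl k)^-1 *: (e a (f k x) - e a x) @[k --> U] --> Z x *m Jac (e a) x.
  by move=> Sx; rewrite -diff_jac; apply: rescaled_diff => //; [exact: dfe|exact: fZ].
have cv a x : S0 x -> (dl k)^-1 *: (e a x *m Jac (f k) x - e a x) @[k --> U] --> e a x *m J x.
  move=> Sx; have -> : (fun k => (dl k)^-1 *: (e a x *m Jac (f k) x - e a x)) =
    (fun k => e a x *m ((dl k)^-1 *: (Jac (f k) x - 1%:M))).
    by apply/funext => k; rewrite -scalemxAr mulmxBr mulmx1.
  by apply: cvg_mulmx; [exact: cvg_cst|exact: fJ].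
pose S := \matrix_(l, b) (Z (p l) *m Jac (e b) (p l) - e b (p l) *m J (p l)) 0 (j l).
have cS : (dl k)^-1 *: (N k - L k) @[k --> U] --> S.
  apply: cvg_mx => l b.
  have h1 : (dl k)^-1 *: (e b (f k (p l)) - e b (p l)) - (dl k)^-1 *: (e b (p l) *m Jac (f k) (p l) - e b (p l)) @[k --> U] -->
     Z (p l) *m Jac (e b) (p l) - e b (p l) *m J (p l) by apply: cvgB; [exact: cs|exact: cv].
  have h2 := cvg_entry (UF := UF) (i := 0) (j := j l) h1.
  rewrite [S l b]mxE.
  have -> // : (fun k => ((dl k)^-1 *: (N k - L k)) l b) = (fun k => ((dl k)^-1 *: (e b (f k (p l)) - e b (p l)) -
     (dl k)^-1 *: (e b (p l) *m Jac (f k) (p l) - e b (p l))) 0 (j l)).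
  by apply/funext => k; rewrite -scalerBr opprB addrA subrK !mxE.
pose Q k := (dl k)^-1 *: ((P k)^T - 1%:M).
have LQ : \forall k \near U, L k *m Q k = (dl k)^-1 *: (N k - L k).
  by apply: (unear NL) => k ->; rewrite /Q -scalemxAr mulmxBr mulmx1.
have A0i : invmx A0 *m A0 = 1%:M by rewrite mulVmx.
pose K := m%:R * `|invmx A0| + 1.
have K0 : 0 < K by rewrite ltr_wpDl // mulr_ge0.
have m1 : 0 < (m%:R * 2 * K : R) + 1 by rewrite ltr_wpDl // !mulr_ge0 // ltW.
(* [L k] is not inverted: [Q] satisfies a fixed-point equation with a small coefficient, which first
   bounds [Q] and then gives its limit. *)
have QE : \forall k \near U, Q k = invmx A0 *m ((dl k)^-1 *: (N k - L k)) + invmx A0 *m ((A0 - L k) *m Q k).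
  apply: (unear LQ) => k H; rewrite -H -mulmxDr -mulmxDl addrC subrK mulmxA A0i mul1mx.
  by [].
have bQ : \forall k \near U, `|Q k| <= 2 * K * (`|S| + 1).
  have h1 : \forall k \near U, `|A0 - L k| < (m%:R * 2 * K + 1)^-1.
    by apply: ((cvgrPdist_lt _ _).1 cL); rewrite invr_gt0.
  have h2 : \forall k \near U, `|S - (dl k)^-1 *: (N k - L k)| < 1 by exact: ((cvgrPdist_lt _ _).1 cS _ ltr01).
  apply: (unear (filter_and _ QE (filter_and _ h1 h2))) => k [a1 [a2 a3]].
  have a4 : `|(dl k)^-1 *: (N k - L k)| <= `|S| + 1.
    by rewrite -(subrK S (_ *: _)) addrC; apply: le_trans (ler_normD _ _) _; rewrite lerD2l distrC ltW.
  have a5 : `|Q k| <= K * (`|S| + 1) + K * (m%:R * `|A0 - L k| * `|Q k|).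
    have mK : m%:R * `|invmx A0| <= K by rewrite /K lerDl.
    rewrite {1}a1; apply: le_trans (ler_normD _ _) _; apply: lerD.
      by apply: le_trans (mulmx_norm_le _ _) _; apply: ler_pM; rewrite ?mulr_ge0.
    apply: le_trans (mulmx_norm_le _ _) _; apply: ler_pM; rewrite ?mulr_ge0 //.
    exact: mulmx_norm_le.
  have a6 : K * (m%:R * `|A0 - L k| * `|Q k|) <= 2^-1 * `|Q k|.
    rewrite !mulrA ler_wpM2r //; have := ltW a2; rewrite -[_^-1]mul1r ler_pdivlMr // => a7.
    have : 0 <= `|A0 - L k| by []; have : K * m%:R * `|A0 - L k| * 2 <= 1; last by lra.
    have a8 : `|A0 - L k| * (m%:R * 2 * K + 1) = K * m%:R * `|A0 - L k| * 2 + `|A0 - L k| by ring.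
    by apply: le_trans a7; rewrite a8 lerDl.
  by rewrite -mulrA; move: a5 a6; move: (K * (`|S| + 1)) (K * _) (`|Q k|) => u v w; lra.
have cQ0 : (A0 - L k) *m Q k @[k --> U] --> (0 : 'M[R]_m).
  apply: (@cvg0_le _ _ _ _ _ (fun k => m%:R * `|A0 - L k| * (2 * K * (`|S| + 1)))).
    rewrite -(mul0r (2 * K * (`|S| + 1))); apply: cvgMl; rewrite -(mulr0 m%:R); apply: cvgMr.
    have cAL : A0 - L k @[k --> U] --> A0 - A0 by apply: cvgB; [exact: cvg_cst|exact: cL].
    by rewrite -(normr0 'M[R]_m) -(subrr A0); exact: (cvg_norm cAL).
  apply: (unear bQ) => k a1; apply: le_trans (mulmx_norm_le _ _) _.
  by rewrite ler_wpM2l // mulr_ge0.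
have cQ : Q k @[k --> U] --> invmx A0 *m S.
  have c1 : invmx A0 *m ((dl k)^-1 *: (N k - L k)) @[k --> U] --> invmx A0 *m S.
    by apply: cvg_mulmx cS; exact: cvg_cst.
  have c2 : invmx A0 *m ((A0 - L k) *m Q k) @[k --> U] --> invmx A0 *m (0 : 'M[R]_m).
    by apply: cvg_mulmx cQ0; exact: cvg_cst.
  have c3 : invmx A0 *m ((dl k)^-1 *: (N k - L k)) + invmx A0 *m ((A0 - L k) *m Q k) @[k --> U] -->
     invmx A0 *m S + invmx A0 *m (0 : 'M[R]_m) by apply: cvgD; [exact: c1|exact: c2].
  rewrite mulmx0 addr0 in c3.
  by apply: cvg_trans c3; apply: near_eq_cvg; apply: (unear QE) => k <-.
pose b := (invmx A0 *m S)^T.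
have cP : (dl k)^-1 *: (P k - 1%:M) @[k --> U] --> b.
  have := cvg_trmx (UF := UF) cQ.
  have -> // : (fun k => (Q k)^T) = (fun k => (dl k)^-1 *: (P k - 1%:M)).
  by apply/funext => k; rewrite /Q linearZ linearB /= trmxK trmx1.
exists b => // x a Sx.
have cPe c k0 : (dl k)^-1 *: (P k k0 c - (1%:M : 'M[R]_m) k0 c) @[k --> U] --> b k0 c.
  have := cvg_entry (UF := UF) (i := k0) (j := c) cP.
  by have -> : (fun k => ((dl k)^-1 *: (P k - 1%:M)) k0 c) = (fun k => (dl k)^-1 *: (P k k0 c - (1%:M : 'M[R]_m) k0 c))
    by apply/funext => k; rewrite !mxE.
apply: cvg_unique (cs a x Sx) _; first exact: norm_hausdorff.
have cR : \sum_c ((dl k)^-1 *: (P k a c - (1%:M : 'M[R]_m) a c)) *: (e c x *m Jac (f k) x) @[k --> U] --> \sum_c b a c *: e c x.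
  apply: cvg_mx => u v; rewrite summxE.
  have -> : (fun k => (\sum_c ((dl k)^-1 *: (P k a c - (1%:M : 'M[R]_m) a c)) *: (e c x *m Jac (f k) x)) u v) =
    (fun k => \sum_c (((dl k)^-1 *: (P k a c - (1%:M : 'M[R]_m) a c)) *: (e c x *m Jac (f k) x)) u v).
    by apply/funext => k; rewrite summxE.
  apply: (cvg_bigsum (UF := UF)) => c; apply: (cvg_entry (UF := UF)); apply: cvgZ; first exact: cPe.
  by rewrite -[X in _ --> X]mulmx1; apply: cvg_mulmx; [exact: cvg_cst|exact: cJ].
apply: (@cvg_trans _ ((\sum_c ((dl k)^-1 *: (P k a c - (1%:M : 'M[R]_m) a c)) *: (e c x *m Jac (f k) x)) +
   (dl k)^-1 *: (e a x *m Jac (f k) x - e a x) @[k --> U])).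
  apply: near_eq_cvg; apply: (unear HP) => k H; rewrite H //.
  have -> : \sum_c ((dl k)^-1 *: (P k a c - (1%:M : 'M[R]_m) a c)) *: (e c x *m Jac (f k) x) =
    (dl k)^-1 *: (\sum_c P k a c *: (e c x *m Jac (f k) x) - e a x *m Jac (f k) x).
    have -> : e a x *m Jac (f k) x = \sum_c (1%:M : 'M[R]_m) a c *: (e c x *m Jac (f k) x).
      rewrite (bigD1 a) //= mxE eqxx scale1r big1 ?addr0 // => c /negPf ca.
      by rewrite mxE eq_sym ca scale0r.
    rewrite -sumrB scaler_sumr; apply: eq_bigr => c _; by rewrite -scalerBl scalerA.
  by rewrite -scalerDr addrA subrK.
by apply: cvgD => //; exact: cv.
Qed.

Section GramDerivative.
Variables (R : realType) (n q : nat) (M : manifold R n) (F : foliation M q).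
Variable (G : fidx F -> 'rV[R]_q -> 'M[R]_q).
Hypothesis tG : transverse_metric G.
Variable U : set_system nat.
Context {UF : UltraFilter U}.
Variable dl : nat -> R.
Variables (i : fidx F) (t0 : 'rV[R]_q) (rT r0 : R).
Implicit Types (x y : 'rV[R]_q) (A : 'M[R]_q) (phi psi : selfmap R q).
Implicit Types (h : nat -> selfmap R q).

Notation B := (ball t0 r0).
Notation fam := (local_fam U dl i t0 rT r0).
Notation lim_field h := (rescaled_limit U h dl).
Hypothesis LC : local_ctx G U dl i t0 rT r0.

Hypothesis cM : closed_manifold M.
Variable Bm : fibre_metric F.
Hypothesis bB : basic_metric Bm.
Variables (m : nat) (hb : 'I_m -> nat -> selfmap R q) (rho : R).
Hypothesis hf : forall a, fam (hb a).
Hypothesis rr : 0 < rho < r0.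
Hypothesis span : forall f, fam f -> exists c : 'I_m -> R, forall x, ball t0 rho x ->
      lim_field f x = \sum_a c a *: lim_field (hb a) x.
Hypothesis free : forall (c : 'I_m -> R) x, ball t0 rho x ->
  (\forall y \near x, \sum_a c a *: lim_field (hb a) y = 0) -> forall a, c a = 0.
Notation e := (fun a => lim_field (hb a)).

Let rB : ball t0 rho `<=` B.
Proof. by move=> x; rewrite !ballE => /lt_trans; apply; case/andP: rr. Qed.

Let ce a : central_section i (ball t0 rho) (lim_field (hb a)).
Proof. by apply: central_sub (fam_central tG LC (hf a)) _ rB; exact: ball_open. Qed.

(* Pulling back the frame by the maps of the family gives constant matrices P;
   the derivative of P at the identity is the matrix of ad. *)
Lemma pull_frame f r : fam f -> 0 < r < rho -> \forall k \near U, exists P : 'M[R]_m, forall x, ball t0 r x ->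
  ball t0 rho (f k x) /\
  (forall b, lim_field (hb b) (f k x) = \sum_c P b c *: (lim_field (hb c) x *m Jac (f k) x)) /\
  \det (gram Bm i e (f k x)) = \det P ^+ 2 * \det (gram Bm i e x).
Proof.
move=> ff /andP[rp rrho]; have /andP[rho0 rhor] := rr.
pose r1 := (r + rho) / 2.
have rr1 : r < r1 by rewrite /r1; lra.
have r1rho : r1 < rho by rewrite /r1; lra.
have sub : ball t0 r `<=` ball t0 r1 by move=> x; rewrite !ballE => /lt_trans; apply.
have sub1 : ball t0 r1 `<=` ball t0 rho by move=> x; rewrite !ballE => /lt_trans; apply.
have [fH [C C0 HC]] := ff.
have e1 : 0 < rho - r1 by rewrite subr_gt0.
apply: (unear (filter_and _ fH (filter_and _ HC (dl_small LC C e1)))) => k [[Om [co BO _]] [h2 h3]].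
have im x : ball t0 r1 x -> ball t0 rho (f k x).
  move=> Bx; rewrite ballE -(subrK x (f k x)) -addrA; apply: le_lt_trans (ler_normD _ _) _.
  have := h2 x (rB (sub1 _ Bx)); rewrite /jd; have := normr_ge0 (Jac (f k) x - Jac id x).
  by move: Bx h3; rewrite ballE /=; lra.
have VO : ball t0 r1 `<=` Om by move=> x /sub1/rB/BO.
have cp b : central_section i (ball t0 r1) (pull (f k) (lim_field (hb b))).
  exact: (pull_central tG cM co (@ball_open _ _ t0 r1) VO im (ce b)).
have /choice[P HP] : forall b, exists c : 'I_m -> R, forall x, ball t0 r x ->
    pull (f k) (lim_field (hb b)) x = \sum_a c a *: lim_field (hb a) x.
  move=> b; have r01 : 0 < r < r1 by rewrite rp.
  have r1r0 : r1 <= r0 by apply/ltW; apply: lt_trans r1rho _.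
  have [g gf Eg] := fam_ext tG LC (cp b) (subset_trans sub1 rB) r01 r1r0.
  have [c Hc] := span gf; exists c => x Bx; rewrite -Eg // Hc //; exact/sub1/sub.
exists (\matrix_(b, c) P b c) => x Bx; split; [exact/im/sub|split].
  move=> b; have u := composite_unit tG co (VO _ (sub _ Bx)).
  have := congr1 (mulmx^~ (Jac (f k) x)) (HP b x Bx); rewrite /pull -mulmxA mulVmx // mulmx1 => ->.
  by rewrite mulmx_suml; apply: eq_bigr => c _; rewrite mxE -scalemxAl.
have Bx1 := sub _ Bx.
have gm := @gram_lin _ _ _ _ _ _ tG cM _ bB m i (ball t0 r) e (fun b => pull (f k) (lim_field (hb b))) (\matrix_(b, c) P b c) x
  (fun a => central_sub (ce a) (@ball_open _ _ t0 r) (subset_trans sub sub1)) Bx.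
have E : gram Bm i (fun b => pull (f k) (lim_field (hb b))) x = gram Bm i e (f k x).
  apply/matrixP => a b; rewrite !mxE.
  have g1 a' : central_germ i (f k x) (lim_field (hb a')) by exists (ball t0 rho) => //; exact: im.
  by have [_ _ ->] := metric_pull tG cM bB co (VO _ Bx1) (g1 a) (g1 b).
rewrite -E gm; last by move=> a y By; rewrite HP //; apply: eq_bigr => b _; rewrite mxE.
by rewrite !det_mulmx det_tr expr2; ring.
Qed.

(** The first formula says that b is the matrix of the bracket with the limit field in the parallel
    frame. The second is the derivative of the law in which det P ^ 2 multiplies the Gram
    determinant. *)
Lemma gram_derivative f r : fam f -> 0 < r < rho -> exists b : 'M[R]_m, forall x, ball t0 r x ->
  (forall a, lim_field f x *m Jac (lim_field (hb a)) x =
     \sum_c b a c *: lim_field (hb c) x + lim_field (hb a) x *m Jac (lim_field f) x) /\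
  'd (fun y => \det (gram Bm i e y)) x (lim_field f x) = 2 * \tr b * \det (gram Bm i e x).
Proof.
move=> ff rrho; have /andP[rp rlt] := rrho; have /andP[rho0 rhor] := rr.
have d0 : \forall k \near U, 0 < dl k by exact: (dl_gt0 LC).
have dc : dl k @[k --> U] --> (0 : R) by exact: dl_cvg LC.
have [_ lf jf] := fam_limit tG LC ff.
have sub : ball t0 r `<=` ball t0 rho by move=> x; rewrite !ballE => /lt_trans; apply.
have Br : ball t0 r t0 by exact: ballxx.
have [P HP] := near_choice UF (0 : 'M[R]_m) (pull_frame ff rrho).
have [b cb Hb] := @frame_derivative R U UF dl q m (ball t0 r) e f (lim_field f) (Jac (lim_field f)) P d0 dc
  (fun c H => free (sub _ Br) (filterS (fun y By => H y By) (open_near (@ball_open _ _ t0 r) Br)))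
  (fun a x Bx => central_diff (ce a) (sub _ Bx)) (fun x Bx => lf x (rB (sub _ Bx))) (fun x Bx => jf x (rB (sub _ Bx)))
  (unear HP (fun k H x Bx => (H x Bx).2.1)).
exists b => x Bx; split; first by move=> a; exact: Hb.
have sD := gram_det_smooth bB (@ball_open _ _ t0 rho) ce.
have dD := smooth_diff (@ball_open _ _ t0 rho) sD (sub _ Bx).
have h1 := rescaled_diff (UF := UF) d0 dc dD (lf x (rB (sub _ Bx))).
apply: cvg_unique h1 _; first exact: norm_hausdorff.
have c1 := rescaled_det (UF := UF) d0 dc cb.
have c2 := rescaled_cvg (UF := UF) d0 dc c1.
(* The factorisation det P^2 - 1 = (det P - 1)(det P + 1), with limits tr b after rescaling and
   2. *)
have c3 : ((dl k)^-1 *: (\det (P k) - 1)) * (\det (P k) + 1) * \det (gram Bm i e x) @[k --> U] --> \tr b * (1 + 1) * \det (gram Bm i e x).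
  by apply: cvgMl; apply: cvgM => //; apply: cvgD => //; exact: cvg_cst.
have -> : 2 * \tr b * \det (gram Bm i e x) = \tr b * (1 + 1) * \det (gram Bm i e x) by ring.
apply: cvg_trans c3; apply: near_eq_cvg; apply: (unear HP) => k /(_ x Bx)[_ [_ ->]].
rewrite -[_ *: (\det (P k) - 1)]/(_ * _) -[RHS]/(_ * _); ring.
Qed.
End GramDerivative.

(** * Constancy along the holonomy *)

Lemma is_derive_fun (R : realType) (V W : normedModType R) (g : V -> W) (c : R -> V) (s : R) (v : V) :
  is_derive s 1 c v -> differentiable g (c s) -> is_derive s 1 (fun u => g (c u)) ('d g (c s) v).
Proof.
move=> [/derivable1_diffP dc Dc] dp.
have dpc : differentiable (g \o c) s by exact: differentiable_comp.
split; first exact/derivable1_diffP.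
have -> : 'D_1 (fun u => g (c u)) s = 'd (g \o c) s 1 by exact: deriveE.
rewrite diff_comp //= -Dc; congr ('d g (c s) _).
by symmetry; exact: deriveE.
Qed.

Lemma const_of_derive0 (R : realType) (g : R -> R) (e : R) : (forall s : R, `|s| < e -> is_derive s 1 g 0) ->
  forall s, 0 <= s < e -> g s = g 0.
Proof.
move=> H s /andP[s0 se]; have [->//|s_neq0] := eqVneq s 0.
have sp : 0 < s by rewrite lt_neqAle eq_sym s_neq0.
have Hx x : x \in `[0, s] -> is_derive x 1 g 0.
  by rewrite in_itv /= => /andP[x0 xs]; apply: H; rewrite ger0_norm //; exact: le_lt_trans xs se.
have Hx' x : x \in `]0, s[ -> is_derive x 1 g 0.
  by rewrite in_itv /= => /andP[x0 xs]; apply: Hx; rewrite in_itv /= !ltW.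
have cg : {within `[0, s], continuous g}.
  apply: derivable_within_continuous => x /Hx[]; by [].
have [c _] := MVT sp Hx' cg.
by rewrite mul0r => /eqP; rewrite subr_eq0 => /eqP.
Qed.

Section IsomJacLip.
Variables (R : realType) (q : nat) (T : set 'rV[R]_q) (G : 'rV[R]_q -> 'M[R]_q).
Hypothesis oT : open T.
Hypothesis sG : forall k l, smooth_on T (fun t => G t k l).
Hypothesis pG : forall t, T t -> posdef (G t).
Variables (t0 : 'rV[R]_q) (rT : R).
Hypothesis rT0 : 0 < rT.
Hypothesis cT : cball t0 rT `<=` T.

(** [Ff] vanishes at the jet of the identity and is Lipschitz, so the second derivatives of an
    isometry are bounded by the distance of its 1-jet from that of the identity, uniformly in the
    isometry. *)
Lemma isom_jac_lip : exists2 L : R, 0 < L & forall (c : 'rV[R]_q) r phi, ball c r `<=` ball t0 rT -> isom T G (ball c r) phi ->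
  (forall x, ball c r x -> ball t0 rT (phi x)) -> forall x y, ball c r x -> ball c r y -> `|Jac phi x - Jac phi y| <= L * `|x - y|.
Proof.
have [C [K [C0 K0 HC HK]]] := Ff_lip oT sG pG cT.
pose K1 := K * (2 * rT + (C + C)).
have K10 : 0 < K1 by rewrite mulr_gt0 // !addr_gt0 // mulr_gt0.
exists (q%:R * K1 + 1); first by rewrite ltr_wpDl // mulr_ge0 // ltW.
move=> c r phi cD iso pD x y Bx By.
have DT : ball t0 rT `<=` T by move=> z; rewrite ballE => /ltW/cT.
have oB := @ball_open _ _ c r.
have [sp _ _] := iso.
apply: mx_norm_leB => [|a k]; first by rewrite mulr_ge0 // addr_ge0 // mulr_ge0 // ltW.
rewrite distrC [`|x - y|]distrC; apply: le_trans (_ : q%:R * K1 * `|y - x| <= _); last by rewrite ler_wpM2r // lerDl.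
apply: (smooth_ball_lip (smooth_jac oB sp a k)) => // l z Bz.
rewrite (iso_pde oT sG pG l a k oB iso (subset_trans cD DT) Bz).
have Dz := cD _ Bz; have Dpz := pD _ Bz.
rewrite -[Ff _ _ _ _ _ _ _]subr0 -(Ff_id oT sG pG l a k (DT _ Dz)).
have a1 : `|Jac phi z| <= C by exact: HC iso Dz Bz Dpz.
have a2 : `|1%:M : 'M[R]_q| <= C.
  rewrite -(jac_id z); apply: (HC _ _ _ (isom_id G DT)) => //; exact: Dz.
apply: le_trans (HK l a k _ _ _ _ _ Dz Dpz Dz a1 a2) _; rewrite /K1 ler_pM2l //; apply: lerD.
  move: Dz Dpz; rewrite !ballE => b1 b2; rewrite -(subrK t0 (phi z)) -addrA; apply: le_trans (ler_normD _ _) _.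
  by rewrite [`|t0 - z|]distrC; move: b1 b2; lra.
by apply: le_trans (ler_normB _ _) _; exact: lerD.
Qed.
End IsomJacLip.

Section FlowApproximation.
Variables (R : realType) (n q : nat) (M : manifold R n) (F : foliation M q).
Variable (G : fidx F -> 'rV[R]_q -> 'M[R]_q).
Hypothesis tG : transverse_metric G.
Variable U : set_system nat.
Context {UF : UltraFilter U}.
Variable dl : nat -> R.
Variables (i : fidx F) (t0 : 'rV[R]_q) (rT r0 : R).
Implicit Types (x y : 'rV[R]_q) (A : 'M[R]_q) (phi psi : selfmap R q).
Implicit Types (h : nat -> selfmap R q).

Notation B := (ball t0 r0).
Notation D := (ball t0 rT).
Notation isoT := (isom (trans i) (G i)).
Notation fam := (local_fam U dl i t0 rT r0).
Notation lim_field h := (rescaled_limit U h dl).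
Hypothesis LC : local_ctx G U dl i t0 rT r0.

Hypothesis cM : closed_manifold M.
Variables (Df : 'rV[R]_q -> R) (rho : R).
Hypothesis rr : 0 < rho < r0.
Hypothesis sD : smooth_on (ball t0 rho) Df.
Hypothesis HD : forall X x, central_section i (ball t0 rho) X -> ball t0 rho x -> 'd Df x (X x) = 0.

(** The geometric clauses of [local_ctx] do not mention the scale, so the sequence of distances in
    [transverse_constancy] may replace [dl]. *)
Lemma local_ctx_step (d : nat -> R) : (\forall k \near U, 0 < d k <= 1) -> d k @[k --> U] --> (0 : R) ->
  local_ctx G U d i t0 rT r0.
Proof. by move=> h1 h2; have [a b c e [f _ _]] := LC; split. Qed.

Let W := ball t0 rho.
Let WB : W `<=` B. Proof. by move=> x; rewrite /W !ballE => /lt_trans; apply; case/andP: rr. Qed.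
Let W0 : W t0. Proof. by apply: ballxx; case/andP: rr. Qed.
Let oW : open W. Proof. exact: ball_open. Qed.

Lemma const_along_flow X tau rho1 (E : R -> selfmap R q) : central_section i W X ->
  (forall y, ball t0 rho1 y -> forall s : R, `|s| < tau ->
     [/\ W (E s y), is_derive s 1 (fun r : R => E r y) (X (E s y)), E 0 y = y & good G i i (E s) y]) ->
  forall y s, ball t0 rho1 y -> 0 <= s < tau -> Df (E s y) = Df y.
Proof.
move=> cX HE y s By st; have s0 : `|s| < tau by case/andP: st => s0 st; rewrite ger0_norm.
rewrite -{2}(_ : E 0 y = y); last by have [] := HE y By s s0.
apply: (@const_of_derive0 R (fun s => Df (E s y)) tau) => // u ut.
have [h1 h2 _ _] := HE y By u ut.
have := is_derive_fun h2 (smooth_diff oW sD h1).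
by rewrite HD.
Qed.

(** A family and the flow of its limit field at time [dl m] have the same rescaled 1-jet in the
    limit, so they differ by o(dl m) on a ball. The flow maps, unlike the holonomy maps, are known
    to preserve [Df]. *)
Lemma approx_by_flow (f : nat -> selfmap R q) : fam f -> exists2 rho2 : R, 0 < rho2 <= rho &
  exists (E : nat -> selfmap R q) (theta : nat -> R), theta m @[m --> U] --> (0 : R) /\
  \forall m \near U, forall x, ball t0 rho2 x ->
    [/\ W (E m x), Df (E m x) = Df x, good G i i (E m) x & jd (f m) (E m) x <= theta m * dl m].
Proof.
move=> ff; have [r00 r0T rT0] := lc_pos LC; have /andP[rho0 rhor] := rr.
have BD := lc_BD LC.
pose Z := lim_field f.
have cZ : central_section i W Z by apply: central_sub oW WB; exact: (fam_central tG LC ff).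
have [tau [rho1 [E [tau0 rho10 HE]]]] : flowbox G i W Z t0 by apply: (fam_flowbox tG LC ff oW WB W0).
have [sZ lf lJf] := fam_limit tG LC ff.
have cB : cball t0 rho `<=` B by move=> x; rewrite /cball /= ballE => /le_lt_trans; apply.
have [K0 K00 [HK0 _]] := smooth_map_cball (@ball_open _ _ t0 r0) sZ cB.
pose rho2 := Num.min rho1 rho.
have rho20 : 0 < rho2 by rewrite lt_min rho10.
have r2r : rho2 <= rho by rewrite ge_min lexx orbT.
have s1 x : ball t0 rho2 x -> ball t0 rho1 x by rewrite !ballE => /lt_le_trans; apply; rewrite ge_min lexx.
have s2 x : ball t0 rho2 x -> W x by rewrite /W !ballE => /lt_le_trans; apply.
have dlg : \forall m \near U, 0 < dl m by exact: (dl_gt0 LC).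
have dlc := dl_cvg LC.
have dlt : \forall m \near U, `|dl m| < tau.
  have h1 : \forall m \near U, `|0 - dl m| < tau by move: dlc => /cvgrPdist_lt/(_ _ tau0).
  by apply: (unear h1) => m; rewrite sub0r normrN.
pose Em m := E (dl m).
have iE : \forall m \near U, isoT (ball t0 rho2) (Em m).
  apply: (unear dlt) => m dm; split.
  - move=> j; apply: smooth_local => x /s1 Bx; have [_ _ _ [V [_ _ Vx] [sV _ _ _]]] := HE x Bx _ dm.
    by exists V.
  - by move=> x /s1 Bx; have [/WB/BD/(lc_DT LC)] := HE x Bx _ dm.
  - by move=> x /s1 Bx; have [_ _ _ [V [_ _ Vx] [_ _ GV _]]] := HE x Bx _ dm; apply: GV.
have DE : \forall m \near U, forall x, ball t0 rho2 x -> D (Em m x).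
  by apply: (unear dlt) => m dm x /s1 Bx; have [/WB/BD] := HE x Bx _ dm.
have CE : \forall m \near U, forall x, ball t0 rho2 x -> `|Em m x - x| <= K0 * dl m.
  apply: (unear (filter_and _ dlt dlg)) => m [dm d0] x /s1 Bx.
  have [_ _ E0 _] := HE x Bx _ dm.
  have := @curve_lip R q (fun r => E r x) (fun r => Z (E r x)) K0 0 (dl m) (ltW d0) (ltW K00).
  rewrite E0 subr0; apply => r /andP[a b].
  have rt : `|r| < tau by rewrite ger0_norm //; apply: le_lt_trans b _; rewrite -(ger0_norm (ltW d0)).
  have [w1 w2 _ _] := HE x Bx _ rt; split => //; apply: HK0.
  by move: w1; rewrite /W ballE /cball /= => /ltW.
have b2B : ball t0 rho2 `<=` B by move=> x /s2/WB.
have [C C0 HC] := jd_of_C0 tG LC b2B rho20 (le_trans r2r (ltW rhor)) (ltW K00) dlg dlc iE DE CE.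
have [sE lE lJE] := lc_family_limit tG LC (subset_trans b2B BD) (dl_le1 LC) iE DE HC.
have EZ x : ball t0 rho2 x -> rescaled_limit U Em dl x = Z x.
  move=> Bx; have d0 : `|0 : R| < tau by rewrite normr0.
  have [_ w2 E0 _] := HE x (s1 x Bx) _ d0.
  have := derive_seq UF w2 dlg dlc; rewrite E0.
  have -> : (fun m => (dl m)^-1 *: (E (0 + dl m) x - x)) = (fun m => (dl m)^-1 *: (Em m x - x)).
    by apply/funext => m; rewrite add0r.
  by move=> c2; apply: (cvg_unique _ (lE x Bx) c2); exact: norm_hausdorff.
have B20 : ball t0 rho2 t0 by exact: ballxx.
have JEZ : Jac (rescaled_limit U Em dl) t0 = Jac Z t0.
  apply: jac_near; first by apply: smooth_map_diff sZ _; [exact: ball_open|exact/b2B].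
  apply: filterS (fun x Bx => esym (EZ x Bx)) _.
  exact: nbhsx_ballx.
exists rho2; first by rewrite rho20.
(* The rate is twice the difference of the two rescaled 1-jets at [t0], which tends to 0 because
   both limit fields have the same 1-jet there. *)
exists Em, (fun m => 2 * (`|(dl m)^-1 *: (f m t0 - t0) - (dl m)^-1 *: (Em m t0 - t0)| +
   `|(dl m)^-1 *: (Jac (f m) t0 - 1%:M) - (dl m)^-1 *: (Jac (Em m) t0 - 1%:M)|)); split.
  have c1 : (dl m)^-1 *: (f m t0 - t0) - (dl m)^-1 *: (Em m t0 - t0) @[m --> U] --> (Z t0 - rescaled_limit U Em dl t0).
    by apply: cvgB; [exact: lf (WB W0)|exact: lE].
  have c2 : (dl m)^-1 *: (Jac (f m) t0 - 1%:M) - (dl m)^-1 *: (Jac (Em m) t0 - 1%:M) @[m --> U] -->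
      (Jac Z t0 - Jac (rescaled_limit U Em dl) t0).
    by apply: cvgB; [exact: lJf (WB W0)|exact: lJE].
  rewrite EZ // subrr in c1; rewrite JEZ subrr in c2.
  set u1 := fun m => _ in c1; set u2 := fun m => _ in c2.
  have c1n : `|u1 m| @[m --> U] --> (0 : R) by rewrite -(normr0 'rV[R]_q); exact: (cvg_norm c1).
  have c2n : `|u2 m| @[m --> U] --> (0 : R) by rewrite -(normr0 'M[R]_q); exact: (cvg_norm c2).
  have c3 : `|u1 m| + `|u2 m| @[m --> U] --> (0 + 0 : R) by apply: cvgD; [exact: c1n|exact: c2n].
  have c4 : 2 * (`|u1 m| + `|u2 m|) @[m --> U] --> (2 * (0 + 0) : R) by apply: cvgM; [exact: cvg_cst|exact: c3].
  by rewrite addr0 mulr0 in c4; exact: c4.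
apply: (unear (filter_and _ (filter_and _ dlt dlg) (filter_and _ (filter_and _ iE DE) (filter_and _ (fam_isom tG ff) (fam_D ff))))).
move=> m [[dm d0] [[im Dm] [jm Fm]]] x Bx.
have [w1 _ _ gd] := HE x (s1 x Bx) _ dm; split => //.
  apply: (const_along_flow cZ HE) (s1 x Bx) _; rewrite (ltW d0) /=.
  by rewrite -(ger0_norm (ltW d0)).
apply: le_trans (jet_id LC b2B (le_trans r2r (ltW rhor)) _ im _ Dm Bx B20) _.
- exact: isom_sub b2B jm.
- by move=> z /b2B; exact: Fm.
rewrite /jd -!scalerBr !normrZ -mulrDr -mulrA ler_pM2l // gtr0_norm ?invr_gt0 //.
rewrite [X in _ <= X]mulrC mulrA mulfV ?gt_eqF // mul1r.
by rewrite !opprB !addrA !subrK.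
Qed.
End FlowApproximation.

Section TransverseConstancy.
Variables (R : realType) (n q : nat) (M : manifold R n) (F : foliation M q).
Variable (G : fidx F -> 'rV[R]_q -> 'M[R]_q).
Hypothesis tG : transverse_metric G.
Variable U : set_system nat.
Context {UF : UltraFilter U}.
Variable dl : nat -> R.
Variables (i : fidx F) (t0 : 'rV[R]_q) (rT r0 : R).
Implicit Types (x y : 'rV[R]_q) (A : 'M[R]_q) (phi psi : selfmap R q).
Implicit Types (h : nat -> selfmap R q).

Notation B := (ball t0 r0).
Notation hol := (local_hol i t0 rT r0).
Hypothesis LC : local_ctx G U dl i t0 rT r0.

Hypothesis cM : closed_manifold M.
Variables (Df : 'rV[R]_q -> R) (rho : R).
Hypothesis rr : 0 < rho < r0.
Hypothesis sD : smooth_on (ball t0 rho) Df.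
Hypothesis HD : forall X x, central_section i (ball t0 rho) X -> ball t0 rho x -> 'd Df x (X x) = 0.

Let W := ball t0 rho.
Let WB : W `<=` B. Proof. by move=> x; rewrite /W !ballE => /lt_trans; apply; case/andP: rr. Qed.
Let W0 : W t0. Proof. by apply: ballxx; case/andP: rr. Qed.
Let oW : open W. Proof. exact: ball_open. Qed.

(* Jets of holonomy maps are compared with the closest limit jet at t0 along
   which Df keeps its value; the rescaled difference converges to a central
   field, whose flow would lead to a still closer such jet. *)
Lemma transverse_constancy : exists2 eta : R, 0 < eta & forall Om (h : selfmap R q), composite i i Om h -> Om t0 ->
  `|h t0 - t0| < eta -> Df (h t0) = Df t0.
Proof.
have [r00 r0T rT0] := lc_pos LC; have /andP[rho0 rhor] := rr.
have [_ _ _ HUE [HU _ _]] := LC.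
have sG (a b : 'I_q) : smooth_on (trans i) (fun t => G i t a b) by case: tG => H _ _ _; exact: H.
have pG t : trans i t -> posdef (G i t) by exact: tG_posdef.
have oT := @trans_open _ _ _ _ F i.
have BD := lc_BD LC; have BT := subset_trans BD (lc_DT LC).
have B0 : B t0 by exact: ballxx.
have [C1 C10 HC1] := isom_jac_bound oT sG pG (lc_cD LC).
have [L1 L10 HL1] := isom_jac_lip oT sG pG rT0 (lc_cD LC).
apply: contrapT => nH.
pose ep (m : nat) : R := m.+1%:R^-1.
have ep0 m : 0 < ep m by rewrite invr_gt0.
have ep1 m : ep m <= 1 by rewrite invf_le1 // ler1n.
have [_ epc] := inv_succ_scale R HU; rewrite -/ep in epc.
have /choice[ho Hho] : forall m, exists ho : set 'rV[R]_q * (selfmap R q),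
    [/\ composite i i ho.1 ho.2, ho.1 t0, `|ho.2 t0 - t0| < ep m & Df (ho.2 t0) <> Df t0].
  move=> m; apply: contrapT => nm; apply: nH; exists (ep m) => // Om h co Ot hm.
  by apply: contrapT => nD; apply: nm; exists (Om, h).
pose h m := (ho m).2; pose J m := Jac (h m) t0.
have ch : h m t0 @[m --> U] --> t0.
  have -> : (fun m => h m t0) = (fun m => (h m t0 - t0) + t0) by apply/funext => m; rewrite subrK.
  rewrite -[X in _ --> X]add0r; apply: cvgD; last exact: cvg_cst.
  by apply: (@cvg0_le _ _ _ _ _ _ epc); apply: filterE => m; have [_ _ /ltW] := Hho m.
have hW : \forall m \near U, W (h m t0).
  have h1 : \forall m \near U, `|t0 - h m t0| < rho by exact: ((cvgrPdist_lt _ _).1 ch _ rho0).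
  by apply: (unear h1) => m; rewrite /W ballE distrC.
have hiso m : J m *m G i (h m t0) *m (J m)^T = G i t0.
  by have [co Ot _ _] := Hho m; exact: (tG_composite tG co Ot).
have Jb : \forall m \near U, `|J m| <= C1.
  by apply: (unear hW) => m Wm; apply: HC1 (hiso m); [exact: BD|exact/BD/WB].
have [Jinf cJ] : exists Jinf : 'M[R]_q, J m @[m --> U] --> Jinf.
  by exists (lim (J m @[m --> U])); exact: (ultra_bounded_mx (UF := UF) Jb).
(* Limit jets with source [t0] whose target keeps the value of [Df]. The set is stable under
   following such a jet by a flow map of a central field. *)
pose Cs (y : 'rV[R]_q) (A : 'M[R]_q) := [/\ W y, ejet i i t0 y A & Df y = Df t0].
have Cinf : Cs t0 Jinf.
  split=> // e e0.
  have h1 : \forall m \near U, `|t0 - h m t0| < e by exact: ((cvgrPdist_lt _ _).1 ch _ e0).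
  have h2 : \forall m \near U, `|Jinf - J m| < e by move: cJ => /cvgrPdist_lt/(_ _ e0).
  have [m [a b]] := proper_ex _ (filter_and _ h1 h2).
  have [co Ot _ _] := Hho m.
  by exists (ho m).1, (h m); rewrite distrC a distrC b.
pose dist m y A : R := `|h m t0 - y| + `|J m - A|.
pose DS m := [set r | exists y A, Cs y A /\ r = dist m y A].
(* The infimum may not be attained; a competitor at distance less than 2 d m is used instead. This d
   serves as the scale for the rescaling. *)
pose d m := inf (DS m).
have DSi m : has_inf (DS m).
  split; first by exists (dist m t0 Jinf), t0, Jinf.
  by exists 0 => r [y [A [_ ->]]]; rewrite addr_ge0.
have dle m y A : Cs y A -> d m <= dist m y A.
  by move=> CA; apply: ge_inf; [case: (DSi m)|exists y, A].
have d_ge0 m : 0 <= d m.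
  by apply: lb_le_inf; [case: (DSi m)|move=> r [y [A [_ ->]]]; rewrite addr_ge0].
have dc : d m @[m --> U] --> (0 : R).
  have c1 : dist m t0 Jinf @[m --> U] --> `|t0 - t0| + `|Jinf - Jinf|.
    apply: cvgD; apply: cvg_norm; apply: cvgB.
    - exact: ch.
    - exact: cvg_cst.
    - exact: cJ.
    - exact: cvg_cst.
  rewrite !subrr !normr0 addr0 in c1.
  apply: (@cvg0_le _ _ _ _ _ _ c1); apply: filterE => m; rewrite ger0_norm //; exact: dle.
(* Distance 0 would give, by continuity of [Df] at [h m t0], the equality of values that [h m] was
   chosen to violate. *)
have d_gt0 : \forall m \near U, 0 < d m.
  apply: (unear hW) => m Wm; rewrite lt_neqAle d_ge0 andbT; apply/negP => /eqP d0.
  have [_ _ _ nD] := Hho m; apply: nD.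
  have nz : 0 < `|Df (h m t0) - Df t0| \/ Df (h m t0) = Df t0.
    by have [->|h1] := eqVneq (Df (h m t0)) (Df t0); [right|left; rewrite normr_gt0 subr_eq0].
  case: nz => // nz; exfalso.
  have /near_normP[e e0 He] := (contP _ _).1 (Ck_cont (sD 0%N) Wm) _ nz.
  have [r [y [A [[Wy _ Dy] ->]]] rlt] := inf_adherent e0 (DSi m).
  have : `|y - h m t0| < e.
    rewrite distrC; apply: le_lt_trans (_ : dist m y A < e); first by rewrite lerDl.
    by move: rlt; rewrite -/(d m) -d0 add0r.
  by move=> /He; rewrite Dy distrC ltxx.
have d1 : \forall m \near U, 0 < d m <= 1.
  have h1 : \forall m \near U, `|0 - d m| < 1 by exact: ((cvgrPdist_lt _ _).1 dc _ ltr01).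
  apply: (unear (filter_and _ d_gt0 h1)) => m [a]; rewrite a sub0r normrN ger0_norm //= => /ltW.
  by [].
have LCd := local_ctx_step LC d1 dc.
(* (y, A) is a nearly closest limit jet, (s, K) an actual holonomy jet within d ep of it, and f the
   extension of the holonomy map that carries the jet (s, K) to the jet of [h m]. *)
pose Q m (p : ('rV[R]_q * 'M[R]_q) * (('rV[R]_q * 'M[R]_q) * (selfmap R q))) :=
  let y := p.1.1 in let A := p.1.2 in let s := p.2.1.1 in let K := p.2.1.2 in let f := p.2.2 in
  [/\ Cs y A, dist m y A < 2 * d m, `|s - y| < d m * ep m, `|K - A| < d m * ep m &
   [/\ K *m G i s *m K^T = G i t0, hol f, f s = h m t0, K *m Jac f s = J m & B s]].
have HQ : \forall m \near U, exists p, Q m p.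
  have e1 : \forall m \near U, `|0 - (3 * d m + ep m)| < r0.
    have c3 : 3 * d m + ep m @[m --> U] --> (3 * 0 + 0 : R) by apply: cvgD => //; apply: cvgM => //; exact: cvg_cst.
    by rewrite mulr0 addr0 in c3; exact: ((cvgrPdist_lt _ _).1 c3 _ r00).
  apply: (unear (filter_and _ (filter_and _ hW d_gt0) e1)) => m [[Wm dm] sm].
  have [co Ot hm _] := Hho m.
  have [r [y [A [CA ->]]] rlt] := inf_adherent dm (DSi m).
  have {}rlt : dist m y A < 2 * d m by move: rlt; rewrite -/(d m); lra.
  have [Wy ej Dy] := CA.
  have em : 0 < d m * ep m by rewrite mulr_gt0.
  have [Ok [k [cok Okt k1 k2]]] := ej _ em.
  have [Op [psi [cop H1 H2]]] := composite_inv cok.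
  have [Opk psik] := H1 _ Okt.
  have dy : `|h m t0 - y| < 2 * d m by apply: le_lt_trans rlt; rewrite lerDl.
  have de : d m * ep m <= d m by rewrite ger_pMr.
  have Bs : B (k t0).
    rewrite ballE; have := ler_distD y (k t0) t0; have := ler_distD (h m t0) y t0.
    rewrite [`|y - h m t0|]distrC; move: sm; rewrite sub0r normrN ger0_norm ?addr_ge0 ?mulr_ge0 //; last exact: ltW.
    by move: dy k1 de hm; rewrite -/(h m); lra.
  have Bh : B (h m (psi (k t0))) by rewrite psik; exact: WB.
  have Om2 : (Op `&` psi @^-1` (ho m).1) (k t0) by split=> //; rewrite /= psik.
  have [f hf Ef] := HUE _ _ (k t0) (composite_comp cop co) Om2 Bs Bh.
  exists ((y, A), ((k t0, Jac k t0), f)); split=> //; split=> //.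
  - exact: (tG_composite tG cok Okt).
  - by rewrite /= (nbhs_singleton Ef) /= psik.
  - have [oOk _ sk _] := composite_dom cok; have [oOm _ sh _] := composite_dom co.
    rewrite /= -jac_comp; [|exact: (smooth_map_diff oOk sk Okt)|exact: (local_hol_diff hf Bs)].
    apply: jac_near; first exact: (smooth_map_diff oOm sh Ot).
    have ck := smooth_cont sk Okt.
    apply: filterS (near_and (near_comp ck Ef) (open_near oOk Okt)) => z [/= -> Oz].
    by have [_ /= ->] := H1 z Oz.
have [p Hp] := near_choice UF ((t0, 0), ((t0, 0), id)) HQ.
pose y m := (p m).1.1; pose A m := (p m).1.2; pose s m := (p m).2.1.1; pose K m := (p m).2.1.2; pose f m := (p m).2.2.
have {}Hp : \forall m \near U, [/\ Cs (y m) (A m), dist m (y m) (A m) < 2 * d m, `|s m - y m| < d m * ep m, `|K m - A m| < d m * ep m &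
   [/\ K m *m G i (s m) *m (K m)^T = G i t0, hol (f m), f m (s m) = h m t0, K m *m Jac (f m) (s m) = J m & B (s m)]] := Hp.
have [Cj Cj0 HCj] := lc_jac_bound tG LC.
have near_t0 (e : R) : 0 < e -> \forall m \near U, 3 * d m + ep m < e.
  move=> e0; have c3 : 3 * d m + ep m @[m --> U] --> (3 * 0 + 0 : R) by apply: cvgD => //; apply: cvgM => //; exact: cvg_cst.
  rewrite mulr0 addr0 in c3; have h1 : \forall m \near U, `|0 - (3 * d m + ep m)| < e by move: c3 => /cvgrPdist_lt/(_ _ e0).
  by apply: (unear h1) => m; rewrite sub0r normrN => /le_lt_trans; apply; exact: ler_norm.
(* f sends s to [h m t0], at distance at most 3 d, and its Jacobian at s minus 1 is K^-1 (J - K),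
   with J - K at most 3 d; hence f is within O(d) of the identity. *)
have ff : local_fam U d i t0 rT r0 f.
  apply: (fam_of_jd tG LCd (x := t0) (C := 2 * (3 + q%:R * C1 * 3))) => //.
  - by rewrite mulr_ge0 // addr_ge0 // !mulr_ge0 // ltW.
  - by apply: (unear Hp) => m [_ _ _ _ [_ ?]].
  apply: (unear (filter_and _ Hp d_gt0)) => m [[[Wy _ _] dlt sy KA [KG hf fs KJ Bs]] dm].
  have jid := jet_id LC (c := t0) (r := r0) (x := t0) (x' := s m) (fun z Bz => Bz) (lexx _) (local_hol_isom tG hf)
    (isom_id (G i) BT) (fun z => local_hol_D hf) BD B0 Bs.
  apply: le_trans jid _; rewrite -mulrA ler_pM2l // /jd jac_id fs.
  have de : d m * ep m <= d m by rewrite ger_pMr.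
  have [n1 n2] : `|h m t0 - y m| < 2 * d m /\ `|J m - A m| < 2 * d m.
    by split; apply: le_lt_trans dlt; rewrite /dist ?lerDl ?lerDr.
  have Ku : K m \in unitmx.
    have := posdef_unit (pG _ (lc_DT LC (BD _ B0))); rewrite -KG !unitmx_mul => /andP[/andP[]].
    by [].
  have iK : `|invmx (K m)| <= C1.
    apply: (HC1 (s m) t0); [exact: BD|exact: BD|].
    by rewrite -KG !mulmxA mulVmx // mul1mx -mulmxA -trmx_mul mulVmx // trmx1 mulmx1.
  have -> : Jac (f m) (s m) - 1%:M = invmx (K m) *m (J m - K m) by rewrite mulmxBr mulVmx // -KJ mulKmx.
  have j3 : `|J m - K m| <= 3 * d m.
    have := ler_distD (A m) (J m) (K m); rewrite [`|A m - K m|]distrC.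
    by move: n2 KA de; move: (`|J m - A m|) (`|K m - A m|) => aa bb; lra.
  have h3 : `|h m t0 - s m| <= 3 * d m.
    have := ler_distD (y m) (h m t0) (s m); rewrite [`|y m - s m|]distrC.
    by move: n1 sy de; move: (`|h m t0 - y m|) (`|s m - y m|) => aa bb; lra.
  have := mulmx_norm_le (invmx (K m)) (J m - K m).
  have : q%:R * `|invmx (K m)| * `|J m - K m| <= q%:R * C1 * (3 * d m).
    apply: ler_pM; rewrite ?mulr_ge0 //; by apply: ler_pM.
  by move: h3; lra.
have [rho2 /andP[rho20 r2r] [E [theta [cth HE]]]] := approx_by_flow tG LCd rr sD HD ff.
pose a := C1 + 1.
(* [c m] collects all relative errors: replacing (y, A) by (s, K), and f by the flow. Both rates
   tend to 0. *)
pose c m := ep m * (q%:R * Cj + q%:R * Cj + q%:R * a * L1) + theta m * (1 + q%:R * a).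
have cc : c m @[m --> U] --> (0 : R).
  have c2 (e : nat -> R) (k : R) : e m @[m --> U] --> (0 : R) -> e m * k @[m --> U] --> (0 : R).
    by move=> ce; rewrite -(mul0r k); apply: cvgM; [exact: ce|exact: cvg_cst].
  by rewrite -(addr0 (0:R)); apply: cvgD; apply: c2; [exact: epc|exact: cth].
have c1 : \forall m \near U, c m < 1.
  have h1 : \forall m \near U, `|0 - c m| < 1 by move: cc => /cvgrPdist_lt/(_ _ ltr01).
  by apply: (unear h1) => m; rewrite sub0r normrN => /le_lt_trans; apply; exact: ler_norm.
have [m [[[[CA dlt sy KA [KG hf fs KJ Bs]] /andP[dm dm1]] [cm sm]] HEm]] :=
  proper_ex _ (filter_and _ (filter_and _ (filter_and _ Hp d1) (filter_and _ c1 (near_t0 _ rho20))) HE).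
have [Wy ej Dy] := CA.
have n1 : `|h m t0 - y m| < 2 * d m by apply: le_lt_trans dlt; rewrite lerDl.
have By2 : ball t0 rho2 (y m).
  rewrite ballE; have := ler_distD (h m t0) (y m) t0; rewrite [`|y m - h m t0|]distrC.
  have [_ _ hm _] := Hho m; rewrite -/(h m) -/(ep m) in hm.
  by move: n1 hm sm dm; move: (`|h m t0 - y m|) (`|h m t0 - t0|) => aa bb; lra.
have [WE DE [V [_ _ Vy] [_ _ _ eV]] jE] := HEm _ By2.
have By := WB Wy; have ih := local_hol_isom tG hf.
(* Following (y, A) by the flow map gives a competitor at distance at most d m c m < d m from the
   jet of [h m], against the choice of d. *)
have CE : Cs (E m (y m)) (A m *m Jac (E m) (y m)).
  by split; [exact: WE|exact: (ejet_comp ej (eV _ Vy))|rewrite DE].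
have := dle m _ _ CE; apply/negP; rewrite -ltNge.
apply: le_lt_trans (_ : _ <= d m * c m) _; last by rewrite gtr_pMr.
have K1 : `|K m| <= C1 by apply: HC1 KG; exact: BD.
have A1 : `|A m| <= a.
  have := ler_distD (K m) (A m) 0; rewrite !subr0 [`|A m - K m|]distrC /a.
  have d1m : d m * ep m <= 1 by rewrite mulr_ile1 // ltW.
  by move: KA d1m; move: (`|K m - A m|) => aa; lra.
have fl : `|f m (s m) - f m (y m)| <= q%:R * Cj * (d m * ep m).
  apply: le_trans (jac_lip (ltW Cj0) (c := t0) (r := r0) (phi := f m) _ _ By Bs) _.
  - by case: ih.
  - by move=> x Bx; exact: (HCj t0 r0 (f m) x BD ih (fun z => local_hol_D hf) Bx).
  - by rewrite ler_wpM2l ?mulr_ge0 // ltW.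
have Jl : `|Jac (f m) (s m) - Jac (f m) (y m)| <= L1 * (d m * ep m).
  apply: le_trans (HL1 t0 r0 (f m) BD ih (fun z => local_hol_D hf) _ _ Bs By) _.
  by rewrite ler_pM2l // ltW.
have Jb2 : `|Jac (f m) (s m)| <= Cj by exact: (HCj t0 r0 (f m) _ BD ih (fun z => local_hol_D hf) Bs).
have [e1 e2] : `|f m (y m) - E m (y m)| <= theta m * d m /\ `|Jac (f m) (y m) - Jac (E m) (y m)| <= theta m * d m.
  by split; apply: le_trans jE; rewrite /jd ?lerDl ?lerDr.
rewrite /dist -fs -KJ.
have -> : K m *m Jac (f m) (s m) - A m *m Jac (E m) (y m) = (K m - A m) *m Jac (f m) (s m) +
    A m *m (Jac (f m) (s m) - Jac (f m) (y m)) + A m *m (Jac (f m) (y m) - Jac (E m) (y m)).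
  by rewrite mulmxBl !mulmxBr; rewrite !addrA subrK subrK.
have t1 := ler_distD (f m (y m)) (f m (s m)) (E m (y m)).
have t2 : `|(K m - A m) *m Jac (f m) (s m)| <= q%:R * (d m * ep m) * Cj.
  apply: le_trans (mulmx_norm_le _ _) _; apply: ler_pM; rewrite ?mulr_ge0 //.
  by apply: ler_pM => //; exact: ltW.
have t3 : `|A m *m (Jac (f m) (s m) - Jac (f m) (y m))| <= q%:R * a * (L1 * (d m * ep m)).
  apply: le_trans (mulmx_norm_le _ _) _; apply: ler_pM; rewrite ?mulr_ge0 //.
  by apply: ler_pM.
have t4 : `|A m *m (Jac (f m) (y m) - Jac (E m) (y m))| <= q%:R * a * (theta m * d m).
  apply: le_trans (mulmx_norm_le _ _) _; apply: ler_pM; rewrite ?mulr_ge0 //.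
  by apply: ler_pM.
set M1 := (K m - A m) *m _ in t2 *; set M2 := A m *m (_ (s m) - _) in t3 *; set M3 := A m *m _ in t4 *.
have t5 : `|M1 + M2 + M3| <= `|M1| + `|M2| + `|M3|.
  by apply: le_trans (ler_normD _ _) _; rewrite lerD2r; exact: ler_normD.
have -> : d m * c m = q%:R * Cj * (d m * ep m) + theta m * d m + (q%:R * (d m * ep m) * Cj + q%:R * a * (L1 * (d m * ep m)) + q%:R * a * (theta m * d m)).
  by rewrite /c; ring.
apply: lerD; first by apply: le_trans t1 _; apply: lerD.
by apply: le_trans t5 _; apply: lerD => //; apply: lerD.
Qed.
End TransverseConstancy.

(** * Bump functions and vector fields on the manifold *)

Section OneVariable.
Variable R : realType.
Implicit Types (P L : {poly R}) (s : R).

(** The family is stable under differentiation, [g a] having derivative [g (dT a)]; one induction on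
    the order then makes all its members smooth. *)
Lemma smooth_comp_family (T : Type) (g : T -> R -> R) (dT : T -> T) (I : set R) p (U : set 'rV[R]_p) f :
  (forall a s, I s -> is_derive s 1 (g a) (g (dT a) s)) -> open U -> smooth_on U f -> (forall x, U x -> I (f x)) ->
  forall a, smooth_on U (fun x => g a (f x)).
Proof.
move=> Hg oU sf fI a k; elim: k a => [|k IH] a.
  split=> // x Ux; apply: continuous_comp; first exact: (Ck_cont (sf 0%N)).
  by apply: differentiable_continuous; apply/derivable1_diffP; have [] := Hg a _ (fI x Ux).
have dg x : U x -> differentiable (g a) (f x) by move=> Ux; apply/derivable1_diffP; have [] := Hg a _ (fI x Ux).
have df x : U x -> differentiable f x by move=> Ux; exact: (smooth_diff oU sf Ux).
have dgf x : U x -> differentiable (g a \o f) x.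
  by move=> Ux; apply: differentiable_comp; [exact: df|exact: dg].
split; first by move=> x Ux; exact: (differentiable_continuous (dgf x Ux)).
move=> l; split.
  by move=> x Ux; exact: (diff_derivable (dgf x Ux)).
apply: (Ck_ext oU _ (Ck_mul oU (IH (dT a)) (smooth_pd l sf k))) => x /set_mem Ux.
rewrite -[RHS]/('D_(delta_mx 0 l) (g a \o f) x) deriveE; last exact: dgf.
rewrite diff_comp; [|exact: df|exact: dg].
have E : 'd f x (delta_mx 0 l) = pd l f x by rewrite /pd deriveE //; exact: (df x Ux).
rewrite -[RHS]/('d (g a) (f x) ('d f x (delta_mx 0 l))) E; set v := pd l f x; have [_ Dg] := Hg a _ (fI x Ux).
have -> : 'd (g a) (f x) v = v *: 'd (g a) (f x) (1 : R) by rewrite -linearZ /= /GRing.scale /= mulr1.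
have <- : 'd (g a) (f x) (1 : R) = g (dT a) (f x) by rewrite -Dg deriveE //; exact: (dg x Ux).
by rewrite /GRing.scale /= mulrC.
Qed.

(** If e' / e is a polynomial in 1/s, the functions e(s) P(1/s) are stable under differentiation.
    This serves both s^(-1/2) and exp(-1/s). *)
Lemma exp_poly_derive (e : R -> R) L P s : s != 0 -> is_derive s 1 e (e s * L.[s^-1]) ->
  is_derive s 1 (fun r => e r * P.[r^-1]) (e s * (L * P - 'X^2 * P^`()).[s^-1]).
Proof.
move=> s0 de.
have dV : is_derive s 1 (fun r : R => r^-1) (- s^-2).
  have := @is_deriveV R id s 1 1 s0 (is_derive_id _ _).
  by rewrite scaler1.
have dP := @is_derive1_comp R (horner P) (fun r => r^-1) s _ _ (is_derive_poly P _) dV.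
have := @is_deriveM R _ e (horner P \o (fun r : R => r^-1)) s 1 _ _ de dP.
move=> [h1 h2]; split; first exact: h1.
apply: (etrans h2); rewrite /GRing.scale /= hornerD hornerN [('X^2 * _).[_]]hornerM hornerXn hornerM -exprVn; ring.
Qed.

Lemma inv_sqrt_smooth p (U : set 'rV[R]_p) f : open U -> smooth_on U f -> (forall x, U x -> 0 < f x) ->
  exists u : 'rV[R]_p -> R, smooth_on U u /\ forall x, U x -> 0 < u x /\ u x ^+ 2 * f x = 1.
Proof.
move=> oU sf f0.
pose e s : R := expR (- (2^-1 * ln s)).
pose L : {poly R} := (- 2^-1)%:P * 'X.
exists (fun x => e (f x)); split; last first.
  move=> x Ux; split; first exact: expR_gt0.
  rewrite /e expr2 -expRD -opprD (_ : 2^-1 * ln (f x) + 2^-1 * ln (f x) = ln (f x)); last by lra.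
  by rewrite expRN lnK ?posrE ?f0 // mulVf // gt_eqF // f0.
have H := @smooth_comp_family _ (fun P s => e s * P.[s^-1]) (fun P => L * P - 'X^2 * P^`()) [set s | 0 < s] p U f _ oU sf f0 1.
apply: (smooth_ext oU _ (H _)) => [x _|P s /= s0]; first by rewrite hornerC mulr1.
apply: exp_poly_derive; first by rewrite gt_eqF.
have d1 := @is_deriveZ R _ _ (@ln R) (2^-1) s 1 _ (is_derive1_ln s0).
have d2 := @is_deriveN R _ _ _ s 1 _ d1.
have := @is_derive1_comp R expR _ s _ _ (is_derive_expR _) d2.
move=> [h1 h2]; split; first exact: h1.
by apply: (etrans h2); rewrite /L !hornerE /e /GRing.scale /=; ring.
Qed.

Lemma expR_dominates P : exists2 C : R, 0 < C & forall y, 0 <= y -> `|P.[y]| <= C * expR y.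
Proof.
exists (\sum_(i < size P) `|P`_i| * i`!%:R + 1); first by rewrite ltr_wpDl ?sumr_ge0.
move=> y y0; rewrite horner_coef; apply: le_trans (ler_norm_sum _ _ _) _.
rewrite mulrDl mul1r ler_wpDr ?expR_ge0 // mulr_suml; apply: ler_sum => i _.
rewrite normrM -mulrA ler_wpM2l // normrX ger0_norm //.
case: (nat_of_ord i) => [|k]; first by rewrite fact0 mul1r expr0 -expR0 ler_expR.
have := expR_ge1Dxn k y0; have f0 : 0 < (k.+1)`!%:R :> R by rewrite ltr0n fact_gt0.
rewrite -ler_pdivrMl // [_^-1 * _]mulrC => /(le_trans _); apply; by rewrite lerDr.
Qed.

Definition flat P s : R := if s <= 0 then 0 else expR (- s^-1) * P.[s^-1].

Lemma flat_quad P : exists2 C : R, 0 < C & forall s, `|flat P s| <= C * s ^+ 2.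
Proof.
have [C C0 HC] := expR_dominates ('X^2 * P); exists C => // s; rewrite /flat; have [_|s0] := leP s 0.
  by rewrite normr0 mulr_ge0 // ?sqr_ge0 // ltW.
have i0 : 0 <= s^-1 by rewrite invr_ge0 ltW.
set b := C * s ^+ 2; have := HC _ i0; rewrite !hornerE exprVn !normrM !normfV (gtr0_norm (exprn_gt0 _ s0)).
rewrite [`|expR _|]ger0_norm ?expR_ge0 // expRN ler_pdivrMl ?exprn_gt0 //.
move=> H; rewrite ler_pdivrMl ?expR_gt0 //; apply: le_trans H _.
by rewrite /b [X in _ <= X](_ : _ = s ^+ 2 * (C * expR s^-1)) //; ring.
Qed.

(** At 0 the exponential decay gives a bound C s^2 on the function, which is a quadratic remainder
    for the derivative 0. *)
Lemma flat_derive P s : is_derive s 1 (flat P) (flat ('X^2 * (P - P^`())) s).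
Proof.
have [s0|s0|->] := ltgtP s 0.
- rewrite {2}/flat ltW //; apply: (@near_eq_is_derive R R R (cst 0) (flat P) s 1 0).
    by have := open_near (@open_lt R 0) s0; apply: filterS => r /= r0; rewrite /flat ltW.
- rewrite {2}/flat leNgt s0 /=.
  apply: (@near_eq_is_derive R R R (fun r => expR (- r^-1) * P.[r^-1])).
    by have := open_near (@open_gt R 0) s0; apply: filterS => r /= r0; rewrite /flat leNgt r0.
  rewrite mulrBr; apply: exp_poly_derive; first by rewrite gt_eqF.
  have dV := @is_deriveV R id s 1 1 (lt0r_neq0 s0) (is_derive_id _ _).
  have d2 := @is_deriveN R _ _ _ s 1 _ dV.
  have [h1 h2] := @is_derive1_comp R expR _ s _ _ (is_derive_expR _) d2.
  by split; [exact: h1|apply: (etrans h2); rewrite hornerXn -exprVn /GRing.scale /=; ring].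
have [C C0 HC] := flat_quad P.
rewrite {2}/flat lexx; apply: (@derive_quad _ R R (flat P) 0 1 0 C 1) => // h _.
by rewrite add0r scaler0 subr0 {2}/flat lexx subr0 [h *: 1]mulr1; exact: HC.
Qed.

Lemma smooth_flat p (U : set 'rV[R]_p) f P : open U -> smooth_on U f -> smooth_on U (fun x => flat P (f x)).
Proof.
by move=> oU sf; apply: (smooth_comp_family (dT := fun P => 'X^2 * (P - P^`())) (I := setT)) => // Q s _; exact: flat_derive.
Qed.

End OneVariable.

(* The Euclidean ball of radius r lies in the ball of the max norm. *)
Lemma bump_function (R : realType) p (c : 'rV[R]_p) (r : R) : 0 < r ->
  exists chi : 'rV[R]_p -> R, [/\ smooth_on setT chi, \forall x \near c, chi x = 1 & forall x, ~ cball c r x -> chi x = 0].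
Proof.
move=> r0; pose w (x : 'rV[R]_p) := r ^+ 2 - \sum_(l < p) (x 0 l - c 0 l) ^+ 2; pose f (s : R) := flat (1 : {poly R}) s.
(* w equals r^2 at c, so w > d near c; there f(d - w) vanishes and the quotient f(w) / (f(w) + f(d -
   w)) is 1. *)
pose d := r ^+ 2 / 2; have d0 : 0 < d by rewrite divr_gt0 // exprn_gt0.
have f_ge0 s : 0 <= f s by rewrite /f /flat; case: ifP => // _; rewrite hornerC mulr1 expR_ge0.
have f_gt0 s : 0 < s -> 0 < f s by move=> s0; rewrite /f /flat leNgt s0 /= hornerC mulr1 expR_gt0.
have f_0 s : s <= 0 -> f s = 0 by rewrite /f /flat => ->.
have sw : smooth_on setT w.
  apply: smooth_sub2; [exact: openT|exact: smooth_cst|apply: smooth_sum; first exact: openT].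
  by move=> l _; under eq_fun do rewrite expr2; apply: smooth_mul; [exact: openT| |];
    apply: smooth_sub2; [exact: openT|exact: smooth_coord|exact: smooth_cst|exact: openT|exact: smooth_coord|exact: smooth_cst].
have wc : w c = r ^+ 2 by rewrite /w big1 ?subr0 // => l _; rewrite subrr expr0n.
have den x : 0 < f (w x) + f (d - w x).
  have [w0|w0] := ltP 0 (w x); first by rewrite ltr_pwDl // f_gt0.
  by rewrite ltr_wpDl // f_gt0 // subr_gt0; apply: le_lt_trans d0.
exists (fun x => f (w x) / (f (w x) + f (d - w x))); split.
- have s1 : smooth_on setT (fun x => f (w x)) by apply: smooth_flat => //; exact: openT.
  have s2 : smooth_on setT (fun x => f (d - w x)).
    by apply: smooth_flat; [exact: openT|apply: smooth_sub2; [exact: openT|exact: smooth_cst|exact: sw]].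
  apply: smooth_mul; [exact: openT|exact: s1|].
  apply: smooth_inv; [exact: openT|by move=> x _; rewrite gt_eqF|].
  by apply: smooth_add; [exact: openT|exact: s1|exact: s2].
- have : \forall x \near c, d < w x.
    have := Ck_cont (sw 0%N) (I : setT c); move=> /(_ [set s | d < s]); rewrite wc; apply.
    have dr : d < r ^+ 2 by rewrite /d; have := exprn_gt0 2 r0; lra.
    exact: (open_near (@open_gt R d) dr).
  apply: filterS => x dw; rewrite (f_0 (d - w x)) ?subr_le0 ?ltW // addr0 mulfV // gt_eqF // f_gt0 //.
  exact: lt_trans dw.
- move=> x nx; rewrite f_0 ?mul0r // leNgt; apply/negP; rewrite subr_gt0 => h; apply: nx.
  suff : `|x - c| <= r by [].
  apply: mx_norm_leB => [|a l]; first exact: ltW.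
  rewrite ord1 -ler_sqr ?nnegrE ?normr_ge0 ?(ltW r0) // real_normK ?num_real //.
  apply: ltW; apply: le_lt_trans h; rewrite (bigD1 l) //= lerDl; apply: sumr_ge0 => k _; exact: sqr_ge0.
Qed.

Lemma diff_lin (R : realType) n (f g : 'rV[R]_n -> R) x (c : R) v : differentiable f x -> differentiable g x ->
  'd (fun y => c * f y + g y) x v = c * 'd f x v + 'd g x v.
Proof.
move=> df dg; have -> : (fun y => c * f y + g y) = c *: f + g by [].
by rewrite (diffD (differentiableZ c df) dg) (diffZ c df).
Qed.

Lemma diff_leibniz (R : realType) n (f g : 'rV[R]_n -> R) x v : differentiable f x -> differentiable g x ->
  'd (fun y => f y * g y) x v = 'd f x v * g x + f x * 'd g x v.
Proof.
move=> df dg; have -> : (fun y => f y * g y) = f * g by [].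
rewrite (diffM df dg) -[LHS]/(f x * 'd g x v + g x * 'd f x v).
by rewrite addrC [g x * _]mulrC.
Qed.

Section SmoothFunctions.
Variables (R : realType) (n : nat) (M : manifold R n).
Implicit Types (a b : chart_idx M) (x y : M) (V W : set M) (u v w : M -> R) (X Y Z : operator M).

Definition smooth_in V u := forall b, smooth_on (chart b @` (dom b `&` V)) (u \o chart_inv b).

Lemma smooth_inT u : smooth_in setT u <-> smooth u.
Proof. by split=> H b; have := H b; rewrite setIT. Qed.

Lemma smooth_in_sub V W u : W `<=` V -> smooth_in V u -> smooth_in W u.
Proof. by move=> WV H b; apply: smooth_sub (H b) => _ [y [dy /WV Vy] <-]; exists y. Qed.

Lemma smooth_in_local V u : (forall x, V x -> exists2 W, W x & smooth_in W u) -> smooth_in V u.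
Proof.
move=> H b; apply: smooth_local => _ [x [dx /H[W Wx sW]] <-].
by exists (chart b @` (dom b `&` W)); [exists x|exact: sW].
Qed.

Lemma chart_image_sub a V : open V -> V `<=` dom a -> open (chart a @` V).
Proof.
move=> oV Va; have := @chart_image_open R n M a V oV; rewrite (_ : dom a `&` V = V) //.
by apply/seteqP; split=> [z []|z Vz] //; split=> //; exact: Va.
Qed.

Lemma smooth_in_chart a V (phi : 'rV[R]_n -> R) : open V -> V `<=` dom a -> smooth_on (chart a @` V) phi ->
  smooth_in V (phi \o chart a).
Proof.
move=> oV Va sp b; have oV' := chart_image_open (a := b) oV.
have -> : (phi \o chart a) \o chart_inv b = phi \o (chart a \o chart_inv b) by [].
apply: smooth_comp sp => //.
- exact: chart_image_sub.
- by move=> _ [y [dy Vy] <-]; rewrite /= chartK //; exists y.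
- move=> j; apply: smooth_sub (@chart_transition R n M b a j) => _ [y [dy Vy] <-].
  by exists y => //; split=> //; exact: Va.
Qed.

Lemma smooth_in_ext V u v : open V -> (forall x, V x -> u x = v x) -> smooth_in V u -> smooth_in V v.
Proof.
move=> oV uv su b; apply: smooth_ext (su b); first exact: chart_image_open.
by move=> z /set_mem/chart_inv_image[[_ Vz] _] /=; exact: uv.
Qed.

Lemma smooth_in_add V u v : open V -> smooth_in V u -> smooth_in V v -> smooth_in V (fun x => u x + v x).
Proof. by move=> oV su sv b; exact: (smooth_add (chart_image_open (a := b) oV) (su b) (sv b)). Qed.

Lemma smooth_in_mul V u v : open V -> smooth_in V u -> smooth_in V v -> smooth_in V (fun x => u x * v x).
Proof. by move=> oV su sv b; exact: (smooth_mul (chart_image_open (a := b) oV) (su b) (sv b)). Qed.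

Lemma smooth_in_cst V (c : R) : smooth_in V (fun=> c).
Proof. by move=> b; exact: smooth_cst. Qed.

Lemma smoothD u v : smooth u -> smooth v -> smooth (fun x => u x + v x).
Proof. by move=> su sv; apply/smooth_inT/smooth_in_add; [exact: openT|exact/smooth_inT|exact/smooth_inT]. Qed.

Lemma smoothM u v : smooth u -> smooth v -> smooth (fun x => u x * v x).
Proof. by move=> su sv; apply/smooth_inT/smooth_in_mul; [exact: openT|exact/smooth_inT|exact/smooth_inT]. Qed.

Lemma smoothC (c : R) : smooth (fun _ : M => c).
Proof. exact/smooth_inT/smooth_in_cst. Qed.

Lemma smoothB u v : smooth u -> smooth v -> smooth (fun x => u x - v x).
Proof.
move=> su sv; rewrite (_ : (fun x => u x - v x) = (fun x => u x + (-1) * v x)).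
  by apply: smoothD => //; apply: smoothM => //; exact: smoothC.
by apply/funext => x; rewrite mulN1r.
Qed.

Lemma smooth_in_cont V u x : open V -> smooth_in V u -> V x -> {for x, continuous u}.
Proof.
move=> oV su Vx; have [a da] := dom_cover x.
have iz : (chart a @` (dom a `&` V)) (chart a x) by exists x.
have c1 : {for chart a x, continuous (u \o chart_inv a)} by exact: (Ck_cont (su a 0%N) iz).
have : {for x, continuous ((u \o chart_inv a) \o chart a)} by apply: continuous_comp => //; exact: chart_continuous.
apply: cont_near_eq; apply: filterS (open_near (dom_open a) da) => y dy.
by rewrite /= chartK.
Qed.

Lemma smooth_chart_diff a u x : smooth u -> dom a x -> differentiable (u \o chart_inv a) (chart a x).
Proof. by move=> su da; apply: (smooth_diff (chart_open (m := M) (a := a)) (su a)); exists x. Qed.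

Hypothesis hM : hausdorff_space M.

(** The bump function lives on a compact set K of a chart; K is closed because M is Hausdorff, so
    the extension by 0 is smooth across the boundary of the chart. *)
Lemma cutoff V x : open V -> V x -> exists chi : M -> R, [/\ smooth chi, \forall y \near x, chi y = 1,
  forall y, chi y != 0 -> V y & forall w, smooth_in V w -> smooth (fun y => chi y * w y)].
Proof.
move=> oV Vx; have [a da] := dom_cover x.
have oV' := chart_image_open (a := a) oV.
have iz : (chart a @` (dom a `&` V)) (chart a x) by exists x.
have [r r0 cV] := open_cball oV' iz.
have [chi0 [s0 one zero]] := bump_function (chart a x) r0.
pose K := chart_inv a @` cball (chart a x) r.
have cK : closed K.
  apply: compact_closed => //; apply: continuous_compact; last exact: cball_compact.
  apply: continuous_in_subspaceT => z /set_mem/cV[y [dy _] <-].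
  by apply: chart_inv_continuous; exists y.
have KV y : K y -> dom a y /\ V y by move=> [z /cV[y' [dy Vy] <-] <-]; rewrite chartK.
pose chi y := if `[<dom a y>] then chi0 (chart a y) else 0.
have chi_dom y : dom a y -> chi y = chi0 (chart a y) by move=> dy; rewrite /chi asboolT.
have chiK y : ~ K y -> chi y = 0.
  move=> nK; have [dy|ndy] := pselect (dom a y); last by rewrite /chi asboolF.
  by rewrite chi_dom //; apply: zero => zK; apply: nK; exists (chart a y) => //; rewrite chartK.
have mul w : smooth_in V w -> smooth (fun y => chi y * w y).
  move=> sw; apply/smooth_inT/smooth_in_local => y _.
  have [Ky|nK] := pselect (K y); last first.
    exists (~` K) => //; apply: (@smooth_in_ext (~` K) (fun=> 0)); first exact: closed_openC.
      by move=> z nz; rewrite chiK // mul0r.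
    exact: smooth_in_cst.
  have [dy Vy] := KV y Ky; have oda : open (dom a `&` V) by exact: openI (dom_open a) oV.
  exists (dom a `&` V) => //; apply: smooth_in_mul => //; last by apply: smooth_in_sub sw; exact: subIsetr.
  apply: (@smooth_in_ext _ (chi0 \o chart a)) => //; first by move=> z [dz _]; rewrite chi_dom.
  by apply: smooth_in_chart => //; apply: smooth_sub s0.
exists chi; split=> //.
- have := mul (fun=> 1) (smooth_in_cst _ _).
  by rewrite (_ : (fun y => chi y * 1) = chi) //; apply/funext => y; rewrite mulr1.
- have h1 := near_comp (chart_continuous da) one.
  by apply: filterS (near_and h1 (open_near (dom_open a) da)) => y [h dy]; rewrite chi_dom.
- move=> y cy; have [Ky|nK] := pselect (K y); first by have [] := KV y Ky.
  by rewrite chiK ?eqxx in cy.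
Qed.

Lemma smooth_extension V u x : open V -> V x -> smooth_in V u -> exists2 u' : M -> R, smooth u' & \forall y \near x, u' y = u y.
Proof.
move=> oV Vx su; have [chi [_ one _ mul]] := cutoff oV Vx.
exists (fun y => chi y * u y); first exact: mul.
by apply: filterS one => y ->; rewrite mul1r.
Qed.

Lemma vf_add Z u v x : vector_field Z -> smooth u -> smooth v -> Z (fun y => u y + v y) x = Z u x + Z v x.
Proof.
move=> [_ lin _] su sv; have := lin 1 u v su sv x; rewrite mul1r => <-.
by congr (Z _ x); apply/funext => y; rewrite mul1r.
Qed.

Lemma vf_cst Z (c : R) x : vector_field Z -> Z (fun=> c) x = 0.
Proof.
move=> vZ; have [_ lin leib] := vZ.
have Z1 : Z (fun=> 1) x = 0.
  have := leib (fun=> 1) (fun=> 1) (smoothC 1) (smoothC 1) x.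
  rewrite (_ : (fun y : M => 1 * 1) = (fun=> 1)); last by apply/funext => y; rewrite mulr1.
  by rewrite mulr1 mul1r => /eqP; rewrite -subr_eq0 opprD addNKr oppr_eq0 => /eqP.
have Z0 : Z (fun=> 0) x = 0.
  have := vf_add x vZ (smoothC 0) (smoothC 0).
  rewrite (_ : (fun y : M => 0 + 0) = (fun=> 0)); last by apply/funext => y; rewrite addr0.
  by move=> /eqP; rewrite -subr_eq0 opprD addNKr oppr_eq0 => /eqP.
have /esym := lin c (fun=> 1) (fun=> 0) (smoothC 1) (smoothC 0) x.
rewrite Z1 Z0 mulr0 addr0 => E; rewrite [RHS]E; congr (Z _ x).
by apply/funext => y; rewrite mulr1 addr0.
Qed.

Lemma vf_scale Z (c : R) u x : vector_field Z -> smooth u -> Z (fun y => c * u y) x = c * Z u x.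
Proof.
move=> vZ su; have [_ lin _] := vZ; have := lin c u (fun=> 0) su (smoothC 0) x.
by rewrite (vf_cst _ _ vZ) addr0 => <-; congr (Z _ x); apply/funext => y; rewrite addr0.
Qed.

Lemma vf_sub Z u v x : vector_field Z -> smooth u -> smooth v -> Z (fun y => u y - v y) x = Z u x - Z v x.
Proof.
move=> vZ su sv; have := vf_add x vZ su (smoothM (smoothC (-1)) sv).
rewrite (vf_scale _ _ vZ sv) mulN1r => <-; congr (Z _ x); apply/funext => y; by rewrite mulN1r.
Qed.

(** A derivation acts on global functions only; multiplying u - v by a cutoff supported where u = v
    gives 0, and the Leibniz rule does the rest. *)
Lemma vf_local Z u v x : vector_field Z -> smooth u -> smooth v -> (\forall y \near x, u y = v y) -> Z u x = Z v x.
Proof.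
move=> vZ su sv uv; apply/eqP; rewrite -subr_eq0 -vf_sub //.
pose A := [set y | u y = v y]; have Ax : A° x by exact: uv.
have [chi [sc one supp _]] := cutoff (@open_interior _ A) Ax.
have sf := smoothB su sv; have [_ _ leib] := vZ.
have := leib _ _ sc sf x.
rewrite (_ : (fun y => chi y * (u y - v y)) = (fun=> 0)); last first.
  apply/funext => y; have [->|/supp/interior_subset uy] := eqVneq (chi y) 0; first by rewrite mul0r.
  by rewrite (uy : u y = v y) subrr mulr0.
by rewrite (vf_cst _ _ vZ) (nbhs_singleton one) mul1r (nbhs_singleton uv) subrr mulr0 add0r => <-.
Qed.

Lemma lie_bracket_vf X Y : vector_field X -> vector_field Y -> vector_field (lie_bracket X Y).
Proof.
move=> vX vY; have [sX linX leibX] := vX; have [sY linY leibY] := vY; split.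
- by move=> u su; apply: smoothB; [exact: sX (sY _ su)|exact: sY (sX _ su)].
- move=> c u v su sv x; rewrite /lie_bracket.
  have E Z : vector_field Z -> Z (fun y => c * u y + v y) = (fun y => c * Z u y + Z v y).
    by move=> [_ linZ _]; apply/funext => y; exact: linZ.
  by rewrite !E // linX ?linY //; [ring| | | |]; [exact: sX|exact: sX|exact: sY|exact: sY].
- move=> u v su sv x; rewrite /lie_bracket.
  have E Z : vector_field Z -> Z (fun y => u y * v y) = (fun y => Z u y * v y + u y * Z v y).
    by move=> [_ _ leibZ]; apply/funext => y; exact: leibZ.
  rewrite !E // !vf_add // ?leibX ?leibY //; [ring|..]; try exact: sX; try exact: sY.
  all: by apply: smoothM => //; (exact: sX || exact: sY).
Qed.

Lemma local_field a V (xi : 'rV[R]_n -> 'rV[R]_n) x : open V -> V `<=` dom a -> V x ->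
  smooth_map_on (chart a @` V) xi -> exists Z (chi : M -> R), [/\ vector_field Z, chi x = 1, forall y, chi y != 0 -> V y &
    forall u y, Z u y = chi y * 'd (u \o chart_inv a) (chart a y) (xi (chart a y))].
Proof.
move=> oV Va Vx sxi; have [chi [sc one supp mul]] := cutoff oV Vx.
exists (fun u y => chi y * 'd (u \o chart_inv a) (chart a y) (xi (chart a y))), chi.
split=> //; first last.
- exact: (nbhs_singleton one).
pose dd u y := 'd (u \o chart_inv a) (chart a y) (xi (chart a y)).
have oVa := chart_image_sub oV Va.
have dz u y : smooth u -> V y -> differentiable (u \o chart_inv a) (chart a y).
  by move=> su /Va; exact: smooth_chart_diff.
split.
- move=> u su; apply: mul.
  apply: (@smooth_in_chart a V (fun z => 'd (u \o chart_inv a) z (xi z))) => //.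
  apply: (@smooth_ext R n (chart a @` V) (fun z => \sum_l xi z 0 l * pd l (u \o chart_inv a) z)) => //.
    by move=> z /set_mem[y Vy <-]; rewrite (diff_pd _ (dz u y su Vy)).
  apply: smooth_sum => // l _; apply: (smooth_mul oVa); first by move: (sxi l).
  by apply: smooth_pd; apply: smooth_sub (su a) => _ [y /Va dy <-]; exists y.
- move=> c u v su sv y.
  change (chi y * dd (fun z => c * u z + v z) y = c * (chi y * dd u y) + chi y * dd v y).
  have [E|/supp Vy] := eqVneq (chi y) 0; first by move: (dd _ y) (dd u y) (dd v y) => d1 d2 d3; rewrite E; ring.
  have -> : dd (fun z => c * u z + v z) y = c * dd u y + dd v y by exact: (diff_lin c _ (dz u y su Vy) (dz v y sv Vy)).
  by move: (dd u y) (dd v y) => d2 d3; ring.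
- move=> u v su sv y.
  change (chi y * dd (fun z => u z * v z) y = chi y * dd u y * v y + u y * (chi y * dd v y)).
  have [E|/supp Vy] := eqVneq (chi y) 0; first by move: (dd _ y) (dd u y) (dd v y) => d1 d2 d3; rewrite E; ring.
  have -> : dd (fun z => u z * v z) y = dd u y * v y + u y * dd v y.
    have E (w : M -> R) : w y = (w \o chart_inv a) (chart a y) by rewrite /= chartK //; exact: Va.
    by rewrite (E u) (E v); exact: (diff_leibniz _ (dz u y su Vy) (dz v y sv Vy)).
  by move: (dd u y) (dd v y) => d2 d3; ring.
Qed.
End SmoothFunctions.

(** * Level sets, basic functions and lifts *)

Section LevelSets.
Variables (R : realType) (n q : nat).
Implicit Types (x y z v xi : 'rV[R]_n) (U : set 'rV[R]_n) (f : 'rV[R]_n -> 'rV[R]_q).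

Lemma derive0_intro (g : R -> R) (s : R) :
  (forall e : R, 0 < e -> \forall h \near (0 : R), `|g (s + h) - g s| <= e * `|h|) -> is_derive s 1 g 0.
Proof.
move=> H; suff c : (h^-1 *: ((g \o shift s) (h *: (1 : R)) - g s)) @[h --> (0:R)^'] --> (0 : R).
  by apply: DeriveDef; [apply/cvg_ex; exists 0|exact: cvg_lim c].
apply/cvgrPdist_le => e e0; have H1 := H e e0.
near=> h.
have h0 : h != 0 by near: h; exact: nbhs_dnbhs_neq.
have hr : `|g (s + h) - g s| <= e * `|h| by near: h; exact: cvg_within H1.
rewrite sub0r normrN normrZ normfV ler_pdivrMl ?normr_gt0 // mulrC.
have -> : (g \o shift s) (h *: (1 : R)) = g (s + h) by rewrite /= [_ *: _]mulr1 addrC.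
by [].
Unshelve. all: by end_near. Qed.

Lemma near0_norm (r : R) : 0 < r -> \forall h \near (0 : R), `|h| < r.
Proof. by move=> r0; apply/near_normP; exists r => // h; rewrite subr0. Qed.

Lemma near0_comp (V : normedModType R) (c : R -> V) (P : V -> Prop) : {for (0 : R), continuous c} -> c 0 = 0 ->
  (\forall h \near (0 : V), P h) -> \forall s \near (0 : R), P (c s).
Proof. by move=> cc c0 H; apply: near_comp cc _; rewrite c0. Qed.

Lemma diff_bound (f : 'rV[R]_n -> R) x : differentiable f x ->
  exists2 K : R, 0 < K & forall v, `|'d f x v| <= K * `|v|.
Proof.
move=> df; exists (\sum_l `|pd l f x| + 1); first by rewrite ltr_wpDl // sumr_ge0.
move=> v; rewrite (diff_pd _ df) mulrDl mul1r; apply: ler_wpDr => //.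
apply: le_trans (ler_norm_sum _ _ _) _; rewrite mulr_suml; apply: ler_sum => l _.
by rewrite normrM mulrC ler_wpM2l // mx_entry_le.
Qed.

(** The point x + s xi misses the level set of c(s) by o(s), and [right_inverse] corrects it by
    o(s). So W takes the value W(x) at x + s xi + o(s), which forces its derivative along xi to be
    0. *)
Lemma level_tangent U f x (c : R -> 'rV[R]_q) xi (W : 'rV[R]_n -> R) : open U -> smooth_map_on U f -> U x ->
  \rank (Jac f x) = q -> c 0 = f x -> is_derive (0 : R) 1 c (xi *m Jac f x) -> differentiable W x ->
  (exists2 e : R, 0 < e & forall z (s : R), `|z - x| < e -> `|s| < e -> f z = c s -> W z = W x) -> 'd W x xi = 0.
Proof.
move=> oU sf Ux rf c0 dc dW HW.
have [e e0 He] := HW; have [P PJ] := rank_right_inverse rf.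
have [rho [rho1 [rho0 _ _ _ H2]]] := right_inverse oU sf Ux PJ.
have [CP CP0 HP] := mulmx_bound P.
have [K Kp HK] := diff_bound dW.
have df := smooth_map_diff oU sf Ux.
pose a := `|'d W x xi|; pose N := `|xi|; have N0 : 0 <= N by exact: normr_ge0.
pose H := N + CP * (2 * (1 + N)); have H0 : 0 <= H by rewrite addr_ge0 // mulr_ge0 ?(ltW CP0) // mulr_ge0 // addr_ge0.
pose C := H + K * (CP * (2 * (1 + N))).
(* All errors at a suitable s > 0 are at most eta s times fixed constants gathered in C; letting eta
   be small compared with a / C gives a contradiction unless a = 0. *)
have main (eta : R) : 0 < eta <= 1 -> a <= eta * C.
  move=> /andP[eta0 eta1].
  have n1 := diff_eps df eta0.
  have dc' : differentiable c 0 by apply/derivable1_diffP; case: dc.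
  have n2 := diff_eps dc' eta0.
  have /near0_ballP[e3 e30 H3] := diff_eps dW eta0.
  pose Bc := 1 + N + H; have Bc0 : 0 < Bc by rewrite /Bc; lra.
  pose m := Num.min (Num.min e e3) rho.
  have m0 : 0 < m by rewrite !lt_min e0 e30.
  have cx : {for (0 : R), continuous (fun s : R => s *: xi)} by exact: scalel_continuous.
  have n1' := near0_comp cx (scale0r xi) n1.
  have [t t0 Ht] : exists2 t : R, 0 < t & forall s : R, `|s| < t -> `|f (x + s *: xi) - f x - 'd f x (s *: xi)| <= eta * `|s *: xi| /\
      `|c (0 + s) - c 0 - 'd c 0 s| <= eta * `|s|.
    by have /near0_ballP[t t0 Ht] := near_and n1' n2; exists t.
  pose s := Num.min t (m / Bc) / 2.
  have mt0 : 0 < Num.min t (m / Bc) by rewrite lt_min t0 divr_gt0.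
  have s0 : 0 < s by rewrite divr_gt0.
  have sl : s < Num.min t (m / Bc) by rewrite ltr_pdivrMr // ltr_pMr // ltr1n.
  have st : `|s| < t by rewrite gtr0_norm //; apply: lt_le_trans sl _; rewrite ge_min lexx.
  have sm : s * Bc < m by rewrite -ltr_pdivlMr //; apply: lt_le_trans sl _; rewrite ge_min lexx orbT.
  have [a1 a2] := Ht s st.
  rewrite diff_jac // in a1.
  have dcE : 'd c 0 s = s *: (xi *m Jac f x).
    rewrite -[s in LHS]mulr1 -[s * 1]/(s *: (1:R)) linearZ /= -deriveE //; by case: dc => _ ->.
  rewrite dcE c0 add0r in a2; rewrite -scalemxAl in a1.
  have a3 : `|c s - f (x + s *: xi)| <= eta * (s * (1 + N)).
    rewrite normrZ (gtr0_norm s0) in a1; rewrite (gtr0_norm s0) in a2.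
    have -> : c s - f (x + s *: xi) = (c s - f x - s *: (xi *m Jac f x)) - (f (x + s *: xi) - f x - s *: (xi *m Jac f x)).
      by rewrite opprB addrA subrK opprB addrA subrK.
    apply: le_trans (ler_normB _ _) _; apply: le_trans (lerD a2 a1) _; rewrite -/N; lra.
  have sN : s * (1 + N) <= s * Bc by rewrite ler_pM2l // /Bc; lra.
  have sH : s * H <= s * Bc by rewrite ler_pM2l // /Bc; lra.
  have sN0 : 0 <= s * (1 + N) by rewrite mulr_ge0 ?(ltW s0) // addr_ge0.
  have es : eta * (s * (1 + N)) <= s * (1 + N) by rewrite ler_piMl.
  have mr : m <= rho by rewrite /m !ge_min lexx orbT.
  have me : m <= e by rewrite /m !ge_min lexx.
  have me3 : m <= e3 by rewrite /m !ge_min lexx !orbT.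
  have [||w [w1 _ w2]] := H2 (x + s *: xi) (c s).
  - rewrite ballE addrAC subrr add0r normrZ (gtr0_norm s0) -/N.
    have : s * N <= s * (1 + N) by rewrite ler_pM2l // lerDr.
    by move: sN sm mr; clear -n q; lra.
  - by move: a3 es sN sm mr; clear -n q; lra.
  have w3 : `|w| <= 2 * (eta * (s * (1 + N))) by apply: le_trans w1 _; rewrite ler_pM2l.
  have wP : `|w *m P| <= CP * (2 * (eta * (s * (1 + N)))) by apply: le_trans (HP w) _; rewrite ler_pM2l.
  pose h := s *: xi + w *m P.
  have hH : `|h| <= s * H.
    apply: le_trans (ler_normD _ _) _; rewrite normrZ (gtr0_norm s0) -/N /H mulrDr lerD2l; apply: le_trans wP _.
    by rewrite [X in _ <= X]mulrCA ler_pM2l // [X in _ <= X]mulrCA ler_pM2l.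
  have Wh : W (x + h) = W x.
    apply: (He _ s).
    - by rewrite addrAC subrr add0r; move: hH sH sm me; clear -n q; lra.
    - have : s * 1 <= s * Bc by rewrite ler_pM2l // /Bc; move: N0 H0; clear -n q; lra.
      by rewrite mulr1 gtr0_norm //; move: sm me; clear -n q; lra.
    - by rewrite /h addrA.
  have he3 : `|h| < e3 by move: hH sH sm me3; clear -n q; lra.
  have := H3 h he3; rewrite Wh subrr sub0r normrN => b1.
  have b2 : s * a = `|'d W x h - 'd W x (w *m P)|.
    by rewrite /h linearD addrK linearZ normrM (gtr0_norm s0).
  have b3 : `|'d W x (w *m P)| <= K * (CP * (2 * (eta * (s * (1 + N))))) by apply: le_trans (HK _) _; rewrite ler_pM2l.
  have b4 : eta * `|h| <= eta * (s * H) by rewrite ler_pM2l.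
  have b5 : s * a <= eta * (s * H) + K * (CP * (2 * (eta * (s * (1 + N))))).
    by rewrite b2; apply: le_trans (ler_normB _ _) _; apply: lerD => //; exact: le_trans b1 b4.
  rewrite -(ler_pM2l s0); apply: le_trans b5 _; rewrite le_eqVlt; apply/orP; left; apply/eqP; rewrite /C; ring.
apply/eqP; rewrite -normr_le0 -/a leNgt; apply/negP => a0.
have C0 : 0 <= C by rewrite addr_ge0 // mulr_ge0 ?(ltW Kp) // mulr_ge0 ?(ltW CP0) // mulr_ge0 // addr_ge0.
have d0 : 0 < C + a + 1 by lra.
pose eta := a / (2 * (C + a + 1)).
have eE : eta * (2 * (C + a + 1)) = a by rewrite divfK // gt_eqF // mulr_gt0.
have eta0 : 0 < eta by rewrite divr_gt0 // mulr_gt0.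
have eta1 : eta <= 1 by rewrite ler_pdivrMr ?mulr_gt0 // mul1r; lra.
have := main eta; rewrite eta0 eta1 => /(_ isT).
have : eta * C <= 2^-1 * a by rewrite -[in X in _ <= X]eE mulrCA mulKf // ler_pM2l //; lra.
by lra.
Qed.

(** Two close points of a level set are joined inside it: a segment parallel to the kernel of the
    Jacobian at x0 is pushed back to the level set along the rows of P. Along this path u has
    derivative 0. *)
Lemma level_const U f x0 (u : 'rV[R]_n -> R) : open U -> smooth_map_on U f -> smooth_on U u -> U x0 ->
  (forall z, U z -> \rank (Jac f z) = q) -> (forall z v, U z -> v *m Jac f z = 0 -> 'd u z v = 0) ->
  exists2 r : R, 0 < r & forall x y, ball x0 r x -> ball x0 r y -> f x = f y -> u x = u y.
Proof.
move=> oU sf su Ux0 rf Hu.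
have [P PJ] := rank_right_inverse (rf _ Ux0).
have [d d0 cU] := open_cball oU Ux0.
have [L L0 [_ HL]] := smooth_map_cball oU sf cU.
have bU : ball x0 d `<=` U by move=> z; rewrite ballE => /ltW; exact: cU.
have sfb : smooth_map_on (ball x0 d) f by move=> j; exact: smooth_sub (sf j).
have [rho [rho1 [rho0 rho10 sub H1 H2]]] := right_inverse (@ball_open _ _ x0 d) sfb (ballxx _ d0) PJ.
have inj z (v : 'rV[R]_q) : ball x0 rho1 z -> ball x0 rho1 (z + v *m P) -> f (z + v *m P) = f z -> v = 0.
  move=> Bz Bv E; have := H1 z v Bz Bv; rewrite E subrr sub0r normrN => h.
  by apply/eqP; rewrite -normr_le0; lra.
pose pr : 'M[R]_n := 1%:M - Jac f x0 *m P.
have [Cp Cp0 HCp] := mulmx_bound pr.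
pose r := Num.min (Num.min rho rho1) (rho / L) / (1 + 4 * Cp).
have K0 : 0 < 1 + 4 * Cp by rewrite addr_gt0 // mulr_gt0.
have r0 : 0 < r by rewrite divr_gt0 // !lt_min rho0 rho10 divr_gt0.
have rK : [/\ r * (1 + 4 * Cp) <= rho, r * (1 + 4 * Cp) <= rho1 & L * (r * (1 + 4 * Cp)) <= rho].
  rewrite /r mulfVK ?gt_eqF //; split; [by rewrite !ge_min lexx|by rewrite !ge_min lexx !orbT|].
  by rewrite -ler_pdivlMl // [_^-1 * _]mulrC ge_min lexx orbT.
have [rK1 rK2 rK3] := rK; have rr1 : r <= r * (1 + 4 * Cp) by rewrite ler_pMr // lerDl mulr_ge0 // ltW.
exists r => // x y; rewrite !ballE => Bx By fxy.
(* [pr] projects to the kernel of the Jacobian along the rows of P, so y differs from [Y 1] by a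
   combination of these rows, and the unique correction of [Y 1] leads to y. *)
pose v := (y - x) *m pr; pose Y s := x + s *: v.
have nv : `|v| <= Cp * (2 * r).
  apply: le_trans (HCp _) _; rewrite ler_pM2l //; have := ler_distD x0 y x; rewrite [`|x0 - x|]distrC.
  by move: Bx By; clear -n q; lra.
have Yx s : `|s| < 2 -> `|Y s - x| <= r * (4 * Cp).
  move=> s2; rewrite /Y addrAC subrr add0r normrZ.
  have -> : r * (4 * Cp) = 2 * (Cp * (2 * r)) by ring.
  by apply: ler_pM => //; exact: ltW.
have BY s : `|s| < 2 -> `|Y s - x0| < r * (1 + 4 * Cp).
  move=> s2; have := ler_distD x (Y s) x0; have := Yx s s2; move: Bx; clear -n q; lra.
have fY s : `|s| < 2 -> `|f x - f (Y s)| < rho.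
  move=> s2; rewrite distrC; apply: le_lt_trans (_ : L * `|Y s - x| < _).
    apply: HL; apply: sub; rewrite ballE; first exact: lt_le_trans (lt_le_trans Bx rr1) rK2.
    exact: lt_le_trans (BY s s2) rK2.
  apply: lt_le_trans rK3; rewrite ltr_pM2l //; apply: le_lt_trans (Yx s s2) _.
  by rewrite ltr_pM2l // ltrDr.
have /choice[w Hw] : forall s, exists w : 'rV[R]_q, `|s| < 2 -> ball x0 rho1 (Y s + w *m P) /\ f (Y s + w *m P) = f x.
  move=> s; have [s2|ns] := boolP (`|s| < 2); last by exists 0.
  have [|w [_ h1 h2]] := H2 (Y s) (f x) _ (fY s s2); last by exists w.
  by rewrite ballE; exact: lt_le_trans (BY s s2) rK1.
pose Z s := Y s + w s *m P.
have Bx1 : ball x0 rho1 x by rewrite ballE; exact: lt_le_trans (lt_le_trans Bx rr1) rK2.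
have By1 : ball x0 rho1 y by rewrite ballE; exact: lt_le_trans (lt_le_trans By rr1) rK2.
have Z0 : Z 0 = x.
  have [|b e] := Hw 0; first by rewrite normr0.
  have Y0 : Y 0 = x by rewrite /Y scale0r addr0.
  by rewrite /Z Y0 in b e *; rewrite (inj _ _ Bx1 b e) mul0mx addr0.
have Z1 : Z 1 = y.
  have [|b e] := Hw 1; first by rewrite normr1 ltr1n.
  have E : Y 1 + w 1 *m P = y + (w 1 - (y - x) *m Jac f x0) *m P.
    rewrite /Y scale1r /v /pr; have Ey : y = x + (y - x) by rewrite addrC subrK.
    rewrite [X in _ = X + _]Ey; move: (y - x) => dd.
    by rewrite mulmxBr mulmx1 mulmxBl mulmxA !addrA -!addrA; congr (_ + (_ + _)); rewrite addrC.
  rewrite /Z E in b *; rewrite E fxy in e.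
  by rewrite (inj _ _ By1 b e) mul0mx addr0.
suff dU (s : R) : `|s| < 2 -> is_derive s 1 (fun s => u (Z s)) 0.
  by rewrite -Z0 -Z1; apply/esym; apply: (const_of_derive0 dU); rewrite ler01 ltr1n.
move=> s2; have [Bs fs] := Hw s s2; rewrite -/(Z s) in Bs fs.
have UZ : U (Z s) by apply/bU/sub.
have [Q QJ] := rank_right_inverse (rf _ UZ).
have dus := smooth_diff oU su UZ; have dfs := smooth_map_diff oU sf UZ.
have [K Kp HK] := diff_bound dus.
have [CP CP0 HP] := mulmx_bound P; have [CQ CQ0 HQ] := mulmx_bound Q.
pose A := (1 + CP * (2 * L)) * (Cp * (2 * r)).
have cl0 : 0 < 1 + CP * (2 * L) by apply: addr_gt0 => //; apply: mulr_gt0 => //; exact: mulr_gt0.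
have A0 : 0 < A by apply: mulr_gt0 => //; apply: mulr_gt0 => //; exact: mulr_gt0.
(* The corrections w(s) are only chosen pointwise; their uniqueness to first order makes the path
   Lipschitz, which is enough to differentiate u along it. *)
have lipZ : \forall h \near (0 : R), `|s + h| < 2 /\ `|Z (s + h) - Z s| <= A * `|h|.
  have o1 : \forall y \near Z s, ball x0 rho1 y by exact: open_near (@ball_open _ _ x0 rho1) Bs.
  have c1 : {for (0 : R), continuous (fun h : R => Z s + h *: v)}.
    by apply: continuousD; [exact: cst_continuous|exact: scalel_continuous].
  have o2 : \forall h \near (0 : R), ball x0 rho1 (Z s + h *: v).
    by apply: near_comp c1 _; rewrite scale0r addr0.
  have o3 := @near0_norm (2 - `|s|); rewrite subr_gt0 in o3.
  apply: filterS (near_and o2 (o3 s2)) => h [Bh h2].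
  have sh : `|s + h| < 2 by apply: le_lt_trans (ler_normD _ _) _; lra.
  split=> //; have [Bsh fsh] := Hw _ sh.
  have E : Z (s + h) = Z s + h *: v + (w (s + h) - w s) *m P.
    by rewrite /Z /Y mulmxBl scalerDl !addrA; rewrite [x + s *: v + _ + h *: v]addrAC [X in _ = X]addrAC addrK.
  rewrite -/(Z _) in Bsh fsh; rewrite E in Bsh fsh *.
  have h1 := H1 _ _ Bh Bsh; rewrite fsh -fs in h1.
  have h3 : `|f (Z s + h *: v) - f (Z s)| <= L * `|h *: v|.
    have := HL (Z s) (Z s + h *: v) (sub _ Bs) (sub _ Bh); by rewrite [X in _ <= _ * `|X|]addrAC subrr add0r.
  set dw := w (s + h) - w s in h1 *.
  have h4 : `|dw| <= 2 * (L * `|h *: v|).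
    have := ler_normB (f (Z s) - f (Z s + h *: v)) (f (Z s) - f (Z s + h *: v) - dw).
    by rewrite opprB addrC subrK [X in _ <= X + _]distrC; move: h1 h3; clear -n q; lra.
  have -> : Z s + h *: v + dw *m P - Z s = h *: v + dw *m P by rewrite -[X in X - _]addrA [Z s + _]addrC addrK.
  apply: le_trans (ler_normD _ _) _.
  have h5 := HP dw.
  have h6 : CP * `|dw| <= CP * (2 * (L * `|h *: v|)) by rewrite ler_pM2l.
  have h7 : `|h *: v| <= `|h| * (Cp * (2 * r)) by rewrite normrZ ler_wpM2l.
  have h8 : (1 + CP * (2 * L)) * `|h *: v| <= (1 + CP * (2 * L)) * (`|h| * (Cp * (2 * r))).
    by rewrite ler_pM2l // addr_gt0 // !mulr_gt0.
  have -> : A * `|h| = (1 + CP * (2 * L)) * (`|h| * (Cp * (2 * r))) by rewrite /A; ring.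
  by move: h5 h6 h8; move: (`|h *: v|) (`|dw|) (`|dw *m P|) => g1 g2 g3; clear -n q; lra.
apply: derive0_intro => e e0.
pose eta := e / (A * (1 + K * CQ)).
have B0 : 0 < 1 + K * CQ by apply: addr_gt0; rewrite ?ltr01 //; exact: mulr_gt0.
have eta0 : 0 < eta by rewrite divr_gt0 // mulr_gt0.
have /near0_ballP[t1 t10 n1] := diff_eps dus eta0; have /near0_ballP[t2 t20 n2] := diff_eps dfs eta0.
have mt : 0 < Num.min t1 t2 / A by rewrite divr_gt0 // lt_min t10.
apply: filterS (near_and lipZ (near0_norm mt)) => h [[sh lz] hm].
have [_ fsh] := Hw _ sh; rewrite -/(Z _) in fsh.
pose k := Z (s + h) - Z s.
have km : `|k| < Num.min t1 t2 by apply: le_lt_trans lz _; rewrite mulrC -ltr_pdivlMr.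
have [k1 k2] : `|k| < t1 /\ `|k| < t2 by move: km; rewrite lt_min => /andP[].
have := n2 k k2; have := n1 k k1; rewrite {1 2}/k [Z s + _]addrC subrK fsh -fs subrr sub0r normrN diff_jac // => a1 a2.
(* du kills the kernel of the Jacobian, so it depends only on the image of k, which is o(|k|)
   because f is constant along the path. *)
have E : 'd u (Z s) k = 'd u (Z s) ((k *m Jac f (Z s)) *m Q).
  apply/eqP; rewrite -subr_eq0 -linearB; apply/eqP; apply: Hu => //.
  by rewrite mulmxBl -!mulmxA QJ mulmx1 subrr.
have a3 : `|'d u (Z s) k| <= K * (CQ * (eta * `|k|)).
  rewrite E; apply: le_trans (HK _) _; rewrite ler_pM2l //; apply: le_trans (HQ _) _; by rewrite ler_pM2l.
have a4 : `|u (Z (s + h)) - u (Z s)| <= eta * `|k| + K * (CQ * (eta * `|k|)).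
  have := ler_normD (u (Z (s + h)) - u (Z s) - 'd u (Z s) k) ('d u (Z s) k); rewrite subrK => /le_trans; apply.
  exact: lerD.
apply: le_trans a4 _.
have -> : eta * `|k| + K * (CQ * (eta * `|k|)) = eta * (1 + K * CQ) * `|k| by ring.
have -> : e * `|h| = eta * (1 + K * CQ) * (A * `|h|).
  by rewrite /eta; field; rewrite !gt_eqF // ltW.
by rewrite ler_pM2l // mulr_gt0.
Qed.
End LevelSets.

Lemma diff_chain (R : realType) p r (phi : 'rV[R]_r -> R) (f : 'rV[R]_p -> 'rV[R]_r) z v :
  differentiable f z -> differentiable phi (f z) -> 'd (phi \o f) z v = 'd phi (f z) (v *m Jac f z).
Proof. by move=> df dphi; rewrite -diff_jac // diff_comp. Qed.

Section Fields.
Variables (R : realType) (n q : nat) (M : manifold R n) (F : foliation M q).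
Hypothesis hM : hausdorff_space M.
Implicit Types (i j : fidx F) (a b : chart_idx M) (x y : M) (u : M -> R) (X Y Z : operator M).

(** A smooth section of the differential of f_i near x: with P0 a right inverse at x, P0 J remains
    invertible nearby and Q = (P0 J)^-1 P0. *)
Lemma chart_splitting i a x : dom a x -> fU i x -> exists V (Q : 'rV[R]_n -> 'M[R]_(q, n)),
  [/\ open V, V x, V `<=` dom a `&` fU i, forall k l, smooth_on (chart a @` V) (fun z => Q z k l) &
   forall y, V y -> Q (chart a y) *m Jac (frep i a) (chart a y) = 1%:M].
Proof.
move=> da Ux; have oW := chart_image_open (a := a) (fU_open (f := F) i).
set W := chart a @` _ in oW.
have sJ k l : smooth_on W (fun z => Jac (frep i a) z k l) by exact: (smooth_jac oW (@frep_smooth R n q M F i a)).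
have iz : W (chart a x) by exists x.
have [P0 PJ] := rank_right_inverse (frep_rank iz).
pose A z := P0 *m Jac (frep i a) z.
have sA k l : smooth_on W (fun z => A z k l).
  rewrite /A; under eq_fun do rewrite mxE; apply: smooth_sum => // c _.
  by apply: smooth_mul => //; exact: smooth_cst.
have sdet := smooth_det oW sA.
have oW' : open (W `&` [set z | \det (A z) != 0]).
  rewrite openE => z [Wz nz]; have cz : {for z, continuous (fun z => \det (A z))} by exact: (Ck_cont (sdet 0%N) Wz).
  have d0 : 0 < `|\det (A z)| by rewrite normr_gt0.
  apply: filterS (near_and (open_near oW Wz) ((contP _ _).1 cz _ d0)) => y [Wy dy]; split=> //=.
  by apply/eqP => Ey; move: dy; rewrite Ey sub0r normrN ltxx.
pose V := (dom a `&` fU i) `&` [set y | \det (A (chart a y)) != 0].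
have VW y : V y -> (W `&` [set z | \det (A z) != 0]) (chart a y) by move=> [dy ny]; split=> //; exists y.
exists V, (fun z => invmx (A z) *m P0); split.
- rewrite openE => y Vy; have [[dy Uy] _] := Vy.
  have h1 := near_comp (chart_continuous dy) (open_near oW' (VW y Vy)).
  have h2 := open_near (openI (dom_open a) (fU_open (f := F) i)) (conj dy Uy : (dom a `&` fU i) y).
  by apply: filterS (near_and h1 h2) => z [[_ h] dz].
- by split=> //=; rewrite /A PJ det1 oner_neq0.
- by move=> y [].
- move=> k l; apply: smooth_sub (_ : smooth_on (W `&` [set z | \det (A z) != 0]) _).
    by move=> _ [y Vy <-]; exact: VW.
  apply: smooth_mulmx => //; last by move=> ? ?; exact: smooth_cst.
  apply: smooth_invmx => //; first by move=> z [_ nz]; rewrite unitmxE unitfE.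
  by move=> ? ?; apply: smooth_sub (sA _ _); exact: subIsetl.
- move=> y [_ ny]; rewrite -mulmxA mulVmx //; by rewrite unitmxE unitfE.
Qed.

Lemma frep_near i a x : dom a x -> fU i x -> forall e : R, 0 < e -> forall V : set M, open V -> V x ->
  exists2 r : R, 0 < r & forall z, `|z - chart a x| < r ->
    [/\ V (chart_inv a z), dom a (chart_inv a z), fU i (chart_inv a z) & chart a (chart_inv a z) = z].
Proof.
move=> da Ux e e0 V oV Vx.
have oW := chart_image_open (a := a) (openI oV (fU_open (f := F) i)).
have iz : (chart a @` (dom a `&` (V `&` fU i))) (chart a x) by exists x.
have /near_normP[r r0 Hr] := open_near oW iz.
by exists r => // z /Hr/chart_inv_image[[d [v f]] c].
Qed.

Lemma level_tangent_chart i a x (c : R -> 'rV[R]_q) xi u : dom a x -> fU i x -> smooth u -> c 0 = ff i x ->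
  is_derive (0 : R) 1 c (xi *m Jac (frep i a) (chart a x)) ->
  (exists2 e : R, 0 < e & \forall y \near x, forall s : R, fU i y -> `|s| < e -> ff i y = c s -> u y = u x) ->
  'd (u \o chart_inv a) (chart a x) xi = 0.
Proof.
move=> da Ux su c0 dc [e e0 H].
have iz : (chart a @` (dom a `&` fU i)) (chart a x) by exists x.
have [V [oV Vx] HV] : exists2 V : set M, open V /\ V x & forall y, V y -> forall s : R, fU i y -> `|s| < e -> ff i y = c s -> u y = u x.
  pose A := [set y | forall s : R, fU i y -> `|s| < e -> ff i y = c s -> u y = u x].
  exists A°; first by split; [exact: open_interior|exact: H].
  by move=> y /interior_subset.
have [r r0 Hr] := frep_near da Ux e0 oV Vx.
have oW := chart_image_open (a := a) (fU_open (f := F) i).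
apply: (level_tangent oW (@frep_smooth R n q M F i a) iz (frep_rank iz) _ dc).
- by rewrite c0 /frep /= chartK.
- exact: smooth_chart_diff.
exists (Num.min e r); first by rewrite lt_min e0.
move=> z s; rewrite !lt_min => /andP[_ zr] /andP[se _] fz.
have [Vz dz Uz cz] := Hr z zr.
by rewrite /= chartK //; apply: (HV _ Vz s).
Qed.

(** The constant field v is corrected by the splitting to v - v J Q, which stays in the kernel of
    the differential of f_i and equals v at x. *)
Lemma leaf_field i a x v : dom a x -> fU i x -> v *m Jac (frep i a) (chart a x) = 0 ->
  exists2 X, tangent_to_leaves F X & forall u, smooth u -> X u x = 'd (u \o chart_inv a) (chart a x) v.
Proof.
move=> da Ux vJ; have [V [Q [oV Vx VU sQ QJ]]] := chart_splitting da Ux.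
have Va : V `<=` dom a by move=> y /VU[].
have oVa := chart_image_sub oV Va.
pose xi z := v - v *m Jac (frep i a) z *m Q z.
have sxi : smooth_map_on (chart a @` V) xi.
  move=> l; rewrite /xi; under eq_fun do rewrite !mxE.
  apply: smooth_sub2 => //; first exact: smooth_cst.
  apply: smooth_sum => // k _; apply: smooth_mul => //; under eq_fun do rewrite mxE.
  apply: smooth_sum => // k' _; apply: smooth_mul => //; first exact: smooth_cst.
  have oW := chart_image_open (a := a) (fU_open (f := F) i).
  apply: smooth_sub (smooth_jac oW (@frep_smooth R n q M F i a) k' k) => _ [y /VU[dy Uy] <-].
  by exists y.
have [X [chi [vX cx supp HX]]] := local_field hM oV Va Vx sxi.
exists X; last by move=> u su; rewrite HX cx mul1r /xi vJ mul0mx subr0.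
split=> // j y Uj u su Hu; rewrite HX.
have [->|/supp Vy] := eqVneq (chi y) 0; first by rewrite mul0r.
have [dy Uy] := VU y Vy.
have -> : 'd (u \o chart_inv a) (chart a y) (xi (chart a y)) = 0; last by rewrite mulr0.
apply: (@level_tangent_chart i a y (fun=> ff i y)) => //.
- by rewrite /xi mulmxBl -[_ *m Q _ *m _]mulmxA QJ // mulmx1 subrr; exact: is_derive_cst.
exists 1 => //; apply: filterS (near_and Hu (open_near (fU_open (f := F) j) Uj)) => z [h Ujz] s Uz _ fz.
by apply: h; split=> //=; rewrite -(fhE Uz Ujz) fz fhE.
Qed.

(** The fields of [leaf_field] show that du kills the kernel of the differential of f_i, so u is
    locally constant on level sets by [level_const]; plaques are connected. *)
Lemma basic_plaque u i x y : basic_function F u -> fU i x -> plaque i x y -> u y = u x.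
Proof.
move=> [su Hu] Ux [Uy fy].
apply: (@conn_ind M (fU i `&` ff i @^-1` [set ff i x]) (fun y => u y = u x) (@ff_connected _ _ _ _ F i _) _ x y) => //.
move=> {y Uy fy} y [Uy fy]; have [a da] := dom_cover y.
have oW := chart_image_open (a := a) (fU_open (f := F) i).
have iz : (chart a @` (dom a `&` fU i)) (chart a y) by exists y.
have suW : smooth_on (chart a @` (dom a `&` fU i)) (u \o chart_inv a).
  by apply: smooth_sub (su a) => _ [z [dz _] <-]; exists z.
have [||r r0 Hr] := level_const oW (@frep_smooth R n q M F i a) suW iz.
- by move=> z; exact: frep_rank.
- move=> _ v [z [dz Uz] <-] vJ; have [X tX HX] := leaf_field dz Uz vJ.
  by rewrite -HX // Hu.
have h1 : \forall z \near y, ball (chart a y) r (chart a z).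
  by apply: (near_comp (chart_continuous da)); exact: nbhsx_ballx.
apply: filterS (near_and h1 (open_near (dom_open a) da)) => z [Bz dz] [Uz fz].
suff -> : u z = u y by [].
have := Hr _ _ Bz (ballxx _ r0); rewrite /= /frep /= !chartK //; apply.
by rewrite (fz : ff i z = _) (fy : ff i y = _).
Qed.

Lemma basic_leaf u x y : basic_function F u -> leaf F x y -> u y = u x.
Proof. by move=> bu; elim=> // i {}y z _ <- Uy pz; exact: (basic_plaque bu Uy pz). Qed.

Lemma basic_leaf_closure u x X : basic_function F u -> tangent_to_leaf_closures F X -> X u x = 0.
Proof.
move=> bu [_ tX]; have [su _] := bu; apply: (tX x u su); apply: filterE => y cy.
apply/eqP; rewrite -subr_eq0 -normr_le0 leNgt; apply/negP => d0.
have cu : {for y, continuous u} by apply: (smooth_in_cont (V := setT)) => //; [exact: openT|exact/smooth_inT].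
have h := (contP _ _).1 cu _ d0.
have [z [lz hz]] := cy _ h.
by move: hz; rewrite /= (basic_leaf bu lz) distrC ltxx.
Qed.

(* The leaf through y comes close to every point over the orbit of f_i(y) under
   the flow of X, so a lift of X is tangent to the leaf closures. *)
Lemma central_lift (G : fidx F -> 'rV[R]_q -> 'M[R]_q) i x (xi : selfmap R q) : transverse_metric G -> closed_manifold M ->
  central_germ i (ff i x) xi -> fU i x ->
  exists2 Z, tangent_to_leaf_closures F Z & forall (phi : 'rV[R]_q -> R) u, smooth u -> differentiable phi (ff i x) ->
     (\forall y \near x, u y = phi (ff i y)) -> Z u x = 'd phi (ff i x) (xi (ff i x)).
Proof.
move=> tG cM [Op Opx cX] Ux; have [a da] := dom_cover x.
have [oO OT sX _] := cX.
have [V0 [Q [oV0 Vx0 VU0 sQ0 QJ0]]] := chart_splitting da Ux.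
have oW := chart_image_open (a := a) (fU_open (f := F) i).
pose V := V0 `&` [set y | Op (ff i y)].
have oV : open V.
  rewrite openE => y [Vy Oy]; have [_ Uy] := VU0 y Vy.
  exact: (near_and (open_near oV0 Vy) (near_comp (ff_cont Uy) (open_near oO Oy))).
have VU : V `<=` dom a `&` fU i by move=> y [/VU0].
have Va : V `<=` dom a by move=> y /VU[].
have oVa := chart_image_sub oV Va.
pose eta z := xi (frep i a z) *m Q z.
have seta : smooth_map_on (chart a @` V) eta.
  move=> l; rewrite /eta; under eq_fun do rewrite mxE.
  apply: smooth_sum => // k _; apply: smooth_mul => //; last first.
    by apply: smooth_sub (sQ0 k l) => _ [y [Vy _] <-]; exists y.
  apply: (smooth_comp oVa oO) (sX k).
    by move=> _ [y [Vy Oy] <-]; rewrite /frep /= chartK //; have [] := VU0 y Vy.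
  move=> k'; apply: smooth_sub (@frep_smooth R n q M F i a k') => _ [y /VU[dy Uy] <-].
  by exists y.
have [Z [chi [vZ cx supp HZ]]] := local_field hM oV Va (conj Vx0 Opx : V x) seta.
have etaJ y : V y -> eta (chart a y) *m Jac (frep i a) (chart a y) = xi (ff i y).
  move=> Vy; have [dy _] := VU y Vy; have [Vy0 _] := Vy.
  by rewrite /eta -mulmxA QJ0 // mulmx1 /frep /= chartK.
exists Z; last first.
  move=> phi u su dphi Hu; rewrite HZ cx mul1r -(etaJ x) //.
  have iz : (chart a @` (dom a `&` fU i)) (chart a x) by exists x.
  have dfr := smooth_map_diff oW (@frep_smooth R n q M F i a) iz.
  have fx : frep i a (chart a x) = ff i x by rewrite /frep /= chartK.
  rewrite -fx in dphi *; rewrite -(diff_chain _ dfr dphi).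
  have dd : differentiable (phi \o frep i a) (chart a x) by exact: differentiable_comp.
  have [|_ -> //] := diff_near (psi := u \o chart_inv a) dd.
  apply: (near_comp (@chart_inv_continuous _ _ M a (chart a x) (imageP _ da)) (P := fun y => (phi (ff i y) : R) = u y)).
  by rewrite chartK //; apply: filterS Hu => z ->.
split=> // y u su Hu; rewrite HZ.
have [->|/supp Vy] := eqVneq (chi y) 0; first by rewrite mul0r.
have [dy Uy] := VU y Vy; have [_ Oy] := Vy.
have [tau [rho [E [tau0 rho0 HE]]]] := central_flowbox tG cM cX Oy.
have H s : `|s| < tau -> [/\ Op (E s (ff i y)), is_derive s 1 (fun r : R => E r (ff i y)) (xi (E s (ff i y))),
    E 0 (ff i y) = ff i y & good G i i (E s) (ff i y)].
  by apply: HE; exact: ballxx.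
have -> : 'd (u \o chart_inv a) (chart a y) (eta (chart a y)) = 0; last by rewrite mulr0.
have n0 : `|0 : R| < tau by rewrite normr0.
have [_ D0 E0 _] := H 0 n0.
apply: (@level_tangent_chart i a y (fun s => E s (ff i y))) => //.
  by rewrite etaJ // -{2}E0.
exists tau => //.
apply: filterS Hu => z Hz s Uz st fz; apply: Hz => N Nz.
have [N' [oN' Nz'] NN] : exists2 N' : set M, open N' /\ N' z & N' `<=` N.
  by exists N°; [split; [exact: open_interior|exact: Nz]|exact: interior_subset].
have oI := @ff_open R n q M F i N' oN'.
have Iz : (ff i @` (fU i `&` N')) (ff i z) by exists z.
have /near_normP[e e0 He] := open_near oI Iz.
have [_ _ _ [V' [_ _ Vy'] [_ _ _ ej]]] := H s st.
have [Om [h [coh Omy h1 _]]] := ej _ Vy' _ e0.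
have [|w [Uw Nw] fw] := He (h (ff i y)); first by rewrite fz.
by exists w; split; [exact: (composite_leaf coh Uy Omy Uw fw)|exact: NN].
Qed.

End Fields.

(** * The secondary class *)

Section LocalFrames.
Variables (R : realType) (n q : nat) (M : manifold R n) (F : foliation M q).
Variable G : fidx F -> 'rV[R]_q -> 'M[R]_q.
Hypotheses (tG : transverse_metric G) (cM : closed_manifold M).
Variable Bm : fibre_metric F.
Hypothesis bB : basic_metric Bm.
Implicit Types (i : fidx F) (t x : 'rV[R]_q).

Lemma fam_germ_eq (U : set_system nat) (UF : UltraFilter U) (dl : nat -> R) i t0 (rT r0 : R) f f' x :
  local_ctx G U dl i t0 rT r0 -> local_fam U dl i t0 rT r0 f -> local_fam U dl i t0 rT r0 f' -> ball t0 r0 x ->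
  (\forall y \near x, rescaled_limit U f dl y = rescaled_limit U f' dl y) ->
  forall y, ball t0 r0 y -> rescaled_limit U f dl y = rescaled_limit U f' dl y.
Proof.
move=> LC ff ff' Bx E; apply: (fam_eq tG LC ff ff' Bx (nbhs_singleton E)).
have [sg _ _] := fam_limit tG LC ff; symmetry; apply: jac_near => //.
exact: smooth_map_diff (@ball_open _ _ t0 r0) sg Bx.
Qed.

Notation Dg i e := (fun t => \det (gram Bm i e t)).

Lemma frame_diff0 i (Op : set 'rV[R]_q) m (e : 'I_m -> selfmap R q) (L : {linear 'rV[R]_q -> R}) t X :
  parallel_frame i Op e -> Op t -> central_germ i t X -> (forall a, L (e a t) = 0) -> L (X t) = 0.
Proof.
move=> [_ _ _ H] Ot gX L0; have [c [/nbhs_singleton -> _]] := H t X Ot gX.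
by rewrite linear_sum big1 // => a _; rewrite linearZ /= L0 [LHS]mulr0.
Qed.

Lemma frame_local i t0 : trans i t0 -> exists m (e : 'I_m -> selfmap R q) (r : R) (tau : 'I_m -> R),
  [/\ 0 < r, parallel_frame i (ball t0 r) e,
   forall x a, ball t0 r x -> 'd (Dg i e) x (e a x) = tau a * Dg i e x &
   (forall a, tau a = 0) -> exists2 eta : R, 0 < eta & forall Om (h : selfmap R q), composite i i Om h -> Om t0 ->
      `|h t0 - t0| < eta -> Dg i e (h t0) = Dg i e t0].
Proof.
move=> Tt; have [U [dl [rT [r0 [UF _ LC]]]]] := default_ctx tG cM Tt ltr01.
have [r00 r0T rT0] := lc_pos LC.
have [m [h [hf H]]] := fam_basis tG LC.
pose rho := r0 / 2; pose r := r0 / 4.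
have rr : 0 < rho < r0 by rewrite /rho; apply/andP; split; lra.
have rr2 : 0 < r < rho by rewrite /rho /r; apply/andP; split; lra.
have rr3 : 0 < r < r0 by rewrite /r; apply/andP; split; lra.
have [span free] := H rho rr.
pose e a := rescaled_limit U (h a) dl.
have pf : parallel_frame i (ball t0 r) e.
  apply: (fam_frame tG LC hf rr span free); first exact: ball_open.
  by move=> x; rewrite !ballE => /lt_trans; apply; case/andP: rr2.
have /choice[tau Htau] : forall a, exists tau : R, forall x, ball t0 r x -> 'd (Dg i e) x (e a x) = tau * Dg i e x.
  move=> a; have [b Hb] := gram_derivative tG LC cM bB hf rr span free (hf a) rr2.
  by exists (2 * \tr b) => x /Hb[].
have [_ _ ce _] := pf.
exists m, e, r, tau; split=> //; first by case/andP: rr2.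
  by move=> x a; exact: Htau.
move=> tau0; apply: (@transverse_constancy _ _ _ _ _ _ tG _ _ _ _ _ _ _ LC (Dg i e) r rr3).
  by apply: (gram_det_smooth bB) => //; exact: ball_open.
move=> X x cX Bx.
have gX : central_germ i x X by exists (ball t0 r).
apply: (frame_diff0 (L := 'd (Dg i e) x) pf Bx gX) => a.
by rewrite Htau // tau0 mul0r.
Qed.

Section Structural.
Variables (g : lie_algebra R) (i : fidx F) (t1 : 'rV[R]_q) (iota : g -> selfmap R q).
Hypotheses (T1 : trans i t1) (Hi : opposite_iso_stalk i t1 iota).
Notation vb := (vbasis {: g}).

Let iota0 : germ_eq t1 (iota 0) (fun=> 0).
Proof.
have [_ lin _ _ _] := Hi; have := lin (-1) 0 0; rewrite scaler0 addr0; apply: filterS => s ->.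
by rewrite scaleN1r addNr.
Qed.

Let iota_inj y z : germ_eq t1 (iota y) (iota z) -> y = z.
Proof.
have [_ lin inj _ _] := Hi; move=> E; apply/eqP; rewrite -subr_eq0; apply/eqP; apply: inj.
have := lin (-1) z y; rewrite scaleN1r [- z + y]addrC => h.
by apply: filterS (near_and h E) => s [-> ->]; rewrite scaleN1r addNr.
Qed.

Let iota_sum m (c : 'I_m -> R) (v : 'I_m -> g) :
  germ_eq t1 (iota (\sum_a c a *: v a)) (fun s => \sum_a c a *: iota (v a) s).
Proof.
have [_ lin _ _ _] := Hi; rewrite /germ_eq.
elim: m c v => [|m IH] c v; first by rewrite big_ord0; apply: filterS iota0 => s ->; rewrite big_ord0.
rewrite big_ord_recl; apply: filterS (near_and (lin (c ord0) (v ord0) (\sum_(a < m) c (lift ord0 a) *: v (lift ord0 a)))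
  (IH (fun a => c (lift ord0 a)) (fun a => v (lift ord0 a)))) => s [-> ->].
by rewrite big_ord_recl.
Qed.

(** The basis of the structural algebra, transported by iota, is a parallel frame, so the matrix b
    of [gram_derivative] for the field of y can be read off in the algebra. The sign is that of the
    opposite bracket. *)
Lemma structural_frame : exists (e : 'I_(\dim {: g}) -> selfmap R q) (r : R),
  [/\ 0 < r, parallel_frame i (ball t1 r) e &
   forall y : g, 'd (Dg i e) t1 (iota y t1) = - 2 * \tr (ad_matrix y) * Dg i e t1].
Proof.
have [cg lin inj surj brk] := Hi.
have [U [dl [rT [r0 [UF _ LC]]]]] := default_ctx tG cM T1 ltr01.
have [r00 r0T rT0] := lc_pos LC.
have B0 : ball t1 r0 t1 by exact: ballxx.
have /choice[h Hh] : forall a : 'I_(\dim {: g}), exists f, local_fam U dl i t1 rT r0 f /\ germ_eq t1 (iota vb`_a) (rescaled_limit U f dl).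
  by move=> a; have [f ff E] := germ_fam tG LC (cg vb`_a) B0; exists f.
pose e a := rescaled_limit U (h a) dl.
have hf a : local_fam U dl i t1 rT r0 (h a) by have [] := Hh a.
have he : \forall s \near t1, forall a : 'I_(\dim {: g}), iota vb`_a s = e a s.
  by apply: near_all => a; have [] := Hh a.
pose rho := r0 / 2; pose r := r0 / 4.
have rr : 0 < rho < r0 by rewrite /rho; apply/andP; split; lra.
have rr2 : 0 < r < rho by rewrite /rho /r; apply/andP; split; lra.
have Br : ball t1 rho t1 by apply: ballxx; case/andP: rr.
have nr : \forall s \near t1, ball t1 rho s by exact: open_near (@ball_open _ _ t1 rho) Br.
have rB x : ball t1 rho x -> ball t1 r0 x by rewrite !ballE => /lt_trans; apply; case/andP: rr.
have isum (c : 'I_(\dim {: g}) -> R) : germ_eq t1 (iota (\sum_a c a *: vb`_a)) (fun s => \sum_a c a *: e a s).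
  apply: filterS (near_and (iota_sum c (fun a : 'I_(\dim {: g}) => vb`_a)) he) => s [-> E].
  by apply: eq_bigr => a _; rewrite E.
have coordE (y : g) : y = \sum_a coord vb a y *: vb`_a by apply: coord_vbasis; exact: memvf.
have span f : local_fam U dl i t1 rT r0 f -> exists c : 'I_(\dim {: g}) -> R, forall x, ball t1 rho x ->
    rescaled_limit U f dl x = \sum_a c a *: rescaled_limit U (h a) dl x.
  move=> ff; have gf : central_germ i t1 (rescaled_limit U f dl).
    by exists (ball t1 r0) => //; exact: (fam_central tG LC ff).
  have [y Ey] := surj _ gf; exists (fun a => coord vb a y).
  have [k fk Ek] := fam_sum tG LC (fun a => coord vb a y) hf rr.
  move=> x Bx; rewrite -Ek //; apply: (fam_germ_eq UF LC ff fk B0 _ (rB _ Bx)).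
  have E2 := isum (fun a => coord vb a y); rewrite -coordE in E2.
  by apply: filterS (near_and (near_and Ey E2) nr) => s [[-> ->] Bs]; rewrite Ek.
have free (c : 'I_(\dim {: g}) -> R) x : ball t1 rho x ->
    (\forall y \near x, \sum_a c a *: rescaled_limit U (h a) dl y = 0) -> forall a, c a = 0.
  move=> Bx E; have [k fk Ek] := fam_sum tG LC c hf rr.
  have E0 : forall y, ball t1 r0 y -> rescaled_limit U k dl y = rescaled_limit U (fun _ => id) dl y.
    apply: (fam_germ_eq UF LC fk (fam_id tG LC) (rB _ Bx)).
    apply: filterS (near_and E (open_near (@ball_open _ _ t1 rho) Bx)) => s [e0 Bs].
    by rewrite Ek // e0 (fam_id_limit tG LC) //; exact: rB.
  have /freeP := basis_free (vbasisP {: g}); apply; apply: inj.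
  apply: filterS (near_and (isum c) nr) => s [-> Bs].
  by rewrite -Ek // E0 ?(fam_id_limit tG LC) //; exact: rB.
exists e, r; split; first by case/andP: rr2.
  apply: (fam_frame tG LC hf rr span free); first exact: ball_open.
  by move=> x; rewrite !ballE => /lt_trans; apply; case/andP: rr2.
move=> y; have [f ff Ef] := germ_fam tG LC (cg y) B0.
have [b Hb] := gram_derivative tG LC cM bB hf rr span free ff rr2.
have Br2 : ball t1 r t1 by apply: ballxx; case/andP: rr2.
have [_ Hd] := Hb t1 Br2; rewrite (nbhs_singleton Ef) [LHS]Hd.
suff -> : b = - ad_matrix y by rewrite linearN /= mulrN mulNr.
have dlim k s : local_fam U dl i t1 rT r0 k -> ball t1 r0 s -> differentiable (rescaled_limit U k dl) s.
  by move=> fk Bs; exact: (central_diff (fam_central tG LC fk) Bs).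
apply/matrixP => a c; rewrite !mxE.
(* The derivative formula says that the bracket of the fields of y and of the a-th basis vector has
   coefficients b a c, while iota turns that bracket into the opposite one. *)
have Eb : \sum_c b a c *: vb`_c = - lie_br y vb`_a.
  apply: iota_inj.
  have Ef' := near_join Ef; have he' := near_join he.
  have nr2 : \forall s \near t1, ball t1 r s by exact: open_near (@ball_open _ _ t1 r) Br2.
  apply: filterS (near_and (near_and (isum (b a)) (brk y vb`_a)) (near_and (near_and Ef' he') nr2)).
  move=> s [[-> <-] [[F1 F2] Bs]]; have [Hs _] := Hb s Bs.
  have Bs0 : ball t1 r0 s by apply: rB; move: Bs; rewrite !ballE => /lt_trans; apply; case/andP: rr2.
  have J1 : 'J (iota y) s = Jac (rescaled_limit U f dl) s.
    rewrite -JacE; apply: jac_near; first exact: dlim.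
    by apply: filterS F1 => z ->.
  have J2 : 'J (iota vb`_a) s = Jac (rescaled_limit U (h a) dl) s.
    rewrite -JacE; apply: jac_near; first exact: dlim.
    by apply: filterS F2 => z ->.
  rewrite /vf_bracket J1 J2 (nbhs_singleton F1) (nbhs_singleton F2 a).
  by rewrite [X in X - _](Hs a) addrK.
have := congr1 (coord vb c) Eb; rewrite linear_sum linearN /= => <-.
rewrite (bigD1 c) //= linearZ /= coord_free ?(basis_free (vbasisP _)) // eqxx mulr1 big1 ?addr0 // => c' nc.
rewrite linearZ /= coord_free ?(basis_free (vbasisP _)) //.
by move: nc; rewrite -val_eqE /= => /negbTE ncE; rewrite ?ncE 1?eq_sym ?ncE [LHS]mulr0.
Qed.
End Structural.
End LocalFrames.

(** * Basic cohomology in degree one modulo the filtration *)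

Section Cohomology.
Variables (R : realType) (n q : nat) (M : manifold R n) (F : foliation M q).
Implicit Types (w eta : form1 M) (u : M -> R) (X Y Z : operator M).

Lemma one_form_lin (c : R) w1 w2 : one_form w1 -> one_form w2 -> one_form (fun X x => w1 X x + c * w2 X x).
Proof.
move=> [s1 e1 l1] [s2 e2 l2]; split.
- by move=> X vX; apply: smoothD; [exact: s1|apply: smoothM; [exact: smoothC|exact: s2]].
- by move=> X Y vX vY XY; rewrite (e1 X Y) // (e2 X Y).
- by move=> f X Y sf vX vY x; rewrite l1 // l2 //; ring.
Qed.

Lemma dform_lin (c : R) w1 w2 X Y x : one_form w1 -> one_form w2 -> vector_field X -> vector_field Y ->
  dform (fun X x => w1 X x + c * w2 X x) X Y x = dform w1 X Y x + c * dform w2 X Y x.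
Proof.
move=> [s1 _ _] [s2 _ _] vX vY; rewrite /dform.
have E Z Z' : vector_field Z -> vector_field Z' -> Z (fun x => w1 Z' x + c * w2 Z' x) x = Z (w1 Z') x + c * Z (w2 Z') x.
  by move=> vZ vZ'; rewrite vf_add ?(vf_scale _ _ vZ) //; [exact: s2|exact: s1|apply: smoothM; [exact: smoothC|exact: s2]].
by rewrite !E //; ring.
Qed.

Lemma closed_basic_lin (c : R) w1 w2 : closed_basic_form F w1 -> closed_basic_form F w2 ->
  closed_basic_form F (fun X x => w1 X x + c * w2 X x).
Proof.
move=> [[f1 b1] c1] [[f2 b2] c2]; split; last by move=> X Y vX vY x; rewrite dform_lin // c1 // c2 // mulr0 addr0.
split; first exact: one_form_lin.
move=> X tX x; have [vX _] := tX; have [z1 d1] := b1 X tX x; have [z2 d2] := b2 X tX x.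
split=> [|Y vY]; first by rewrite z1 z2 mulr0 addr0.
by rewrite dform_lin // d1 // d2 // mulr0 addr0.
Qed.

Lemma closed_basic0 : closed_basic_form F (fun _ _ => 0).
Proof.
have o0 : one_form (fun (_ : operator M) (_ : M) => 0 : R).
  split=> [X _|//|f X Y _ _ _ x]; first exact: smoothC.
  by rewrite mulr0 addr0.
have d0 X Y : vector_field X -> vector_field Y -> forall x, dform (fun (_ : operator M) (_ : M) => 0 : R) X Y x = 0.
  by move=> vX vY x; rewrite /dform !vf_cst // !subr0.
split; last exact: d0.
by split=> // X [vX _] x; split=> // Y vY; exact: d0.
Qed.

Lemma basic_function_lin (c : R) u1 u2 : basic_function F u1 -> basic_function F u2 -> basic_function F (fun x => u1 x + c * u2 x).
Proof.
move=> [s1 b1] [s2 b2]; split; first by apply: smoothD => //; apply: smoothM => //; exact: smoothC.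
move=> X tX x; have [vX _] := tX; rewrite vf_add //; last by apply: smoothM => //; exact: smoothC.
by rewrite (vf_scale _ _ vX s2) b1 // b2 // mulr0 addr0.
Qed.

Lemma vf_lin (c : R) u1 u2 X x : vector_field X -> basic_function F u1 -> basic_function F u2 ->
  X (fun x => u1 x + c * u2 x) x = X u1 x + c * X u2 x.
Proof.
move=> vX [s1 _] [s2 _]; rewrite vf_add ?(vf_scale _ _ vX s2) //; by apply: smoothM => //; exact: smoothC.
Qed.

Lemma F1_lin (c : R) w1 w2 : closed_basic_form F w1 -> closed_basic_form F w2 -> F1_form F w1 -> F1_form F w2 ->
  F1_form F (fun X x => w1 X x + c * w2 X x).
Proof.
move=> c1 c2 [_ f1] [_ f2]; split; first by have [] := closed_basic_lin c c1 c2.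
by move=> X tX x; rewrite f1 // f2 // mulr0 addr0.
Qed.

Lemma F1H1P eta : closed_basic_form F eta -> F1H1 F (H1_class F eta) <->
  exists w u, [/\ closed_basic_form F w, F1_form F w, basic_function F u &
    forall X, vector_field X -> forall x, eta X x = w X x + X u x].
Proof.
move=> ce; split=> [[w [cw fw E]]|[w [u [cw fw bu E]]]].
  have : H1_class F eta eta.
    split=> //; exists (fun=> 0); last by move=> X vX x; rewrite vf_cst // addr0.
    by split=> [|X [vX _] x]; [exact: smoothC|rewrite vf_cst].
  by rewrite E => -[_ [u bu Eu]]; exists w, u.
exists w; split=> //; apply/seteqP; split=> xi [cxi [v bv Ev]]; split=> //.
  exists (fun x => v x + 1 * u x); first exact: basic_function_lin.
  by move=> X vX x; rewrite Ev // E // vf_lin //; ring.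
exists (fun x => v x + (-1) * u x); first exact: basic_function_lin.
by move=> X vX x; rewrite Ev // E // vf_lin //; ring.
Qed.

(** For a basic function u, du kills the fields tangent to leaf closures because u is constant on
    these closures. So adding exact basic forms or forms of filtration 1 does not affect the
    restriction to such fields, which decides the class. *)
Lemma H1_mod_F1P w : hausdorff_space M -> closed_basic_form F w ->
  H1_mod_F1_class F w = H1_mod_F1_class F (fun _ _ => 0) <->
  forall X, tangent_to_leaf_closures F X -> forall x, w X x = 0.
Proof.
move=> hM cw; have c0 := closed_basic0.
have sub w1 w2 : (fun X x => w1 X x - w2 X x) = (fun X x => w1 X x + (-1) * w2 X x) :> form1 M.
  by apply/funext => X; apply/funext => x; rewrite mulN1r.
have memP eta w' : closed_basic_form F w' -> H1_mod_F1_class F w' eta <-> closed_basic_form F eta /\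
    exists v u, [/\ closed_basic_form F v, F1_form F v, basic_function F u &
    forall X, vector_field X -> forall x, eta X x = w' X x + (v X x + X u x)].
  move=> cw'; rewrite /H1_mod_F1_class /= sub; split=> -[ce].
    move=> /(F1H1P (closed_basic_lin (-1) ce cw'))[v [u [cv fv bu E]]]; split=> //; exists v, u; split=> // X vX x.
    by rewrite -E //; ring.
  move=> [v [u [cv fv bu E]]]; split=> //; apply/(F1H1P (closed_basic_lin (-1) ce cw')); exists v, u; split=> // X vX x.
  by rewrite E //; ring.
have z0 : F1_form F (fun _ _ => 0) by split=> //; case: c0.
have b0 : basic_function F (fun=> 0) by split=> [|X [vX _] x]; [exact: smoothC|rewrite vf_cst].
split=> [E X tX x|H].
  have : H1_mod_F1_class F w w.
    by apply/(memP _ _ cw); split=> //; exists (fun _ _ => 0), (fun=> 0); split=> // Y vY y; rewrite vf_cst // !addr0.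
  rewrite E => /(memP _ _ c0)[_ [v [u [_ [_ fv] bu Ew]]]]; have [vX _] := tX.
  by rewrite Ew // fv // (basic_leaf_closure hM x bu tX) !addr0.
have fw : F1_form F w by split=> //; case: cw.
apply/seteqP; split=> eta; [move/(memP _ _ cw)|move/(memP _ _ c0)] => -[ce [v [u [cv fv bu E]]]].
  apply/(memP _ _ c0); split=> //; exists (fun X x => v X x + 1 * w X x), u; split=> //.
  - exact: closed_basic_lin.
  - exact: F1_lin.
  - by move=> X vX x; rewrite E //; ring.
apply/(memP _ _ cw); split=> //; exists (fun X x => v X x + (-1) * w X x), u; split=> //.
- exact: closed_basic_lin.
- exact: F1_lin.
- by move=> X vX x; rewrite E //; ring.
Qed.
End Cohomology.

Section SecondaryClass.
Variables (R : realType) (n q : nat) (M : manifold R n) (F : foliation M q).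
Variable G : fidx F -> 'rV[R]_q -> 'M[R]_q.
Hypotheses (tG : transverse_metric G) (cM : closed_manifold M).
Variable Bm : fibre_metric F.
Hypothesis bB : basic_metric Bm.
Variable delta : form1 M.
Hypothesis dB : first_secondary_form Bm delta.
Implicit Types (i j : fidx F) (t : 'rV[R]_q) (x y : M) (u v : M -> R) (X Y Z : operator M).

Notation Dg i e := (fun t => \det (gram Bm i e t)).

Let hM : hausdorff_space M. Proof. by case: cM. Qed.

Lemma frame_gt0 i (Op : set 'rV[R]_q) m (e : 'I_m -> selfmap R q) t : parallel_frame i Op e -> Op t -> 0 < Dg i e t.
Proof.
move=> [_ _ ce H] Ot; apply: (gram_det_gt0 tG cM bB ce Ot) => c E a.
have gX : central_germ i t (e a) by exists Op.
have [c0 [_ uniq]] := H t (e a) Ot gX.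
have e1 : c0 = delta_mx 0 a.
  apply: uniq; apply: filterE => s; rewrite (bigD1 a) //= mxE !eqxx scale1r big1 ?addr0 // => b ba.
  by rewrite mxE eqxx (negbTE ba) scale0r.
have e2 : c0 = delta_mx 0 a + \row_b c b.
  apply: uniq; apply: filterS E => s Es; under eq_bigr do rewrite !mxE scalerDl.
  rewrite big_split /= Es addr0 (bigD1 a) //= !eqxx scale1r big1 ?addr0 // => b ba.
  by rewrite (negbTE ba) scale0r.
move: e2; rewrite e1 => /eqP; rewrite -subr_eq0 opprD addNKr oppr_eq0 => /eqP/rowP/(_ a).
by rewrite !mxE.
Qed.

Lemma smooth_in_pullback i (Op : set 'rV[R]_q) (phi : 'rV[R]_q -> R) : open Op -> smooth_on Op phi ->
  open (fU (f := F) i `&` ff i @^-1` Op) /\ smooth_in (fU (f := F) i `&` ff i @^-1` Op) (phi \o ff i).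
Proof.
move=> oO sp; have oV : open (fU (f := F) i `&` ff i @^-1` Op).
  rewrite openE => y [Uy Oy].
  exact: (near_and (open_near (fU_open (f := F) i) Uy) (near_comp (ff_cont Uy) (open_near oO Oy))).
split=> // b; have oVb := chart_image_open (a := b) oV.
apply: (smooth_comp oVb oO) sp.
  by move=> _ [y [dy [Uy Oy]] <-]; rewrite /= chartK.
move=> k; apply: smooth_sub (@frep_smooth R n q M F i b k) => _ [y [dy [Uy _]] <-].
by exists y.
Qed.

(** Vector fields act on global functions, so the coefficient u of the unit section and its inverse
    v are extended from a neighbourhood of x to M. With v, the formula for delta is a product to
    which the Leibniz rule applies. *)
Lemma frame_unit i (Op : set 'rV[R]_q) m (e : 'I_m -> selfmap R q) x : parallel_frame i Op e -> fU i x -> Op (ff i x) ->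
  exists (phi : 'rV[R]_q -> R) u v, [/\ smooth_on Op phi, forall t, Op t -> 0 < phi t /\ phi t ^+ 2 * Dg i e t = 1,
    smooth u /\ smooth v, \forall y \near x, u y = phi (ff i y) /\ u y * v y = 1 &
    forall Z, vector_field Z -> \forall y \near x, delta Z y = (2 * pi)^-1 * (Z u y * v y)].
Proof.
move=> pf Ux Ox; have [oO _ ce _] := pf.
have sD := gram_det_smooth bB oO ce.
have [phi [sp Hp]] := inv_sqrt_smooth oO sD (fun t Ot => frame_gt0 pf Ot).
have p0 t : Op t -> phi t != 0 by move=> /Hp[p0 _]; rewrite gt_eqF.
have [oV su] := smooth_in_pullback i oO sp.
have [_ sv] := smooth_in_pullback i oO (smooth_inv oO p0 sp).
have Vx : (fU (f := F) i `&` ff i @^-1` Op) x by [].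
have [u us uE] := smooth_extension hM oV Vx su.
have [v vs vE] := smooth_extension hM oV Vx sv.
exists phi, u, v; split=> //.
  apply: filterS (near_and (near_and uE vE) (open_near oV Vx)) => y [[-> ->] [_ Oy]]; split=> //=.
  by rewrite mulfV // p0.
move=> Z vZ.
pose W := (fU (f := F) i `&` ff i @^-1` Op) `&` [set y | u y = phi (ff i y)]°.
have oW : open W by apply: openI => //; exact: open_interior.
have Wx : W x by split=> //; exact: uE.
have WE y : W y -> u y = phi (ff i y) by move=> [_ /interior_subset].
have [_ Hd] := dB.
have HW : forall y, W y -> Z u y = 2 * pi * delta Z y * u y.
  apply: (Hd i Op m e W u pf oW _ us) => //; first by move=> y [].
  by move=> y Wy; rewrite WE //; have [[_ Oy] _] := Wy; have [_] := Hp _ Oy.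
apply: filterS (near_and (near_and uE vE) (open_near oW Wx)) => y [[uy vy] Wy].
have [[_ Oy] _] := Wy; rewrite HW // vy uy /=.
have pi0 : pi != 0 :> R by rewrite gt_eqF // pi_gt0.
rewrite mulfK ?p0 // mulKf // mulf_neq0 //.
Qed.

Lemma delta_smooth X : vector_field X -> smooth (delta X).
Proof. by move=> vX; have [[sd _ _] _] := dB; exact: sd. Qed.

Lemma chart_frame x : exists i m (e : 'I_m -> selfmap R q) Op, [/\ fU i x, Op (ff i x) & parallel_frame i Op e].
Proof.
have [i Ux] := fU_cover F x; have Tt : trans i (ff i x) by exists x.
have [m [e [r [_ [r0 pf _ _]]]]] := frame_local tG cM bB Tt.
by exists i, m, e, (ball (ff i x) r); split=> //; exact: ballxx.
Qed.

(** Locally 2 pi delta = du / u, so delta is closed. Near each point u is a function of f_i, hence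
    constant on plaques, so delta kills the fields tangent to the leaves. *)
Lemma delta_closed_basic : closed_basic_form F delta.
Proof.
have [od _] := dB.
have cl : closed_form delta.
  move=> X Y vX vY x; have [i [m [e [Op [Ux Ox pf]]]]] := chart_frame x.
  have [phi [u [v [sp Hp [us vs] uv Hd]]]] := frame_unit pf Ux Ox.
  have uv1 := (nbhs_singleton uv).2.
  have key Z Z' : vector_field Z -> vector_field Z' ->
      Z (delta Z') x = (2 * pi)^-1 * (Z (Z' u) x * v x + Z' u x * Z v x).
    move=> vZ vZ'; have [sZ' _ _] := vZ'; have [_ _ leib] := vZ.
    have s1 := smoothM (sZ' u us) vs.
    rewrite (vf_local hM vZ (delta_smooth vZ') (smoothM (smoothC _) s1) (Hd Z' vZ')).
    by rewrite (vf_scale _ _ vZ s1) leib //; exact: sZ'.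
  have dv Z : vector_field Z -> Z v x = - v x * Z u x * v x.
    move=> vZ; have [_ _ leib] := vZ.
    have : Z (fun y => u y * v y) x = 0.
      rewrite -(vf_cst 1 x vZ); apply: (vf_local hM vZ (smoothM us vs) (smoothC _)).
      by apply: filterS uv => y [].
    rewrite leib // => E; have : v x * (Z u x * v x + u x * Z v x) = 0 by rewrite E mulr0.
    rewrite mulrDr [v x * (u x * _)]mulrA [v x * u x]mulrC uv1 mul1r => /eqP.
    by rewrite addr_eq0 => /eqP E2; rewrite -[LHS]opprK -E2; ring.
  rewrite /dform !key // (nbhs_singleton (Hd _ (lie_bracket_vf vX vY))) !dv // /lie_bracket.
  by ring.
split=> //; split=> // X tX x; have [vX HX] := tX; split=> [|Y vY]; last exact: cl.
have [i [m [e [Op [Ux Ox pf]]]]] := chart_frame x.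
have [phi [u [v [sp Hp [us vs] uv Hd]]]] := frame_unit pf Ux Ox.
rewrite (nbhs_singleton (Hd X vX)) (HX i x Ux u us) ?mul0r ?mulr0 //.
have [ux _] := nbhs_singleton uv; apply: filterS uv => y [uy _] [Uy fy]; rewrite uy ux.
by rewrite (fy : ff i y = ff i x).
Qed.

(** The differential of f_i sends the vector of Z at x to w. As Z is a derivation, this is tested on
    smooth functions that agree near x with a pull-back by f_i. *)
Definition projects i Z x (w : 'rV[R]_q) := forall (phi : 'rV[R]_q -> R) u, smooth u -> differentiable phi (ff i x) ->
  (\forall y \near x, u y = phi (ff i y)) -> Z u x = 'd phi (ff i x) w.

(** Differentiating phi^2 D = 1 along w shows that the derivatives of phi and of the Gram
    determinant D vanish together, and delta Z is a nonzero multiple of the former. *)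
Lemma delta_eq0 i (Op : set 'rV[R]_q) m (e : 'I_m -> selfmap R q) x Z w : parallel_frame i Op e -> fU i x -> Op (ff i x) ->
  vector_field Z -> projects i Z x w -> delta Z x = 0 <-> 'd (Dg i e) (ff i x) w = 0.
Proof.
move=> pf Ux Ox vZ pZ; have [oO _ ce _] := pf.
have [phi [u [v [sp Hp [us vs] uv Hd]]]] := frame_unit pf Ux Ox.
have sD := gram_det_smooth bB oO ce.
have dp := smooth_diff oO sp Ox; have dD := smooth_diff oO sD Ox.
have [p0 pE] := Hp _ Ox.
have D0 := frame_gt0 pf Ox.
have E : 'd (fun t => phi t * phi t * Dg i e t) (ff i x) w = 0.
  have dc : differentiable (fun _ : 'rV[R]_q => 1 : R) (ff i x) by exact: differentiable_cst.
  have [|_ ->] := diff_near (psi := fun t => phi t * phi t * Dg i e t) dc.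
    by apply: filterS (open_near oO Ox) => t /Hp[_]; rewrite expr2.
  by rewrite diff_cst.
rewrite diff_leibniz // in E; last exact: differentiableM.
rewrite diff_leibniz // in E.
have Zu : Z u x = 'd phi (ff i x) w by apply: pZ => //; apply: filterS uv => y [].
rewrite (nbhs_singleton (Hd Z vZ)) Zu.
have pi0 : (2 * pi)^-1 != 0 :> R by rewrite invr_eq0 mulf_neq0 // gt_eqF // pi_gt0.
have v0 : v x != 0.
  by apply/eqP => v0; move: (nbhs_singleton uv).2; rewrite v0 mulr0 => /eqP; rewrite eq_sym oner_eq0.
move: E D0 p0; set dphi := 'd phi _ _; set dDg := 'd (Dg i e) _ _; set d := Dg i e _; set p := phi _.
move: dphi dDg d p => dphi dDg d p E D0 p0.
split=> H.
  have z : dphi = 0 by move/eqP: H; rewrite !mulf_eq0 (negbTE pi0) (negbTE v0) orbF /= => /eqP.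
  move: E; rewrite z mul0r mulr0 addr0 mul0r add0r => /eqP; rewrite !mulf_eq0 gt_eqF //= => /eqP.
  by [].
have /eqP : dphi * (2 * p * d) = 0 by rewrite -[RHS]E H; ring.
by rewrite !mulf_eq0 (gt_eqF p0) (gt_eqF D0) pnatr_eq0 !orbF => /eqP ->; rewrite mul0r mulr0.
Qed.
End SecondaryClass.

Lemma diff_chain_at (R : realType) p r (phi : 'rV[R]_r -> R) (f : 'rV[R]_p -> 'rV[R]_r) z y v :
  differentiable f z -> f z = y -> differentiable phi y -> 'd (phi \o f) z v = 'd phi y (v *m Jac f z).
Proof. by move=> df <-; exact: diff_chain. Qed.

(** * Vanishing on central fields *)

Section Propagation.
Variables (R : realType) (n q : nat) (M : manifold R n) (F : foliation M q).
Variable G : fidx F -> 'rV[R]_q -> 'M[R]_q.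
Hypotheses (tG : transverse_metric G) (cM : closed_manifold M).
Variable Bm : fibre_metric F.
Hypothesis bB : basic_metric Bm.
Variable delta : form1 M.
Hypothesis dB : first_secondary_form Bm delta.
Implicit Types (i j : fidx F) (t : 'rV[R]_q) (x y : M) (u v : M -> R) (X Y Z : operator M) (xi : selfmap R q).

Notation Dg i e := (fun t => \det (gram Bm i e t)).

Let hM : hausdorff_space M. Proof. by case: cM. Qed.

(** All fields projecting to the central germ are tested; by [delta_eq0] the choice among them is
    immaterial for the vanishing. *)
Definition kills_central_in i x := forall xi Z, central_germ i (ff i x) xi -> vector_field Z -> projects i Z x (xi (ff i x)) -> delta Z x = 0.

Definition kills_central x := forall i, fU i x -> kills_central_in i x.

(** Pulling a central germ back by the transition map gives a central germ in the other chart with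
    the same lifts. *)
Lemma kills_central_index i j x : fU i x -> fU j x -> kills_central_in i x -> kills_central_in j x.
Proof.
move=> Ui Uj H xi Z gX vZ pZ.
have T2 : trans2 i j (ff i x) by exists x.
have hx : fh i j (ff i x) = ff j x by exact: fhE.
have T2' : trans2 j i (ff j x) by rewrite -hx; exact: fh_trans2.
have gX' : central_germ j (fh i j (ff i x)) xi by rewrite hx.
have [gp _ _] := metric_pull tG cM bB (composite_fh i j) T2 gX' gX'.
apply: (H _ Z gp vZ) => phi u su dphi Hu.
have dh : differentiable (fh j i) (ff j x).
  exact: (smooth_map_diff (@trans2_open _ _ _ _ F j i) (@fh_smooth _ _ _ _ F j i) T2').
have dh' : differentiable (fh i j) (ff i x).
  exact: (smooth_map_diff (@trans2_open _ _ _ _ F i j) (@fh_smooth _ _ _ _ F i j) T2).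
have hx' : fh j i (ff j x) = ff i x by exact: fhE.
have E1 : Z u x = 'd (phi \o fh j i) (ff j x) (xi (ff j x)).
  apply: pZ => //; last first.
    apply: filterS (near_and Hu (open_near (openI (fU_open (f := F) i) (fU_open (f := F) j)) (conj Ui Uj))) => y [-> [Vi Vj]].
    by rewrite /= fhE.
  by apply: differentiable_comp => //; rewrite hx'.
have J1 : Jac (fh i j) (ff i x) *m Jac (fh j i) (ff j x) = 1%:M.
  rewrite -hx -jac_comp ?hx // -(jac_id (ff i x)); apply: jac_near; first exact: ex_diff.
  by apply: filterS (open_near (@trans2_open _ _ _ _ F i j) T2) => t Tt; rewrite /= fhK.
have uJ := composite_unit tG (composite_fh i j) T2.
have J2 : invmx (Jac (fh i j) (ff i x)) = Jac (fh j i) (ff j x) by rewrite -[RHS](mulKmx uJ) J1 mulmx1.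
have Ep : pull (fh i j) xi (ff i x) = xi (ff j x) *m Jac (fh j i) (ff j x) by rewrite /pull hx J2.
rewrite Ep; exact: (etrans E1 (diff_chain_at (xi (ff j x)) dh hx' dphi)).
Qed.

Lemma kills_central_frame i m (e : 'I_m -> selfmap R q) (Op : set 'rV[R]_q) x : parallel_frame i Op e ->
  fU i x -> Op (ff i x) -> kills_central x <-> forall xi, central_germ i (ff i x) xi -> 'd (Dg i e) (ff i x) (xi (ff i x)) = 0.
Proof.
move=> pf Ux Ox; split=> [H xi gX|H j Uj].
  have [Z [vZ _] pZ] := central_lift hM tG cM gX Ux.
  by apply/(delta_eq0 tG cM bB dB pf Ux Ox vZ pZ); exact: (H i Ux xi Z gX vZ pZ).
apply: (kills_central_index Ux Uj) => xi Z gX vZ pZ.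
by apply/(delta_eq0 tG cM bB dB pf Ux Ox vZ pZ); exact: H.
Qed.

Lemma kills_central_tau i m (e : 'I_m -> selfmap R q) (Op : set 'rV[R]_q) (tau : 'I_m -> R) x : parallel_frame i Op e ->
  (forall t a, Op t -> 'd (Dg i e) t (e a t) = tau a * Dg i e t) -> fU i x -> Op (ff i x) ->
  kills_central x <-> forall a, tau a = 0.
Proof.
move=> pf Ht Ux Ox; have [_ _ ce _] := pf; have D0 := frame_gt0 tG cM bB pf Ox.
split=> [/(kills_central_frame pf Ux Ox) H a|H].
  have ga : central_germ i (ff i x) (e a) by exists Op.
  by have := H _ ga; rewrite Ht // => /eqP; rewrite mulf_eq0 (gt_eqF D0) orbF => /eqP.
apply/(kills_central_frame pf Ux Ox) => xi gX.
by apply: (frame_diff0 (L := 'd (Dg i e) (ff i x)) pf Ox gX) => a; rewrite Ht // H mul0r.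
Qed.

(** Over a ball of [frame_local] the condition reads that all [tau a] are 0, which does not depend
    on the point; M is connected. *)
Lemma kills_central_everywhere x y : kills_central x -> kills_central y.
Proof.
have [_ _ co] := cM.
apply: (@conn_ind M setT kills_central co _ x y I I) => z _.
have [i Uz] := fU_cover F z; have Tt : trans i (ff i z) by exists z.
have [m [e [r [tau [r0 pf Ht _]]]]] := frame_local tG cM bB Tt.
have nb : \forall t \near ff i z, ball (ff i z) r t by exact: nbhsx_ballx.
apply: filterS (near_and (near_comp (ff_cont Uz) nb) (open_near (fU_open (f := F) i) Uz)) => w [Bw Uw] _.
have h1 := kills_central_tau pf Ht Uw Bw; have h2 := kills_central_tau pf Ht Uz (ballxx _ r0).
by split=> [/h1/h2|/h2/h1].
Qed.

Lemma kills_central_unimodular (g : lie_algebra R) i x iota : fU i x -> @opposite_iso_stalk _ _ _ _ F g i (ff i x) iota ->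
  kills_central x <-> unimodular g.
Proof.
move=> Ux Hi; have Tt : trans i (ff i x) by exists x.
have [e [r [r0 pf Ht]]] := structural_frame tG cM bB Tt Hi.
have Bx : ball (ff i x) r (ff i x) by exact: ballxx.
have D0 := frame_gt0 tG cM bB pf Bx; have [cg _ _ surj _] := Hi.
split=> [/(kills_central_frame pf Ux Bx) H y|H].
  have := H _ (cg y); rewrite Ht => /eqP.
  by rewrite !mulf_eq0 (gt_eqF D0) oppr_eq0 pnatr_eq0 orbF /= => /eqP.
apply/(kills_central_frame pf Ux Bx) => xi gX; have [y Ey] := surj _ gX.
by rewrite (nbhs_singleton Ey) Ht H mulr0 mul0r.
Qed.

(** From left to right, lifts of central fields are tangent to leaf closures. Conversely, a tangent
    field has to kill every function locally constant on the leaf closure, and the coefficient u of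
    the unit section is one by [transverse_constancy]. *)
Lemma kills_closure_tangent : (forall X, tangent_to_leaf_closures F X -> forall x, delta X x = 0) <-> forall x, kills_central x.
Proof.
split=> [H x i Ux xi Z gX vZ pZ|H X tX x].
  have Tt : trans i (ff i x) by exists x.
  have [m [e [r [_ [r0 pf _ _]]]]] := frame_local tG cM bB Tt.
  have Bx : ball (ff i x) r (ff i x) by exact: ballxx.
  have [Z' tZ' pZ'] := central_lift hM tG cM gX Ux; have [vZ' _] := tZ'.
  apply/(delta_eq0 tG cM bB dB pf Ux Bx vZ pZ).
  by apply/(delta_eq0 tG cM bB dB pf Ux Bx vZ' pZ'); exact: H.
have [i Ux] := fU_cover F x; have Tt : trans i (ff i x) by exists x.
have [m [e [r [tau [r0 pf Ht Hc]]]]] := frame_local tG cM bB Tt.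
have Bx : ball (ff i x) r (ff i x) by exact: ballxx.
have [eta eta0 Heta] := Hc ((kills_central_tau pf Ht Ux Bx).1 (H x)).
have [phi [u [v [sp Hp [us vs] uv Hd]]]] := frame_unit tG cM bB dB pf Ux Bx.
have [vX HX] := tX; rewrite (nbhs_singleton (Hd X vX)) (HX x u us) ?mul0r ?mulr0 //.
have [ux _] := nbhs_singleton uv.
pose V := [set y | [/\ fU i y, ball (ff i x) r (ff i y), `|ff i y - ff i x| < eta & u y = phi (ff i y)]].
have nV : \forall y \near x, V y.
  have n1 : \forall t \near ff i x, ball (ff i x) r t by exact: nbhsx_ballx.
  have n2 : \forall t \near ff i x, ball (ff i x) eta t by exact: nbhsx_ballx.
  apply: filterS (near_and (near_and uv (open_near (fU_open (f := F) i) Ux)) (near_comp (ff_cont Ux) (near_and n1 n2))).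
  by move=> y [[[uy _] Uy] [b1 b2]]; split=> //; move: b2; rewrite ballE.
(* A point of V on the leaf of x is reached from f_i(x) by a composite that moves it by less than
   [eta], so the Gram determinant is the same at both ends, and with it its positive inverse square
   root u. *)
have uE z : V z -> leaf F x z -> u z = u x.
  move=> [Uz Bz ez uz] lz; have [Om [h [co Ox hz]]] := leaf_composite lz Ux Uz.
  have := Heta _ _ co Ox; rewrite hz => /(_ ez) DE.
  have [p0 pE] := Hp _ Bz; have [p0' pE'] := Hp _ Bx.
  rewrite uz ux; move: pE; rewrite DE -pE' => /(mulIf (lt0r_neq0 (frame_gt0 tG cM bB pf Bx))).
  by move=> /eqP; rewrite eqrXn2 ?ltW // => /eqP.
apply: filterS (near_join nV) => y Vy cy.
apply/eqP; rewrite -subr_eq0 -normr_le0 leNgt; apply/negP => d0.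
have cu : {for y, continuous u} by apply: (smooth_in_cont (V := setT)) => //; [exact: openT|exact/smooth_inT].
have hd := (contP _ _).1 cu _ d0.
have [z [lz [hz Vz]]] := cy _ (near_and hd Vy).
by move: hz; rewrite /= (uE z Vz lz) distrC ltxx.
Qed.

End Propagation.

Theorem theorem1p2 (R : realType) (n q : nat) (M : manifold R n)
    (M_closed : closed_manifold M) (F : foliation M q)
    (F_riemannian : riemannian_foliation F)
    (g : lie_algebra R) (g_structural : structural_lie_algebra F g)
    (B : fibre_metric F) (B_basic : basic_metric B)
    (delta : form1 M) (delta_secondary : first_secondary_form B delta) :
  H1_mod_F1_class F delta = H1_mod_F1_class F (fun _ _ => 0%R)
  <-> unimodular g.
Proof.
have [G tG] := F_riemannian; have [hM _ _] := M_closed.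
have [i [t [iota [[x Ux <-] Hi]]]] := g_structural.
have c1 := H1_mod_F1P hM (delta_closed_basic tG M_closed B_basic delta_secondary).
have c2 := kills_closure_tangent tG M_closed B_basic delta_secondary.
have c3 := kills_central_unimodular tG M_closed B_basic delta_secondary Ux Hi.
split=> [/c1/c2 H|/c3 H]; first exact/c3.
by apply/c1/c2 => y; exact: (kills_central_everywhere tG M_closed B_basic delta_secondary H).
Qed.
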